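(* Let $\Psi$ be a NACIFS on $\mathbb D$ with limit set $\mathbb X$ and let $\omega$ be the harmonic measure of $\hat{\mathbb C}\setminus\mathbb X$ evaluated at $\infty$. Then $$HD(\omega)=\liminf_{n}\frac{H_{\omega,n}}{\chi_{\omega,n}}\quad\text{and}\quad PD(\omega)=\limsup_{n}\frac{H_{\omega,n}}{\chi_{\omega,n}},$$ where $H_{\omega,n}=-\frac1n\sum_{X\in\mathcal U_n}\omega(X)\log\omega(X)$ and $\chi_{\omega,n}=\frac1n\sum_{X\in\mathcal U_n}\omega(X)\log\|T_n'(X)\|$. Moreover, for $\omega$-almost every $x\in\mathbb X$, $$HD(\omega)=\liminf_{n}\frac{h_{\omega,n}(x)}{\chi_{n}(x)}\quad\text{and}\quad PD(\omega)=\limsup_{n}\frac{h_{\omega,n}(x)}{\chi_{n}(x)},$$ where for $x\in\mathbb X$, $h_{\omega,n}(x)=-\frac1n\log\omega(X_n(x))$ and $\chi_n(x)=\frac1n\log|T_n'(x)|$.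
   Context: $\mathbb D$ is the open unit disk of $\mathbb C$; for $t>0$, $tE=\{tz: z\in E\}$. A non-autonomous conformal iterated function system (NACIFS) on $\mathbb D$ is a sequence $\Psi=(\Psi_n)_{n\ge1}$ of finite collections of conformal contractions $\Psi_n=\{\psi_{n,i}:\mathbb D\to\mathbb D\,;\,1\le i\le d_n\}$ such that for some $\eta\in(0,1)$ and some fixed open neighborhood $V\supset(1+\eta)\mathbb D$: (1) Conformality: each $\psi_{n,i}$ extends to an injective holomorphic map $V\to V$. (2) Open set and annulus conditions: writing $V_{n,i}=\psi_{n,i}(V)$, one has $V_{n,i}\cap V_{n,j}=\emptyset$ for all $n$ and all $1\le i\ne j\le d_n$, and $V_{n,i}\subset(1-\eta)\mathbb D$ for all $n,i$. (3) Bounded contraction: $\eta<|\psi_{n,i}'(x)|<1-\eta$ for all $n$, all $1\le i\le d_n$ and all $x\in V_{n,i}$. The limit set of $\Psi$ is $\mathbb X=\bigcap_{n\ge1}\ \bigcup_{a_1,\dots,a_n}\psi_{1,a_1}\circ\cdots\circ\psi_{n,a_n}(\mathbb D)$, the union being over $1\le a_j\le d_j$. $\Phi_n$ is the map defined on $\bigcup_i\psi_{n,i}(\mathbb D)$ by $\Phi_n=\psi_{n,i}^{-1}$ on $\psi_{n,i}(\mathbb D)$, and $T_n=\Phi_n\circ\cdots\circ\Phi_1$. $\mathcal U_n$ is the collection of connected components of $T_n^{-1}(\mathbb D)$, i.e. of the sets $\psi_{1,a_1}\circ\cdots\circ\psi_{n,a_n}(\mathbb D)$. For $X\in\mathcal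 U_n$, $\|T_n'(X)\|=\sup_{z\in X}|T_n'(z)|$. For $x\in\mathbb X$, $X_n(x)$ is the intersection with $\mathbb X$ of the unique element of $\mathcal U_n$ containing $x$. For a probability measure $\mu$, $HD(\mu)=\inf\{HD(Z):\mu(Z)=1\}$ and $PD(\mu)=\inf\{PD(Z):\mu(Z)=1\}$, where $Z$ ranges over Borel subsets of the support of $\mu$ and $HD(Z)$, $PD(Z)$ are the Hausdorff and packing dimensions of $Z$. *)

(* Defs.v *)
From HB Require Import structures.
From mathcomp Require Import all_boot all_order all_algebra.
From mathcomp Require Import all_classical all_reals all_analysis.
From mathcomp.real_closed Require Import complex.

Set Implicit Arguments.
Unset Strict Implicit.
Unset Printing Implicit Defensive.

Import Order.TTheory GRing.Theory Num.Theory.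
Import numFieldNormedType.Exports.

Local Open Scope classical_set_scope.
Local Open Scope ring_scope.

(* The type [R[i]] seen as a [numFieldType], so that it inherits the canonical
   topology of numerical fields and so that [derivable f z 1] and [derive1 f z] are
   the complex notions: the limit of [h^-1 *: (f (h + z) - f z)] is taken over
   complex [h]. *)
Definition C (R : realType) : numFieldType := R[i].

(* The norm of the numerical field [C R] takes its values in [C R]; [cabs] is
   the real-valued modulus. *)
Definition cabs (R : realType) (z : C R) : R := Normc.normc z.

Definition expi (R : realType) (t : R) : C R := Complex (cos t) (sin t).

Definition unit_disk (R : realType) : set (C R) := [set z | cabs z < 1].

Definition dilate (R : realType) (t : R) (E : set (C R)) : set (C R) :=
  [set (real_complex R t : C R) * z | z in E].

Definition borelC (R : realType) : measurableType _ :=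
  g_sigma_algebraType (@open (C R)).

Section Dimensions.
Context {R : realType}.
Local Open Scope ereal_scope.

(* The maximum with 0 only matters for the empty set, of diameter 0. *)
Definition diameter (A : set (C R)) : \bar R :=
  maxe 0 (ereal_sup [set (cabs (p.1 - p.2)%R)%:E | p in A `*` A]).

(* The covers are the countable families, indexed by a set [D] of naturals. *)
Definition hausdorff_premeasure (s delta : R) (A : set (C R)) : \bar R :=
  ereal_inf [set x | exists (D : set nat) (U : nat -> set (C R)),
    [/\ A `<=` \bigcup_(k in D) U k,
        forall k, D k -> diameter (U k) <= delta%:E
      & x = \esum_(k in D) diameter (U k) `^ s]].

Definition hausdorff_measure (s : R) (A : set (C R)) : \bar R :=
  ereal_sup [set hausdorff_premeasure s delta A | delta in [set e | (0 < e)%R]].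

Definition hausdorff_dim (A : set (C R)) : \bar R :=
  ereal_inf [set s%:E | s in
    [set s : R | (0 < s)%R /\ hausdorff_measure s A = 0]].

Definition cball (c : C R) (r : R) : set (C R) :=
  [set z | (cabs (z - c) <= r)%R].

(* Packings are countable families of pairwise disjoint closed balls centred
   in [A]. *)
Definition packing_sum (s delta : R) (A : set (C R)) : \bar R :=
  ereal_sup [set x | exists (D : set nat) (c : nat -> C R) (r : nat -> R),
    [/\ forall k, D k -> A (c k),
        forall k, D k -> (0 < r k <= delta)%R,
        trivIset D (fun k => cball (c k) (r k))
      & x = \esum_(k in D) ((2 * r k) `^ s)%:E]].

Definition packing_premeasure (s : R) (A : set (C R)) : \bar R :=
  ereal_inf [set packing_sum s delta A | delta in [set e | (0 < e)%R]].

Definition packing_measure (s : R) (A : set (C R)) : \bar R :=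
  ereal_inf [set x | exists E : nat -> set (C R),
    A `<=` \bigcup_k E k /\
    x = \sum_(0 <= k <oo) packing_premeasure s (E k)].

Definition packing_dim (A : set (C R)) : \bar R :=
  ereal_inf [set s%:E | s in
    [set s : R | (0 < s)%R /\ packing_measure s A = 0]].

Definition msupport (mu : probability (borelC R) R) : set (C R) :=
  [set x | forall U : set (C R), open U -> U x -> 0 < mu U].

(* Borel subsets of full measure of the support. *)
Definition carriers (mu : probability (borelC R) R) : set (set (C R)) :=
  [set Z | [/\ measurable (Z : set (borelC R)),
               Z `<=` msupport mu & mu Z = 1]].

Definition HD (mu : probability (borelC R) R) : \bar R :=
  ereal_inf [set hausdorff_dim Z | Z in carriers mu].

Definition PD (mu : probability (borelC R) R) : \bar R :=
  ereal_inf [set packing_dim Z | Z in carriers mu].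

End Dimensions.

Section HarmonicMeasure.
Context {R : realType}.

(* The Riemann sphere; [None] is the point at infinity. *)
Definition sphere : topologicalType := one_point_compactification (C R).

Definition infty : sphere := None.

(* The circle of radius [r] about [p] in the chart [z] at a finite point and
   in the chart [1 / z] at infinity. *)
Definition circle (p : sphere) (r t : R) : sphere :=
  match p with
  | Some z => Some (z + (real_complex R r : C R) * expi t)
  | None => Some ((real_complex R r : C R) * expi t)^-1
  end.

(* Upper semicontinuous with values in [-oo, +oo) and satisfying the local
   submean inequality; the function identically equal to -oo is allowed. *)
Definition subharmonic (Omega : set sphere) (u : sphere -> \bar R) : Prop :=
  forall p, Omega p ->
  [/\ (u p < +oo)%E,
      forall a : R, (u p < a%:E)%E -> \forall q \near p, (u q < a%:E)%E
    & exists2 rho : R, 0 < rho & forall r : R, 0 < r < rho ->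
        (u p <= ((2 * pi)^-1)%:E *
                \int[lebesgue_measure]_(t in `[0%R, (2 * pi)%R])
                  u (circle p r t))%E].

Definition outer_domain (K : set (C R)) : set sphere :=
  ~` ((Some : C R -> sphere) @` K).

Definition frontier (K : set (C R)) : set (C R) := closure K `\` K°.

Definition perron_family (K : set (C R)) (phi : C R -> R) :
    set (sphere -> \bar R) :=
  [set u | subharmonic (outer_domain K) u /\
    forall zeta, frontier K zeta ->
      (limf_esup u (within (outer_domain K) (nbhs (Some zeta : sphere)))
         <= (phi zeta)%:E)%E].

Definition perron_solution (K : set (C R)) (phi : C R -> R) (p : sphere) :
    \bar R :=
  ereal_sup [set u p | u in perron_family K phi].

(* For a compact set [K], the harmonic measure at [p] of the complement of [K]
   in the sphere is the Borel probability measure on the boundary which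
   represents the Perron solution of the Dirichlet problem at [p], for every
   continuous boundary function. It is unique; it does not exist when [K] is
   polar and has at least two points. *)
Definition is_harmonic_measure (K : set (C R)) (p : sphere)
    (omega : probability (borelC R) R) : Prop :=
  omega (~` frontier K) = 0%E /\
  forall phi : C R -> R, {within frontier K, continuous phi} ->
    perron_solution K phi p = (\int[omega]_(z in frontier K) (phi z)%:E)%E.

End HarmonicMeasure.

(* In what follows [d n] and [psi n] are the objects of level n.+1, and only
   the maps [psi n i] with [i < d n] are relevant. *)
Section NACIFS.
Context {R : realType}.
Variables (d : nat -> nat) (psi : nat -> nat -> C R -> C R).

(* On V the total function [psi n i] is the injective holomorphic extension of
   the n.+1-st level contraction of the disk. *)
Definition is_nacifs : Prop :=
  exists (eta : R) (V : set (C R)),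
    [/\ 0 < eta < 1, open V & dilate (1 + eta) (@unit_disk R) `<=` V] /\
    forall n i, (i < d n)%N ->
    [/\ psi n i @` @unit_disk R `<=` @unit_disk R /\
        (exists2 k : R, k < 1 & forall x y : C R,
           unit_disk x -> unit_disk y ->
           cabs (psi n i x - psi n i y) <= k * cabs (x - y)),
        [/\ psi n i @` V `<=` V, {in V &, injective (psi n i)}
          & forall z, V z -> derivable (psi n i) z 1],
        forall j, (j < d n)%N -> i != j ->
          psi n i @` V `&` psi n j @` V = set0,
        psi n i @` V `<=` dilate (1 - eta) (@unit_disk R)
      & forall x, (psi n i @` V) x -> eta < cabs (derive1 (psi n i) x) < 1 - eta].

Fixpoint branch (a : nat -> nat) (n : nat) : C R -> C R :=
  if n is m.+1 then branch a m \o psi m (a m) else id.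

Definition cylinders (n : nat) : set (set (C R)) :=
  [set X | exists2 a : nat -> nat, (forall k, (k < n)%N -> (a k < d k)%N)
           & X = branch a n @` @unit_disk R].

Definition limit_set : set (C R) :=
  \bigcap_(n in [set n | (0 < n)%N]) \bigcup_(X in cylinders n) X.

(* [Phi n] takes the value 0 off the union of the [psi n i @` unit_disk]. *)
Definition Phi (n : nat) (z : C R) : C R :=
  xget 0 [set w | unit_disk w /\ exists2 i, (i < d n)%N & psi n i w = z].

Fixpoint T (n : nat) : C R -> C R :=
  if n is m.+1 then Phi m \o T m else id.

Definition T_norm (n : nat) (X : set (C R)) : R :=
  sup [set cabs (derive1 (T n) z) | z in X].

Definition cylinder_at (n : nat) (x : C R) : set (C R) :=
  limit_set `&` xget set0 [set X | cylinders n X /\ X x].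

Variable omega : probability (borelC R) R.

Definition H (n : nat) : R :=
  - (n%:R^-1 * \sum_(X \in cylinders n) fine (omega X) * ln (fine (omega X))).

Definition chi (n : nat) : R :=
  n%:R^-1 * \sum_(X \in cylinders n) fine (omega X) * ln (T_norm n X).

Definition h_loc (n : nat) (x : C R) : R :=
  - (n%:R^-1 * ln (fine (omega (cylinder_at n x)))).

Definition chi_loc (n : nat) (x : C R) : R :=
  n%:R^-1 * ln (cabs (derive1 (T n) x)).

End NACIFS.

(* Main.v *)
(* Let P be the harmonic measure of cylinders, words of length n coding the cylinders of level n.

Potential theory enters through one inequality only: P(uv) P(u') <= C P(u'v) P(u) for |u| = |u'|. By bounded distortion the branches of u and u' can be compared through the Dirichlet problem for the limit set of the shifted system in a fixed disk; explicit approximate solutions, built by iterated Poisson modifications and transported by the branches, compete in the Perron families of locally constant boundary data. If all these local solutions vanish and there are at least two cylinders of some level, then the limit set is polar and cannot carry a harmonic measure.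

Hence -ln P(u) and -ln |branch'(u)| are almost additive functions of blocks whose joint law dominates a multiple of the product law. This forces a variance decay at dyadic scales, so by Borel-Cantelli -ln P and ln |T_n'| differ from their means by o(n) almost surely. The ratio of the means is H / chi up to o(1), and the two dimensions follow by mass distribution, covers by cylinders, and packings by balls centred in the cylinders of one level. *)
From HB Require Import structures.
From mathcomp Require Import all_boot all_order all_algebra.
From mathcomp Require Import all_classical all_reals all_analysis.
From mathcomp.real_closed Require Import complex.
From mathcomp Require Import ring lra zify.
Require Import Defs.
Set Implicit Arguments.
Unset Strict Implicit.
Unset Printing Implicit Defensive.
Import Order.TTheory GRing.Theory Num.Theory.
Import numFieldNormedType.Exports.
Local Open Scope classical_set_scope.
Local Open Scope ring_scope.

(** * The complex plane *)

(** The harmonic measure is known only through Perron families, and the limit set may have irregular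
    points or be polar. The comparison of masses is written without division, so that a vanishing
    local solution is allowed; that case is then excluded by a maximum principle for competitors
    penalized by a large multiple of a small local supersolution. The system is non-autonomous, so
    there is no invariant measure to apply an ergodic theorem to, and the law of a block depends on
    its starting level. Domination of the product law lowers the growth factor of the variance under
    doubling only from 4 to [4 - c]. This gives summability along [n = j 2^k] for fixed [j], not
    along all [n]; almost monotonicity fills the gaps. The complex analysis all descends from the
    mean value property. *)

Lemma le0_of_eps {R : realFieldType} (x K : R) : 0 <= K ->
  (forall e : R, 0 < e -> x <= e * K) -> x <= 0.
Proof.
move=> K0 h; rewrite leNgt; apply/negP => x0.
have K1 : 0 < 2 * (K + 1) by rewrite mulr_gt0// ltr_wpDl.
have := h _ (divr_gt0 x0 K1); rewrite mulrAC ler_pdivlMr//.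
have := mulr_ge0 (ltW x0) K0; nra.
Qed.

Lemma pos_min2 {R : realFieldType} (a b : R) : 0 < a -> 0 < b ->
  exists2 d : R, 0 < d & d <= a /\ d <= b.
Proof.
move=> a0 b0; exists (Num.min a b); first by rewrite lt_min a0 b0.
by rewrite !ge_min !lexx orbT.
Qed.

Section Modulus.
Context {R : realType}.
Implicit Types (z w h : C R) (x y : R).

Definition rc (x : R) : C R := real_complex R x.
Definition re (z : C R) : R := complex.Re z.
Definition im (z : C R) : R := complex.Im z.
Definition iC : C R := Complex 0 1.

Lemma C_eq z w : re z = re w -> im z = im w -> z = w.
Proof. by case: z => a b; case: w => c d /= -> ->. Qed.

Lemma reD z w : re (z + w) = re z + re w. Proof. by case: z => a b; case: w. Qed.
Lemma imD z w : im (z + w) = im z + im w. Proof. by case: z => a b; case: w. Qed.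
Lemma reN z : re (- z) = - re z. Proof. by case: z. Qed.
Lemma imN z : im (- z) = - im z. Proof. by case: z. Qed.
Lemma reB z w : re (z - w) = re z - re w. Proof. by rewrite reD reN. Qed.
Lemma imB z w : im (z - w) = im z - im w. Proof. by rewrite imD imN. Qed.
Lemma reM z w : re (z * w) = re z * re w - im z * im w.
Proof. by case: z => a b; case: w. Qed.
Lemma imM z w : im (z * w) = re z * im w + im z * re w.
Proof. by case: z => a b; case: w => c d /=; rewrite mulrC. Qed.
Lemma re_rc x : re (rc x) = x. Proof. by []. Qed.
Lemma im_rc x : im (rc x) = 0. Proof. by []. Qed.
Lemma re1 : re 1 = 1. Proof. by []. Qed.
Lemma im1 : im 1 = 0. Proof. by []. Qed.
Lemma re0 : re 0 = 0. Proof. by []. Qed.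
Lemma im0 : im 0 = 0. Proof. by []. Qed.
Lemma re_iC : re iC = 0. Proof. by []. Qed.
Lemma im_iC : im iC = 1. Proof. by []. Qed.
Definition cE := (reD, imD, reN, imN, reM, imM, re_rc, im_rc, re1, im1, re0, im0, re_iC, im_iC).

Lemma rc0 : rc 0 = 0. Proof. by []. Qed.
Lemma rc1 : rc 1 = 1. Proof. by []. Qed.
Lemma rcD x y : rc (x + y) = rc x + rc y. Proof. by apply: C_eq; rewrite !cE ?addr0. Qed.
Lemma rcN x : rc (- x) = - rc x. Proof. by apply: C_eq; rewrite !cE ?oppr0. Qed.
Lemma rcB x y : rc (x - y) = rc x - rc y. Proof. by rewrite rcD rcN. Qed.
Lemma rcM x y : rc (x * y) = rc x * rc y.
Proof. by apply: C_eq; rewrite !cE; ring. Qed.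
Lemma cabs_ge0 z : 0 <= cabs z.
Proof. by case: z => a b; exact: sqrtr_ge0. Qed.
Lemma cabsM z w : cabs (z * w) = cabs z * cabs w.
Proof. exact: Normc.normcM. Qed.
Lemma cabsN z : cabs (- z) = cabs z. Proof. exact: normcN. Qed.
Lemma cabsV z : cabs z^-1 = (cabs z)^-1. Proof. exact: Normc.normcV. Qed.
Lemma cabsf z w : cabs (z / w) = cabs z / cabs w. Proof. by rewrite cabsM cabsV. Qed.
Lemma cabs0 : cabs (0 : C R) = 0. Proof. exact: Normc.normc0. Qed.
Lemma cabs1 : cabs (1 : C R) = 1. Proof. exact: Normc.normc1. Qed.
Lemma cabs0_eq0 z : cabs z = 0 -> z = 0. Proof. exact: Normc.eq0_normc. Qed.
Lemma cabs_eq0 z : (cabs z == 0) = (z == 0).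
Proof. by apply/eqP/eqP => [/cabs0_eq0//|->]; exact: cabs0. Qed.
Lemma cabs_gt0 z : (0 < cabs z) = (z != 0).
Proof. by rewrite lt0r cabs_eq0 cabs_ge0 andbT. Qed.
Lemma cabsD z w : cabs (z + w) <= cabs z + cabs w. Proof. exact: le_normcD. Qed.
Lemma cabsBC z w : cabs (z - w) = cabs (w - z). Proof. by rewrite -cabsN opprB. Qed.
Lemma cabsB z w : cabs (z - w) <= cabs z + cabs w.
Proof. by rewrite (le_trans (cabsD _ _))// cabsN. Qed.
Lemma cabs_tri z w h : cabs (z - w) <= cabs (z - h) + cabs (h - w).
Proof. by rewrite (le_trans _ (cabsD _ _))// subrKA. Qed.
Lemma cabs_subl z w : cabs z - cabs w <= cabs (z - w).
Proof. by rewrite lerBlDr (le_trans _ (cabsD _ _))// subrK. Qed.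
Lemma cabs_dist z w : `|cabs z - cabs w| <= cabs (z - w).
Proof. by rewrite ler_norml lerNl opprB cabs_subl cabsBC cabs_subl. Qed.
Lemma cabs_rc x : cabs (rc x) = `|x|.
Proof. by rewrite /cabs /= expr0n/= addr0 sqrtr_sqr. Qed.
Lemma cabsX z n : cabs (z ^+ n) = cabs z ^+ n.
Proof. by elim: n => [|n IH]; rewrite ?expr0 ?cabs1// !exprS cabsM IH. Qed.
Lemma cabs_sqr z : cabs z ^+ 2 = re z ^+ 2 + im z ^+ 2.
Proof. by case: z => a b; rewrite /cabs /= sqr_sqrtr// addr_ge0// sqr_ge0. Qed.
Lemma re_le z : `|re z| <= cabs z.
Proof. by rewrite -sqrtr_sqr; case: z => a b; rewrite ler_wsqrtr// lerDl sqr_ge0. Qed.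
Lemma im_le z : `|im z| <= cabs z.
Proof. by rewrite -sqrtr_sqr; case: z => a b; rewrite ler_wsqrtr// lerDr sqr_ge0. Qed.
Lemma cabs_le z : cabs z <= `|re z| + `|im z|.
Proof.
rewrite -(@ler_pXn2r _ 2)// ?nnegrE ?cabs_ge0 ?addr_ge0// cabs_sqr.
rewrite sqrrD !real_normK ?num_real// -addrA lerD2l lerDr.
by rewrite mulrn_wge0// mulr_ge0.
Qed.
Lemma normcC z : `|z| = rc (cabs z) :> C R. Proof. by case: z. Qed.

Definition cj z : C R := Complex (re z) (- im z).
Lemma re_cj z : re (cj z) = re z. Proof. by []. Qed.
Lemma im_cj z : im (cj z) = - im z. Proof. by []. Qed.
Lemma mul_cj z : z * cj z = rc (cabs z ^+ 2).
Proof. by apply: C_eq; rewrite !cE ?re_cj ?im_cj ?cabs_sqr; ring. Qed.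
Lemma cabs_cj z : cabs (cj z) = cabs z.
Proof. by case: z => a b; rewrite /cabs /= sqrrN. Qed.

Lemma cabs_expi x : cabs (expi x) = 1.
Proof. by rewrite /cabs /= cos2Dsin2 sqrtr1. Qed.
Lemma expi_neq0 x : expi x != 0.
Proof. by rewrite -cabs_gt0 cabs_expi. Qed.
Lemma expi0 : expi (0 : R) = 1.
Proof. by apply: C_eq; rewrite /= ?cos0 ?sin0. Qed.
Lemma expiD x y : expi (x + y) = expi x * expi y.
Proof. by apply: C_eq; rewrite !cE/= ?cosD ?sinD; ring. Qed.
Lemma polar z : exists2 t, 0 <= t <= 2 * pi & z = rc (cabs z) * expi t.
Proof.
have [->|z0] := eqVneq z 0.
  by exists 0; rewrite ?lexx ?mulr_ge0 ?pi_ge0// cabs0 rc0 mul0r.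
have r0 : 0 < cabs z by rewrite cabs_gt0.
pose a := re z / cabs z; pose b := im z / cabs z.
have ab : a ^+ 2 + b ^+ 2 = 1.
  rewrite /a /b !expr_div_n -mulrDl -cabs_sqr divff// expf_neq0//.
  by rewrite gt_eqF.
have a1 : -1 <= a <= 1.
  by rewrite -ler_norml /a normrM normfV (gtr0_norm r0) ler_pdivrMr// mul1r re_le.
have ac : cos (acos a) = a by rewrite acosK// in_itv.
have a0pi : 0 <= acos a <= pi by rewrite acos_ge0//= acos_lepi.
have sE : sin (acos a) = `|b|.
  rewrite sin_acos// -[X in _ - X]addr0 -ab.
  by rewrite addr0 addrC addKr sqrtr_sqr.
have pi0 : 0 < pi :> R := pi_gt0 R.
have za : re z = cabs z * a by rewrite /a mulrC divfK// gt_eqF.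
have zb : im z = cabs z * b by rewrite /b mulrC divfK// gt_eqF.
have [b0|b0] := leP 0 b.
  exists (acos a); first by case/andP: a0pi => *; apply/andP; split; lra.
  by apply: C_eq; rewrite !cE/= ?ac ?sE ?ger0_norm//; lra.
exists (2 * pi - acos a); first by case/andP: a0pi => *; apply/andP; split; lra.
have c2 : cos (2 * pi - acos a) = a.
  by rewrite cosB mulr_natl cos2pi sin2pi ac mul0r addr0 mul1r.
have s2 : sin (2 * pi - acos a) = b.
  by rewrite sinB mulr_natl cos2pi sin2pi sE mul0r sub0r mul1r ltr0_norm// opprK.
by apply: C_eq; rewrite !cE/= ?c2 ?s2; lra.
Qed.

(** Balls of a numerical field have radii in that field; a positive element of [C R] has zero
    imaginary part, which gives real radii. *)
Lemma nbhsCP z (A : set (C R)) :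
  nbhs z A <-> exists2 e : R, 0 < e & forall w, cabs (w - z) < e -> A w.
Proof.
split.
  move=> /nbhs_ballP[e /= e0 eA].
  have [er ei] : 0 < re e /\ e = rc (re e).
    move: e0; rewrite ltcE/= => /andP[/eqP i0 r0]; split=> //.
    by apply: C_eq.
  exists (re e) => // w we; apply: eA; rewrite /ball/= ei distrC normcC.
  by rewrite ltcE/= eqxx.
move=> [e e0 eA]; apply/nbhs_ballP; exists (rc e) => /=.
  by rewrite ltcE/= eqxx.
move=> w; rewrite /ball/= distrC normcC ltcE/= eqxx/=; exact: eA.
Qed.
End Modulus.

(** * Goursat's theorem in logarithmic coordinates *)

Section RealIntegral.
Context {R : realType}.
Notation mu := (@lebesgue_measure R).

(** Two-sided continuity at each point of the segment, so that it passes to subsegments. *)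
Definition contitv (f : R -> R) (a b : R) :=
  forall x, a <= x <= b -> {for x, continuous f}.

Definition ii (f : R -> R) (a b : R) : R := \int[mu]_(x in `[a, b]) f x.

Lemma contitv_int f a b : contitv f a b -> mu.-integrable `[a, b] (EFin \o f).
Proof.
move=> cf; apply: continuous_compact_integrable; first exact: segment_compact.
apply: continuous_in_subspaceT => x; rewrite inE/= in_itv/= => xab.
exact: cf.
Qed.

Lemma iiD f g a b : contitv f a b -> contitv g a b ->
  ii (fun x => f x + g x) a b = ii f a b + ii g a b.
Proof. by move=> cf cg; rewrite /ii RintegralD//; exact: contitv_int. Qed.

Lemma iiB f g a b : contitv f a b -> contitv g a b ->
  ii (fun x => f x - g x) a b = ii f a b - ii g a b.
Proof. by move=> cf cg; rewrite /ii RintegralB//; exact: contitv_int. Qed.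

Lemma iiZ f k a b : contitv f a b -> ii (fun x => k * f x) a b = k * ii f a b.
Proof. by move=> cf; rewrite /ii RintegralZl//; exact: contitv_int. Qed.

Lemma ii_cst k a b : a <= b -> ii (fun=> k) a b = k * (b - a).
Proof.
move=> ab; rewrite /ii Rintegral_cst//= lebesgue_measure_itv/= lte_fin.
by move: ab; rewrite le_eqVlt => /predU1P[->|->//]; rewrite ltxx subrr.
Qed.

Lemma ii_le f g a b : contitv f a b -> contitv g a b ->
  (forall x, a <= x <= b -> f x <= g x) -> ii f a b <= ii g a b.
Proof.
move=> cf cg fg; have icf := contitv_int cf; have icg := contitv_int cg.
by apply: le_Rintegral => // x /=; rewrite in_itv/=; exact: fg.
Qed.

Lemma contitv_cst k a b : contitv (fun=> k) a b.
Proof. by move=> x _; exact: cst_continuous. Qed.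

Lemma contitvS f a b c d : a <= c -> d <= b -> contitv f a b -> contitv f c d.
Proof. by move=> ac db cf x /andP[cx xd]; apply: cf; apply/andP; split; lra. Qed.

Lemma ii_bound f M a b : a <= b -> contitv f a b ->
  (forall x, a <= x <= b -> `|f x| <= M) -> `|ii f a b| <= M * (b - a).
Proof.
move=> ab cf fM; rewrite ler_norml -mulNr -!ii_cst//; apply/andP; split.
  apply: ii_le => //; first exact: contitv_cst.
  by move=> x /fM; rewrite ler_norml => /andP[].
apply: ii_le => //; first exact: contitv_cst.
by move=> x /fM; rewrite ler_norml => /andP[].
Qed.

Lemma ii_split f a b c : a <= b -> b <= c -> contitv f a c ->
  ii f a c = ii f a b + ii f b c.
Proof.
move=> ab bc cf; have icf := contitv_int cf.
have := @Rintegral_itvB R f (BLeft a) (BRight c) b icf.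
rewrite !bnd_simp => /(_ ab bc) h.
rewrite /ii -[X in _ + X](@Rintegral_itv_obnd_cbnd _ b (BRight c) f) -?h ?subrKC//.
by apply: integrableS icf => //; apply: subset_itvr; rewrite bnd_simp.
Qed.

Lemma eq_ii f g a b : (forall x, a <= x <= b -> f x = g x) -> ii f a b = ii g a b.
Proof.
move=> fg; apply: eq_Rintegral => x; rewrite inE/= in_itv/=; exact: fg.
Qed.

Lemma rcontP (f : R -> R) x : {for x, continuous f} <->
  forall e : R, 0 < e -> exists2 d : R, 0 < d & forall y, `|y - x| < d -> `|f y - f x| < e.
Proof.
split=> [/cvgrPdist_lt cf e e0|cf].
  have /nbhs_ballP[d /= d0 dP] := cf _ e0.
  by exists d => // y yd; rewrite distrC; apply: dP; rewrite /ball/= distrC.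
apply/cvgrPdist_lt => e e0; have [d d0 dP] := cf _ e0.
apply/nbhs_ballP; exists d => //= y; rewrite /ball/= distrC => yd.
by rewrite distrC; exact: dP.
Qed.
End RealIntegral.

(** The integral of [Q dx + P dy] over the boundary of the rectangle, that is, the imaginary part of
    the contour integral of [P + i Q]. *)
Definition green_defect {R : realType} (P Q : R -> R -> R) (x1 x2 y1 y2 : R) : R :=
  ii (fun y => P x2 y - P x1 y) y1 y2 - ii (fun x => Q x y2 - Q x y1) x1 x2.

Section Goursat.
Context {R : realType}.
Variables (P Q : R -> R -> R).
Local Notation E := (green_defect P Q).

(** Real differentiability of [P] and [Q] with [P_x = Q_y], the Cauchy-Riemann equation that makes
    [Q dx + P dy] closed. *)
Definition cr_pair (x y : R) := exists a b c : R, forall e : R, 0 < e ->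
  exists2 d : R, 0 < d & forall h k, `|h| < d -> `|k| < d ->
    `|P (x + h) (y + k) - P x y - (a * h + b * k)| <= e * (`|h| + `|k|) /\
    `|Q (x + h) (y + k) - Q x y - (c * h + a * k)| <= e * (`|h| + `|k|).

Lemma cr_pair_cont x y : cr_pair x y ->
  [/\ {for x, continuous (P ^~ y)}, {for y, continuous (P x)},
      {for x, continuous (Q ^~ y)} & {for y, continuous (Q x)}].
Proof.
move=> [a [b [c H]]].
have key : forall e : R, 0 < e -> exists2 d : R, 0 < d & forall h k, `|h| < d -> `|k| < d ->
    `|P (x + h) (y + k) - P x y| < e /\ `|Q (x + h) (y + k) - Q x y| < e.
  move=> e e0; have [d d0 dP] := H _ ltr01.
  pose M := 1 + `|a| + `|b| + `|c|.
  have a0 := normr_ge0 a; have b0 := normr_ge0 b; have c0 := normr_ge0 c.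
  have M0 : 0 < M by rewrite /M; lra.
  exists (Num.min d (e / (4 * M))).
    by rewrite lt_min d0/= divr_gt0// mulr_gt0.
  move=> h k; rewrite !lt_min => /andP[hd he] /andP[kd ke].
  have [p q] := dP h k hd kd.
  have heM : M * `|h| < e / 4.
    by move: he; rewrite ltr_pdivlMr ?mulr_gt0// => he; lra.
  have keM : M * `|k| < e / 4.
    by move: ke; rewrite ltr_pdivlMr ?mulr_gt0// => ke; lra.
  have bnd (u v : R) (z : R) : `|z - (u * h + v * k)| <= 1 * (`|h| + `|k|) ->
      1 + `|u| <= M -> 1 + `|v| <= M -> `|z| < e.
    move=> zle uM vM.
    have -> : z = (z - (u * h + v * k)) + (u * h + v * k) by ring.
    have t1 := ler_normD (z - (u * h + v * k)) (u * h + v * k).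
    have t2 := ler_normD (u * h) (v * k).
    have t3 : (1 + `|u|) * `|h| <= M * `|h| by rewrite ler_wpM2r.
    have t4 : (1 + `|v|) * `|k| <= M * `|k| by rewrite ler_wpM2r.
    rewrite !normrM in t2; lra.
  have [M1 M2 M3] : [/\ 1 + `|a| <= M, 1 + `|b| <= M & 1 + `|c| <= M].
    by rewrite /M; clear -a0 b0 c0; split; lra.
  by split; [apply: (bnd a b)|apply: (bnd c a)].
split; apply/rcontP => e e0; have [d d0 dP] := key _ e0; exists d => // z zd.
- by have [+ _] := dP (z - x) 0 zd (ltac:(by rewrite normr0)); rewrite addr0 subrKC.
- by have [+ _] := dP 0 (z - y) (ltac:(by rewrite normr0)) zd; rewrite addr0 subrKC.
- by have [_ +] := dP (z - x) 0 zd (ltac:(by rewrite normr0)); rewrite addr0 subrKC.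
- by have [_ +] := dP 0 (z - y) (ltac:(by rewrite normr0)) zd; rewrite addr0 subrKC.
Qed.

Variables (X1 Y1 a b : R).
Hypothesis a0 : 0 <= a.
Hypothesis b0 : 0 <= b.
Local Notation X2 := (X1 + a).
Local Notation Y2 := (Y1 + b).
Hypothesis PQ : forall x y, X1 <= x <= X2 -> Y1 <= y <= Y2 -> cr_pair x y.

Let cB (f g : R -> R) s t : contitv f s t -> contitv g s t -> contitv (fun x => f x - g x) s t.
Proof. by move=> cf cg x xab; apply: continuousB; [exact: cf|exact: cg]. Qed.

Let cPy x : X1 <= x <= X2 -> contitv (P x) Y1 Y2.
Proof. by move=> xX y yY; have [] := cr_pair_cont (PQ xX yY). Qed.

Let cQx y : Y1 <= y <= Y2 -> contitv (Q ^~ y) X1 X2.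
Proof. by move=> yY x xX; have [] := cr_pair_cont (PQ xX yY). Qed.

Let E_xsplit x1 x2 x3 y1 y2 : X1 <= x1 -> x1 <= x2 -> x2 <= x3 -> x3 <= X2 ->
  Y1 <= y1 -> y1 <= y2 -> y2 <= Y2 ->
  E x1 x3 y1 y2 = E x1 x2 y1 y2 + E x2 x3 y1 y2.
Proof.
move=> ? ? ? ? ? ? ?; rewrite /green_defect.
have cP x : X1 <= x <= X2 -> contitv (P x) y1 y2.
  by move=> xX; apply: contitvS (cPy xX); lra.
have cQ s t y : X1 <= s -> t <= X2 -> Y1 <= y <= Y2 -> contitv (Q ^~ y) s t.
  by move=> aX bX yY; apply: contitvS (cQx yY); lra.
rewrite (@ii_split _ _ x1 x2 x3)//; last by apply: cB; apply: cQ; lra.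
rewrite !iiB; try (by apply: cP; lra); try (by apply: cQ; lra).
lra.
Qed.

Let E_ysplit x1 x2 y1 y2 y3 : X1 <= x1 -> x1 <= x2 -> x2 <= X2 ->
  Y1 <= y1 -> y1 <= y2 -> y2 <= y3 -> y3 <= Y2 ->
  E x1 x2 y1 y3 = E x1 x2 y1 y2 + E x1 x2 y2 y3.
Proof.
move=> ? ? ? ? ? ? ?; rewrite /green_defect.
have cP s t x : Y1 <= s -> t <= Y2 -> X1 <= x <= X2 -> contitv (P x) s t.
  by move=> aX bX xX; apply: contitvS (cPy xX); lra.
have cQ y : Y1 <= y <= Y2 -> contitv (Q ^~ y) x1 x2.
  by move=> yY; apply: contitvS (cQx yY); lra.
rewrite (@ii_split _ _ y1 y2 y3)//; last by apply: cB; apply: cP; lra.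
rewrite !iiB; try (by apply: cP; lra); try (by apply: cQ; lra).
lra.
Qed.

(** A dyadic subrectangle of generation [n] is represented by its lower left corner. *)
Let En n (p : R * R) := E p.1 (p.1 + a / 2 ^+ n) p.2 (p.2 + b / 2 ^+ n).
Let ok n (p : R * R) := [&& X1 <= p.1, p.1 + a / 2 ^+ n <= X2, Y1 <= p.2 & p.2 + b / 2 ^+ n <= Y2].

Let half (c : R) n : c / 2 ^+ n = c / 2 ^+ n.+1 + c / 2 ^+ n.+1.
Proof. by rewrite exprS; field; rewrite expf_neq0. Qed.
Let q0 (c : R) n : 0 <= c -> 0 <= c / 2 ^+ n.
Proof. by move=> c0; rewrite divr_ge0// exprn_ge0. Qed.

Let sub n (p q : R * R) := [/\ p.1 <= q.1, q.1 + a / 2 ^+ n.+1 <= p.1 + a / 2 ^+ n,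
   p.2 <= q.2 & q.2 + b / 2 ^+ n.+1 <= p.2 + b / 2 ^+ n].

Let quarter_ge (S e1 e2 e3 e4 : R) : S <= `|(e1 + e2) + (e3 + e4)| ->
  [\/ S <= 4 * `|e1|, S <= 4 * `|e2|, S <= 4 * `|e3| | S <= 4 * `|e4|].
Proof.
move=> h; have := ler_normD (e1 + e2) (e3 + e4).
have := ler_normD e1 e2; have := ler_normD e3 e4.
have [n1|n1] := leP S (4 * `|e1|); first by constructor 1.
have [n2|n2] := leP S (4 * `|e2|); first by constructor 2.
have [n3|n3] := leP S (4 * `|e3|); first by constructor 3.
by move=> *; constructor 4; lra.
Qed.

Let step n p : ok n p -> exists q, [/\ ok n.+1 q, sub n p q & `|En n p| <= 4 * `|En n.+1 q| ].
Proof.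
case: p => x y; rewrite /ok /En /sub /=.
move: (q0 n.+1 a0) (q0 n.+1 b0); rewrite !(half _ n).
move: (a / 2 ^+ n.+1) (b / 2 ^+ n.+1) => u v u0 v0 /and4P[h1 h2 h3 h4].
have s1 := @E_xsplit x (x + u) (x + u + u) y (y + v + v) h1 (ltac:(lra)) (ltac:(lra)) (ltac:(lra)) h3 (ltac:(lra)) (ltac:(lra)).
have s2 := @E_ysplit x (x + u) y (y + v) (y + v + v) h1 (ltac:(lra)) (ltac:(lra)) h3 (ltac:(lra)) (ltac:(lra)) (ltac:(lra)).
have s3 := @E_ysplit (x + u) (x + u + u) y (y + v) (y + v + v) (ltac:(lra)) (ltac:(lra)) (ltac:(lra)) h3 (ltac:(lra)) (ltac:(lra)) (ltac:(lra)).
rewrite !addrA s1 s2 s3 {s1 s2 s3}.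
move: (quarter_ge (lexx `|E x (x + u) y (y + v) + E x (x + u) (y + v) (y + v + v) +
  (E (x + u) (x + u + u) y (y + v) + E (x + u) (x + u + u) (y + v) (y + v + v))|)).
case=> n1.
- exists (x, y); split=> //=; first by apply/and4P; split; lra.
  by split; lra.
- exists (x, y + v); split=> //=; first by apply/and4P; split; lra.
  by split; lra.
- exists (x + u, y); split=> //=; first by apply/and4P; split; lra.
  by split; lra.
- exists (x + u, y + v); split=> //=; first by apply/and4P; split; lra.
  by split; lra.
Qed.

(** Goursat's bisection: the defect is additive, so one of the four quarters always carries at least
    a quarter of it. The nested rectangles shrink to a point, where the first-order expansion makes
    the defect small compared with the area. *)
Lemma goursat_def : ii (fun y => P X2 y - P X1 y) Y1 Y2 = ii (fun x => Q x Y2 - Q x Y1) X1 X2.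
Proof.
apply/eqP; rewrite -subr_eq0 -/(E X1 X2 Y1 Y2); apply/eqP.
pose nx n p : R * R := xget p [set q | [/\ ok n.+1 q, sub n p q & `|En n p| <= 4 * `|En n.+1 q| ]].
pose fix s n : R * R := if n is m.+1 then nx m (s m) else (X1, Y1).
have ok_s n : ok n (s n).
  elim: n => [|n IH /=]; first by rewrite /ok /= expr0 !divr1 !lexx.
  by rewrite /nx; case: xgetP => [q _ []//|/(_ _)]; have [q qP] := step IH => /(_ q).
have sP n : sub n (s n) (s n.+1) /\ `|En n (s n)| <= 4 * `|En n.+1 (s n.+1)|.
  rewrite [s n.+1]/= /nx; case: xgetP => [q _ []//|/(_ _)].
  by have [q qP] := step (ok_s n) => /(_ q).
have E0n n : `|E X1 X2 Y1 Y2| <= 4 ^+ n * `|En n (s n)|.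
  elim: n => [|n IH]; first by rewrite /En /= !expr0 !divr1 mul1r.
  apply: (le_trans IH); rewrite exprSr -mulrA ler_wpM2l ?exprn_ge0//.
  by have [_] := sP n.
have nested (c : R) (u : nat -> R) : 0 <= c -> (forall n, u n <= u n.+1) ->
    (forall n, u n.+1 + c / 2 ^+ n.+1 <= u n + c / 2 ^+ n) ->
    exists x, forall n, u n <= x <= u n + c / 2 ^+ n.
  move=> c0 ui ud.
  have mono n m : u n <= u (n + m)%N.
    by elim: m => [|m IH]; rewrite ?addn0// addnS (le_trans IH).
  have anti n m : u (n + m)%N + c / 2 ^+ (n + m) <= u n + c / 2 ^+ n.
    by elim: m => [|m IH]; rewrite ?addn0// addnS (le_trans (ud _)).
  have ub n m : u m <= u n + c / 2 ^+ n.
    have [nm|mn] := leqP n m.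
      by rewrite -(subnKC nm); have := anti n (m - n)%N; have := q0 (n + (m - n)) c0; lra.
    by have := mono m (n - m)%N; rewrite subnKC 1?ltnW//; have := q0 n c0; lra.
  have hs : has_sup (range u).
    by split; [exists (u 0%N); exists 0%N|exists (u 0%N + c / 2 ^+ 0) => _ [m _ <-]].
  exists (sup (range u)) => n; apply/andP; split.
    by apply: ub_le_sup; [case: hs|exists n].
  by apply: ge_sup; [case: hs|move=> _ [m _ <-]].
have [X XP] := nested a (fun n => (s n).1) a0 (fun n => let: conj (And4 h _ _ _) _ := sP n in h)
  (fun n => let: conj (And4 _ h _ _) _ := sP n in h).
have [Y YP] := nested b (fun n => (s n).2) b0 (fun n => let: conj (And4 _ _ h _) _ := sP n in h)
  (fun n => let: conj (And4 _ _ _ h) _ := sP n in h).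
have XX : X1 <= X <= X2.
  by have := XP 0%N; rewrite /= expr0 divr1.
have YY : Y1 <= Y <= Y2.
  by have := YP 0%N; rewrite /= expr0 divr1.
have [ca [cb [cc H]]] := PQ XX YY.
have bound (e : R) : 0 < e -> `|E X1 X2 Y1 Y2| <= e * (4 * (a + b) ^+ 2).
  move=> e0; have [d d0 dP] := H _ e0.
  have [n nd] : exists n, a / 2 ^+ n < d /\ b / 2 ^+ n < d.
    have abd : 0 <= (a + b) / d by apply: divr_ge0; [exact: addr_ge0|exact: ltW].
    pose N := Num.bound ((a + b) / d); exists N.+1.
    have Nd : (a + b) / d < 2 ^+ N.+1.
      apply: (lt_le_trans (archi_boundP abd)).
      by rewrite -natrX ler_nat ltnW// (ltn_trans (ltnSn _))// ltn_expl.
    have p0 : 0 < 2 ^+ N.+1 :> R by rewrite exprn_gt0.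
    rewrite ltr_pdivrMr// in Nd; rewrite !ltr_pdivrMr//.
    by have := a0; have := b0; split; lra.
  apply: (le_trans (E0n n)).
  rewrite /En; move: (ok_s n) (XP n) (YP n); case: (s n) => x y; rewrite /ok /=.
  move: nd => [ad bd].
  set u := a / 2 ^+ n; set v := b / 2 ^+ n => /and4P[k1 k2 k3 k4] xX yY.
  have u0 : 0 <= u by exact: q0.
  have v0 : 0 <= v by exact: q0.
  have uE : u * 2 ^+ n = a by rewrite /u divfK// expf_neq0.
  have vE : v * 2 ^+ n = b by rewrite /v divfK// expf_neq0.
  rewrite -/u in ad; rewrite -/v in bd.
  clearbody u v; clear ok_s sP nested H E0n XP YP; clear s nx.
  have est x' y' : x <= x' <= x + u -> y <= y' <= y + v ->
     `|P x' y' - P X Y - (ca * (x' - X) + cb * (y' - Y))| <= e * (u + v) /\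
     `|Q x' y' - Q X Y - (cc * (x' - X) + ca * (y' - Y))| <= e * (u + v).
    move=> xx yy.
    have hu : `|x' - X| <= u by rewrite ler_norml; apply/andP; split; lra.
    have hv : `|y' - Y| <= v by rewrite ler_norml; apply/andP; split; lra.
    have := dP (x' - X) (y' - Y) (le_lt_trans hu ad) (le_lt_trans hv bd).
    rewrite !subrKC => -[p q]; split; [apply: (le_trans p)|apply: (le_trans q)];
    by rewrite ler_pM2l// lerD.
  have uv0 : 0 <= e * (u + v) by apply: mulr_ge0; [exact: ltW|exact: addr_ge0].
  have iP : `|ii (fun y0 => P (x + u) y0 - P x y0 - ca * u) y (y + v)| <= 2 * (e * (u + v)) * (y + v - y).
    apply: ii_bound; first lra.
      apply: cB; last exact: contitv_cst.
      by apply: cB; (apply: contitvS (cPy _); lra).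
    move=> y' yy.
    have [p1 _] := est (x + u) y' (ltac:(lra)) yy.
    have [p2 _] := est x y' (ltac:(lra)) yy.
    have -> : P (x + u) y' - P x y' - ca * u =
      (P (x + u) y' - P X Y - (ca * (x + u - X) + cb * (y' - Y))) -
      (P x y' - P X Y - (ca * (x - X) + cb * (y' - Y))) by ring.
    by rewrite (le_trans (ler_normB _ _))//; lra.
  have iQ : `|ii (fun x0 => Q x0 (y + v) - Q x0 y - ca * v) x (x + u)| <= 2 * (e * (u + v)) * (x + u - x).
    apply: ii_bound; first lra.
      apply: cB; last exact: contitv_cst.
      by apply: cB; (apply: contitvS (cQx _); lra).
    move=> x' xx.
    have [_ p1] := est x' (y + v) xx (ltac:(lra)).
    have [_ p2] := est x' y xx (ltac:(lra)).
    have -> : Q x' (y + v) - Q x' y - ca * v =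
      (Q x' (y + v) - Q X Y - (cc * (x' - X) + ca * (y + v - Y))) -
      (Q x' y - Q X Y - (cc * (x' - X) + ca * (y - Y))) by ring.
    by rewrite (le_trans (ler_normB _ _))//; lra.
  rewrite iiB ?ii_cst in iP; [|lra|by apply: cB; (apply: contitvS (cPy _); lra)|exact: contitv_cst].
  rewrite iiB ?ii_cst in iQ; [|lra|by apply: cB; (apply: contitvS (cQx _); lra)|exact: contitv_cst].
  (* Both integrals have the same main term [ca * u * v], by the coefficient shared in [cr_pair];
     only the errors remain. *)
  have Ele : `|E x (x + u) y (y + v)| <= 2 * (e * (u + v)) * (u + v).
    rewrite /green_defect; set I := ii _ _ _ in iP *; set J := ii _ _ _ in iQ *.
    have -> : I - J = (I - ca * u * (y + v - y)) - (J - ca * v * (x + u - x)) by ring.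
    by rewrite (le_trans (ler_normB _ _))// (le_trans (lerD iP iQ))//; lra.
  (* The factor [4 ^+ n] lost in the bisection is exactly the ratio of the squared sizes. *)
  have -> : 4 * (a + b) ^+ 2 = 4 ^+ n * (4 * (u + v) ^+ 2).
    rewrite -uE -vE (_ : 4 = 2 * 2 :> R) ?exprMn; ring.
  rewrite mulrCA ler_wpM2l ?exprn_ge0// (le_trans Ele)//.
  have := mulr_ge0 uv0 (addr_ge0 u0 v0); lra.
apply/eqP; rewrite -normr_eq0 eq_le normr_ge0 andbT.
apply: (le0_of_eps _ bound); exact: mulr_ge0 (ler0n _ _) (sqr_ge0 _).
Qed.
End Goursat.

Lemma goursat {R : realType} (P Q : R -> R -> R) (x1 x2 y1 y2 : R) :
  x1 <= x2 -> y1 <= y2 ->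
  (forall x y, x1 <= x <= x2 -> y1 <= y <= y2 -> cr_pair P Q x y) ->
  ii (fun y => P x2 y - P x1 y) y1 y2 = ii (fun x => Q x y2 - Q x y1) x1 x2.
Proof.
rewrite -[x1 <= x2]subr_ge0 -[y1 <= y2]subr_ge0 => x12 y12 PQ.
by have := @goursat_def R P Q x1 y1 _ _ x12 y12; rewrite !subrKC; exact.
Qed.

(** * Complex derivatives and the mean value property *)

Section ContAt.
Context {K : numFieldType} {T : topologicalType}.
Implicit Types (f g : T -> K) (x : T).
Lemma contD f g x : {for x, continuous f} -> {for x, continuous g} ->
  {for x, continuous (fun w => f w + g w)}.
Proof. exact: cvgD. Qed.
Lemma contN f x : {for x, continuous f} -> {for x, continuous (fun w => - f w)}.
Proof. exact: cvgN. Qed.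
Lemma contB f g x : {for x, continuous f} -> {for x, continuous g} ->
  {for x, continuous (fun w => f w - g w)}.
Proof. exact: cvgB. Qed.
Lemma contM f g x : {for x, continuous f} -> {for x, continuous g} ->
  {for x, continuous (fun w => f w * g w)}.
Proof. exact: cvgM. Qed.
Lemma contV f x : f x != 0 -> {for x, continuous f} ->
  {for x, continuous (fun w => (f w)^-1)}.
Proof. exact: cvgV. Qed.
Lemma contf f g x : g x != 0 -> {for x, continuous f} -> {for x, continuous g} ->
  {for x, continuous (fun w => f w / g w)}.
Proof. by move=> gx cf cg; apply: contM => //; exact: contV. Qed.
Lemma cont_cst (k : K) x : {for x, continuous (fun=> k)}.
Proof. exact: cvg_cst. Qed.
End ContAt.

Lemma cont_comp {T U V : topologicalType} (f : T -> U) (g : U -> V) (x : T) :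
  {for x, continuous f} -> {for f x, continuous g} -> {for x, continuous (fun w => g (f w))}.
Proof. exact: continuous_comp. Qed.

Lemma cont_id {T : topologicalType} (x : T) : {for x, continuous (fun w : T => w)}.
Proof. exact: cvg_id. Qed.

Section ContC.
Context {R : realType}.
Implicit Types (f g : C R -> C R) (u v : C R -> R) (z : C R).
Lemma ccontD f g z : {for z, continuous f} -> {for z, continuous g} ->
  {for z, continuous (fun w => f w + g w)}.
Proof. by move=> cf cg; exact (contD cf cg). Qed.
Lemma ccontN f z : {for z, continuous f} -> {for z, continuous (fun w => - f w)}.
Proof. by move=> cf; exact (contN cf). Qed.
Lemma ccontB f g z : {for z, continuous f} -> {for z, continuous g} ->
  {for z, continuous (fun w => f w - g w)}.
Proof. by move=> cf cg; exact (contB cf cg). Qed.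
Lemma ccontM f g z : {for z, continuous f} -> {for z, continuous g} ->
  {for z, continuous (fun w => f w * g w)}.
Proof. by move=> cf cg; exact (contM cf cg). Qed.
Lemma ccontf f g z : g z != 0 -> {for z, continuous f} -> {for z, continuous g} ->
  {for z, continuous (fun w => f w / g w)}.
Proof. by move=> gz cf cg; exact (contf gz cf cg). Qed.
Lemma ccont_cst (k z : C R) : {for z, continuous (fun _ : C R => k)}.
Proof. exact (@cont_cst (C R) (C R) k z). Qed.
Lemma ccont_id z : {for z, continuous (fun w : C R => w)}.
Proof. exact (@cont_id (C R) z). Qed.
Lemma ccont_comp f g z : {for z, continuous f} -> {for f z, continuous g} ->
  {for z, continuous (fun w => g (f w))}.
Proof. by move=> cf cg; exact (cont_comp cf cg). Qed.
Lemma vcontD u v z : {for z, continuous u} -> {for z, continuous v} ->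
  {for z, continuous (fun w => u w + v w)}.
Proof. by move=> cf cg; exact (contD cf cg). Qed.
Lemma vcontN u z : {for z, continuous u} -> {for z, continuous (fun w => - u w)}.
Proof. by move=> cf; exact (contN cf). Qed.
Lemma vcontB u v z : {for z, continuous u} -> {for z, continuous v} ->
  {for z, continuous (fun w => u w - v w)}.
Proof. by move=> cf cg; exact (contB cf cg). Qed.
Lemma vcontM u v z : {for z, continuous u} -> {for z, continuous v} ->
  {for z, continuous (fun w => u w * v w)}.
Proof. by move=> cf cg; exact (contM cf cg). Qed.
Lemma vcont_cst (k : R) z : {for z, continuous (fun _ : C R => k)}.
Proof. exact (@cont_cst R (C R) k z). Qed.
Lemma vcont_comp f v z : {for z, continuous f} -> {for f z, continuous v} ->
  {for z, continuous (fun w => v (f w))}.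
Proof. by move=> cf cg; exact (cont_comp cf cg). Qed.
Lemma rcont_comp (g : R -> C R) v (t : R) : {for t, continuous g} -> {for g t, continuous v} ->
  {for t, continuous (fun s => v (g s))}.
Proof. by move=> cf cg; exact (cont_comp cf cg). Qed.
End ContC.

Section Continuity.
Context {R : realType}.
Implicit Types (z w h l m : C R) (f g q : C R -> C R).

Lemma nbhsRP (x : R) (A : set R) :
  nbhs x A <-> exists2 e : R, 0 < e & forall y, `|y - x| < e -> A y.
Proof.
split=> [/nbhs_ballP[e /= e0 eA]|[e e0 eA]].
  by exists e => // y ye; apply: eA; rewrite /ball/= distrC.
by apply/nbhs_ballP; exists e => //= y; rewrite /ball/= distrC => /eA.
Qed.

Lemma ccontP f z : {for z, continuous f} <->
  forall e : R, 0 < e -> exists2 d : R, 0 < d &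
    forall w, cabs (w - z) < d -> cabs (f w - f z) < e.
Proof.
split=> [cf e e0|H A /nbhsCP[e e0 eA]].
  have /nbhsCP : nbhs z (f @^-1` [set w | cabs (w - f z) < e]).
    by apply: cf; apply/nbhsCP; exists e.
  by [].
by apply/nbhsCP; have [d d0 dP] := H _ e0; exists d => // w /dP /eA.
Qed.

Lemma vcontP (v : C R -> R) z : {for z, continuous v} <->
  forall e : R, 0 < e -> exists2 d : R, 0 < d &
    forall w, cabs (w - z) < d -> `|v w - v z| < e.
Proof.
split=> [cf e e0|H A /nbhsRP[e e0 eA]].
  have /nbhsCP : nbhs z (v @^-1` [set w | `|w - v z| < e]).
    by apply: cf; apply/nbhsRP; exists e.
  by [].
by apply/nbhsCP; have [d d0 dP] := H _ e0; exists d => // w /dP /eA.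
Qed.

Lemma tcontP (g : R -> C R) t : {for t, continuous g} <->
  forall e : R, 0 < e -> exists2 d : R, 0 < d &
    forall s, `|s - t| < d -> cabs (g s - g t) < e.
Proof.
split=> [cf e e0|H A /nbhsCP[e e0 eA]].
  have /nbhsRP : nbhs t (g @^-1` [set w | cabs (w - g t) < e]).
    by apply: cf; apply/nbhsCP; exists e.
  by [].
by apply/nbhsRP; have [d d0 dP] := H _ e0; exists d => // w /dP /eA.
Qed.

Lemma re_cont z : {for z, continuous (@re R)}.
Proof.
apply/vcontP => e e0; exists e => // w we; rewrite -reB.
exact: le_lt_trans (re_le _) we.
Qed.

Lemma im_cont z : {for z, continuous (@im R)}.
Proof.
apply/vcontP => e e0; exists e => // w we; rewrite -imB.
exact: le_lt_trans (im_le _) we.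
Qed.

Lemma cabs_cont z : {for z, continuous (@cabs R)}.
Proof.
apply/vcontP => e e0; exists e => // w we.
exact: le_lt_trans (cabs_dist _ _) we.
Qed.

Lemma rc_cont (x : R) : {for x, continuous (@rc R)}.
Proof. by apply/tcontP => e e0; exists e => // y; rewrite -rcB cabs_rc. Qed.

Lemma expi_cont (t : R) : {for t, continuous (@expi R)}.
Proof.
apply/tcontP => e e0.
have e2 : 0 < e / 2 by rewrite divr_gt0.
have /rcontP/(_ _ e2)[d d0 dP] := @continuous_cos R t.
have /rcontP/(_ _ e2)[d' d'0 d'P] := @continuous_sin R t.
exists (Num.min d d'); first by rewrite lt_min d0.
move=> s; rewrite lt_min => /andP[/dP h1 /d'P h2].
apply: (le_lt_trans (cabs_le _)); rewrite reB imB /=; lra.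
Qed.

Definition circ (c : C R) (r t : R) : C R := c + rc r * expi t.

Lemma circ_cont c r t : {for t, continuous (circ c r)}.
Proof.
apply: contD; first exact: cont_cst.
by apply: contM; [exact: cont_cst|exact: expi_cont].
Qed.

Lemma circ_dist c r t : cabs (circ c r t - c) = `|r|.
Proof. by rewrite /circ addrC addKr cabsM cabs_rc cabs_expi mulr1. Qed.

Lemma circP c z : exists2 t, 0 <= t <= 2 * pi & z = circ c (cabs (z - c)) t.
Proof. by have [t t01 zE] := polar (z - c); exists t => //; rewrite /circ -zE subrKC. Qed.

(* Carathéodory's form of complex differentiability. *)
Definition cderiv f z l := exists q : C R -> C R,
  [/\ forall w, f w = f z + q w * (w - z), {for z, continuous q} & q z = l].

Definition cdiff f z := exists l, cderiv f z l.

Lemma cderiv_cont f z l : cderiv f z l -> {for z, continuous f}.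
Proof.
move=> [q [fE cq _]].
have -> : f = fun w => f z + q w * (w - z) by apply/funext => w; exact: fE.
apply: ccontD; first exact: ccont_cst.
apply: ccontM; first exact: cq.
by apply: ccontB; [exact: ccont_id|exact: ccont_cst].
Qed.

Lemma cderivP f z l : cderiv f z l <-> forall e : R, 0 < e -> exists2 d : R, 0 < d &
    forall h, cabs h < d -> cabs (f (z + h) - f z - l * h) <= e * cabs h.
Proof.
split=> [[q [fE /ccontP cq ql]] e e0|H].
  have [d d0 dP] := cq _ e0; exists d => // h hd.
  have -> : f (z + h) - f z - l * h = (q (z + h) - q z) * h.
    by rewrite fE ql; ring.
  rewrite cabsM ler_wpM2r ?cabs_ge0// ltW// dP//.
  by rewrite addrC addKr.
exists (fun w => if w == z then l else (f w - f z) / (w - z)); split.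
- move=> w; case: eqP => [->|/eqP wz]; first by rewrite subrr mulr0 addr0.
  by rewrite divfK ?subr_eq0// subrKC.
- apply/ccontP => e e0; have [d d0 dP] := H _ (divr_gt0 e0 (ltr0n _ 2)).
  exists d => // w wd; rewrite eqxx; case: eqP => [_|/eqP wz].
    by rewrite subrr cabs0.
  have wz0 : w - z != 0 by rewrite subr_eq0.
  have -> : (f w - f z) / (w - z) - l = (f (z + (w - z)) - f z - l * (w - z)) / (w - z).
    by rewrite subrKC; field.
  rewrite cabsf ltr_pdivrMr ?cabs_gt0//.
  apply: (le_lt_trans (dP _ wd)); rewrite ltr_pM2r ?cabs_gt0//.
  by rewrite ltr_pdivrMr// ltr_pMr// ltr1n.
- by rewrite eqxx.
Qed.

Lemma cderiv_near f g z l (r : R) : 0 < r -> (forall w, cabs (w - z) < r -> f w = g w) ->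
  cderiv f z l -> cderiv g z l.
Proof.
move=> r0 fg /cderivP H; apply/cderivP => e e0; have [d d0 dP] := H _ e0.
exists (Num.min d r); first by rewrite lt_min d0.
move=> h; rewrite lt_min => /andP[hd hr].
rewrite -!fg ?subrr ?cabs0//; last by rewrite addrC addKr.
exact: dP.
Qed.

Lemma cderiv_id z : cderiv id z 1.
Proof. by exists (fun=> 1); split; [move=> w; rewrite mul1r subrKC|exact: ccont_cst|]. Qed.

Lemma cderiv_cst l z : cderiv (fun=> l) z 0.
Proof. by exists (fun=> 0); split; [move=> w; rewrite mul0r addr0|exact: ccont_cst|]. Qed.

Lemma cderivD f g z l m : cderiv f z l -> cderiv g z m ->
  cderiv (fun w => f w + g w) z (l + m).
Proof.
move=> [p [fE cp <-]] [q [gE cq <-]]; exists (fun w => p w + q w); split; last by [].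
  by move=> w; rewrite fE gE; ring.
exact: ccontD.
Qed.

Lemma cderivM f g z l m : cderiv f z l -> cderiv g z m ->
  cderiv (fun w => f w * g w) z (l * g z + f z * m).
Proof.
move=> df dg; have cg := cderiv_cont dg.
case: df => [p [fE cp <-]]; case: dg => [q [gE cq <-]].
exists (fun w => p w * g w + f z * q w); split; last by [].
  by move=> w; rewrite [f w]fE [g w]gE; ring.
apply: ccontD; apply: ccontM; [exact: cp|exact: cg|exact: ccont_cst|exact: cq].
Qed.

Lemma cderivZ k f z l : cderiv f z l -> cderiv (fun w => k * f w) z (k * l).
Proof. by move=> df; have := cderivM (cderiv_cst k z) df; rewrite mul0r add0r. Qed.

Lemma cderivN f z l : cderiv f z l -> cderiv (fun w => - f w) z (- l).
Proof.
by move=> df; have := cderivZ (-1) df; rewrite mulN1r; under eq_fun do rewrite mulN1r.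
Qed.

Lemma cderivB f g z l m : cderiv f z l -> cderiv g z m ->
  cderiv (fun w => f w - g w) z (l - m).
Proof. by move=> df dg; apply: cderivD => //; exact: cderivN. Qed.

Lemma cderiv_comp f g z l m : cderiv f (g z) l -> cderiv g z m ->
  cderiv (f \o g) z (l * m).
Proof.
move=> df dg; have cg := cderiv_cont dg.
case: df => [p [fE cp <-]]; case: dg => [q [gE cq <-]].
exists (fun w => p (g w) * q w); split; last by [].
  by move=> w /=; rewrite fE [X in p _ * (X - _)]gE; ring.
apply: ccontM; last exact: cq.
exact (ccont_comp cg cp).
Qed.

Lemma cderivV f z l : f z != 0 -> cderiv f z l ->
  cderiv (fun w => (f w)^-1) z (- l / f z ^+ 2).
Proof.
move=> fz0 df; have cf := cderiv_cont df.
have [d d0 dP] : exists2 d : R, 0 < d & forall w, cabs (w - z) < d -> f w != 0.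
  have fz : 0 < cabs (f z) by rewrite cabs_gt0.
  have [d d0 dP] := (ccontP f z).1 cf _ fz; exists d => // w /dP h.
  apply: contraTneq h => ->; by rewrite sub0r cabsN ltxx.
case: df => [q [fE cq <-]].
pose p w := if f w == 0 then 0 else - q w / (f w * f z).
suff : cderiv (fun w => (f z)^-1 + p w * (w - z)) z (- q z / f z ^+ 2).
  apply: (cderiv_near d0) => w /dP fw; rewrite /p (negbTE fw).
  have qE : q w * (w - z) = f w - f z by apply/eqP; rewrite eq_sym subr_eq addrC -fE.
  by rewrite mulrAC mulNr qE; field; rewrite fw.
exists p; split.
- by move=> w; rewrite subrr mulr0 addr0.
- have h : {for z, continuous (fun w => - q w / (f w * f z))}.
    apply: ccontf; first by rewrite mulf_neq0.
      exact: ccontN.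
    by apply: ccontM; [exact: cf|exact: ccont_cst].
  apply/ccontP => e e0; have [d' d'0 d'P] := (ccontP _ _).1 h _ e0.
  exists (Num.min d d'); first by rewrite lt_min d0.
  move=> w; rewrite lt_min => /andP[wd wd'].
  by rewrite /p (negbTE (dP _ wd)) (negbTE fz0); exact: d'P.
- by rewrite /p (negbTE fz0) expr2.
Qed.

Lemma cderivf f g z l m : g z != 0 -> cderiv f z l -> cderiv g z m ->
  cderiv (fun w => f w / g w) z (l / g z - f z * m / g z ^+ 2).
Proof.
move=> gz df dg; have := cderivM df (cderivV gz dg).
by rewrite mulNr mulrN mulrA.
Qed.

Lemma derivable_cderiv f z : derivable f z 1 -> cderiv f z (derive1 f z).
Proof.
move=> df; have H : h^-1 *: (f (h + z) - f z) @[h --> 0^'] --> derive1 f z.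
  have : cvg (h^-1 *: ((f \o shift z) (h *: 1) - f z) @[h --> 0^']) by exact: df.
  rewrite /derive1; under eq_fun => h do rewrite /= /GRing.scale/= mulr1; exact.
apply/cderivP => e e0.
have : nbhs (derive1 f z) [set w | cabs (w - derive1 f z) < e].
  by apply/nbhsCP; exists e.
move/H; rewrite /= => /nbhsCP[d d0 dP]; exists d => // h hd.
have [->|h0] := eqVneq h 0; first by rewrite addr0 mulr0 !subrr cabs0 mulr0.
have := dP h; rewrite subr0 => /(_ hd h0) /ltW he.
have -> : f (z + h) - f z - derive1 f z * h = (h^-1 *: (f (h + z) - f z) - derive1 f z) * h.
  by rewrite /GRing.scale/= (addrC h); field.
by rewrite cabsM ler_wpM2r// cabs_ge0.
Qed.

Lemma cderiv_derive1 f z l : cderiv f z l -> derive1 f z = l.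
Proof.
move=> /cderivP H; apply: cvg_lim; first exact: norm_hausdorff.
move=> A /nbhsCP[e e0 eA].
have [d d0 dP] := H _ (divr_gt0 e0 (ltr0n _ 2)).
apply/nbhsCP; exists d => // h; rewrite subr0 => hd h0.
apply: eA; rewrite /GRing.scale/=.
have -> : h^-1 * (f (h + z) - f z) - l = (f (z + h) - f z - l * h) / h.
  by rewrite (addrC h); field.
rewrite cabsf ltr_pdivrMr ?cabs_gt0//.
apply: (le_lt_trans (dP _ hd)); rewrite ltr_pM2r ?cabs_gt0//.
by rewrite ltr_pdivrMr// ltr_pMr// ltr1n.
Qed.

Lemma rderivP (f : R -> R) (x l : R) : is_derive x 1 f l -> forall e : R, 0 < e ->
  exists2 d : R, 0 < d & forall h : R, `|h| < d -> `|f (x + h) - f x - l * h| <= e * `|h|.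
Proof.
move=> df e e0.
have H : h^-1 *: (f (h + x) - f x) @[h --> 0^'] --> l.
  have [df1 <-] := df; have := df1; rewrite /derivable /derive.
  suff -> : (fun h0 : R => h0^-1 *: ((f \o shift x) (h0 *: 1) - f x)) = (fun h0 : R => h0^-1 *: (f (h0 + x) - f x)) by [].
  by apply/funext => h0; rewrite /= /GRing.scale/= mulr1.
have : nbhs l [set w | `|w - l| < e] by apply/nbhsRP; exists e.
move/H; rewrite /= => /nbhsRP[d d0 dP]; exists d => // h hd.
have [->|h0] := eqVneq h 0; first by rewrite addr0 mulr0 !subrr normr0 mulr0.
have := dP h; rewrite subr0 => /(_ hd h0) /ltW he.
have -> : f (x + h) - f x - l * h = (h^-1 *: (f (h + x) - f x) - l) * h.
  by rewrite /GRing.scale/= (addrC h); field.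
by rewrite normrM ler_wpM2r.
Qed.

Definition cexp z : C R := rc (expR (re z)) * expi (im z).

Lemma cexpD z w : cexp (z + w) = cexp z * cexp w.
Proof. by rewrite /cexp reD imD expRD expiD rcM; ring. Qed.

Lemma cabs_cexp z : cabs (cexp z) = expR (re z).
Proof. by rewrite /cexp cabsM cabs_rc cabs_expi mulr1 ger0_norm// expR_ge0. Qed.

Lemma cexp_neq0 z : cexp z != 0.
Proof. by rewrite -cabs_gt0 cabs_cexp expR_gt0. Qed.

(** The addition formula reduces the claim to the origin, where the expansions of [expR], [cos] and
    [sin] are multiplied out. *)
Lemma cderiv_cexp z : cderiv cexp z (cexp z).
Proof.
suff H : cderiv cexp 0 1.
  apply/cderivP => e e0.
  have e1 : 0 < e / cabs (cexp z) by rewrite divr_gt0// cabs_gt0 cexp_neq0.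
  have [d d0 dP] := (cderivP _ _ _).1 H _ e1; exists d => // h /dP.
  rewrite add0r mul1r {2}/cexp re0 im0 expR0 rc1 expi0 mulr1 => hh.
  have -> : cexp (z + h) - cexp z - cexp z * h = cexp z * (cexp h - 1 - h).
    by rewrite cexpD; ring.
  rewrite cabsM mulrC -ler_pdivlMr ?cabs_gt0 ?cexp_neq0//.
  by apply: (le_trans hh); rewrite mulrAC.
apply/cderivP => e e0.
(* All three expansions are taken with error [k]; the bounds [A1] and [A2] below add up to
   [9 k |h|], which is less than [e |h|]. *)
pose k : R := Num.min (e / 16) 1.
have k0 : 0 < k by rewrite lt_min ltr01 divr_gt0.
have k1 : k <= 1 by rewrite ge_min lexx orbT.
have ke : k <= e / 16 by rewrite ge_min lexx.
have [d1 d10 P1] := rderivP (is_derive_expR 0) k0.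
have [d2 d20 P2] := rderivP (is_derive_cos 0) k0.
have [d3 d30 P3] := rderivP (is_derive_sin 0) k0.
have [d4 d40 [dd1 dd2]] := pos_min2 d10 d20.
have [d5 d50 [dd3 dk]] := pos_min2 d30 k0.
have [d d0 [d14 d15]] := pos_min2 d40 d50.
move: (le_trans d14 dd1) (le_trans d14 dd2) (le_trans d15 dd3) (le_trans d15 dk) => {}dd1 {}dd2 {}dd3 {}dk.
exists d => // h hd; have := re_le h; have := im_le h.
set x := re h; set y := im h; set n := cabs h => yn xn.
have [xd yd] : `|x| < d /\ `|y| < d by split; [exact: le_lt_trans xn hd|exact: le_lt_trans yn hd].
have {P1} := P1 x (lt_le_trans xd dd1).
have {P2} := P2 y (lt_le_trans yd dd2).
have {P3} := P3 y (lt_le_trans yd dd3).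
rewrite !add0r sin0 cos0 expR0 !mul1r !oppr0 !mul0r !subr0 ?addr0 => s1 c1 x1.
rewrite /cexp re0 im0 expR0 rc1 expi0 mulr1 -/x -/y.
apply: (le_trans (cabs_le _)).
rewrite !cE /= -/x -/y !(mul0r, subr0, addr0, oppr0).
move: s1 c1 x1; set ee := expR x; set cc := cos y; set ss := sin y.
clearbody ee cc ss x y n; clear -k0 k1 ke xd yd dk yn xn e0 => s1 c1 x1.
have n0 : 0 <= n by apply: le_trans xn.
have e2 : `|ee| <= 3.
  have -> : ee = (ee - 1 - x) + 1 + x by ring.
  apply: (le_trans (ler_normD _ _)).
  apply: (le_trans (lerD (ler_normD _ _) (lexx _))); rewrite normr1.
  have : k * `|x| <= 1 * 1 by apply: ler_pM => //; lra.
  lra.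
have kx : k * `|x| <= k * n by rewrite ler_pM2l.
have ky : k * `|y| <= k * n by rewrite ler_pM2l.
have A1 : `|ee * cc - 1 - x| <= 4 * (k * n).
  have -> : ee * cc - 1 - x = (ee - 1 - x) + ee * (cc - 1) by ring.
  apply: (le_trans (ler_normD _ _)); rewrite normrM.
  have : `|ee| * `|cc - 1| <= 3 * (k * n) by apply: ler_pM => //; lra.
  lra.
have A2 : `|ee * ss - y| <= 5 * (k * n).
  have -> : ee * ss - y = ee * (ss - y) + (ee - 1 - x) * y + x * y by ring.
  apply: (le_trans (ler_normD _ _)).
  apply: (le_trans (lerD (ler_normD _ _) (lexx _))); rewrite !normrM.
  have : `|ee| * `|ss - y| <= 3 * (k * n) by apply: ler_pM => //; lra.
  have : `|ee - 1 - x| * `|y| <= (k * n) * 1 by apply: ler_pM => //; lra.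
  have : `|x| * `|y| <= k * n by apply: ler_pM => //; lra.
  lra.
have := lerD A1 A2; set B := `|_ - x| + _ => AB.
apply: (le_trans AB).
have : k * n <= e / 16 * n by rewrite ler_wpM2r.
have := mulr_ge0 (ltW e0) n0; lra.
Qed.

Definition avg (g : R -> R) : R := (2 * pi)^-1 * ii g 0 (2 * pi).

Lemma cexp_ln (x y : R) : 0 < x -> cexp (Complex (ln x) y : C R) = rc x * expi y.
Proof. by move=> x0; rewrite /cexp /= lnK. Qed.

Lemma cont_re_circ f c (r : R) : (forall t, {for circ c r t, continuous f}) ->
  forall t, {for t, continuous (fun t => re (f (circ c r t)))}.
Proof.
move=> cf t.
exact (@rcont_comp _ _ (fun z => re (f z)) t (@circ_cont c r t) (@vcont_comp _ f _ _ (cf t) (@re_cont _))).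
Qed.

(* Goursat's theorem in logarithmic coordinates about [c] makes the integral over
   the circle independent of the radius; continuity at [c] gives its limit. *)
Lemma mean_value f c (r0 : R) :
  (forall z, 0 < cabs (z - c) < r0 -> cdiff f z) -> {for c, continuous f} ->
  forall r : R, 0 < r < r0 -> avg (fun t => re (f (circ c r t))) = re (f c).
Proof.
move=> df cf.
pose G (z : C R) := f (c + cexp z).
pose P x y := re (G (Complex x y)); pose Q x y := im (G (Complex x y)).
have pi0 : 0 < 2 * pi :> R by rewrite mulr_gt0// pi_gt0.
have crPQ x y : x < ln r0 -> 0 < r0 -> cr_pair P Q x y.
  move=> xr r00; pose z0 : C R := Complex x y.
  have [l dl] : cdiff f (c + cexp z0).
    apply: df; rewrite addrC addKr cabs_cexp expR_gt0/= /z0/=.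
    by rewrite -[ltRHS]lnK// ltr_expR.
  have dz : cderiv (fun z => c + cexp z) z0 (cexp z0).
    have := cderivD (cderiv_cst c z0) (cderiv_cexp z0); rewrite add0r; exact.
  have /cderivP dG := @cderiv_comp f (fun z => c + cexp z) z0 _ _ dl dz.
  move: (l * cexp z0) dG => m dG.
  exists (re m), (- im m), (im m) => e e0; have [d d0 dP] := dG _ e0.
  exists (d / 2); first by rewrite divr_gt0.
  move=> h k hd kd; pose H : C R := Complex h k.
  have Hle : cabs H <= `|h| + `|k| by exact: cabs_le.
  have Hd : cabs H < d by lra.
  have := dP _ Hd; have -> : z0 + H = Complex (x + h) (y + k) by [].
  move=> dH; have {}dH := le_trans dH (ler_wpM2l (ltW e0) Hle).
  split.
    apply: le_trans dH; apply: le_trans (re_le _); rewrite !cE /= /P /G /z0/=.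
    by rewrite mulNr.
  apply: le_trans dH; apply: le_trans (im_le _); rewrite !cE /= /Q /G /z0/=.
  by rewrite (addrC (re m * k)).
pose M r := ii (fun t => re (f (circ c r t))) 0 (2 * pi).
have ME s : 0 < s -> M s = ii (P (ln s)) 0 (2 * pi).
  by move=> s0; apply: eq_ii => t _; rewrite /P /G cexp_ln.
have Meq s r : 0 < s -> s <= r -> r < r0 -> M s = M r.
  move=> s0 sr rr0; have r00 : 0 < r by exact: lt_le_trans sr.
  have r000 : 0 < r0 by exact: lt_trans rr0.
  have crs x y : x <= ln r -> cr_pair P Q x y.
    by move=> xr; apply: crPQ => //; apply: le_lt_trans xr _; rewrite ltr_ln.
  have := @goursat R P Q (ln s) (ln r) 0 (2 * pi) _ (ltW pi0) _.
  rewrite ler_ln ?posrE// => /(_ sr) H.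
  have {}H := H (fun x y xs _ => crs x y (proj2 (andP xs))).
  (* The sides at the angles 0 and 2 pi carry equal values, by periodicity of [expi], and cancel. *)
  rewrite (@eq_ii _ (fun x => Q x (2 * pi) - Q x 0) (fun=> 0)) in H; last first.
    move=> x _; rewrite /Q /G /cexp/= expi0.
    have -> : expi (2 * pi) = 1 :> C R.
      by apply: C_eq; rewrite /= mulr_natl ?cos2pi ?sin2pi.
    by rewrite subrr.
  rewrite ii_cst ?mul0r in H; last by rewrite ler_ln ?posrE.
  rewrite iiB in H; [|move=> t _|move=> t _].
  - by rewrite (ME _ s0) (ME _ r00) (subr0_eq H).
  - by have [] := cr_pair_cont (crs (ln r) t (lexx _)).
  - by have [] := cr_pair_cont (crs (ln s) t (ltac:(by rewrite ler_ln ?posrE))).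
move=> r /andP[rp rr0].
suff H : M r - re (f c) * (2 * pi) = 0.
  by rewrite /avg -/(M r) (subr0_eq H) mulrC mulfK// gt_eqF.
apply/eqP; rewrite -normr_eq0 eq_le normr_ge0 andbT.
apply: (le0_of_eps (ltW pi0)) => e e0.
have [d d0 dP] := (ccontP _ _).1 cf _ e0.
pose s := Num.min (d / 2) r.
have s0 : 0 < s by rewrite lt_min rp divr_gt0.
have sr : s <= r by rewrite ge_min lexx orbT.
have sd : s < d by rewrite gt_min; apply/orP; left; rewrite ltr_pdivrMr// ltr_pMr// ltr1n.
rewrite -(Meq s)//.
have cs t : {for t, continuous (fun t => re (f (circ c s t)))}.
  apply: cont_re_circ => t'.
  have [|l dl] := df (circ c s t'); last exact: cderiv_cont dl.
  by rewrite circ_dist gtr0_norm// s0 (le_lt_trans sr).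
have := @ii_bound _ (fun t => re (f (circ c s t)) - re (f c)) e 0 (2 * pi) (ltW pi0).
rewrite iiB; [|by move=> t _; exact: cs|exact: contitv_cst].
rewrite ii_cst ?subr0; last exact: ltW.
apply.
  by move=> t _; apply: contB; [exact: cs|exact: cont_cst].
move=> t _; rewrite -reB; apply: le_trans (re_le _) _; apply/ltW/dP.
by rewrite circ_dist gtr0_norm.
Qed.
End Continuity.

(** * Circle averages and the maximum principle *)

Section Average.
Context {R : realType}.
Implicit Types (g h : R -> R) (k M : R).

Definition tc g := forall t, {for t, continuous g}.

Let pi20 : 0 < 2 * pi :> R. Proof. by rewrite mulr_gt0// pi_gt0. Qed.
Let tci g a b : tc g -> contitv g a b. Proof. by move=> cg t _; exact: cg. Qed.

Lemma tcD g h : tc g -> tc h -> tc (fun t => g t + h t).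
Proof. by move=> cg ch t; exact (contD (cg t) (ch t)). Qed.
Lemma tcB g h : tc g -> tc h -> tc (fun t => g t - h t).
Proof. by move=> cg ch t; exact (contB (cg t) (ch t)). Qed.
Lemma tcM g h : tc g -> tc h -> tc (fun t => g t * h t).
Proof. by move=> cg ch t; exact (contM (cg t) (ch t)). Qed.
Lemma tc_cst k : tc (fun=> k). Proof. by move=> t; exact: cont_cst. Qed.
Lemma tcZ k g : tc g -> tc (fun t => k * g t).
Proof. by move=> cg; apply: tcM => //; exact: tc_cst. Qed.
Lemma tcN g : tc g -> tc (fun t => - g t).
Proof. by move=> cg t; exact (contN (cg t)). Qed.
Lemma tc_norm g : tc g -> tc (fun t => `|g t|).
Proof. by move=> cg t; apply: (cont_comp (cg t)); exact: norm_continuous. Qed.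

Lemma avgD g h : tc g -> tc h -> avg (fun t => g t + h t) = avg g + avg h.
Proof. by move=> cg ch; rewrite /avg iiD ?mulrDr//; exact: tci. Qed.
Lemma avgB g h : tc g -> tc h -> avg (fun t => g t - h t) = avg g - avg h.
Proof. by move=> cg ch; rewrite /avg iiB ?mulrBr//; exact: tci. Qed.
Lemma avgZ k g : tc g -> avg (fun t => k * g t) = k * avg g.
Proof. by move=> cg; rewrite /avg iiZ; [rewrite mulrCA|exact: tci]. Qed.
Lemma avgN g : tc g -> avg (fun t => - g t) = - avg g.
Proof.
by move=> cg; rewrite -mulN1r -avgZ//; congr avg; apply/funext => t; rewrite mulN1r.
Qed.
Lemma avg_cst k : avg (fun=> k) = k.
Proof. by rewrite /avg ii_cst ?subr0 1?ltW// mulrC mulfK// gt_eqF. Qed.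
Lemma eq_avg g h : (forall t, 0 <= t <= 2 * pi -> g t = h t) -> avg g = avg h.
Proof. by move=> gh; rewrite /avg; congr (_ * _); exact: eq_ii. Qed.
Lemma avg_le g h : tc g -> tc h -> (forall t, 0 <= t <= 2 * pi -> g t <= h t) ->
  avg g <= avg h.
Proof.
move=> cg ch gh; rewrite /avg ler_pM2l ?invr_gt0//.
by apply: ii_le => //; exact: tci.
Qed.
Lemma avg_norm_le g M : tc g -> (forall t, 0 <= t <= 2 * pi -> `|g t| <= M) ->
  `|avg g| <= M.
Proof.
move=> cg gM; rewrite ler_norml -{1}(avg_cst (- M)) -{2}(avg_cst M).
apply/andP; split; apply: avg_le => //; try exact: tc_cst.
  by move=> t /gM; rewrite ler_norml => /andP[].
by move=> t /gM; rewrite ler_norml => /andP[].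
Qed.

Lemma tc_bounded g : tc g -> exists2 M, 0 <= M & forall t, 0 <= t <= 2 * pi -> `|g t| <= M.
Proof.
move=> cg.
have [t0 _ t0P] := @EVT_max R (fun t => `|g t|) 0 (2 * pi) (ltW pi20)
  (continuous_subspaceT (tc_norm cg)).
by exists `|g t0| => // t t01; apply: t0P; rewrite in_itv.
Qed.
End Average.

Section Zt.
Context {R : realType}.
Definition zt (r t : R) : C R := rc r * expi t.
Lemma zt_cont r t : {for t, continuous (zt r)}.
Proof. exact (@contM (C R) R (fun=> rc r) (@expi R) t (@cont_cst (C R) R (rc r) t) (@expi_cont _ t)). Qed.
Lemma cabs_zt (r t : R) : 0 <= r -> cabs (zt r t) = r.
Proof. by move=> r0; rewrite cabsM cabs_rc cabs_expi mulr1 ger0_norm. Qed.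
Lemma circE c (r t : R) : circ c r t = c + zt r t. Proof. by []. Qed.
End Zt.
Global Opaque zt.

Section Compactness.
Context {R : realType}.
Implicit Types (A : set (C R)) (v : C R -> R) (M r : R).

Lemma openCP A : open A <-> forall z, A z -> exists2 e : R, 0 < e &
  forall w, cabs (w - z) < e -> A w.
Proof.
rewrite openE; split=> H z Az; first by apply/nbhsCP; exact: H.
by rewrite /interior; apply/nbhsCP; exact: H.
Qed.

Lemma closedCP A : closed A <-> forall z, (forall e : R, 0 < e ->
  exists2 w, A w & cabs (w - z) < e) -> A z.
Proof.
split=> H z.
  move=> h; apply: H => B /nbhsCP[e e0 eB].
  by have [w Aw we] := h e e0; exists w; split => //; exact: eB.
move=> h; apply: H => e e0.
have /h[w [Aw we]] : nbhs z [set w | cabs (w - z) < e] by apply/nbhsCP; exists e.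
by exists w.
Qed.

Lemma bounded_closed_compactC A M : closed A -> (forall z, A z -> cabs z <= M) -> compact A.
Proof.
move=> clA AM.
pose f (p : R * R) : C R := Complex p.1 p.2.
have cf : continuous f.
  move=> p B /nbhsCP[e e0 eB].
  have e2 : 0 < e / 2 by rewrite divr_gt0.
  exists (ball p.1 (e / 2), ball p.2 (e / 2)) => /=.
    by split; apply/nbhs_ballP; exists (e / 2).
  move=> q /= [q1 q2]; apply: eB; apply: (le_lt_trans (cabs_le _)).
  by move: q1 q2; rewrite /ball/= distrC => q1; rewrite distrC => q2; rewrite /f /=; lra.
have cS : compact (f @` (`[- M, M]%classic `*` `[- M, M]%classic)).
  apply: continuous_compact; first exact: continuous_subspaceT.
  by apply: compact_setX; exact: segment_compact.
apply: (subclosed_compact clA cS) => z Az.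
have zM := AM _ Az; have := le_trans (re_le z) zM; have := le_trans (im_le z) zM.
rewrite !ler_norml => iz rz; exists (re z, im z); last by case: (z).
by split; rewrite /= in_itv.
Qed.

Lemma compact_max A v : compact A -> A !=set0 -> (forall z, A z -> {for z, continuous v}) ->
  exists2 z, A z & forall w, A w -> v w <= v z.
Proof.
move=> cA A0 cv.
have [|z Az zP] := @compact_EVT_max (C R) R v A A0 cA.
  by apply: continuous_in_subspaceT => z /set_mem; exact: cv.
exists z; first exact: set_mem.
by move=> w Aw; apply: zP; exact: mem_set.
Qed.

Definition submean v (z : C R) := exists2 e : R, 0 < e &
  forall r, 0 < r < e -> v z <= avg (fun t => v (circ z r t)).

Lemma vcirc_cont v (z : C R) r : (forall t, {for circ z r t, continuous v}) ->
  tc (fun t => v (circ z r t)).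
Proof. by move=> cv t; exact (@rcont_comp _ _ v t (@circ_cont _ z r t) (cv t)). Qed.

Lemma avg_linear (k : C R) r : 0 < r -> avg (fun t => re (k * (rc r * expi t))) = 0.
Proof.
move=> r0.
have d z : cderiv (fun u => k * u) z (k * 1) by apply: cderivZ; exact: cderiv_id.
have := @mean_value R (fun u => k * u) 0 (r + 1) (fun z _ => ex_intro _ _ (d z)) (cderiv_cont (d 0)) r.
rewrite mulr0 re0 r0 ltrDl ltr01 => <- //.
by apply: eq_avg => t _; rewrite /circ add0r.
Qed.

Lemma avg_sqr (z : C R) r : 0 < r ->
  avg (fun t => cabs (circ z r t) ^+ 2) = cabs z ^+ 2 + r ^+ 2.
Proof.
move=> r0.
have E t : cabs (circ z r t) ^+ 2 = (cabs z ^+ 2 + r ^+ 2) + 2 * re (cj z * (rc r * expi t)).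
  rewrite /circ !cabs_sqr !cE /=.
  have := @cos2Dsin2 R t => h.
  have -> : r ^+ 2 = r ^+ 2 * (cos t ^+ 2 + sin t ^+ 2) by rewrite h mulr1.
  ring.
have c1 : tc (fun t => re (cj z * (rc r * expi t))).
  move=> t; apply: (@rcont_comp R _ (fun w => re (cj z * w))).
    exact: zt_cont.
  apply: (@vcont_comp R (fun w => cj z * w) re); last exact: re_cont.
  exact: (cderiv_cont (cderivZ (cj z) (cderiv_id _))).
under eq_avg => t _ do rewrite E.
rewrite avgD; [|exact: tc_cst|exact: tcZ].
by rewrite avg_cst avgZ// avg_linear// mulr0 addr0.
Qed.

(* A maximum point of [v + s |z|^2] contradicts the submean inequality strictly,
   so no connectedness is needed. *)
Lemma max_principle A v M : compact A -> (forall z, A z -> cabs z <= M) ->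
  (forall z, A z -> v z <= 0 \/ [/\ submean v z, {for z, continuous v} &
     exists2 e : R, 0 < e & forall y, cabs (y - z) < e ->
       {for y, continuous v} /\ (A y \/ v y <= 0)]) ->
  (forall z, A z -> {for z, continuous v}) ->
  forall z, A z -> v z <= 0.
Proof.
move=> cA AM H cv p Ap; rewrite leNgt; apply/negP => vp.
have M0 : 0 <= M by exact: le_trans (cabs_ge0 p) (AM _ Ap).
pose N := (M + 1) ^+ 2.
have N0 : 0 < N by rewrite exprn_gt0// ltr_wpDl.
(* With this [s] the value [w p] is at least [v p / 2], while the added term is nonpositive on the
   disk of radius [M + 1], which contains every circle of radius below 1 about a point of [A]. *)
pose s := v p / (2 * N).
have s0 : 0 < s by rewrite divr_gt0// mulr_gt0.
pose w z := v z + s * (cabs z ^+ 2 - N).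
have sq z : {for z, continuous (fun z => s * (cabs z ^+ 2 - N))}.
  apply: vcontM; first exact: vcont_cst.
  apply: vcontB; last exact: vcont_cst.
  apply: vcontM; exact: cabs_cont.
have cw z : A z -> {for z, continuous w}.
  by move=> Az; apply: vcontD; [exact: cv|exact: sq].
have [q Aq qP] := compact_max cA (ex_intro _ p Ap) cw.
have wN z : cabs z <= M + 1 -> s * (cabs z ^+ 2 - N) <= 0.
  move=> zM; rewrite pmulr_rle0// subr_le0 /N lerXn2r// ?nnegrE ?cabs_ge0//.
  by rewrite addr_ge0.
have wp : 0 < w p.
  have : - N <= cabs p ^+ 2 - N by rewrite lerDr sqr_ge0.
  rewrite -(ler_pM2l s0) /w; have : s * N * 2 = v p.
    by rewrite /s; field; rewrite gt_eqF.
  lra.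
have wq : 0 < w q by apply: lt_le_trans (qP _ Ap).
have vq : 0 < v q.
  by apply: lt_le_trans wq _; rewrite /w gerDl wN// (le_trans (AM _ Aq))// lerDl.
have [vq0|[[e1 e10 sub] _ [e2 e20 near]]] := H _ Aq; first by move: vq; rewrite ltNge vq0.
have [e3 e30 [e31 e32]] := pos_min2 e10 e20.
have [e e0 [ee3 e4]] := pos_min2 e30 ltr01.
pose r := e / 2.
have r0 : 0 < r by rewrite divr_gt0.
have re' : r < e by rewrite /r; lra.
have nearr t : cabs (circ q r t - q) < e2.
  by rewrite circ_dist gtr0_norm//; lra.
have c1 : tc (fun t => v (circ q r t)).
  by apply: vcirc_cont => t; have [] := near _ (nearr t).
have c2 : tc (fun t => cabs (circ q r t) ^+ 2).
  by apply: (@vcirc_cont (fun z => cabs z ^+ 2)) => t; apply: vcontM; exact: cabs_cont.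
have le t : v (circ q r t) <= w q - s * (cabs (circ q r t) ^+ 2 - N).
  rewrite lerBrDr -/(w _).
  have [_ [Ay|vy]] := near _ (nearr t); first exact: qP.
  apply: le_trans (ltW wq); rewrite -[leRHS]addr0 lerD// wN//.
  have := cabs_tri (circ q r t) 0 q; rewrite !subr0 circ_dist gtr0_norm//.
  by have := AM _ Aq; lra.
have := sub r; rewrite r0/= => /(_ (ltac:(lra))).
apply/negP; rewrite -ltNge.
have cst3 : tc (fun t => s * (cabs (circ q r t) ^+ 2 - N)).
  by apply: tcZ; apply: tcB => //; exact: tc_cst.
apply: (@le_lt_trans _ _ (avg (fun t => w q - s * (cabs (circ q r t) ^+ 2 - N)))).
  by apply: avg_le => //; apply: tcB => //; exact: tc_cst.
rewrite avgB//; last exact: tc_cst.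
rewrite avg_cst avgZ; last by apply: tcB => //; exact: tc_cst.
rewrite avgB//; last exact: tc_cst.
rewrite avg_sqr// avg_cst /w -addrA gtrDl -mulrBr pmulr_rlt0//.
by rewrite (_ : _ - _ - _ = - r ^+ 2); [rewrite oppr_lt0 exprn_gt0|ring].
Qed.
End Compactness.

(** * Poisson integrals *)

Section Poisson.
Context {R : realType}.
Implicit Types (z w h k c : C R) (r t : R) (v : C R -> R) (g : R -> R).

Lemma invC z : z^-1 = cj z * rc ((cabs z ^+ 2)^-1).
Proof.
have [->|z0] := eqVneq z 0; first by rewrite cabs0 expr0n/= !invr0 rc0 mulr0.
apply: (mulIf z0); rewrite mulVf// mulrAC -[cj z * z]mulrC mul_cj -rcM mulfV//.
by rewrite expf_neq0// cabs_eq0.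
Qed.

(** The Poisson kernel, as the real part of the Schwarz kernel; [pkerE] is the usual formula. *)
Definition pker r w t : R := re ((zt r t + w) / (zt r t - w)).

Lemma zt_sub_ge r w t : cabs w < r -> r - cabs w <= cabs (zt r t - w).
Proof.
move=> wr; rewrite -{1}(@cabs_zt _ r t); first exact: cabs_subl.
by apply: le_trans (ltW wr); exact: cabs_ge0.
Qed.

Lemma zt_sub_le r w t : cabs w < r -> cabs (zt r t - w) <= r + cabs w.
Proof.
move=> wr; rewrite -{2}(@cabs_zt _ r t); first exact: cabsB.
by apply: le_trans (ltW wr); exact: cabs_ge0.
Qed.

Lemma zt_sub_neq0 r w t : cabs w < r -> zt r t - w != 0.
Proof.
by move=> wr; rewrite -cabs_gt0 (lt_le_trans _ (zt_sub_ge t wr))// subr_gt0.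
Qed.

Lemma pkerE r w t : cabs w < r ->
  pker r w t = (r ^+ 2 - cabs w ^+ 2) / cabs (zt r t - w) ^+ 2.
Proof.
move=> wr; rewrite /pker invC mulrA mulrC reM re_rc im_rc mul0r subr0 mulrC.
congr (_ / _); have r0 : 0 <= r by apply: le_trans (ltW wr); exact: cabs_ge0.
rewrite -(_ : cabs (zt r t) ^+ 2 = r ^+ 2); last by rewrite cabs_zt.
rewrite !cabs_sqr; move: (zt r t) => [a b]; case: w wr => c d _.
by rewrite !cE /=; ring.
Qed.

Lemma pker_ge r w t : cabs w < r -> (r - cabs w) / (r + cabs w) <= pker r w t.
Proof.
move=> wr; have w0 := cabs_ge0 w; rewrite pkerE//.
have h1 := zt_sub_ge t wr; have h2 := zt_sub_le t wr.
have p0 : 0 < cabs (zt r t - w) by rewrite cabs_gt0 zt_sub_neq0.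
rewrite ler_pdivrMr; last lra.
rewrite mulrAC ler_pdivlMr ?exprn_gt0//.
rewrite subr_sqr -mulrA -expr2 ler_pM2l ?subr_gt0// lerXn2r// nnegrE; lra.
Qed.

Lemma pker_le r w t : cabs w < r -> pker r w t <= (r + cabs w) / (r - cabs w).
Proof.
move=> wr; have w0 := cabs_ge0 w; rewrite pkerE//.
have h1 := zt_sub_ge t wr; have h2 := zt_sub_le t wr.
have p0 : 0 < cabs (zt r t - w) by rewrite cabs_gt0 zt_sub_neq0.
rewrite ler_pdivlMr; last lra.
rewrite mulrAC ler_pdivrMr ?exprn_gt0//.
rewrite [X in X * _](_ : _ = (r + cabs w) * (r - cabs w)); last by rewrite subr_sqr mulrC.
rewrite -mulrA -expr2 ler_pM2l ?lerXn2r// ?nnegrE; lra.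
Qed.

Lemma pker_gt0 r w t : cabs w < r -> 0 < pker r w t.
Proof.
move=> wr; have w0 := cabs_ge0 w; apply: lt_le_trans (pker_ge t wr).
by rewrite divr_gt0//; lra.
Qed.

Lemma pker_lip r a b t : cabs a < r -> cabs b < r ->
  `|pker r a t - pker r b t| <= 2 * r / ((r - cabs a) * (r - cabs b)) * cabs (a - b).
Proof.
move=> ar br; rewrite /pker -reB; apply: (le_trans (re_le _)).
have na := zt_sub_neq0 t ar; have nb := zt_sub_neq0 t br.
have -> : (zt r t + a) / (zt r t - a) - (zt r t + b) / (zt r t - b) =
  (rc 2 * zt r t * (a - b)) / ((zt r t - a) * (zt r t - b)).
  have -> : rc 2 = 1 + 1 :> C R by rewrite -rc1 -rcD.
  by field; rewrite na nb.
have a0 := cabs_ge0 a; have b0 := cabs_ge0 b.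
have zr : cabs (zt r t) = r by apply: cabs_zt; lra.
rewrite cabsf (cabsM (rc 2 * zt r t)) (cabsM (rc 2)) (cabsM (zt r t - a)) zr cabs_rc.
rewrite ger0_norm// mulrAC; apply: ler_wpM2r; first exact: cabs_ge0.
rewrite ler_wpM2l//; first lra.
rewrite lef_pV2 ?posrE ?mulr_gt0 ?cabs_gt0 ?subr_gt0//.
by apply: ler_pM; rewrite ?subr_ge0 ?(ltW ar) ?(ltW br)// zt_sub_ge.
Qed.

Definition cc (f : R -> C R) := forall t, {for t, continuous f}.

Lemma cc_zt r : cc (zt r). Proof. exact: zt_cont. Qed.
Lemma ccD_ f f' : cc f -> cc f' -> cc (fun t => f t + f' t).
Proof. by move=> cf cg t; exact (contD (cf t) (cg t)). Qed.
Lemma ccB_ f f' : cc f -> cc f' -> cc (fun t => f t - f' t).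
Proof. by move=> cf cg t; exact (contB (cf t) (cg t)). Qed.
Lemma ccM_ f f' : cc f -> cc f' -> cc (fun t => f t * f' t).
Proof. by move=> cf cg t; exact (contM (cf t) (cg t)). Qed.
Lemma ccf_ f f' : (forall t, f' t != 0) -> cc f -> cc f' -> cc (fun t => f t / f' t).
Proof. by move=> f0 cf cg t; exact (contf (f0 t) (cf t) (cg t)). Qed.
Lemma cc_cst k : cc (fun=> k). Proof. by move=> t; exact: cont_cst. Qed.
Lemma cc_rc g : tc g -> cc (fun t => rc (g t)).
Proof. by move=> cg t; exact (cont_comp (cg t) (@rc_cont _ _)). Qed.
Lemma tc_re f : cc f -> tc (fun t => re (f t)).
Proof. by move=> cf t; exact (@rcont_comp _ f re t (cf t) (@re_cont _ _)). Qed.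
Lemma tc_im f : cc f -> tc (fun t => im (f t)).
Proof. by move=> cf t; exact (@rcont_comp _ f im t (cf t) (@im_cont _ _)). Qed.

Definition cavg (f : R -> C R) : C R := Complex (avg (fun t => re (f t))) (avg (fun t => im (f t))).

Lemma cavgB f f' : cc f -> cc f' -> cavg (fun t => f t - f' t) = cavg f - cavg f'.
Proof.
move=> cf cf'; apply: C_eq; rewrite ?reB ?imB /=.
  by rewrite -(avgB (tc_re cf) (tc_re cf')); apply: eq_avg => t _; rewrite reB.
by rewrite -(avgB (tc_im cf) (tc_im cf')); apply: eq_avg => t _; rewrite imB.
Qed.

Lemma cavgZ k f : cc f -> cavg (fun t => k * f t) = k * cavg f.
Proof.
move=> cf; have c1 := tc_re cf; have c2 := tc_im cf.
apply: C_eq; rewrite ?reM ?imM /=.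
  rewrite -!avgZ// -avgB; [|exact: tcZ|exact: tcZ].
  by apply: eq_avg => t _; rewrite reM.
rewrite -!avgZ// -avgD; [|exact: tcZ|exact: tcZ].
by apply: eq_avg => t _; rewrite imM.
Qed.

Lemma cavg_le f (M : R) : cc f -> (forall t, 0 <= t <= 2 * pi -> cabs (f t) <= M) ->
  cabs (cavg f) <= 2 * M.
Proof.
move=> cf fM; apply: (le_trans (cabs_le _)); rewrite mulr_natl mulr2n.
apply: lerD; (apply: avg_norm_le; [exact: tc_re|exact: tc_im] || idtac).
  by apply: avg_norm_le; [exact: tc_re|move=> t /fM; exact: le_trans (re_le _)].
by apply: avg_norm_le; [exact: tc_im|move=> t /fM; exact: le_trans (im_le _)].
Qed.

Lemma cc_ker r w : cabs w < r -> cc (fun t => (zt r t + w) / (zt r t - w)).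
Proof.
move=> wr; apply: ccf_; first by move=> t; exact: zt_sub_neq0.
  by apply: ccD_; [exact: cc_zt|exact: cc_cst].
by apply: ccB_; [exact: cc_zt|exact: cc_cst].
Qed.

Lemma tc_pker r w : cabs w < r -> tc (pker r w).
Proof. by move=> wr; exact: (tc_re (cc_ker wr)). Qed.

(** The Schwarz integral: a holomorphic function in the disk whose real part is the Poisson integral
    of [g]. *)
Definition schwarz r g w : C R := cavg (fun t => rc (g t) * ((zt r t + w) / (zt r t - w))).

Lemma re_schwarz r g w : re (schwarz r g w) = avg (fun t => g t * pker r w t).
Proof. by apply: eq_avg => t _; rewrite reM re_rc im_rc mul0r subr0. Qed.

(** Differentiation under the integral: the kernel has derivative [2 zeta / (zeta - w)^2], and the
    remainder is exactly [h^2] times a kernel that stays bounded while [w + h] keeps half the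
    distance of [w] to the circle. *)
Lemma schwarz_cdiff r g w : tc g -> cabs w < r -> cdiff (schwarz r g) w.
Proof.
move=> cg wr; have [M M0 gM] := tc_bounded cg.
have cgw w' : cabs w' < r -> cc (fun t => rc (g t) * ((zt r t + w') / (zt r t - w'))).
  by move=> wr'; apply: ccM_; [exact: cc_rc|exact: cc_ker].
have czw w' : cc (fun t => zt r t - w') by apply: ccB_; [exact: cc_zt|exact: cc_cst].
pose L t := rc (g t) * (rc 2 * zt r t / ((zt r t - w) * (zt r t - w))).
have cL : cc L.
  apply: ccM_; first exact: cc_rc.
  apply: ccf_; first by move=> t; rewrite mulf_neq0// zt_sub_neq0.
    by apply: ccM_; [exact: cc_cst|exact: cc_zt].
  exact: ccM_.
exists (cavg L); apply/cderivP => e e0.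
pose d0 := r - cabs w.
have d00 : 0 < d0 by rewrite subr_gt0.
have r0 : 0 < r by exact: le_lt_trans (cabs_ge0 w) wr.
pose B := 2 * (M * (2 * r / (d0 * d0 * (d0 / 2)))).
have B0 : 0 <= B.
  by apply: mulr_ge0 => //; apply: mulr_ge0 => //; apply: divr_ge0; apply: ltW;
     rewrite !mulr_gt0// ?divr_gt0.
have [d dgt0 [dd0 de]] := pos_min2 (divr_gt0 d00 (ltr0n _ 2)) (divr_gt0 e0 (ltr_wpDl B0 ltr01)).
exists d => // h hd.
have wh : cabs (w + h) < r.
  by apply: le_lt_trans (cabsD _ _) _; move: dd0 hd; rewrite /d0; lra.
have -> : schwarz r g (w + h) - schwarz r g w - cavg L * h =
   cavg (fun t => h ^+ 2 * (rc (g t) * (rc 2 * zt r t / ((zt r t - w) * (zt r t - w) * (zt r t - (w + h)))))).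
  rewrite [cavg L * h]mulrC -cavgZ// /schwarz -cavgB; [|exact: cgw|exact: cgw].
  rewrite -cavgB; first last.
  - exact (ccM_ (@cc_cst h) cL).
  - by apply: ccB_; exact: cgw.
  congr cavg; apply/funext => t; rewrite /L.
  have n1 := zt_sub_neq0 t wr; have n2 := zt_sub_neq0 t wh.
  have -> : rc 2 = 1 + 1 :> C R by rewrite -rc1 -rcD.
  by field; rewrite n1 n2.
rewrite cavgZ; last first.
  apply: ccM_; first exact: cc_rc.
  apply: ccf_; first by move=> t; rewrite !mulf_neq0// zt_sub_neq0.
    by apply: ccM_; [exact: cc_cst|exact: cc_zt].
  exact (ccM_ (ccM_ (czw w) (czw w)) (czw (w + h))).
rewrite cabsM cabsX expr2 -mulrA mulrC.
rewrite ler_wpM2r ?cabs_ge0//.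
apply: (@le_trans _ _ (cabs h * B)).
  rewrite ler_wpM2l ?cabs_ge0//; apply: cavg_le.
    apply: ccM_; first exact: cc_rc.
    apply: ccf_; first by move=> t; rewrite !mulf_neq0// zt_sub_neq0.
      by apply: ccM_; [exact: cc_cst|exact: cc_zt].
    exact (ccM_ (ccM_ (czw w) (czw w)) (czw (w + h))).
  move=> t t01; rewrite cabsM cabs_rc; apply: ler_pM; rewrite ?cabs_ge0//.
    exact: gM.
  have n1 := zt_sub_ge t wr; have n2 := zt_sub_ge t wh.
  have n3 : d0 / 2 <= cabs (zt r t - (w + h)).
    apply: le_trans n2; have hh := lt_le_trans hd dd0.
    by rewrite /d0 in hh *; have := cabsD w h; lra.
  have zr : cabs (zt r t) = r by apply: cabs_zt; exact: ltW.
  rewrite cabsf (cabsM (rc 2)) (cabsM ((zt r t - w) * _)) (cabsM (zt r t - w)) zr cabs_rc ger0_norm//.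
  rewrite ler_wpM2l//; first by rewrite mulr_ge0// ltW.
  have d20 : 0 < d0 / 2 by rewrite divr_gt0.
  have q1 : 0 < cabs (zt r t - w) by exact: lt_le_trans n1.
  have q2 : 0 < cabs (zt r t - (w + h)) by exact: lt_le_trans n3.
  rewrite lef_pV2 ?posrE ?mulr_gt0//.
  by apply: ler_pM => //; [rewrite mulr_ge0// ltW|exact: ltW|apply: ler_pM => //; exact: ltW].
apply: (@le_trans _ _ (d * B)); first by rewrite ler_wpM2r// ltW.
apply: (@le_trans _ _ (e / (B + 1) * B)); first by rewrite ler_wpM2r.
rewrite mulrAC ler_pdivrMr ?ltr_wpDl//; lra.
Qed.

Lemma avg_pker r w : cabs w < r -> avg (pker r w) = 1.
Proof.
move=> wr; have w0 := cabs_ge0 w; have r0 : 0 < r by exact: le_lt_trans wr.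
pose rho := 2 * r ^+ 2 / (r + cabs w).
have rw : 0 < r + cabs w by lra.
have rrho : r < rho.
  by rewrite /rho ltr_pdivlMr// expr2; nra.
pose F u := (rc (r ^+ 2) + u * cj w) / (rc (r ^+ 2) - u * cj w).
have nz u : cabs u < rho -> rc (r ^+ 2) - u * cj w != 0.
  move=> ur; rewrite -cabs_gt0.
  have : cabs (u * cj w) < r ^+ 2.
    rewrite cabsM cabs_cj; have u0 := cabs_ge0 u.
    have : cabs u * (r + cabs w) < 2 * r ^+ 2 by rewrite -ltr_pdivlMr.
    rewrite expr2; nra.
  move=> h; have := cabs_subl (rc (r ^+ 2)) (u * cj w).
  rewrite cabs_rc ger0_norm ?sqr_ge0//; lra.
have dF u : cabs u < rho -> cdiff F u.
  move=> ur.
  have dm : cderiv (fun u => u * cj w) u (1 * cj w + u * 0).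
    by apply: cderivM; [exact: cderiv_id|exact: cderiv_cst].
  eexists; exact (@cderivf _ (fun u => rc (r ^+ 2) + u * cj w) (fun u => rc (r ^+ 2) - u * cj w) u _ _ (nz _ ur)
    (cderivD (cderiv_cst _ _) dm) (cderivB (cderiv_cst _ _) dm)).
have F0 : F 0 = 1.
  rewrite /F !mul0r addr0 subr0 divff//.
  by rewrite -cabs_gt0 cabs_rc ger0_norm ?sqr_ge0// exprn_gt0.
have c0 : {for 0, continuous F}.
  have [|l dl] := dF 0; first by rewrite cabs0 (lt_trans r0).
  exact: cderiv_cont dl.
have dF0 z : 0 < cabs (z - 0) < rho -> cdiff F z.
  by rewrite subr0 => /andP[_ zr]; exact: dF.
have := mean_value dF0 c0; move/(_ r); rewrite F0 re1 r0 rrho => /(_ isT) <-.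
apply: eq_avg => t _; rewrite -(re_cj (F _)) /pker; congr re.
have cjM z1 z2 : cj (z1 * z2) = cj z1 * cj z2.
  by apply: C_eq; rewrite !cE /= !cE; ring.
have cjV z1 : cj z1^-1 = (cj z1)^-1.
  rewrite !invC cjM cabs_cj; congr (_ * _).
  by apply: C_eq; rewrite /= ?oppr0.
have cjD z1 z2 : cj (z1 + z2) = cj z1 + cj z2 by apply: C_eq; rewrite !cE /= !cE; ring.
have cjN z1 : cj (- z1) = - cj z1 by apply: C_eq; rewrite !cE /= !cE.
have cjr x : cj (rc x) = rc x by apply: C_eq; rewrite /= ?oppr0.
have cjK z1 : cj (cj z1) = z1 by apply: C_eq; rewrite /= ?opprK.
rewrite /F cjM cjV !cjD cjN !cjr !cjM !cjK circE add0r.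
have -> : rc (r ^+ 2) = zt r t * cj (zt r t) by rewrite mul_cj cabs_zt// ltW.
have n0 : cj (zt r t) != 0 by rewrite -cabs_gt0 cabs_cj cabs_zt// ltW.
rewrite mulrC -[cj (zt r t) * w]mulrC.
have n1 := zt_sub_neq0 t wr.
by rewrite -mulrDl -mulrBl invfM mulrACA mulfV// mulr1 mulrC.
Qed.
End Poisson.

(** * Subharmonic functions and the log-Poisson formula *)

Section Subharmonic.
Context {R : realType}.
Implicit Types (z w c : C R) (r t M e : R) (u v : C R -> R) (f F phi : C R -> C R).

Definition cball_ c r : set (C R) := [set z | cabs (z - c) <= r].

Lemma cball_compact c r : compact (cball_ c r).
Proof.
apply: (@bounded_closed_compactC _ _ (r + cabs c)).
  apply/closedCP => z h; rewrite /cball_/= leNgt; apply/negP => zr.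
  have [w /= wr wz] := h (cabs (z - c) - r) (ltac:(by rewrite subr_gt0)).
  by have := cabs_tri z c w; rewrite (cabsBC z w); rewrite /cball_/= in wr; lra.
by move=> z /= zr; have := cabs_tri z 0 c; rewrite !subr0; rewrite /cball_/= in zr; lra.
Qed.

Lemma ball_max v c r : 0 < r -> (forall z, cabs (z - c) <= r -> {for z, continuous v}) ->
  (forall z, cabs (z - c) < r -> submean v z) ->
  (forall z, cabs (z - c) = r -> v z <= 0) ->
  forall z, cabs (z - c) <= r -> v z <= 0.
Proof.
move=> r0 cv sv bv; apply: (@max_principle _ (cball_ c r) v (r + cabs c)).
- exact: cball_compact.
- by move=> z /= zr; have := cabs_tri z 0 c; rewrite !subr0; rewrite /cball_/= in zr; lra.
- move=> z; rewrite /cball_/= le_eqVlt => /predU1P[/bv|zr]; first by left.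
  right; split; [exact: sv|by apply: cv; exact: ltW|].
  exists (r - cabs (z - c)); first by rewrite subr_gt0.
  move=> y yz; have yr : cabs (y - c) <= r by have := cabs_tri y c z; lra.
  by split; [exact: cv|left].
- by move=> z; exact: cv.
Qed.

(** The submean inequality is required after composition with every holomorphic germ at the point.
    In this form subharmonicity is stable under holomorphic changes of variable by definition;
    [charm] is the harmonic analogue. *)
Definition csub v z0 := forall phi w0 (d : R), 0 < d -> phi w0 = z0 ->
  (forall w, cabs (w - w0) < d -> cdiff phi w) ->
  exists2 e : R, 0 < e & forall r, 0 < r < e -> v z0 <= avg (fun t => v (phi (circ w0 r t))).

Definition charm v z0 := forall phi w0 (d : R), 0 < d -> phi w0 = z0 ->
  (forall w, cabs (w - w0) < d -> cdiff phi w) ->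
  exists2 e : R, 0 < e & forall r, 0 < r < e -> avg (fun t => v (phi (circ w0 r t))) = v z0.

Lemma charm_csub v z : charm v z -> csub v z.
Proof. by move=> H phi w d d0 pw dp; have [e e0 He] := H _ _ _ d0 pw dp; exists e => // r /He ->. Qed.

Lemma cdiff_id z : cdiff id z. Proof. by exists 1; exact: cderiv_id. Qed.

Lemma csub_submean v z : csub v z -> submean v z.
Proof. by move=> /(_ id z 1 ltr01 erefl (fun w _ => cdiff_id w)). Qed.

Lemma charm_mean v z : charm v z -> exists2 e : R, 0 < e &
  forall r, 0 < r < e -> avg (fun t => v (circ z r t)) = v z.
Proof. by move=> /(_ id z 1 ltr01 erefl (fun w _ => cdiff_id w)). Qed.

Lemma cdiff_cont f z : cdiff f z -> {for z, continuous f}.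
Proof. by move=> [l]; exact: cderiv_cont. Qed.

Lemma phi_circ phi w0 (d k : R) : 0 < d -> 0 < k ->
  (forall w, cabs (w - w0) < d -> cdiff phi w) ->
  exists2 e : R, 0 < e & e <= d /\ forall w, cabs (w - w0) < e -> cabs (phi w - phi w0) < k.
Proof.
move=> d0 k0 dp; have /ccontP/(_ _ k0)[e e0 eP] : {for w0, continuous phi}.
  by apply: cdiff_cont; apply: dp; rewrite subrr cabs0.
have [x x0 [xe xd]] := pos_min2 e0 d0; exists x => //; split=> // w wx.
by apply: eP; lra.
Qed.

Lemma cdiff_comp f phi w : cdiff f (phi w) -> cdiff phi w -> cdiff (fun w => f (phi w)) w.
Proof. by move=> [l dl] [m dm]; exists (l * m); exact (@cderiv_comp _ f phi w l m dl dm). Qed.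

Lemma charm_near u v z e : 0 < e -> (forall w, cabs (w - z) < e -> u w = v w) ->
  charm u z -> charm v z.
Proof.
move=> e0 uv H phi w0 d d0 pw dp; have [k k0 kP] := H _ _ _ d0 pw dp.
have [x x0 [xd xP]] := phi_circ d0 e0 dp; rewrite pw in xP.
have [y y0 [yx yk]] := pos_min2 x0 k0; exists y => // r /andP[r0 ry].
rewrite -uv ?subrr ?cabs0// -(kP r); last by rewrite r0/=; lra.
apply: eq_avg => t _; rewrite uv//; apply: xP.
by rewrite circ_dist gtr0_norm//; lra.
Qed.

Lemma re_charm f z e : 0 < e -> (forall w, cabs (w - z) < e -> cdiff f w) ->
  charm (fun w => re (f w)) z.
Proof.
move=> e0 df phi w0 d d0 pw dp.
have [x x0 [xd xP]] := phi_circ d0 e0 dp; rewrite pw in xP.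
exists x => // r /andP[r0 rx].
have dfp w : cabs (w - w0) < x -> cdiff (fun w => f (phi w)) w.
  move=> wx; apply: cdiff_comp; [exact/df/xP|apply: dp; lra].
have c0 : {for w0, continuous (fun w => f (phi w))}.
  by apply: cdiff_cont; apply: dfp; rewrite subrr cabs0.
have dfp' w : 0 < cabs (w - w0) < x -> cdiff (fun w => f (phi w)) w.
  by move=> /andP[_]; exact: dfp.
by have := mean_value dfp' c0; move/(_ r); rewrite r0 rx => /(_ isT) ->; rewrite pw.
Qed.

(** The Poisson modification: [v] is replaced by the Poisson integral of its values on the circle
    inside the disk, and kept elsewhere. *)
Definition PM c r v z : R :=
  if cabs (z - c) < r then avg (fun t => v (circ c r t) * pker r (z - c) t) else v z.

Lemma PM_out c r v z : r <= cabs (z - c) -> PM c r v z = v z.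
Proof. by rewrite /PM leNgt => /negbTE ->. Qed.

Lemma PM_in c r v z : cabs (z - c) < r ->
  PM c r v z = re (schwarz r (fun t => v (circ c r t)) (z - c)).
Proof. by rewrite /PM re_schwarz => ->. Qed.

Section PoissonModification.
Variables (c : C R) (r : R) (v : C R -> R).
Hypothesis r0 : 0 < r.
Hypothesis cv : forall z, cabs (z - c) = r -> {for z, continuous v}.

Let cvt : tc (fun t => v (circ c r t)).
Proof. by apply: vcirc_cont => t; apply: cv; rewrite circ_dist gtr0_norm. Qed.

Lemma schwarzC_cdiff z : cabs (z - c) < r ->
  cdiff (fun w => schwarz r (fun t => v (circ c r t)) (w - c)) z.
Proof.
move=> zr; apply: (@cdiff_comp (schwarz r _) (fun w => w - c)).
  exact: schwarz_cdiff.
by exists (1 - 0); apply: cderivB; [exact: cderiv_id|exact: cderiv_cst].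
Qed.

Lemma near_in z : cabs (z - c) < r -> exists2 e : R, 0 < e &
  forall w, cabs (w - z) < e -> cabs (w - c) < r.
Proof.
move=> zr; exists (r - cabs (z - c)); first by rewrite subr_gt0.
by move=> w wz; have := cabs_tri w c z; lra.
Qed.

Lemma PM_charm z : cabs (z - c) < r -> charm (PM c r v) z.
Proof.
move=> zr; have [e e0 eP] := near_in zr.
apply: (@charm_near (fun w => re (schwarz r (fun t => v (circ c r t)) (w - c))) _ _ e) => //.
  by move=> w /eP wr; rewrite PM_in.
by apply: (re_charm e0) => w /eP; exact: schwarzC_cdiff.
Qed.

Lemma PM_cont_in z : cabs (z - c) < r -> {for z, continuous (PM c r v)}.
Proof.
move=> zr; have [e e0 eP] := near_in zr.
have h : {for z, continuous (fun w => re (schwarz r (fun t => v (circ c r t)) (w - c)))}.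
  apply: (@vcont_comp _ (fun w => schwarz r (fun t => v (circ c r t)) (w - c)) re).
    exact: cdiff_cont (schwarzC_cdiff zr).
  exact: re_cont.
apply/vcontP => k k0; have /vcontP/(_ _ k0)[d d0 dP] := h.
have [x x0 [xd xe]] := pos_min2 d0 e0; exists x => // w wx.
rewrite !PM_in//; last by apply: eP; lra.
by apply: dP; lra.
Qed.

(** As [w] tends to the boundary point [z0], the arc near [z0] contributes little by continuity of
    [v], and the rest contributes little because the kernel there is of order [|w - z0|]. *)
Lemma PM_cont_bd z0 : cabs (z0 - c) = r -> {for z0, continuous (PM c r v)}.
Proof.
move=> z0r; apply/vcontP => e e0.
have e2 : 0 < e / 2 by rewrite divr_gt0.
have /vcontP/(_ _ e2)[d d0 dP] := cv z0r.
have cg : tc (fun t => v (circ c r t) - v z0) by apply: tcB; [exact: cvt|exact: tc_cst].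
have [M M0 MP] := tc_bounded cg.
(* At distance at least [d] from [z0] on the circle, the kernel is at most
   [2 r |w - z0| / (d / 2)^2]. *)
pose B := M * (8 * r / d ^+ 2).
have B0 : 0 <= B by apply: mulr_ge0 => //; apply: divr_ge0; [exact: mulr_ge0 (ltW r0)|exact: sqr_ge0].
have [x x0 [xd xe]] := pos_min2 (divr_gt0 d0 (ltr0n _ 2)) (divr_gt0 e2 (ltr_wpDl B0 ltr01)).
exists x => // w wx; rewrite [PM c r v z0]PM_out; last by rewrite z0r.
have [wr|wr] := ltP (cabs (w - c)) r; last first.
  by rewrite PM_out//; have := dP w (ltac:(lra)); lra.
rewrite /PM wr.
have -> : v z0 = avg (fun t => v z0 * pker r (w - c) t).
  by rewrite avgZ ?avg_pker ?mulr1//; exact: tc_pker.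
have cpk := tc_pker wr.
rewrite -avgB; [|by apply: tcM|exact: tcZ].
apply: (@le_lt_trans _ _ (e / 2 + B * cabs (w - z0))); last first.
  suff : B * cabs (w - z0) < e / 2 by lra.
  apply: (@le_lt_trans _ _ (B * (e / 2 / (B + 1)))).
    by rewrite ler_wpM2l// ltW// (lt_le_trans wx).
  rewrite mulrCA gtr_pMr// ltr_pdivrMr ?ltr_wpDl//; lra.
have -> : e / 2 + B * cabs (w - z0) = avg (fun t => e / 2 * pker r (w - c) t + B * cabs (w - z0)).
  rewrite avgD; [|exact: tcZ|exact: tc_cst].
  by rewrite avg_cst avgZ// avg_pker ?mulr1.
apply: (@le_trans _ _ (avg (fun t => `|v (circ c r t) - v z0| * pker r (w - c) t))).
  rewrite ler_norml; apply/andP; split.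
    rewrite -avgN; last by apply: tcM => //; exact: tc_norm.
    apply: avg_le; [by apply: tcN; apply: tcM => //; exact: tc_norm| |].
      by apply: tcB; [exact: tcM|exact: tcZ].
    move=> t _; rewrite -mulrBl -mulNr ler_pM2r ?pker_gt0//.
    by rewrite lerNl ler_normr lexx orbT.
  apply: avg_le; [| |].
  - by apply: tcB; [exact: tcM|exact: tcZ].
  - by apply: tcM => //; exact: tc_norm.
  - by move=> t _; rewrite -mulrBl ler_pM2r ?pker_gt0// ler_norm.
apply: avg_le; [by apply: tcM => //; exact: tc_norm|by apply: tcD; [exact: tcZ|exact: tc_cst]|].
move=> t t01; have pk0 := pker_gt0 t wr.
have Bw : 0 <= B * cabs (w - z0) by rewrite mulr_ge0// cabs_ge0.
have [near|far] := ltP (cabs (circ c r t - z0)) d.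
  apply: (@le_trans _ _ (e / 2 * pker r (w - c) t)); last by rewrite lerDl.
  by rewrite ler_wpM2r ?(ltW pk0)// ltW// dP.
apply: (@le_trans _ _ (B * cabs (w - z0))); last by rewrite lerDr mulr_ge0// ltW.
rewrite /B -mulrA; apply: ler_pM => //; first exact: ltW.
  exact: MP.
rewrite pkerE//.
have nn : d / 2 <= cabs (zt r t - (w - c)).
  have -> : zt r t - (w - c) = circ c r t - w by rewrite circE; ring.
  by have := cabs_tri (circ c r t) z0 w; lra.
have d20 : 0 < d / 2 by rewrite divr_gt0.
apply: (@le_trans _ _ ((r ^+ 2 - cabs (w - c) ^+ 2) / (d / 2) ^+ 2)).
  apply: ler_wpM2l; first by rewrite subr_ge0 lerXn2r// ?nnegrE ?cabs_ge0// ltW.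
  rewrite lef_pV2 ?posrE ?exprn_gt0//; last by apply: lt_le_trans nn.
  by rewrite lerXn2r// ?nnegrE ?ltW// (lt_le_trans d20).
have -> : 8 * r / d ^+ 2 * cabs (w - z0) = (2 * r * cabs (w - z0)) / (d / 2) ^+ 2.
  by field; rewrite gt_eqF.
rewrite ler_wpM2r ?invr_ge0 ?sqr_ge0// subr_sqr mulrC.
have h1 : r - cabs (w - c) <= cabs (w - z0).
  by rewrite -z0r (cabsBC w z0); have := cabs_tri z0 c w; lra.
have c0 := cabs_ge0 (w - c).
by apply: ler_pM; lra.
Qed.

Lemma PM_cont z : (r < cabs (z - c) -> {for z, continuous v}) -> {for z, continuous (PM c r v)}.
Proof.
case: (ltgtP (cabs (z - c)) r) => [zr _|zr /(_ isT) cz|zr _].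
- exact: PM_cont_in.
- apply/vcontP => e e0; have /vcontP/(_ _ e0)[d d0 dP] := cz.
  have h : 0 < cabs (z - c) - r by rewrite subr_gt0.
  have [x x0 [xd xe]] := pos_min2 d0 h; exists x => // w wx.
  rewrite !PM_out; [|exact: ltW|].
    by apply: dP; lra.
  by have := cabs_tri z c w; rewrite (cabsBC z w); lra.
- exact: PM_cont_bd.
Qed.

Lemma PM_le M : (forall z, cabs (z - c) = r -> v z <= M) -> forall z, cabs (z - c) <= r -> PM c r v z <= M.
Proof.
move=> vM z; rewrite le_eqVlt => /predU1P[zr|zr]; first by rewrite PM_out ?zr//; exact: vM.
have cpk := tc_pker zr.
have -> : M = avg (fun t => M * pker r (z - c) t) by rewrite avgZ// avg_pker ?mulr1.
rewrite /PM zr; apply: avg_le; [exact: tcM|exact: tcZ|].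
by move=> t _; rewrite ler_wpM2r ?(ltW (pker_gt0 _ _))// vM// circ_dist gtr0_norm.
Qed.

Lemma PM_harnack : (forall z, cabs (z - c) = r -> 0 <= v z) -> forall z, cabs (z - c) < r ->
  (r - cabs (z - c)) / (r + cabs (z - c)) * avg (fun t => v (circ c r t)) <= PM c r v z /\
  PM c r v z <= (r + cabs (z - c)) / (r - cabs (z - c)) * avg (fun t => v (circ c r t)).
Proof.
move=> v0 z zr; have cpk := tc_pker zr.
have vt t : 0 <= v (circ c r t) by apply: v0; rewrite circ_dist gtr0_norm.
rewrite /PM zr -!avgZ//; split; apply: avg_le; try exact: tcM; try exact: tcZ.
  by move=> t _; rewrite mulrC ler_wpM2l// pker_ge.
by move=> t _; rewrite [leRHS]mulrC ler_wpM2l// pker_le.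
Qed.

Lemma PM_lip M : 0 <= M -> (forall z, cabs (z - c) = r -> `|v z| <= M) ->
  forall a b, cabs (a - c) < r -> cabs (b - c) < r ->
  `|PM c r v a - PM c r v b| <= M * (2 * r / ((r - cabs (a - c)) * (r - cabs (b - c)))) * cabs (a - b).
Proof.
move=> M0 vM a b ar br; rewrite /PM ar br.
have ca := tc_pker ar; have cb := tc_pker br.
rewrite -avgB; [|exact: tcM|exact: tcM].
apply: avg_norm_le; first by apply: tcB; exact: tcM.
move=> t _; rewrite -mulrBr normrM -mulrA; apply: ler_pM => //.
  by apply: vM; rewrite circ_dist gtr0_norm.
by have := pker_lip t ar br; rewrite (_ : a - c - (b - c) = a - b)//; ring.
Qed.

(** The difference [v - PM v] is submean in the disk, the modification being harmonic there, and it
    vanishes on the circle. *)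
Lemma sub_le_PM : (forall z, cabs (z - c) <= r -> {for z, continuous v}) ->
  (forall z, cabs (z - c) < r -> submean v z) -> forall z, cabs (z - c) <= r -> v z <= PM c r v z.
Proof.
move=> cvv sv z zr; rewrite -subr_le0.
have cPM w : cabs (w - c) <= r -> {for w, continuous (PM c r v)}.
  by move=> wr; apply: PM_cont; rewrite ltNge wr.
apply: (@ball_max (fun z => v z - PM c r v z) c r) => //.
- by move=> w wr; apply: vcontB; [exact: cvv|exact: cPM].
- move=> w wr; have [e e0 eP] := sv _ wr; have [d d0 dP] := charm_mean (PM_charm wr).
  have [k k0 kP] := near_in wr.
  have [x x0 [xe xd]] := pos_min2 e0 d0; have [y y0 [yx yk]] := pos_min2 x0 k0.
  exists y => // s /andP[s0 sy].
  have ci t : cabs (circ w s t - c) <= r.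
    by apply/ltW/kP; rewrite circ_dist gtr0_norm//; lra.
  rewrite avgB; [|by apply: vcirc_cont => t; exact: cvv|by apply: vcirc_cont => t; exact: cPM].
  by rewrite dP ?lerB ?eP// s0/=; lra.
- by move=> w wr; rewrite PM_out ?wr// subrr.
Qed.
End PoissonModification.

Lemma PMN c r v z : 0 < r -> (forall z, cabs (z - c) = r -> {for z, continuous v}) ->
  PM c r (fun w => - v w) z = - PM c r v z.
Proof.
move=> r0 cv; rewrite /PM; case: ifP => // zr.
rewrite -avgN; last first.
  apply: tcM; last exact: tc_pker.
  by apply: vcirc_cont => t; apply: cv; rewrite circ_dist gtr0_norm.
by apply: eq_avg => t _; rewrite mulNr.
Qed.

Lemma charm_submeanN v z : (exists2 e : R, 0 < e & forall w, cabs (w - z) < e -> {for w, continuous v}) ->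
  charm v z -> submean (fun w => - v w) z.
Proof.
move=> [e e0 eP] /charm_mean[d d0 dP]; have [x x0 [xe xd]] := pos_min2 e0 d0.
exists x => // r /andP[r0 rx]; rewrite avgN ?dP//; first by rewrite r0/=; lra.
by apply: vcirc_cont => t; apply: eP; rewrite circ_dist gtr0_norm//; lra.
Qed.

Lemma harm_eq_PM v c r : 0 < r -> (forall z, cabs (z - c) <= r -> {for z, continuous v}) ->
  (forall z, cabs (z - c) < r -> charm v z) -> forall z, cabs (z - c) <= r -> PM c r v z = v z.
Proof.
move=> r0 cv hv z zr.
have cb w : cabs (w - c) = r -> {for w, continuous v} by move=> wr; apply: cv; rewrite wr.
apply/eqP; rewrite eq_le; apply/andP; split; last first.
  by apply: sub_le_PM => // w wr; apply: csub_submean; apply: charm_csub; exact: hv.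
rewrite -lerN2 -PMN//; apply: (@sub_le_PM _ _ (fun w => - v w)) => //.
- by move=> w wr; apply: vcontN; exact: cb.
- by move=> w wr; apply: vcontN; exact: cv.
- move=> w wr; apply: charm_submeanN; last exact: hv.
  by have [e e0 eP] := near_in wr; exists e => // y /eP yr; apply: cv; exact: ltW.
Qed.

(** Continuity at [z] and holomorphy in a punctured neighbourhood: this is what is known of a
    difference quotient at its diagonal point, and what [mean_value] asks for. *)
Definition good f z := {for z, continuous f} /\
  exists2 e : R, 0 < e & forall w, 0 < cabs (w - z) < e -> cdiff f w.

(** A rotation [l] makes the value at [z] positive; then [|f z|] is the average of the real part of
    [l f], which is at most the average of [|f|]. *)
Lemma good_submean f z : good f z -> submean (fun w => cabs (f w)) z.
Proof.
move=> [cf [e e0 df]]; exists e => // r /andP[r0 re_].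
have cfr t : {for circ z r t, continuous f}.
  by apply: cdiff_cont; apply: df; rewrite circ_dist gtr0_norm// r0.
have cn : tc (fun t => cabs (f (circ z r t))).
  by apply: (@vcirc_cont _ (fun w => cabs (f w))) => t; apply: (@vcont_comp _ f (@cabs R)); [exact: cfr|exact: cabs_cont].
have [fz0|fz0] := eqVneq (f z) 0.
  rewrite fz0 cabs0 -(avg_cst 0); apply: avg_le => //; first exact: tc_cst.
  by move=> t _; exact: cabs_ge0.
pose l := cj (f z) / rc (cabs (f z)).
have a0 : 0 < cabs (f z) by rewrite cabs_gt0.
have n0 : rc (cabs (f z)) != 0 by rewrite -cabs_gt0 cabs_rc gtr0_norm.
have l1 : cabs l = 1 by rewrite cabsf cabs_cj cabs_rc gtr0_norm// divff// gt_eqF.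
have lf : l * f z = rc (cabs (f z)).
  by rewrite /l mulrAC [cj _ * _]mulrC mul_cj expr2 rcM mulfK.
have dl w : 0 < cabs (w - z) < e -> cdiff (fun w => l * f w) w.
  by move=> /df[m dm]; exists (l * m); exact: cderivZ.
have cl : {for z, continuous (fun w => l * f w)}.
  by apply: ccontM; [exact: ccont_cst|exact: cf].
have := mean_value dl cl; move/(_ r); rewrite r0 re_ lf re_rc => /(_ isT) <-.
apply: avg_le => //.
  apply: (@vcirc_cont _ (fun w => re (l * f w))) => t.
  apply: (@vcont_comp _ (fun w => l * f w) re); last exact: re_cont.
  by apply: ccontM; [exact: ccont_cst|exact: cfr].
move=> t _; apply: (le_trans (ler_norm _)); apply: (le_trans (re_le _)).
by rewrite cabsM l1 mul1r.
Qed.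

Lemma goodM f g z : good f z -> good g z -> good (fun w => f w * g w) z.
Proof.
move=> [cf [e e0 df]] [cg [d d0 dg]]; split; first by apply: ccontM; [exact: cf|exact: cg].
have [x x0 [xe xd]] := pos_min2 e0 d0; exists x => // w /andP[w0 wx].
have [l dl] := df w (ltac:(rewrite w0/=; lra)); have [m dm] := dg w (ltac:(rewrite w0/=; lra)).
by eexists; apply: cderivM; [exact: dl|exact: dm].
Qed.

Lemma good_cdiff f z e : 0 < e -> (forall w, cabs (w - z) < e -> cdiff f w) -> good f z.
Proof.
move=> e0 df; split; first by apply: cdiff_cont; apply: df; rewrite subrr cabs0.
by exists e => // w /andP[_]; exact: df.
Qed.

Lemma goodV f z : f z != 0 -> good f z -> good (fun w => (f w)^-1) z.
Proof.
move=> fz [cf [e e0 df]].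
split.
  exact (@contV (C R) (C R) f z fz cf).
have a0 : 0 < cabs (f z) by rewrite cabs_gt0.
have /ccontP/(_ _ a0)[d d0 dP] := cf.
have [x x0 [xe xd]] := pos_min2 e0 d0; exists x => // w /andP[w0 wx].
have [l dl] := df w (ltac:(rewrite w0/=; lra)).
eexists; apply: cderivV; last exact: dl.
have := dP w (ltac:(lra)); apply: contraTneq => ->; by rewrite sub0r cabsN ltxx.
Qed.

Lemma max_modulus f c r M : 0 < r -> (forall z, cabs (z - c) <= r -> {for z, continuous f}) ->
  (forall z, cabs (z - c) < r -> good f z) -> (forall z, cabs (z - c) = r -> cabs (f z) <= M) ->
  forall z, cabs (z - c) <= r -> cabs (f z) <= M.
Proof.
move=> r0 cf gf bf z zr; rewrite -subr_le0.
have ca w : cabs (w - c) <= r -> {for w, continuous (fun w => cabs (f w))}.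
  by move=> wr; apply: (@vcont_comp _ f (@cabs R)); [exact: cf|exact: cabs_cont].
apply: (@ball_max (fun z => cabs (f z) - M) c r) => //.
- by move=> w wr; apply: vcontB; [exact: ca|exact: vcont_cst].
- move=> w wr; have [e e0 eP] := good_submean (gf _ wr).
  have [k k0 kP] := near_in wr.
  have [x x0 [xe xd]] := pos_min2 e0 k0; exists x => // s /andP[s0 sx].
  rewrite avgB; [|by apply: (@vcirc_cont _ (fun y => cabs (f y))) => t; apply: ca; apply/ltW/kP; rewrite circ_dist gtr0_norm//; lra|exact: tc_cst].
  by rewrite avg_cst lerB// eP// s0/=; lra.
- by move=> w wr; rewrite subr_le0 bf.
Qed.

Section LogPoisson.
Variables (F : C R -> C R) (c : C R) (r : R).
Hypothesis r0 : 0 < r.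

Let lnF (F : C R -> C R) w := ln (cabs (F w)).

Let ln_le (G : C R -> C R) : (forall z, cabs (z - c) <= r -> {for z, continuous G} /\ G z != 0) ->
  (forall z, cabs (z - c) < r -> good G z) ->
  (forall z, cabs (z - c) <= r -> {for z, continuous (lnF G)}) /\
  (forall z, cabs (z - c) <= r -> lnF G z <= PM c r (lnF G) z).
Proof.
move=> cG gG.
have pG z : cabs (z - c) <= r -> 0 < cabs (G z) by move=> /cG[_]; rewrite cabs_gt0.
have clG z : cabs (z - c) <= r -> {for z, continuous (lnF G)}.
  move=> zr; apply: (@cont_comp _ _ _ (fun w => cabs (G w)) (@ln R)).
    by apply: (@vcont_comp _ G (@cabs R)); [exact: (cG _ zr).1|exact: cabs_cont].
  exact/continuous_ln/pG.
have cb z : cabs (z - c) = r -> {for z, continuous (lnF G)} by move=> zr; apply: clG; rewrite zr.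
split=> // z zr.
have cPM w : cabs (w - c) <= r -> {for w, continuous (PM c r (lnF G))}.
  by move=> wr; apply: PM_cont => //; rewrite ltNge wr.
(* Inside the disk this is the modulus of the holomorphic [G exp (- p)] minus 1, with [p] the
   Schwarz integral of [ln |G|]; on the circle it vanishes. *)
pose V w := cabs (G w) * expR (- PM c r (lnF G) w) - 1.
suff : V z <= 0.
  by rewrite subr_le0 expRN ler_pdivrMr ?expR_gt0// mul1r -[X in X <= _](lnK (pG _ zr)) ler_expR.
apply: (@ball_max V c r) => //.
- move=> w wr; apply: vcontB; last exact: vcont_cst.
  apply: vcontM.
    by apply: (@vcont_comp _ G (@cabs R)); [exact: (cG _ wr).1|exact: cabs_cont].
  apply: (@cont_comp _ _ _ (fun w => - PM c r (lnF G) w) (@expR R)).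
    by apply: vcontN; exact: cPM.
  exact: continuous_expR.
- move=> w wr; have [k k0 kP] := near_in wr.
  pose p y := schwarz r (fun t => lnF G (circ c r t)) (y - c).
  have gp : good (fun y => cexp (- p y)) w.
    apply: (good_cdiff k0) => y /kP yr; apply: (@cdiff_comp (@cexp R) (fun y => - p y)).
      by eexists; exact: cderiv_cexp.
    by have [l dl] := schwarzC_cdiff r0 cb yr; exists (- l); exact: cderivN.
  have [e e0 eP] := good_submean (goodM (gG _ wr) gp).
  have [x x0 [xe xd]] := pos_min2 e0 k0; exists x => // s /andP[s0 sx].
  have VE y : cabs (y - w) < k -> cabs (G y * cexp (- p y)) - 1 = V y.
    by move=> /kP yr; rewrite cabsM cabs_cexp reN /V PM_in.
  rewrite -VE ?subrr ?cabs0// lerBlDr.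
  have ci t : cabs (circ w s t - w) < k by rewrite circ_dist gtr0_norm//; lra.
  have dp y : cabs (y - w) < k -> cdiff (fun y => cexp (- p y)) y.
    move=> /kP yr; apply: (@cdiff_comp (@cexp R) (fun y => - p y)).
      by eexists; exact: cderiv_cexp.
    by have [l dl] := schwarzC_cdiff r0 cb yr; exists (- l); exact: cderivN.
  have cX : tc (fun t => cabs (G (circ w s t) * cexp (- p (circ w s t)))).
    apply: (@vcirc_cont _ (fun y => cabs (G y * cexp (- p y)))) => t.
    apply: (@vcont_comp _ (fun y => G y * cexp (- p y)) (@cabs R)); last exact: cabs_cont.
    apply: ccontM; first exact: (cG _ (ltW (kP _ (ci t)))).1.
    exact: cdiff_cont (dp _ (ci t)).
  rewrite -(eq_avg (g := fun t => cabs (G (circ w s t) * cexp (- p (circ w s t))) - 1)); last first.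
    by move=> t _; exact: VE.
  rewrite avgB; [|exact: cX|exact: tc_cst].
  by rewrite avg_cst subrK eP// s0/=; lra.
- move=> w wr; rewrite /V PM_out ?wr// expRN /lnF lnK ?divff ?subrr//.
    by rewrite gt_eqF// pG// wr.
  by apply: pG; rewrite wr.
Qed.

(* Compare [F] with [exp] of the Schwarz integral of [ln |F|] by the maximum modulus
   principle; the same for [1 / F] gives the reverse inequality. *)
Lemma log_poisson : (forall z, cabs (z - c) <= r -> {for z, continuous F} /\ F z != 0) ->
  (forall z, cabs (z - c) < r -> good F z) ->
  (forall z, cabs (z - c) <= r -> {for z, continuous (fun w => ln (cabs (F w)))}) /\
  forall z, cabs (z - c) <= r -> ln (cabs (F z)) = PM c r (fun w => ln (cabs (F w))) z.
Proof.
move=> cF gF; have [cl le1] := ln_le cF gF; split=> // z zr.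
apply/eqP; rewrite eq_le; apply/andP; split; first exact: le1.
have gV w : cabs (w - c) < r -> good (fun w => (F w)^-1) w.
  by move=> wr; apply: goodV; [exact: (cF w (ltW wr)).2|exact: gF].
have cV w : cabs (w - c) <= r -> {for w, continuous (fun w => (F w)^-1)} /\ (F w)^-1 != 0.
  move=> /cF[c1 n1]; split; last by rewrite invr_eq0.
  exact (@contV (C R) (C R) F w n1 c1).
have [_ le2] := ln_le cV gV.
have := le2 z zr.
have -> : lnF (fun w => (F w)^-1) = fun w => - lnF F w.
  apply/funext => w; rewrite /lnF cabsV; have [h|h] := ltP 0 (cabs (F w)); first by rewrite lnV.
  by rewrite !ln0 ?oppr0// invr_le0.
rewrite PMN ?lerN2// => w wr; apply: cl; rewrite wr//.
Qed.
End LogPoisson.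
End Subharmonic.

(** * Difference quotients of injective holomorphic maps *)

Section Quotient.
Context {R : realType}.
Implicit Types (z w : C R) (r e : R) (f : C R -> C R).

Definition dq f w' w : C R := if w == w' then derive1 f w' else (f w - f w') / (w - w').

Lemma dqE f w' w : w != w' -> dq f w' w = (f w - f w') / (w - w').
Proof. by rewrite /dq => /negbTE ->. Qed.
Lemma dq_diag f w : dq f w w = derive1 f w.
Proof. by rewrite /dq eqxx. Qed.
Lemma dqC f w' w : dq f w' w = dq f w w'.
Proof.
have [->//|ww] := eqVneq w w'; rewrite !dqE// 1?eq_sym//.
by rewrite -(opprB (f w')) -(opprB w') invrN mulrNN.
Qed.
Lemma dqM f w' w : f w - f w' = dq f w' w * (w - w').
Proof.
have [->|ww] := eqVneq w w'; first by rewrite !subrr mulr0.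
by rewrite dqE// divfK// subr_eq0.
Qed.
Lemma cabs_dqM f w' w : cabs (f w - f w') = cabs (dq f w' w) * cabs (w - w').
Proof. by rewrite dqM cabsM. Qed.

Lemma dq_cont_diag f w' : cdiff f w' -> {for w', continuous (dq f w')}.
Proof.
move=> [l dl]; have lE := cderiv_derive1 dl; have [q [fE cq ql]] := dl.
suff -> : dq f w' = q by exact: cq.
apply/funext => w; have [->|ww] := eqVneq w w'; first by rewrite dq_diag lE ql.
by rewrite dqE// fE addrC addKr mulfK// subr_eq0.
Qed.

Lemma dq_cdiff f w' w : w != w' -> cdiff f w -> cdiff (dq f w') w.
Proof.
move=> ww [l dl]; have e0 : 0 < cabs (w - w') by rewrite cabs_gt0 subr_eq0.
have n0 : w - w' != 0 by rewrite subr_eq0.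
eexists; apply: (@cderiv_near _ (fun z => (f z - f w') / (z - w')) _ _ _ _ e0); last first.
  exact (@cderivf _ (fun z => f z - f w') (fun z => z - w') w _ _ n0
    (cderivB dl (cderiv_cst _ _)) (cderivB (cderiv_id _) (cderiv_cst _ _))).
move=> z zw; rewrite dqE//; apply: contraTneq zw => ->.
by rewrite cabsBC ltxx.
Qed.

Lemma dq_good f w' w e : 0 < e -> cdiff f w' -> (forall z, cabs (z - w) < e -> cdiff f z) ->
  good (dq f w') w.
Proof.
move=> e0 dw' df; have dw : cdiff f w by apply: df; rewrite subrr cabs0.
have [<-|ww] := eqVneq w w'.
  split; first exact: dq_cont_diag.
  by exists e => // z /andP[z0 ze]; apply: dq_cdiff; [rewrite -subr_eq0 -cabs_gt0|exact: df].
split; first by apply: cdiff_cont; exact: dq_cdiff.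
have n0 : 0 < cabs (w - w') by rewrite cabs_gt0 subr_eq0.
have [x x0 [xe xn]] := pos_min2 e0 n0.
exists x => // z /andP[z0 zx]; apply: dq_cdiff; last by apply: df; lra.
by apply: contraTneq zx => ->; rewrite cabsBC -leNgt.
Qed.

(* The minimum modulus of [f - f w] on the circle bounds the distance from [f w] to
   omitted values, by the maximum principle for [1 / (f - y)]. *)
Lemma disk_in_image f w r (m : R) : 0 < r -> 0 < m -> (forall z, cabs (z - w) <= r -> cdiff f z) ->
  (forall z, cabs (z - w) = r -> m <= cabs (f z - f w)) ->
  forall y, cabs (y - f w) < m / 2 -> exists2 z, cabs (z - w) < r & f z = y.
Proof.
move=> r0 m0 df mP y ym; apply: contrapT => ny.
have bd z : cabs (z - w) = r -> m / 2 < cabs (f z - y).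
  by move=> /mP; have := cabs_tri (f z) (f w) y; lra.
have nz z : cabs (z - w) <= r -> f z - y != 0.
  rewrite le_eqVlt => /predU1P[/bd|zr]; first by rewrite -cabs_gt0; lra.
  by rewrite subr_eq0; apply/eqP => fz; apply: ny; exists z.
have dg z : cabs (z - w) <= r -> cdiff (fun z => (f z - y)^-1) z.
  move=> zr; have [l dl] := df _ zr; eexists; apply: cderivV; first exact: nz.
  by apply: cderivB; [exact: dl|exact: cderiv_cst].
have gg z : cabs (z - w) < r -> good (fun z => (f z - y)^-1) z.
  move=> zr; have [e e0 eP] := near_in zr.
  by apply: (good_cdiff e0) => v /eP/ltW; exact: dg.
have H := @max_modulus _ (fun z => (f z - y)^-1) w r (m / 2)^-1 r0
  (fun z zr => cdiff_cont (dg z zr)) gg.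
have m20 : 0 < m / 2 by rewrite divr_gt0.
have Hb z : cabs (z - w) = r -> cabs (f z - y)^-1 <= (m / 2)^-1.
  move=> zr; have b := bd _ zr; rewrite cabsV lef_pV2 ?posrE//; first exact: ltW.
  exact: lt_trans b.
have w0 : cabs (w - w) <= r by rewrite subrr cabs0 ltW.
have := H Hb w w0; rewrite cabsV lef_pV2 ?posrE// ?cabs_gt0 ?nz//.
by rewrite leNgt cabsBC ym.
Qed.

Lemma inv_cderiv f g w l e : 0 < e -> cderiv f w l -> l != 0 -> g (f w) = w ->
  {for f w, continuous g} -> (forall z, cabs (z - f w) < e -> f (g z) = z) ->
  cderiv g (f w) l^-1.
Proof.
move=> e0 [q [fE cq ql]] l0 gw cg fg.
pose h z := w + (q (g z))^-1 * (z - f w).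
apply: (@cderiv_near _ h _ _ _ _ e0).
  move=> z zw; have := fE (g z); rewrite fg// => zE.
  have [qz|qz] := eqVneq (q (g z)) 0.
    by rewrite /h qz invr0 mul0r addr0 [in RHS]zE qz mul0r addr0 gw.
  have E : q (g z) * (g z - w) = z - f w by apply/esym/eqP; rewrite subr_eq addrC; apply/eqP.
  by rewrite /h -E mulKf// subrKC.
exists (fun z => (q (g z))^-1); split.
- by move=> z; rewrite /h subrr mulr0 addr0.
- apply: (@contV (C R) (C R) (fun z => q (g z))); first by rewrite gw ql.
  by apply: (@ccont_comp _ g q); [exact: cg|rewrite gw; exact: cq].
- by rewrite gw ql.
Qed.

Lemma is_derive_eps (g : R -> R) (x l : R) : (forall e, 0 < e ->
  exists2 d : R, 0 < d & forall h : R, `|h| < d -> `|g (x + h) - g x - l * h| <= e * `|h|) ->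
  is_derive x 1 g l.
Proof.
move=> H.
have cv : h^-1 *: ((g \o shift x) (h *: 1) - g x) @[h --> 0^'] --> l.
  move=> A /nbhsRP[e e0 eA].
  have [d d0 dP] := H _ (divr_gt0 e0 (ltr0n _ 2)).
  apply/nbhsRP; exists d => // h; rewrite subr0 => hd h0.
  apply: eA; rewrite /GRing.scale/= mulr1.
  have -> : h^-1 * (g (h + x) - g x) - l = (g (x + h) - g x - l * h) / h.
    by rewrite (addrC h); field.
  rewrite normrM normfV ltr_pdivrMr ?normr_gt0//.
  apply: (le_lt_trans (dP _ hd)); rewrite ltr_pM2r ?normr_gt0//.
  by rewrite ltr_pdivrMr// ltr_pMr// ltr1n.
split; first by apply/cvg_ex; exists l.
exact: cvg_lim cv.
Qed.

(** The real mean value theorem on segments, for the real and imaginary parts. *)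
Lemma cderiv0_const f w e : (forall z, cabs (z - w) < e -> cderiv f z 0) ->
  forall z, cabs (z - w) < e -> f z = f w.
Proof.
move=> df z ze.
have part (p : C R -> R) : (forall a b, p (a - b) = p a - p b) -> (forall a, `|p a| <= cabs a) ->
    p (f z) = p (f w).
  move=> pB ple; pose g t := p (f (w + rc t * (z - w))).
  have dg (t : R) : 0 <= t <= 1 -> is_derive t 1 g 0.
    move=> /andP[t0 t1]; apply: is_derive_eps => k k0.
    have [|d d0 dP] := (cderivP f (w + rc t * (z - w)) 0).1 _ (k / (cabs (z - w) + 1)) (divr_gt0 k0 (ltr_wpDl (cabs_ge0 _) ltr01)).
      apply: df; rewrite addrC addKr cabsM cabs_rc ger0_norm//.
      by apply: le_lt_trans ze; rewrite ler_piMl ?cabs_ge0.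
    have z0 := cabs_ge0 (z - w).
    exists (d / (cabs (z - w) + 1)); first by rewrite divr_gt0// ltr_wpDl.
    move=> h hd; rewrite mul0r subr0 /g -pB; apply: (le_trans (ple _)).
    have hd' : cabs (rc h * (z - w)) < d.
      rewrite cabsM cabs_rc; move: hd; rewrite ltr_pdivlMr ?ltr_wpDl// => hd.
      by apply: le_lt_trans hd; rewrite ler_wpM2l// lerDl.
    have := dP _ hd'; rewrite mul0r subr0 -addrA -mulrDl -rcD => H; apply: (le_trans H).
    rewrite cabsM cabs_rc mulrCA mulrC ler_wpM2r// mulrAC ler_pdivrMr ?ltr_wpDl//.
    by rewrite ler_pM2l// lerDl.
  have cg : {within `[0, 1], continuous g}.
    apply: derivable_within_continuous => t; rewrite in_itv/= => /dg dt.
    by have [] := dt.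
  have [t _] := @MVT R g (fun=> 0) 0 1 ltr01 (fun t tt => dg t (ltac:(by move: tt; rewrite in_itv/= => /andP[/ltW -> /ltW ->]))) cg.
  rewrite mul0r /g rc0 rc1 mul0r addr0 mul1r subrKC => /eqP.
  by rewrite subr_eq0 => /eqP.
by apply: C_eq; apply: part => *; rewrite ?reB ?imB// ?re_le ?im_le.
Qed.
End Quotient.

(** * Distortion of a single contraction *)

Section Harnack.
Context {R : realType}.
Implicit Types (c z a b : C R) (r s k : R) (v : C R -> R).

Lemma PM_cstB c r k v z : 0 < r -> (forall w, cabs (w - c) = r -> {for w, continuous v}) ->
  PM c r (fun w => k - v w) z = k - PM c r v z.
Proof.
move=> r0 cv; rewrite /PM; case: ifP => // zr; have cpk := tc_pker zr.
have cvt : tc (fun t => v (circ c r t)).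
  by apply: vcirc_cont => t; apply: cv; rewrite circ_dist gtr0_norm.
have {2}-> : k = avg (fun t => k * pker r (z - c) t) by rewrite avgZ// avg_pker ?mulr1.
rewrite -avgB; [|exact: tcZ|exact: tcM].
by apply: eq_avg => t _; rewrite mulrBl.
Qed.

(** Both values are compared with the average over the circle, at the cost of one factor each; hence
    the square. *)
Lemma harnack_ball v c r s : 0 <= s < r -> (forall z, cabs (z - c) <= r -> {for z, continuous v}) ->
  (forall z, cabs (z - c) <= r -> PM c r v z = v z) ->
  (forall z, cabs (z - c) = r -> 0 <= v z) ->
  forall a b, cabs (a - c) <= s -> cabs (b - c) <= s -> v a <= ((r + s) / (r - s)) ^+ 2 * v b.
Proof.
move=> /andP[s0 sr] cv pv v0 a b As bs.
have r0 : 0 < r by lra.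
have cb z : cabs (z - c) = r -> {for z, continuous v} by move=> zr; apply: cv; rewrite zr.
have [_ ha] := PM_harnack r0 cb v0 (le_lt_trans As sr).
have [hb _] := PM_harnack r0 cb v0 (le_lt_trans bs sr).
have aA : cabs (a - c) <= r by lra.
have bB : cabs (b - c) <= r by lra.
rewrite pv// in ha; rewrite pv// in hb.
move: ha hb; set A := avg _.
have A0 : 0 <= A.
  rewrite /A -(avg_cst 0); apply: avg_le; [exact: tc_cst|by apply: vcirc_cont => t; apply: cb; rewrite circ_dist gtr0_norm|].
  by move=> t _; apply: v0; rewrite circ_dist gtr0_norm.
clearbody A; have a0 := cabs_ge0 (a - c); have b0 := cabs_ge0 (b - c) => ha hb.
have k0 : 0 < (r + s) / (r - s) by rewrite divr_gt0//; lra.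
have h1 : (r + cabs (a - c)) / (r - cabs (a - c)) <= (r + s) / (r - s).
  apply: ler_pM; [lra|by rewrite invr_ge0; lra|lra|].
  by rewrite lef_pV2 ?posrE; lra.
have h2 : ((r + s) / (r - s))^-1 <= (r - cabs (b - c)) / (r + cabs (b - c)).
  rewrite invf_div; apply: ler_pM; [lra|by rewrite invr_ge0; lra|lra|].
  by rewrite lef_pV2 ?posrE; lra.
have h3 : A <= (r + s) / (r - s) * v b.
  by rewrite -ler_pdivrMl//; apply: le_trans hb; rewrite ler_wpM2r.
apply: (le_trans ha); apply: (@le_trans _ _ ((r + s) / (r - s) * A)); first by rewrite ler_wpM2r.
by rewrite expr2 -[leRHS]mulrA ler_pM2l.
Qed.
End Harnack.

Section Univalent.
Context {R : realType}.
Variable eta : R.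
Hypothesis eta01 : 0 < eta < 1.
Implicit Types (V : set (C R)) (f : C R -> C R) (w z x y : C R).

(** The conditions on one map. The derivative is bounded below only on the image of [V], so a lower
    bound on the unit disk has to be derived. *)
Definition nacmap V f : Prop :=
  [/\ forall z, cabs z < 1 + eta -> V z,
      forall z, V z -> cdiff f z,
      forall z w, V z -> V w -> f z = f w -> z = w,
      forall z, V z -> cabs (f z) < 1 - eta
    & forall z, V z -> eta < cabs (derive1 f (f z))].

Let e0 : 0 < eta. Proof. by case/andP: eta01. Qed.
Let e1 : eta < 1. Proof. by case/andP: eta01. Qed.
Local Notation R1 := (1 + eta / 2).
Local Notation R2 := (1 + eta / 4).
Local Notation R3 := (1 + eta / 8).

Section OneMap.
Variables (V : set (C R)) (f : C R -> C R).
Hypothesis nf : nacmap V f.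

Let VR z : cabs z < 1 + eta -> V z. Proof. by case: nf => h _ _ _ _; exact: h. Qed.
Let df z : V z -> cdiff f z. Proof. by case: nf => _ h _ _ _; exact: h. Qed.
Let finj z w : V z -> V w -> f z = f w -> z = w. Proof. by case: nf => _ _ h _ _; exact: h. Qed.
Let fle z : V z -> cabs (f z) < 1 - eta. Proof. by case: nf => _ _ _ h _; exact: h. Qed.

Lemma dq_goodV w' w : V w' -> cabs w < 1 + eta -> good (dq f w') w.
Proof.
move=> vw' wr; apply: (@dq_good _ _ _ _ (1 + eta - cabs w)); first by rewrite subr_gt0.
  exact: df.
move=> z zw; apply/df/VR; have := cabs_tri z 0 w; rewrite !subr0; lra.
Qed.

Lemma dq_contV w' w : V w' -> cabs w < 1 + eta -> {for w, continuous (dq f w')}.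
Proof. by move=> h k; have [] := dq_goodV h k. Qed.

(** Maximum modulus: on the circle of radius [R1] the numerator is at most 2 and the denominator at
    least [eta / 4]. *)
Lemma dq_upper w w' : cabs w <= R1 -> cabs w' <= R2 -> cabs (dq f w' w) <= 8 / eta.
Proof.
move=> wr wr'; have ee := e0; have vw' : V w' by apply: VR; lra.
apply: (@max_modulus _ (dq f w') 0 R1); rewrite ?subr0//; first lra.
- by move=> z; rewrite subr0 => zr; apply: dq_contV => //; lra.
- by move=> z; rewrite subr0 => zr; apply: dq_goodV => //; lra.
- move=> z; rewrite subr0 => zr.
  have zw : eta / 4 <= cabs (z - w') by have := cabs_subl z w'; lra.
  have zw0 : 0 < cabs (z - w') by lra.
  have := cabs_dqM f w' z; have := cabsB (f z) (f w').
  have := fle (VR (z := z) (ltac:(lra))); have := fle vw'.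
  rewrite ler_pdivlMr// => h1 h2 h3 h4.
  have h5 : cabs (dq f w' z) * (eta / 4) <= 2.
    by apply: (@le_trans _ _ (cabs (dq f w' z) * cabs (z - w'))); [rewrite ler_wpM2l ?cabs_ge0|lra].
  lra.
Qed.

(** What Harnack's inequality for the positive harmonic function [ln (8 / eta) - ln |dq|] makes of a
    lower bound [m] at one point of the disk of radius [R2]. *)
Definition low_bound (m : R) : R :=
  expR (ln (8 / eta) - ((R1 + R2) / (R1 - R2)) ^+ 2 * (ln (8 / eta) - ln m)).

Lemma dq_neq0 w' w : cabs w < 1 + eta -> cabs w' < 1 + eta -> derive1 f w' != 0 -> dq f w' w != 0.
Proof.
move=> wr wr' d0; have [->|ww] := eqVneq w w'; first by rewrite dq_diag.
rewrite dqE// mulf_neq0 ?invr_neq0 ?subr_eq0//.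
by apply: contraNneq ww => /finj ->//; exact: VR.
Qed.

(** By injectivity the difference quotient has no zero off the diagonal, and on it the value is the
    derivative at [w']; hence [log_poisson] applies. *)
Lemma dq_log w' rho : cabs w' < 1 + eta -> derive1 f w' != 0 -> 0 < rho < 1 + eta ->
  (forall z, cabs (z - 0) <= rho -> {for z, continuous (fun w => ln (cabs (dq f w' w)))}) /\
  (forall z, cabs (z - 0) <= rho -> ln (cabs (dq f w' z)) = PM 0 rho (fun w => ln (cabs (dq f w' w))) z).
Proof.
move=> wr d0 /andP[r0 rr]; have vw' := VR wr; apply: log_poisson => //.
  move=> z; rewrite subr0 => zr; have zr' := le_lt_trans zr rr.
  by split; [exact: dq_contV|exact: dq_neq0].
by move=> z; rewrite subr0 => zr; apply: dq_goodV => //; exact: lt_trans rr.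
Qed.

Lemma dq_lower w' (m : R) x y : cabs w' <= R2 -> derive1 f w' != 0 -> 0 < m ->
  cabs x <= R2 -> m <= cabs (dq f w' x) -> cabs y <= R2 -> low_bound m <= cabs (dq f w' y).
Proof.
move=> wr' d0 m0 xr mx yr; have ee := e0; have vw' : V w' by apply: VR; lra.
have nz z : cabs z < 1 + eta -> dq f w' z != 0.
  by move=> zr; apply: dq_neq0 => //; lra.
have r10 : 0 < R1 by lra.
have wr'' : cabs w' < 1 + eta by lra.
have r11 : 0 < R1 < 1 + eta by apply/andP; split; lra.
have [cl ll] := dq_log wr'' d0 r11.
pose K := ln (8 / eta).
have cb w : cabs (w - 0) = R1 -> {for w, continuous (fun w => ln (cabs (dq f w' w)))}.
  by move=> wr; apply: cl; rewrite wr.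
have := @harnack_ball _ (fun z => K - ln (cabs (dq f w' z))) 0 R1 R2 _ _ _ _ y x.
rewrite !subr0 => H; rewrite /low_bound -/K -[leRHS]lnK ?posrE ?cabs_gt0 ?nz//; last lra.
rewrite ler_expR.
have {}H : K - ln (cabs (dq f w' y)) <= ((R1 + R2) / (R1 - R2)) ^+ 2 * (K - ln (cabs (dq f w' x))).
  apply: H => //; first by apply/andP; split; lra.
  - move=> z zr; apply: vcontB; [exact: vcont_cst|exact: cl].
  - by move=> z zr; rewrite PM_cstB// -ll.
  - move=> z; rewrite subr0 => zr; rewrite subr_ge0 ler_ln ?posrE ?divr_gt0//.
      by apply: dq_upper => //; rewrite zr.
    by rewrite cabs_gt0 nz//; lra.
have hm : ln m <= ln (cabs (dq f w' x)) by rewrite ler_ln ?posrE// (lt_le_trans m0).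
have : ((R1 + R2) / (R1 - R2)) ^+ 2 * (K - ln (cabs (dq f w' x))) <= ((R1 + R2) / (R1 - R2)) ^+ 2 * (K - ln m).
  by rewrite ler_wpM2l ?sqr_ge0// lerB.
lra.
Qed.

Let m2 := low_bound (low_bound eta).
Let m20 : 0 < m2. Proof. exact: expR_gt0. Qed.

(** The hypothesis bounds the derivative at [x0 = f 0]. Harnack carries this bound from [(x0, x0)]
    to [(x0, w')] and, by symmetry of the difference quotient, from there to [(w', w)]; each passage
    costs one [low_bound]. *)
Lemma dq_lower2 w w' : cabs w <= R2 -> cabs w' <= R2 -> derive1 f w' != 0 -> m2 <= cabs (dq f w' w).
Proof.
move=> wr wr' d0; have ee := e0; have ee1 := e1.
pose x0 := f 0.
have v0 : V 0 by apply: VR; rewrite cabs0; lra.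
have x0r : cabs x0 <= R2 by have := fle v0; rewrite /x0; lra.
have dx0 : eta < cabs (derive1 f x0) by case: nf => _ _ _ _ h; exact: h.
have m1 : low_bound eta <= cabs (dq f x0 w').
  apply: (@dq_lower x0 eta x0); [exact: x0r| |exact: e0|exact: x0r|by rewrite dq_diag ltW|exact: wr'].
  by rewrite -cabs_gt0; lra.
apply: (@dq_lower w' _ x0); [exact: wr'|exact: d0|exact: expR_gt0|exact: x0r| |exact: wr].
by rewrite dqC.
Qed.

(** At a zero [w] of the derivative the quotient based at [w] is small nearby, whereas [dq_lower2]
    bounds it below wherever the derivative is nonzero. So the derivative vanishes on a disk and [f]
    is constant there, against injectivity. *)
Lemma derive1_neq0 w : cabs w < R2 -> derive1 f w != 0.
Proof.
move=> wr; have ee := e0; apply/eqP => d0.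
have vw : V w by apply: VR; lra.
have /ccontP/(_ _ m20)[d d00 dP] := dq_cont_diag (df vw).
have rw : 0 < R2 - cabs w by rewrite subr_gt0.
have [k k0 [kd kr]] := pos_min2 d00 rw.
have kV z : cabs (z - w) < k -> cabs z < R2 by move=> zk; have := cabs_tri z 0 w; rewrite !subr0; lra.
have dz z : cabs (z - w) < k -> cderiv f z 0.
  move=> zk; have zR := kV _ zk.
  have [l dl] := df (VR (z := z) (ltac:(lra))).
  have lE := cderiv_derive1 dl; have [z0|z0] := eqVneq (derive1 f z) 0.
    by rewrite -z0 lE.
  have := dq_lower2 (ltW wr) (ltW zR) z0; rewrite dqC.
  by have := dP z (ltac:(lra)); rewrite dq_diag d0 subr0; lra.
pose z := w + rc (k / 2).
have zw : cabs (z - w) = k / 2 by rewrite /z addrC addKr cabs_rc ger0_norm// divr_ge0// ltW.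
have zk : cabs (z - w) < k by rewrite zw; lra.
have := cderiv0_const dz zk => /finj E; have := E (VR (z := z) (ltac:(have := kV z zk; lra))) vw.
by move=> zE; move: zw; rewrite zE subrr cabs0; lra.
Qed.

Lemma dq_bounds w w' : cabs w <= R3 -> cabs w' <= R3 ->
  m2 <= cabs (dq f w' w) /\ cabs (dq f w' w) <= 8 / eta.
Proof.
move=> wr wr'; have ee := e0; split; last by apply: dq_upper; lra.
by apply: dq_lower2; [lra|lra|apply: derive1_neq0; lra].
Qed.

Let M0 := `|ln m2| + `|ln (8 / eta)|.

(** On the disk of radius [R3] the function [ln |dq|] is bounded by [M0] and equals its Poisson
    integral; the unit disk keeps the distance [eta / 8] from that circle. *)
Lemma ln_dq_lip w' a b : cabs w' <= 1 -> cabs a <= 1 -> cabs b <= 1 ->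
  `|ln (cabs (dq f w' a)) - ln (cabs (dq f w' b))| <= M0 * (2 * R3 / (eta / 8 * (eta / 8))) * cabs (a - b).
Proof.
move=> wr ar br; have ee := e0; have vw' : V w' by apply: VR; lra.
have bd z : cabs z <= R3 -> m2 <= cabs (dq f w' z) /\ cabs (dq f w' z) <= 8 / eta.
  by move=> zr; apply: dq_bounds => //; lra.
have nz z : cabs z <= R3 -> 0 < cabs (dq f w' z).
  by move=> /bd[h _]; apply: lt_le_trans h.
have r30 : 0 < R3 by lra.
have wr'' : cabs w' < 1 + eta by lra.
have r11 : 0 < R3 < 1 + eta by apply/andP; split; lra.
have d0 : derive1 f w' != 0 by apply: derive1_neq0; lra.
have [cl ll] := dq_log wr'' d0 r11.
rewrite (ll a) ?(ll b) ?subr0; [|lra|lra].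
have cb z : cabs (z - 0) = R3 -> {for z, continuous (fun w => ln (cabs (dq f w' w)))}.
  by move=> zr; apply: cl; rewrite zr.
have M00 : 0 <= M0 by rewrite /M0 addr_ge0.
have := @PM_lip _ 0 R3 (fun w => ln (cabs (dq f w' w))) r30 cb M0 M00 _ a b.
rewrite !subr0 => H; apply: (le_trans (H _ _ _)) => //; [|lra|lra|].
  move=> z; rewrite subr0 => zr; have zr3 : cabs z <= R3 by rewrite zr.
  have [h1 h2] := bd z zr3; have p := nz z zr3.
  have l1 : ln m2 <= ln (cabs (dq f w' z)) by rewrite ler_ln ?posrE.
  have l2 : ln (cabs (dq f w' z)) <= ln (8 / eta) by rewrite ler_ln ?posrE ?divr_gt0.
  have := ler_norm (ln (8 / eta)); have := ler_norm (- ln m2); rewrite normrN.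
  rewrite /M0 ler_norml; have := normr_ge0 (ln m2); have := normr_ge0 (ln (8 / eta)).
  by move=> *; apply/andP; split; lra.
rewrite ler_wpM2r ?cabs_ge0// ler_wpM2l// ler_wpM2l//; first lra.
have a0 := cabs_ge0 a; have b0 := cabs_ge0 b.
rewrite lef_pV2 ?posrE ?mulr_gt0 ?divr_gt0//; [|lra|lra].
by apply: ler_pM; lra.
Qed.

(** The difference of the squares is [(r^2 - |a|^2) (r^2 - |b|^2)]. *)
Lemma disk_lemma (r : R) (a b : C R) : 0 < r -> cabs a <= r -> cabs b <= r ->
  r * cabs (a - b) <= cabs (rc (r ^+ 2) - a * cj b).
Proof.
move=> r0 ar br; rewrite -(@ler_pXn2r _ 2)// ?nnegrE ?mulr_ge0 ?cabs_ge0// ?(ltW r0)//.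
have a2 : cabs a ^+ 2 <= r ^+ 2 by rewrite lerXn2r// nnegrE ?cabs_ge0// ltW.
have b2 : cabs b ^+ 2 <= r ^+ 2 by rewrite lerXn2r// nnegrE ?cabs_ge0// ltW.
have := mulr_ge0 (ltac:(by rewrite subr_ge0) : 0 <= r ^+ 2 - cabs a ^+ 2) (ltac:(by rewrite subr_ge0) : 0 <= r ^+ 2 - cabs b ^+ 2).
rewrite exprMn !cabs_sqr !cE /=; move: (re a) (im a) (re b) (im b) => a1 a3 b1 b3.
rewrite -subr_ge0 => h; rewrite -subr_ge0; apply: le_trans h _.
rewrite le_eqVlt; apply/orP; left; apply/eqP; ring.
Qed.

Let rr := 1 - eta.
(** The pseudo-hyperbolic distance of the disk of radius [R1]. *)
Definition phd (a b : C R) : R := R1 * cabs (a - b) / cabs (rc (R1 ^+ 2) - a * cj b).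
(** The largest ratio of the pseudo-hyperbolic distances of the disks of radii [R1] and [1 - eta],
    over pairs of points of the smaller one. *)
Definition kap : R := 2 * (1 - eta) * R1 / (R1 ^+ 2 + (1 - eta) ^+ 2).

Lemma kap01 : 0 < kap < 1.
Proof.
have ee := e0; have ee1 := e1; rewrite /kap.
have p1 : 0 < R1 ^+ 2 + (1 - eta) ^+ 2 by rewrite addr_gt0// exprn_gt0; lra.
apply/andP; split; first by rewrite divr_gt0// !mulr_gt0//; lra.
rewrite ltr_pdivrMr// mul1r -subr_gt0 (_ : _ - _ = (R1 - (1 - eta)) ^+ 2); last by ring.
by rewrite exprn_gt0//; lra.
Qed.

(** On the disk [|s| <= r^2] the ratio of the two moduli is largest at [s = - r^2]; the difference
    of the squares is displayed as a sum of nonnegative terms. *)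
Lemma phd_step (r S : R) (s : C R) : 0 < r -> r <= S -> cabs s <= r ^+ 2 ->
  (S ^+ 2 + r ^+ 2) * cabs (rc (r ^+ 2) - s) <= 2 * r ^+ 2 * cabs (rc (S ^+ 2) - s).
Proof.
move=> r0 rS sr; have rs0 : 0 < r ^+ 2 by rewrite exprn_gt0.
have RS : r ^+ 2 <= S ^+ 2 by rewrite lerXn2r// nnegrE; lra.
rewrite -(@ler_pXn2r _ 2)// ?nnegrE ?mulr_ge0 ?cabs_ge0 ?addr_ge0 ?sqr_ge0//.
have := re_le s; rewrite ler_norml => /andP[h1 _].
have : cabs s ^+ 2 <= (r ^+ 2) ^+ 2 by rewrite lerXn2r// nnegrE ?cabs_ge0 ?ltW.
rewrite !exprMn !cabs_sqr !cE /=; move: (re s) (im s) h1 (r ^+ 2) (S ^+ 2) sr rs0 RS => x y h1 B A sr B0 BA.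
have xB : 0 <= x + B by lra.
move=> h2; rewrite -subr_ge0.
have -> : 2 ^+ 2 * B ^+ 2 * ((A + - x) ^+ 2 + (0 - y) ^+ 2) - (A + B) ^+ 2 * ((B + - x) ^+ 2 + (0 - y) ^+ 2) =
  (A - B) * (A + 3 * B) * (B ^+ 2 - (x ^+ 2 + y ^+ 2)) + 2 * B * (A - B) ^+ 2 * (x + B) by ring.
apply: addr_ge0; apply: mulr_ge0; [|by rewrite subr_ge0|  |exact: xB].
  by apply: mulr_ge0; lra.
by apply: mulr_ge0; [lra|exact: sqr_ge0].
all: exact: ltW.
Qed.

(** The Schwarz-Pick lemma for a map from the disk of radius [R1] to that of radius [rr], with
    denominators cleared. The maximum modulus principle is applied to the quotient of the two
    Blaschke factors, written with [dq] so that it is continuous at [b]; on the circle one has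
    [|R1^2 - z b*| = R1 |z - b|]. *)
Lemma schwarz_pick w b : cabs w <= R1 -> cabs b < R1 ->
  rr * cabs (f w - f b) * cabs (rc (R1 ^+ 2) - w * cj b) <=
  R1 * cabs (w - b) * cabs (rc (rr ^+ 2) - f w * cj (f b)).
Proof.
move=> wr br; have ee := e0; have ee1 := e1.
have rr0 : 0 < rr by rewrite /rr; lra.
have vb : V b by apply: VR; lra.
have flr z : V z -> cabs (f z) <= rr by move=> /fle/ltW.
have dn z : V z -> rc (rr ^+ 2) - f z * cj (f b) != 0.
  move=> vz; rewrite -cabs_gt0; apply: lt_le_trans (cabs_subl _ _).
  rewrite cabs_rc ger0_norm ?sqr_ge0// cabsM cabs_cj subr_gt0 expr2.
  apply: (@le_lt_trans _ _ (rr * cabs (f b))); first by rewrite ler_wpM2r ?cabs_ge0 ?flr.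
  by rewrite ltr_pM2l// fle.
pose N z := rc rr * (rc (R1 ^+ 2) - z * cj b).
pose D z := rc R1 * (rc (rr ^+ 2) - f z * cj (f b)).
have R1n : rc R1 != 0 :> C R by rewrite -cabs_gt0 cabs_rc gtr0_norm; lra.
have D0 z : V z -> D z != 0 by move=> vz; rewrite mulf_neq0// dn.
pose G z := N z / D z.
have dG z : V z -> cdiff G z.
  move=> vz; have [l dl] := df vz.
  have dN : cderiv N z (rc rr * (0 - (1 * cj b + z * 0))).
    by apply: cderivZ; apply: cderivB; [exact: cderiv_cst|apply: cderivM; [exact: cderiv_id|exact: cderiv_cst]].
  have dD : cderiv D z (rc R1 * (0 - (l * cj (f b) + f z * 0))).
    by apply: cderivZ; apply: cderivB; [exact: cderiv_cst|apply: cderivM; [exact: dl|exact: cderiv_cst]].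
  by eexists; exact (@cderivf _ N D z _ _ (D0 z vz) dN dD).
have gG z : cabs z < 1 + eta -> good G z.
  move=> zr; apply: (@good_cdiff _ _ _ (1 + eta - cabs z)); first by rewrite subr_gt0.
  by move=> y yz; apply/dG/VR; have := cabs_tri y 0 z; rewrite !subr0; lra.
have gQ z : cabs z < 1 + eta -> good (fun z => dq f b z * G z) z.
  by move=> zr; apply: goodM; [exact: dq_goodV|exact: gG].
have Q1 : cabs (dq f b w * G w) <= 1.
  apply: (@max_modulus _ (fun z => dq f b z * G z) 0 R1); rewrite ?subr0//; first lra.
  - by move=> z; rewrite subr0 => zr; have [] := gQ z (ltac:(lra)).
  - by move=> z; rewrite subr0 => zr; apply: gQ; lra.
  - move=> z; rewrite subr0 => zr; have vz : V z by apply: VR; lra.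
    have zb : 0 < cabs (z - b) by have := cabs_subl z b; lra.
    have zE : cabs (rc (R1 ^+ 2) - z * cj b) = R1 * cabs (z - b).
      have -> : rc (R1 ^+ 2) - z * cj b = z * cj (z - b).
        rewrite -zr -mul_cj -mulrBr; congr (_ * _).
        by apply: C_eq; rewrite !cE /= !cE; ring.
      by rewrite cabsM cabs_cj zr.
    rewrite cabsM /G cabsf /N /D (cabsM (rc rr)) (cabsM (rc R1)) zE !cabs_rc !gtr0_norm//; last lra.
    have h := disk_lemma rr0 (flr _ vz) (flr _ vb).
    rewrite cabs_dqM in h.
    have p : 0 < cabs (rc (rr ^+ 2) - f z * cj (f b)) by rewrite cabs_gt0 dn.
    rewrite mulrA ler_pdivrMr ?mulr_gt0//; last lra.
    rewrite mul1r (_ : cabs (dq f b z) * _ = R1 * (rr * (cabs (dq f b z) * cabs (z - b)))); last by ring.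
    by rewrite ler_pM2l//; lra.
have vw : V w by apply: VR; lra.
have p : 0 < cabs (rc (rr ^+ 2) - f w * cj (f b)) by rewrite cabs_gt0 dn.
have R10 : 0 < R1 by lra.
move: Q1; rewrite cabsM /G cabsf /N /D (cabsM (rc rr)) (cabsM (rc R1)) !cabs_rc !gtr0_norm//.
rewrite mulrA ler_pdivrMr ?mulr_gt0// mul1r => h.
rewrite cabs_dqM; have := ler_wpM2r (cabs_ge0 (w - b)) h.
move: (cabs (dq f b w)) (cabs (w - b)) (cabs (rc (R1 ^+ 2) - w * cj b)) (cabs (rc (rr ^+ 2) - f w * cj (f b))) => q d X Z.
by rewrite (_ : q * (rr * X) * d = rr * (q * d) * X) 1?(_ : R1 * Z * d = R1 * d * Z)//; ring.
Qed.

(** The contraction comes from the image lying in the smaller disk of radius [1 - eta], measured by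
    [phd_step]. *)
Lemma phd_contract w b : cabs w < R1 -> cabs b < R1 -> phd (f w) (f b) <= kap * phd w b.
Proof.
move=> wr br; have ee := e0; have ee1 := e1.
have rr0 : 0 < rr by rewrite /rr; lra.
have R10 : 0 < R1 by lra.
have vb : V b by apply: VR; lra.
have vw : V w by apply: VR; lra.
have sp := schwarz_pick (ltW wr) br.
have fw := fle vw; have fb := fle vb.
have s2 : cabs (f w * cj (f b)) <= rr ^+ 2.
  by rewrite cabsM cabs_cj expr2; apply: ler_pM; rewrite ?cabs_ge0 ?ltW.
have := @phd_step rr R1 _ rr0 _ s2; rewrite /rr => /(_ (ltac:(lra))) st.
rewrite /phd.
have pos (u v : C R) : cabs u < R1 -> cabs v < R1 -> 0 < cabs (rc (R1 ^+ 2) - u * cj v).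
  move=> ur vr; apply: lt_le_trans (cabs_subl _ _).
  rewrite cabs_rc ger0_norm ?sqr_ge0// cabsM cabs_cj subr_gt0 expr2.
  by apply: ltr_pM; rewrite ?cabs_ge0.
have p1 := pos _ _ wr br.
have p2 := pos (f w) (f b) (ltac:(lra)) (ltac:(lra)).
move: p1 p2 sp st; rewrite -/rr.
set X := cabs (rc (R1 ^+ 2) - w * cj b); set Y := cabs (rc (R1 ^+ 2) - f w * cj (f b)).
set Z := cabs (rc (rr ^+ 2) - _); set A := cabs (f w - f b); set B := cabs (w - b).
have A0 : 0 <= A by exact: cabs_ge0.
have B0 : 0 <= B by exact: cabs_ge0.
have kE : kap = 2 * rr * R1 / (R1 ^+ 2 + rr ^+ 2) by [].
rewrite kE; clearbody X Y Z A B rr; move: (R1) R10 => S S0 X0 Y0 sp st.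
have SS : 0 < S ^+ 2 + rr ^+ 2 by rewrite addr_gt0// exprn_gt0.
rewrite ler_pdivrMr// (_ : _ * Y = (2 * rr * S * (S * B) * Y) / ((S ^+ 2 + rr ^+ 2) * X)); last first.
  by field; rewrite !gt_eqF.
rewrite ler_pdivlMr ?mulr_gt0//.
have h1 := ler_wpM2l (ltW SS) sp.
have h2 := ler_wpM2l (mulr_ge0 (ltW S0) B0) st.
rewrite -(ler_pM2l rr0).
have E1 : rr * (S * A * ((S ^+ 2 + rr ^+ 2) * X)) = S * ((S ^+ 2 + rr ^+ 2) * (rr * A * X)) by ring.
have E2 : rr * (2 * rr * S * (S * B) * Y) = S * (S * B * (2 * rr ^+ 2 * Y)) by ring.
rewrite E1 E2 ler_pM2l//; apply: le_trans h2; apply: le_trans h1 _.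
by rewrite le_eqVlt; apply/orP; left; apply/eqP; ring.
Qed.

End OneMap.
End Univalent.

(** * Local solution of the Dirichlet problem *)

Section SubharmonicClosure.
Context {R : realType}.
Implicit Types (z w c y : C R) (r t M e l : R) (u v s : C R -> R) (phi : C R -> C R).

Definition cnear v z := exists2 e : R, 0 < e & forall w, cabs (w - z) < e -> {for w, continuous v}.

Lemma cnear_at v z : cnear v z -> {for z, continuous v}.
Proof. by move=> [e e0 eP]; apply: eP; rewrite subrr cabs0. Qed.

Lemma vphi_tc v phi w0 (d : R) : 0 < d -> cnear v (phi w0) ->
  (forall w, cabs (w - w0) < d -> cdiff phi w) ->
  exists2 e : R, 0 < e & forall r, 0 < r < e -> tc (fun t => v (phi (circ w0 r t))).
Proof.
move=> d0 [k k0 cv] dp; have [x x0 [xd xP]] := phi_circ d0 k0 dp.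
exists x => // r /andP[r0 rx].
have rr t : cabs (circ w0 r t - w0) < x by rewrite circ_dist gtr0_norm.
apply: (@vcirc_cont _ (fun w => v (phi w))) => t.
apply: (@vcont_comp _ phi v); first by apply: cdiff_cont; apply: dp; have := rr t; lra.
by apply: cv; exact: xP.
Qed.

Lemma csubD u v z : cnear u z -> cnear v z -> csub u z -> csub v z -> csub (fun w => u w + v w) z.
Proof.
move=> cu cv su sv phi w0 d d0 pw dp.
have [e1 e10 E1] := su _ _ _ d0 pw dp; have [e2 e20 E2] := sv _ _ _ d0 pw dp.
rewrite -pw in cu cv; have [e3 e30 E3] := vphi_tc d0 cu dp; have [e4 e40 E4] := vphi_tc d0 cv dp.
have [x x0 [x1 x2]] := pos_min2 e10 e20; have [x' x'0 [x3 x4]] := pos_min2 e30 e40.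
have [m m0 [mx mx']] := pos_min2 x0 x'0; exists m => // r /andP[r0 rm].
rewrite avgD; [|by apply: E3; rewrite r0/=; lra|by apply: E4; rewrite r0/=; lra].
by apply: lerD; [apply: E1|apply: E2]; rewrite r0/=; lra.
Qed.

Lemma csubZ l v z : 0 <= l -> cnear v z -> csub v z -> csub (fun w => l * v w) z.
Proof.
move=> l0 cv sv phi w0 d d0 pw dp.
have [e1 e10 E1] := sv _ _ _ d0 pw dp.
rewrite -pw in cv; have [e3 e30 E3] := vphi_tc d0 cv dp.
have [x x0 [x1 x2]] := pos_min2 e10 e30; exists x => // r /andP[r0 rm].
rewrite avgZ; last by apply: E3; rewrite r0/=; lra.
by rewrite ler_wpM2l//; apply: E1; rewrite r0/=; lra.
Qed.

Lemma csub_near u v z e : 0 < e -> (forall w, cabs (w - z) < e -> u w = v w) ->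
  csub u z -> csub v z.
Proof.
move=> e0 uv H phi w0 d d0 pw dp; have [k k0 kP] := H _ _ _ d0 pw dp.
have [x x0 [xd xP]] := phi_circ d0 e0 dp; rewrite pw in xP.
have [y y0 [yx yk]] := pos_min2 x0 k0; exists y => // r /andP[r0 ry].
rewrite -uv ?subrr ?cabs0//; have -> : avg (fun t => v (phi (circ w0 r t))) = avg (fun t => u (phi (circ w0 r t))).
  apply: eq_avg => t _; rewrite uv//; apply: xP.
  by rewrite circ_dist gtr0_norm//; lra.
by apply: kP; rewrite r0/=; lra.
Qed.

(** A function that lies above a subharmonic one and touches it at [z] inherits the submean
    inequality at [z]. *)
Lemma csub_minorant u v z : u z = v z -> (exists2 e : R, 0 < e & forall w, cabs (w - z) < e -> u w <= v w) ->
  cnear u z -> cnear v z -> csub u z -> csub v z.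
Proof.
move=> uv [e e0 le] cu cv su phi w0 d d0 pw dp.
have [e1 e10 E1] := su _ _ _ d0 pw dp.
have [x x0 [xd xP]] := phi_circ d0 e0 dp; rewrite pw in xP.
rewrite -pw in cu cv; have [e3 e30 E3] := vphi_tc d0 cu dp; have [e4 e40 E4] := vphi_tc d0 cv dp.
have [y y0 [yx y1]] := pos_min2 x0 e10; have [y' y'0 [y3 y4]] := pos_min2 e30 e40.
have [m m0 [my my']] := pos_min2 y0 y'0; exists m => // r /andP[r0 rm].
rewrite -uv; apply: (le_trans (E1 r _)); first by rewrite r0/=; lra.
apply: avg_le; [by apply: E3; rewrite r0/=; lra|by apply: E4; rewrite r0/=; lra|].
by move=> t _; apply: le; apply: xP; rewrite circ_dist gtr0_norm//; lra.
Qed.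

Lemma csub_cst l z : csub (fun=> l) z.
Proof. by move=> phi w0 d d0 _ _; exists 1 => // r _; rewrite avg_cst. Qed.

Lemma charm_csubN v z : cnear v z -> charm v z -> csub (fun w => - v w) z.
Proof.
move=> cv hv phi w0 d d0 pw dp; have [e1 e10 E1] := hv _ _ _ d0 pw dp.
rewrite -pw in cv; have [e3 e30 E3] := vphi_tc d0 cv dp.
have [x x0 [x1 x3]] := pos_min2 e10 e30; exists x => // r /andP[r0 rx].
rewrite avgN; last by apply: E3; rewrite r0/=; lra.
by rewrite E1// r0/=; lra.
Qed.

Lemma charmB u v z : cnear u z -> cnear v z -> charm u z -> charm v z -> charm (fun w => u w - v w) z.
Proof.
move=> cu cv hu hv phi w0 d d0 pw dp.
have [e1 e10 E1] := hu _ _ _ d0 pw dp; have [e2 e20 E2] := hv _ _ _ d0 pw dp.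
rewrite -pw in cu cv; have [e3 e30 E3] := vphi_tc d0 cu dp; have [e4 e40 E4] := vphi_tc d0 cv dp.
have [x x0 [x1 x2]] := pos_min2 e10 e20; have [x' x'0 [x3 x4]] := pos_min2 e30 e40.
have [m m0 [mx mx']] := pos_min2 x0 x'0; exists m => // r /andP[r0 rm].
rewrite avgB; [|by apply: E3; rewrite r0/=; lra|by apply: E4; rewrite r0/=; lra].
by rewrite E1 ?E2//; rewrite r0/=; lra.
Qed.

Definition shc s := (forall z, {for z, continuous s}) /\ (forall z, csub s z).

Lemma shc_near s z : shc s -> cnear s z.
Proof. by move=> [cs _]; exists 1. Qed.

Lemma PM_mono c r u v z : 0 < r -> (forall w, cabs (w - c) = r -> {for w, continuous u} /\ {for w, continuous v}) ->
  (forall w, cabs (w - c) = r -> u w <= v w) -> cabs (z - c) <= r -> PM c r u z <= PM c r v z.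
Proof.
move=> r0 cuv uv; rewrite le_eqVlt => /predU1P[zr|zr]; first by rewrite !PM_out ?zr//; exact: uv.
rewrite /PM zr; have cpk := tc_pker zr.
have cr t : cabs (circ c r t - c) = r by rewrite circ_dist gtr0_norm.
apply: avg_le; [by apply: tcM => //; apply: vcirc_cont => t; apply: (cuv _ _).1|by apply: tcM => //; apply: vcirc_cont => t; apply: (cuv _ _).2|].
by move=> t _; rewrite ler_wpM2r ?uv// ltW// pker_gt0.
Qed.

Lemma PM_shc c r s : 0 < r -> shc s -> shc (PM c r s) /\ forall z, s z <= PM c r s z.
Proof.
move=> r0 [cs ss].
have cP z : {for z, continuous (PM c r s)} by apply: PM_cont.
have le z : s z <= PM c r s z.
  have [zr|zr] := leP (cabs (z - c)) r; last by rewrite PM_out// ltW.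
  by apply: sub_le_PM => // w _; exact: csub_submean.
split=> //; split=> // z; have [zr|zr] := ltP (cabs (z - c)) r.
  by apply: charm_csub; exact: PM_charm.
by apply: (@csub_minorant s) => //; [rewrite PM_out|exists 1|exists 1|exists 1].
Qed.

Lemma affine_mean phi w0 (d : R) k : 0 < d -> (forall w, cabs (w - w0) < d -> cdiff phi w) ->
  exists2 e : R, 0 < e & forall r, 0 < r < e -> forall a : C R,
    tc (fun t => re (phi (circ w0 r t) * a)) /\ avg (fun t => k + re (phi (circ w0 r t) * a)) = k + re (phi w0 * a).
Proof.
move=> d0 dp; exists d => // r /andP[r0 rd] a.
have dpa w : cabs (w - w0) < d -> cdiff (fun w => phi w * a) w.
  by move=> /dp[l dl]; eexists; apply: cderivM; [exact: dl|exact: cderiv_cst].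
have ct : tc (fun t => re (phi (circ w0 r t) * a)).
  apply: (@vcirc_cont _ (fun w => re (phi w * a))) => t.
  apply: (@vcont_comp _ (fun w => phi w * a) re); last exact: re_cont.
  by apply: cdiff_cont; apply: dpa; rewrite circ_dist gtr0_norm.
split=> //; rewrite avgD//; last exact: tc_cst.
rewrite avg_cst; congr (_ + _).
have dpa' w : 0 < cabs (w - w0) < d -> cdiff (fun w => phi w * a) w by move=> /andP[_]; exact: dpa.
have c0 : {for w0, continuous (fun w => phi w * a)} by apply: cdiff_cont; apply: dpa; rewrite subrr cabs0.
by apply: (mean_value dpa' c0); rewrite r0.
Qed.

Lemma cabs_sqr_ge z y : cabs z ^+ 2 - cabs (z - y) ^+ 2 = 2 * re (z * cj y) - cabs y ^+ 2.
Proof. by rewrite !cabs_sqr !cE /=; ring. Qed.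

(** * Cut-off functions as differences of subharmonic functions *)

Section Bump.
Variables (Y : set (C R)) (l : R).
Hypothesis l0 : 0 < l.
Hypothesis Y1 : forall y, Y y -> cabs y <= 1.

Let E z : set R := [set l * cabs z ^+ 2] `|` [set 1 + l * (cabs z ^+ 2 - cabs (z - y) ^+ 2) | y in Y].

Definition bump1 z : R := sup (E z).
Definition bump2 z : R := l * cabs z ^+ 2.

Let E_ub z x : E z x -> x <= 1 + l * cabs z ^+ 2.
Proof.
move=> [->|[y _ <-]]; first by rewrite lerDr.
by rewrite lerD2l ler_pM2l// gerBl sqr_ge0.
Qed.

Let E_has z : has_sup (E z).
Proof. by split; [exists (l * cabs z ^+ 2); left|exists (1 + l * cabs z ^+ 2); exact: E_ub]. Qed.

Lemma bump_ge z : bump2 z <= bump1 z.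
Proof. by apply: ub_le_sup; [case: (E_has z)|left]. Qed.

Lemma bump_le z : bump1 z <= 1 + bump2 z.
Proof. by apply: ge_sup; [case: (E_has z)|exact: E_ub]. Qed.

Lemma bump_in y : Y y -> bump1 y - bump2 y = 1.
Proof.
move=> Yy; apply/eqP; rewrite eq_le lerBlDr bump_le/= lerBrDr.
apply: ub_le_sup; first by case: (E_has y).
by right; exists y => //; rewrite subrr cabs0 expr0n/= subr0.
Qed.

Lemma bump_out z : (forall y, Y y -> 1 <= l * cabs (z - y) ^+ 2) -> bump1 z = bump2 z.
Proof.
move=> H; apply/eqP; rewrite eq_le bump_ge andbT; apply: ge_sup; first by case: (E_has z).
move=> x [->//|[y /H h <-]]; rewrite /bump2 mulrBr; lra.
Qed.

Lemma bump2_cont z : {for z, continuous bump2}.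
Proof.
by apply: vcontM; [exact: vcont_cst|apply: vcontM; exact: cabs_cont].
Qed.

Lemma bump1_cont z : {for z, continuous bump1}.
Proof.
apply/vcontP => e e0; pose N := cabs z + 1.
have N0 : 0 < l * (2 * N) by rewrite !mulr_gt0//; have := cabs_ge0 z; rewrite /N; lra.
have [x x0 [x1 xe]] := pos_min2 ltr01 (divr_gt0 e0 N0).
have key w1 w2 : cabs w1 <= N -> cabs w2 <= N -> bump1 w1 <= bump1 w2 + l * (2 * N) * cabs (w1 - w2).
  move=> h1 h2; have cw := cabs_ge0 (w1 - w2); have [cw1 cw2] := (cabs_ge0 w1, cabs_ge0 w2).
  have N1 : 1 <= N by rewrite /N lerDr cabs_ge0.
  apply: ge_sup; first by case: (E_has w1).
  have dd := cabs_subl w1 w2.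
  move=> a [->|[y Yy <-]].
    apply: (@le_trans _ _ (bump2 w2 + l * (2 * N) * cabs (w1 - w2))); last by rewrite lerD2r bump_ge.
    rewrite /bump2 -mulrA -mulrDr ler_pM2l//.
    have : (cabs w1 - cabs w2) * (cabs w1 + cabs w2) <= cabs (w1 - w2) * (2 * N).
      apply: (@le_trans _ _ (cabs (w1 - w2) * (cabs w1 + cabs w2))).
        by rewrite ler_wpM2r//; lra.
      by rewrite ler_wpM2l//; lra.
    by rewrite -subr_sqr; lra.
  apply: (@le_trans _ _ (1 + l * (cabs w2 ^+ 2 - cabs (w2 - y) ^+ 2) + l * (2 * N) * cabs (w1 - w2))); last first.
    by rewrite lerD2r; apply: ub_le_sup; [case: (E_has w2)|right; exists y].
  rewrite -addrA lerD2l -mulrA -mulrDr ler_pM2l// !cabs_sqr_ge.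
  have -> : re (w1 * cj y) = re (w2 * cj y) + re ((w1 - w2) * cj y) by rewrite -reD -mulrDl subrKC.
  have : re ((w1 - w2) * cj y) <= cabs (w1 - w2) * N.
    apply: (le_trans (ler_norm _)); apply: (le_trans (re_le _)).
    rewrite cabsM cabs_cj ler_wpM2l//; have := Y1 Yy; lra.
  lra.
exists x => // w wx.
have wN : cabs w <= N by have := cabs_subl w z; rewrite /N; lra.
have zN : cabs z <= N by rewrite /N lerDl.
have := key _ _ wN zN; have := key _ _ zN wN; rewrite (cabsBC z w).
have : l * (2 * N) * cabs (w - z) < e.
  by rewrite mulrC -ltr_pdivlMr//; lra.
by move=> h1 h2 h3; rewrite ltr_norml; apply/andP; split; lra.
Qed.

Lemma bump2_shc : shc bump2.
Proof.
split=> [z|z]; first exact: bump2_cont.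
move=> phi w0 d d0 <- dp.
have cb : cnear bump2 (phi w0) by exists 1 => // w _; exact: bump2_cont.
have [e e0 eP] := affine_mean (- (l * cabs (phi w0) ^+ 2)) d0 dp.
have [e' e'0 E'] := vphi_tc d0 cb dp.
have [x x0 [xe xe']] := pos_min2 e0 e'0; exists x => // r /andP[r0 rx].
have [ct ae] := eP r (ltac:(rewrite r0/=; lra)) (rc (2 * l) * cj (phi w0)).
have E2 a : re (a * (rc (2 * l) * cj (phi w0))) = 2 * l * re (a * cj (phi w0)).
  by rewrite !cE /=; ring.
have b2 : bump2 (phi w0) = - (l * cabs (phi w0) ^+ 2) + re (phi w0 * (rc (2 * l) * cj (phi w0))).
  by rewrite E2 mul_cj re_rc /bump2; ring.
rewrite b2 -ae; apply: avg_le.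
- by apply: tcD => //; exact: tc_cst.
- by apply: E'; rewrite r0/=; lra.
move=> t _; rewrite E2; set p := phi (circ w0 r t).
have := cabs_sqr_ge p (phi w0); have := sqr_ge0 (cabs (p - phi w0)) => h1 h2.
have : 2 * re (p * cj (phi w0)) - cabs (phi w0) ^+ 2 <= cabs p ^+ 2 by lra.
by rewrite -(ler_pM2l l0) /bump2; lra.
Qed.

Lemma bump1_shc : shc bump1.
Proof.
split=> [z|z]; first exact: bump1_cont.
move=> phi w0 d d0 <- dp.
have cb : cnear bump1 (phi w0) by exists 1 => // w _; exact: bump1_cont.
have [e e0 eP] := affine_mean 0 d0 dp.
have [e' e'0 E'] := vphi_tc d0 cb dp.
have [_ /(_ (phi w0)) sb2] := bump2_shc.
have [e2 e20 E2] := sb2 phi w0 d d0 erefl dp.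
have cb2 : cnear bump2 (phi w0) by exists 1 => // w _; exact: bump2_cont.
have [e3 e30 E3] := vphi_tc d0 cb2 dp.
have [x x0 [xe xe']] := pos_min2 e0 e'0; have [x' x'0 [xe2 xe3]] := pos_min2 e20 e30.
have [m m0 [mx mx']] := pos_min2 x0 x'0; exists m => // r /andP[r0 rm].
have cb1 : tc (fun t => bump1 (phi (circ w0 r t))) by apply: E'; rewrite r0/=; lra.
apply: ge_sup; first by case: (E_has (phi w0)).
move=> a [->|[y Yy <-]].
  apply: (le_trans (E2 r _)); first by rewrite r0/=; lra.
  by apply: avg_le => //; [apply: E3; rewrite r0/=; lra|move=> t _; exact: bump_ge].
have [ct ae] := eP r (ltac:(rewrite r0/=; lra)) (rc (2 * l) * cj y).
have E4 a0 : re (a0 * (rc (2 * l) * cj y)) = 2 * l * re (a0 * cj y) by rewrite !cE /=; ring.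
have F a0 : 1 + l * (cabs a0 ^+ 2 - cabs (a0 - y) ^+ 2) = (1 - l * cabs y ^+ 2) + re (a0 * (rc (2 * l) * cj y)).
  by rewrite cabs_sqr_ge E4; ring.
have ae' : avg (fun t => re (phi (circ w0 r t) * (rc (2 * l) * cj y))) = re (phi w0 * (rc (2 * l) * cj y)).
  by rewrite -[RHS]add0r -ae; apply: eq_avg => t _; rewrite add0r.
rewrite F -ae' -[X in X + _](avg_cst) -avgD//; last exact: tc_cst.
apply: avg_le => //; first by apply: tcD => //; exact: tc_cst.
move=> t _; rewrite -F; apply: ub_le_sup; [case: (E_has (phi (circ w0 r t)))=> //|].
by right; exists y.
Qed.
End Bump.
End SubharmonicClosure.

(** * Harmonic functions as limits of iterated Poisson modifications *)

Lemma inj_unbounded (f : nat -> nat) : injective f -> forall N, exists m, (N <= f m)%N.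
Proof.
move=> fi N; apply/not_existsP => H.
have lt m : (f m < N)%N by rewrite ltnNge; apply/negP/H.
have /leq_card : injective (fun i : 'I_N.+1 => Ordinal (lt i)).
  by move=> i j /(congr1 val)/= /fi /val_inj.
by rewrite !card_ord ltnn.
Qed.

Section Solve.
Context {R : realType}.
Implicit Types (z w c : C R) (r t M e : R) (u v s : C R -> R) (k j N : nat).

(** An enumeration of the rational disks in which each disk recurs infinitely often, thanks to the
    last component of the code. *)
Definition bseq k : C R * R :=
  if (unpickle k : option (rat * rat * rat * nat)) is Some (a, b, r, _) then
    (Complex (ratr a) (ratr b), ratr r) else (0, 0).

Lemma bseq_inf (a b r : rat) N : exists2 k, (N <= k)%N & bseq k = (Complex (ratr a) (ratr b), ratr r).
Proof.
have [m mN] := @inj_unbounded (fun m => pickle (a, b, r, m : nat))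
  (fun m1 m2 h => congr1 snd (pcan_inj pickleK h)) N.
by exists (pickle (a, b, r, m)) => //; rewrite /bseq pickleK.
Qed.

Lemma bseq_dense z e : 0 < e -> exists c r, [/\ cabs (z - c) < r / 2, r < e &
  forall N, exists2 k, (N <= k)%N & bseq k = (c, r)].
Proof.
move=> e0.
have [r] := @rat_in_itvoo R (e / 2) e (ltac:(lra)); rewrite in_itv/= => /andP[r1 r2].
have [a] := @rat_in_itvoo R (re z - e / 10) (re z) (ltac:(lra)); rewrite in_itv/= => /andP[a1 a2].
have [b] := @rat_in_itvoo R (im z - e / 10) (im z) (ltac:(lra)); rewrite in_itv/= => /andP[b1 b2].
exists (Complex (ratr a) (ratr b)), (ratr r); split=> //; last exact: bseq_inf.
apply: le_lt_trans (cabs_le _) _; rewrite reB imB /= !ger0_norm; rewrite /re /im in a1 a2 b1 b2 *; lra.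
Qed.

Section Sequence.
Variables (G : set (C R)).
Hypothesis oG : open G.
Hypothesis G1 : forall z, G z -> cabs z <= 1.

Definition okb (b : C R * R) := 0 < b.2 /\ cball_ b.1 b.2 `<=` G.

(** Modifications over all rational disks contained in [G], each performed infinitely often. For
    subharmonic [s] the sequence increases, and its limit [pml] is harmonic in [G]. *)
Fixpoint pms s k : C R -> R :=
  if k is j.+1 then (if `[< okb (bseq j) >] then PM (bseq j).1 (bseq j).2 (pms s j) else pms s j)
  else s.

Lemma pms_shc s k : shc s -> shc (pms s k).
Proof.
move=> ss; elim: k => [//|k IH]/=; case: asboolP => // -[r0 _].
exact: (PM_shc _ r0 IH).1.
Qed.

Lemma pms_leS s k z : shc s -> pms s k z <= pms s k.+1 z.
Proof. by move=> ss /=; case: asboolP => // -[r0 _]; exact: (PM_shc _ r0 (pms_shc k ss)).2. Qed.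

Lemma pms_le s k j z : shc s -> (k <= j)%N -> pms s k z <= pms s j z.
Proof.
move=> ss /subnKC <-; elim: (j - k)%N => [|i IH]; first by rewrite addn0.
by rewrite addnS; apply: le_trans IH _; exact: pms_leS.
Qed.

(** A finite stage changes [s] only on a closed subset of [G], hence keeps the values of [s] near
    the boundary; the limit has no such property. *)
Lemma pms_off s k : exists2 A, closed A & A `<=` G /\ forall z, ~ A z -> pms s k z = s z.
Proof.
elim: k => [|k [A cA [AG As]]]; first by exists set0; [exact: closed0|split].
rewrite /=; case: asboolP => [[r0 bG]|_]; last by exists A.
exists (A `|` cball_ (bseq k).1 (bseq k).2).
  by apply: closedU => //; apply: compact_closed; [exact: norm_hausdorff|exact: cball_compact].
split; first by move=> z [/AG|/bG].
by move=> z /not_orP[/As zA /negP]; rewrite -ltNge => zb; rewrite PM_out ?ltW.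
Qed.

Lemma pms_mono s1 s2 k z : shc s1 -> shc s2 -> (forall w, s1 w <= s2 w) -> pms s1 k z <= pms s2 k z.
Proof.
move=> h1 h2 le; elim: k z => [//|k IH] z /=; case: asboolP => // -[r0 _].
have [zr|zr] := leP (cabs (z - (bseq k).1)) (bseq k).2; last by rewrite !PM_out; [exact: IH|exact: ltW|exact: ltW].
by apply: PM_mono => // w _; split; [have [] := pms_shc k h1|have [] := pms_shc k h2].
Qed.

Section Limit.
Variables (s : C R -> R) (M : R).
Hypothesis ss : shc s.
Hypothesis sM : forall z, cabs z <= 1 -> `|s z| <= M.

Let M0 : 0 <= M. Proof. by apply: le_trans (sM (z := 0) _); rewrite ?cabs0. Qed.

Lemma pms_bd k z : G z -> `|pms s k z| <= M.
Proof.
elim: k z => [z /G1/sM//|k IH z Gz]/=; case: asboolP => [[r0 bG]|_]; last exact: IH.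
have [zr|zr] := leP (cabs (z - (bseq k).1)) (bseq k).2; last by rewrite PM_out; [exact: IH|exact: ltW].
have cv w : cabs (w - (bseq k).1) = (bseq k).2 -> {for w, continuous (pms s k)}.
  by move=> _; have [] := pms_shc k ss.
have bd w : cabs (w - (bseq k).1) = (bseq k).2 -> `|pms s k w| <= M.
  by move=> wr; apply/IH/bG; rewrite /cball_/= wr.
rewrite ler_norml; apply/andP; split.
  apply: le_trans ((PM_shc (bseq k).1 r0 (pms_shc k ss)).2 z).
  by have := IH z Gz; rewrite ler_norml => /andP[].
by apply: PM_le => // w /bd; rewrite ler_norml => /andP[].
Qed.

Definition pml z := sup (range (fun k => pms s k z)).

Lemma pml_has z : has_sup (range (fun k => pms s k z)).
Proof.
split; first by exists (s z), 0%N.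
have [Gz|Gz] := pselect (G z).
  by exists M => _ [k _ <-]; have := pms_bd k Gz; rewrite ler_norml => /andP[].
exists (s z) => _ [k _ <-]; have [A _ [AG ->]] := pms_off s k => //.
by move=> /AG.
Qed.

Lemma pml_ge k z : pms s k z <= pml z.
Proof. by apply: ub_le_sup; [case: (pml_has z)|exists k]. Qed.

Lemma pml_lim e z : 0 < e -> exists N, forall k, (N <= k)%N -> pml z - e < pms s k z.
Proof.
move=> e0; have [_ [N _ <-] h] := sup_adherent e0 (pml_has z).
by exists N => k Nk; apply: lt_le_trans h _; exact: pms_le.
Qed.

Definition iob c r := okb (c, r) /\ forall N, exists2 k, (N <= k)%N & bseq k = (c, r).

Lemma iob_dense z e : 0 < e -> G z -> exists c r, [/\ cabs (z - c) < r / 2, r < e & iob c r].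
Proof.
move=> e0 Gz; have /openCP/(_ _ Gz)[d d0 dG] := oG.
have [x x0 [xe xd]] := pos_min2 e0 (ltac:(lra) : 0 < d / 2).
have [c [r [zc rx io]]] := bseq_dense z x0.
exists c, r; split=> //; first lra; split=> //; split=> /=; first by have := cabs_ge0 (z - c); lra.
move=> w; rewrite /cball_/= => wr; apply: dG.
by have := cabs_tri w z c; rewrite (cabsBC c z); lra.
Qed.

(** Just after each visit to the disk the stage is a Poisson integral there, with a Lipschitz
    constant independent of the stage; the limit inherits it along these stages. *)
Lemma pml_lip c r a b : iob c r -> cabs (a - c) < r / 2 -> cabs (b - c) < r / 2 ->
  pml a - pml b <= M * (8 / r) * cabs (a - b).
Proof.
move=> [[/= r0 bG] io] ar br; rewrite -subr_le0; apply: (@le0_of_eps _ _ 1) => // e e0.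
have [N NP] := pml_lim a e0; have [k Nk kE] := io N.
have h1 := NP k.+1 (leqW Nk); have h2 := pml_ge k.+1 b.
have : pms s k.+1 a - pms s k.+1 b <= M * (8 / r) * cabs (a - b).
  rewrite /= kE; case: asboolP => [_|/(_ (conj r0 bG))//].
  have cv w : cabs (w - c) = r -> {for w, continuous (pms s k)} by move=> _; have [] := pms_shc k ss.
  have bd w : cabs (w - c) = r -> `|pms s k w| <= M by move=> wr; apply/pms_bd/bG; rewrite /cball_/= wr.
  apply: (le_trans (ler_norm _)); apply: (le_trans (PM_lip r0 cv M0 bd _ _)); [lra|lra|].
  rewrite ler_wpM2r ?cabs_ge0// ler_wpM2l//.
  have -> : 8 / r = 2 * r / ((r / 2) * (r / 2)) by field; rewrite gt_eqF.
  rewrite ler_wpM2l//; first lra.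
  rewrite lef_pV2 ?posrE; [|apply: mulr_gt0; lra|apply: mulr_gt0; lra].
  by apply: ler_pM; lra.
by rewrite mulr1; lra.
Qed.

Lemma pml_cont z : G z -> {for z, continuous pml}.
Proof.
move=> Gz; have [c [r [zc _ io]]] := iob_dense ltr01 Gz.
have r0 : 0 < r by have := cabs_ge0 (z - c); lra.
apply/vcontP => e e0.
pose L := M * (8 / r) + 1.
have L0 : 0 < L by rewrite /L ltr_wpDl// mulr_ge0// divr_ge0// ltW.
have [x x0 [xe xd]] := pos_min2 (divr_gt0 e0 L0) (ltac:(lra) : 0 < r / 2 - cabs (z - c)).
exists x => // w wx.
have wr : cabs (w - c) < r / 2 by have := cabs_tri w c z; lra.
have h1 := pml_lip io zc wr; have h2 := pml_lip io wr zc.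
have : M * (8 / r) * cabs (w - z) < e.
  apply: (@le_lt_trans _ _ (L * cabs (w - z))); first by rewrite ler_wpM2r ?cabs_ge0// /L lerDl.
  by rewrite mulrC -ltr_pdivlMr//; lra.
by rewrite (cabsBC z w) in h1; rewrite ltr_norml; lra.
Qed.

(* Dini's argument on the increasing sequence of modifications. *)
Lemma pml_unif A e : 0 < e -> compact A -> A `<=` G ->
  exists N, forall k, (N <= k)%N -> forall z, A z -> pml z - e < pms s k z.
Proof.
move=> e0 /compact_near_coveringP cA AG.
have [|N _ NP] := cA nat \oo (fun k z => pml z - e < pms s k z) _; last by exists N.
move=> z Az; have e2 : 0 < e / 4 by lra.
have [N NP] := pml_lim z e2.
have /vcontP/(_ _ e2)[d1 d10 P1] := pml_cont (AG _ Az).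
have /vcontP/(_ _ e2)[d2 d20 P2] := (pms_shc N ss).1 z.
have [x x0 [x1 x2]] := pos_min2 d10 d20.
exists ([set w | cabs (w - z) < x], [set k | (N <= k)%N]) => /=.
  by split; [apply/nbhsCP; exists x|exists N].
move=> [w k] /= [wx Nk]; have := P1 w (ltac:(lra)); have := P2 w (ltac:(lra)); have := NP N (leqnn N).
have := pms_le w ss Nk; rewrite !ltr_norml; lra.
Qed.

(** At a late visit to the disk the next stage is the Poisson integral of the present one. Uniform
    convergence on the closed disk gives one inequality, monotonicity the other. *)
Lemma pml_PM c r z : iob c r -> cabs (z - c) <= r -> PM c r pml z = pml z.
Proof.
move=> [[/= r0 bG] io] zr; apply/eqP; rewrite eq_le.
have cv k w : {for w, continuous (pms s k)} by have [] := pms_shc k ss.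
have cl w : cabs (w - c) = r -> {for w, continuous pml}.
  by move=> wr; apply/pml_cont/bG; rewrite /cball_/= wr.
have kP k : bseq k = (c, r) -> pms s k.+1 z = PM c r (pms s k) z.
  by move=> kE /=; rewrite kE; case: asboolP => // -[].
apply/andP; split; rewrite -subr_le0; apply: (@le0_of_eps _ _ 1) => // e e0; rewrite mulr1.
  have [N NP] := pml_unif e0 (@cball_compact _ c r) bG.
  have [k Nk kE] := io N; have := pml_ge k.+1 z; rewrite kP//.
  have : PM c r (fun w => pml w - e) z <= PM c r (pms s k) z.
    apply: PM_mono => // w wr; first by split=> //; apply: vcontB; [exact: cl|exact: vcont_cst].
    by apply/ltW/NP => //; rewrite /cball_/= wr.
  have -> : (fun w => pml w - e) = (fun w => - e - - pml w) by apply/funext => w; rewrite opprK addrC.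
  rewrite PM_cstB//; last by move=> w wr; apply: vcontN; exact: cl.
  by rewrite PMN//; lra.
have [N NP] := pml_lim z e0; have [k Nk kE] := io N.
have := NP k.+1 (leqW Nk); rewrite kP//.
have : PM c r (pms s k) z <= PM c r pml z.
  apply: PM_mono => // w wr; [by split=> //; exact: cl|exact: pml_ge].
lra.
Qed.

Lemma pml_charm z : G z -> charm pml z.
Proof.
move=> Gz; have [c [r [zc _ io]]] := iob_dense ltr01 Gz.
have r0 : 0 < r by have := cabs_ge0 (z - c); lra.
have zr : cabs (z - c) < r by lra.
have [e e0 eP] := near_in zr.
apply: (@charm_near _ (PM c r pml) _ _ e) => //.
  by move=> w /eP wr; apply: pml_PM => //; exact: ltW.
apply: PM_charm => // w wr; apply/pml_cont; case: io => -[_ h] _; apply: h => /=.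
by rewrite /cball_/= wr.
Qed.
End Limit.
End Sequence.
End Solve.

(** * The Dirichlet problem between a compact set and a circle *)

Section Local.
Context {R : realType}.
Variables (eta : R) (eta01 : 0 < eta < 1).
Implicit Types (z w c y : C R) (r t M e l : R) (u v h U : C R -> R) (K Y : set (C R)).

Let etp : 0 < eta. Proof. by case/andP: eta01. Qed.
Let et1 : eta < 1. Proof. by case/andP: eta01. Qed.
Local Notation Ro := (1 - eta / 4).
Local Notation rg := (1 - eta / 2).

(** A chain of disks of radius [eta / 5] centred on the circle of radius [rg], all inside the
    annulus, with consecutive centres at most [eta / 10] apart. Each link costs the factor
    [9 = ((1/5 + 1/10) / (1/5 - 1/10))^2], and the number of links depends only on [eta]. *)
Lemma harnack_circle : exists2 C0 : R, 1 <= C0 & forall f : C R -> R,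
  (forall z, 1 - eta < cabs z < Ro -> [/\ {for z, continuous f}, charm f z & 0 <= f z]) ->
  forall a b, cabs a = rg -> cabs b = rg -> f a <= C0 * f b.
Proof.
have ee := etp; have ee1 := et1; have rg0 : 0 < rg by lra.
have e10 : 0 < eta / 10 by lra.
have /tcontP/(_ _ e10)[d d0 dP] := @expi_cont R 0.
have [N NP] : exists N : nat, 2 * pi / N.+1%:R < d.
  have q0 : 0 <= 2 * pi / d by rewrite divr_ge0 ?mulr_ge0 ?pi_ge0// ltW.
  exists (Num.bound (2 * pi / d)); have := archi_boundP q0.
  rewrite ltr_pdivrMr// ltr_pdivrMr// [d * _]mulrC => /lt_le_trans; apply.
  by rewrite ler_wpM2r ?(ltW d0)// ler_nat.
exists (9 ^+ N.+1); first by rewrite exprn_ege1//; lra.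
move=> f fP.
have zon s : cabs (circ 0 rg s) = rg by rewrite /circ add0r; exact: cabs_zt (ltW rg0).
have step s x : `|x| < d -> f (circ 0 rg s) <= 9 * f (circ 0 rg (s + x)).
  move=> xd; set b := circ 0 rg (s + x).
  have br : cabs b = rg by exact: zon.
  have ab : cabs (circ 0 rg s - b) <= eta / 10.
    have -> : circ 0 rg s - b = rc rg * (expi s * (1 - expi x)) by rewrite /b /circ expiD; ring.
    rewrite !cabsM cabs_expi cabs_rc gtr0_norm// mul1r cabsBC.
    have := dP x; rewrite subr0 expi0 => /(_ xd) h.
    have : rg * cabs (expi x - 1) <= 1 * cabs (expi x - 1) by apply: ler_wpM2r; [exact: cabs_ge0|lra].
    by lra.
  have nb z : cabs (z - b) <= eta / 5 -> 1 - eta < cabs z < Ro.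
    move=> zb; have := cabs_subl b z; rewrite (cabsBC b z); have := cabs_subl z b; rewrite br.
    by move=> *; apply/andP; split; lra.
  have c9 : ((eta / 5 + eta / 10) / (eta / 5 - eta / 10)) ^+ 2 = 9 by field; lra.
  have s0 : 0 <= eta / 10 < eta / 5 by apply/andP; split; lra.
  have r0 : 0 < eta / 5 by lra.
  have cf z : cabs (z - b) <= eta / 5 -> {for z, continuous f} by move=> /nb/fP[].
  rewrite -c9; apply: (harnack_ball s0 cf) => //.
  - by apply: harm_eq_PM => // z zr; have [] := fP _ (nb z (ltW zr)).
  - by move=> z zr; have [] := fP z (nb z _) => //; rewrite zr.
  - by rewrite subrr cabs0; lra.
move=> a b ar br.
have [s s1] := circP 0 a; have [s' s'1] := circP 0 b; rewrite !subr0 ar br => -> ->.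
pose x := (s' - s) / N.+1%:R.
have xd : `|x| < d.
  apply: le_lt_trans NP; rewrite /x normrM (@ger0_norm _ (_^-1)) ?invr_ge0//.
  rewrite ler_pM2r ?invr_gt0// ler_norml; apply/andP; split; lra.
have it k : f (circ 0 rg s) <= 9 ^+ k * f (circ 0 rg (s + k%:R * x)).
  elim: k => [|k IH]; first by rewrite expr0 mul1r mul0r addr0.
  apply: (le_trans IH); rewrite exprSr -mulrA; apply: ler_wpM2l; first by rewrite exprn_ge0//; lra.
  have := step (s + k%:R * x) x xd; rewrite -addrA.
  by have -> : k%:R * x + x = k.+1%:R * x by rewrite -natr1 mulrDl mul1r.
have := it N.+1; have -> : s + N.+1%:R * x = s' by rewrite /x mulrC mulfVK ?pnatr_eq0// addrC subrK.
by [].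
Qed.

Definition annulus_domain K : set (C R) := [set z | cabs z < Ro /\ ~ K z].

Lemma annulus_domain_open K : closed K -> open (annulus_domain K).
Proof.
have ee := etp.
move=> /closedCP cK; apply/openCP => z [zR nK].
have [e e0 eP] : exists2 e : R, 0 < e & forall w, K w -> e <= cabs (w - z).
  apply: contrapT => h; apply: nK; apply: cK => e e0.
  apply: contrapT => nw; apply: h; exists e => // w Kw; rewrite leNgt; apply/negP => wz.
  by apply: nw; exists w.
have [x x0 [xe xd]] := pos_min2 e0 (ltac:(lra) : 0 < Ro - cabs z).
exists x => // w wx; split; first by have := cabs_tri w 0 z; rewrite !subr0; lra.
by move=> /eP; lra.
Qed.

Lemma closed_in_ball A r : closed A -> (forall z, A z -> cabs z < r) -> 0 < r ->
  exists2 r', r' < r & forall z, A z -> cabs z <= r'.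
Proof.
move=> cA Ar r0; have [A0|A0] := pselect (A !=set0); last first.
  by exists 0 => // z Az; case: A0; exists z.
have cpA : compact A by apply: (@bounded_closed_compactC _ _ r) => // z /Ar/ltW.
have [z Az zP] := compact_max cpA A0 (fun z _ => @cabs_cont R z).
by exists (cabs z) => //; exact: Ar.
Qed.

Lemma closed_off A z : closed A -> ~ A z -> exists2 e : R, 0 < e & forall w, cabs (w - z) < e -> ~ A w.
Proof.
move=> cA nA; have /openCP/(_ _ nA)[e e0 eP] : open (~` A) by rewrite openC.
by exists e.
Qed.

(* [h] and [U] approximate from below and above the harmonic measure of [Y] in
   the domain between [K] and the circle of radius [Ro]; [a] is its value at [rg]. *)
Lemma local_solution : exists2 C0 : R, 1 <= C0 & forall K Y (rho : R), closed K ->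
  (forall z, K z -> cabs z <= 1 - eta) -> Y `<=` K -> 0 < rho ->
  (forall y z, Y y -> K z -> ~ Y z -> rho <= cabs (z - y)) ->
  exists2 a : R, 0 <= a & forall delta : R, 0 < delta -> exists h U : C R -> R,
  [/\ forall z, annulus_domain K z -> [/\ {for z, continuous h}, csub h z,
        {for z, continuous U}, csub (fun w => - U w) z & 0 <= U z],
      exists2 Ri : R, rg < Ri < Ro & forall z, Ri <= cabs z < Ro -> h z <= 0,
      forall z e, K z -> 0 < e -> exists2 d : R, 0 < d & forall w, annulus_domain K w ->
        cabs (w - z) < d -> h w <= \1_Y z + e /\ \1_Y z - e <= U w
    & forall z, cabs z = rg -> a / C0 - delta <= h z /\ U z <= C0 * a + delta].
Proof.
have ee := etp; have ee1 := et1.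
have [C0 C01 CP] := harnack_circle; exists C0 => // K Y rho cK K1 YK rho0 sep.
(* The support radius [p] of the cut-off is below the separation of [Y] from the rest of [K] and
   below the gap [eta / 2] between [K] and the circle of radius [rg]; so the cut-off is the
   indicator of [Y] on [K] and vanishes from that circle outwards. *)
have [p p0 [pr pe]] := pos_min2 rho0 (ltac:(lra) : 0 < eta / 2).
pose l := (p ^+ 2)^-1; have l0 : 0 < l by rewrite invr_gt0 exprn_gt0.
have lp x : p <= x -> 1 <= l * x ^+ 2.
  move=> px; rewrite /l mulrC ler_pdivlMr ?exprn_gt0// mul1r lerXn2r// nnegrE; lra.
have Y1 y : Y y -> cabs y <= 1 by move=> /YK/K1; lra.
have ss1 := bump1_shc l0 Y1; have ss2 := @bump2_shc R l l0.
set s1 := bump1 Y l in ss1; set s2 := bump2 l in ss2.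
have s21 z : s2 z <= s1 z := bump_ge Y l0 z.
have s12 z : s1 z <= 1 + s2 z := bump_le Y l0 z.
have sYn z : K z -> s1 z - s2 z = \1_Y z.
  move=> Kz; rewrite indicE; have [Yz|Yz] := pselect (Y z).
    by rewrite mem_set//; exact: bump_in.
  rewrite memNset// /s1 /s2 (bump_out l0) ?subrr// => y Yy; apply: lp.
  by apply: le_trans pr _; exact: sep.
have out z : rg <= cabs z -> s1 z = s2 z.
  move=> zr; apply: (bump_out l0) => y Yy; apply: lp.
  by have := cabs_subl z y; have := K1 _ (YK _ Yy); lra.
pose G := annulus_domain K; have oG : open G by exact: annulus_domain_open.
have G1 z : G z -> cabs z <= 1 by move=> [h _]; lra.
have sM2 z : cabs z <= 1 -> 0 <= s2 z <= l.
  move=> z1; rewrite /s2 /bump2 mulr_ge0 ?sqr_ge0 ?(ltW l0)//=.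
  by rewrite ger_pMr// exprn_ile1 ?cabs_ge0.
have b1 z : cabs z <= 1 -> `|s1 z| <= 1 + l.
  by move=> /sM2 h; have := s21 z; have := s12 z; rewrite ler_norml; lra.
have b2 z : cabs z <= 1 -> `|s2 z| <= 1 + l.
  by move=> /sM2 h; rewrite ler_norml; lra.
clearbody s1 s2 l.
pose u1 := pml G s1; pose u2 := pml G s2.
have c1 z : G z -> {for z, continuous u1} by move=> Gz; exact (@pml_cont R G oG G1 s1 _ ss1 b1 z Gz).
have c2 z : G z -> {for z, continuous u2} by move=> Gz; exact (@pml_cont R G oG G1 s2 _ ss2 b2 z Gz).
have h1 z : G z -> charm u1 z by move=> Gz; exact (@pml_charm R G oG G1 s1 _ ss1 b1 z Gz).
have h2 z : G z -> charm u2 z by move=> Gz; exact (@pml_charm R G oG G1 s2 _ ss2 b2 z Gz).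
have ge1 k z : pms G s1 k z <= u1 z by exact (@pml_ge R G G1 s1 _ ss1 b1 k z).
have ge2 k z : pms G s2 k z <= u2 z by exact (@pml_ge R G G1 s2 _ ss2 b2 k z).
have mono k z : pms G s2 k z <= pms G s1 k z by exact: pms_mono.
have le21 z : u2 z <= u1 z.
  apply: ge_sup; first by exists (s2 z), 0%N.
  by move=> _ [k _ <-]; exact: le_trans (mono k z) (ge1 k z).
have nG z : G z -> exists2 e : R, 0 < e & forall w, cabs (w - z) < e -> G w by move/openCP: oG; exact.
have n1 z : G z -> cnear u1 z by move=> /nG[e e0 eP]; exists e => // w /eP; exact: c1.
have n2 z : G z -> cnear u2 z by move=> /nG[e e0 eP]; exists e => // w /eP; exact: c2.
(* The difference [f = u1 - u2] is the local solution itself, positive and harmonic in the annulus,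
   so its values on the circle of radius [rg] are comparable to the one at [w0]. *)
pose w0 : C R := rc rg; pose f z := u1 z - u2 z.
have fP z : 1 - eta < cabs z < Ro -> [/\ {for z, continuous f}, charm f z & 0 <= f z].
  move=> /andP[z1 z2]; have Gz : G z by split=> // /K1; lra.
  split; [by apply: vcontB; [exact: c1|exact: c2]| |by rewrite subr_ge0].
  exact: charmB (n1 _ Gz) (n2 _ Gz) (h1 _ Gz) (h2 _ Gz).
have w0r : cabs w0 = rg by rewrite cabs_rc gtr0_norm//; lra.
exists (f w0); first by rewrite subr_ge0.
move=> delta delta0.
pose S : set (C R) := [set z | cabs z = rg].
have SG : S `<=` G by move=> z zr; split; [rewrite zr; lra|move=> /K1; rewrite zr; lra].
have cS : compact S.
  apply: (@bounded_closed_compactC _ _ rg); last by move=> z ->.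
  apply/closedCP => z zP; apply/eqP; rewrite eq_le; apply/andP; split; rewrite -subr_le0; apply: (@le0_of_eps _ _ 1) => // e ep; have [w /= wr wz] := zP e ep; rewrite mulr1 -wr.
    by have := cabs_subl z w; rewrite cabsBC; lra.
  by have := cabs_subl w z; lra.
have [N1 NP1] := pml_unif oG G1 ss1 b1 delta0 cS SG.
have [N2 NP2] := pml_unif oG G1 ss2 b2 delta0 cS SG.
pose k := maxn N1 N2.
have [A1 cA1 [AG1 Ao1]] := pms_off G s1 k; have [A2 cA2 [AG2 Ao2]] := pms_off G s2 k.
have p1 := pms_shc G k ss1; have p2 := pms_shc G k ss2.
(* One of the two limits is replaced by a finite stage: [h] is then subharmonic and below [f], [U]
   superharmonic and above [f]. Near the boundary the stage is still [s1] or [s2], while [u1 >= s1]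
   and [u2 >= s2]; this gives the boundary inequalities at every point of [K], regular or not. *)
exists (fun z => pms G s1 k z - u2 z), (fun z => u1 z - pms G s2 k z); split.
- move=> z Gz; split.
  + by apply: vcontB; [exact: p1.1|exact: c2].
  + apply: (@csubD _ (pms G s1 k) (fun w => - u2 w)); [exact: shc_near| |exact: p1.2|].
      have [e ep eP] := n2 _ Gz; exists e => // w /eP cw; exact: (vcontN cw).
    by apply: charm_csubN; [exact: n2|exact: h2].
  + by apply: vcontB; [exact: c1|exact: p2.1].
  + apply: (@csub_near _ (fun w => pms G s2 k w + - u1 w) _ _ 1) => //.
      by move=> w _; rewrite opprB.
    apply: csubD; [exact: shc_near| |exact: p2.2|].
      have [e ep eP] := n1 _ Gz; exists e => // w /eP cw; exact: (vcontN cw).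
    by apply: charm_csubN; [exact: n1|exact: h1].
  + by rewrite subr_ge0; exact: le_trans (mono k z) (ge1 k z).
- have [r' r'1 r'P] := closed_in_ball cA1 (fun z Az => (AG1 z Az).1) (ltac:(lra)).
  (* Beyond the radius [r'] the finite stage is unmodified and equals [s1 = s2], so [h] is
     nonpositive there. *)
  pose Ri := Num.max (Num.max (r' / 2 + Ro / 2) (Ro - eta / 8)) 0.
  have m1 : r' / 2 + Ro / 2 <= Ri by rewrite /Ri !le_max lexx.
  have m2 : Ro - eta / 8 <= Ri by rewrite /Ri !le_max lexx orbT.
  have m3 : Ri < Ro by rewrite /Ri !gt_max; apply/andP; split; [apply/andP; split|]; lra.
  exists Ri; first by apply/andP; split; lra.
  move=> z /andP[z1 z2]; rewrite Ao1; last by move=> /r'P; lra.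
  by rewrite out; [rewrite subr_le0; exact: (ge2 0%N z)|lra].
- move=> z e Kz ep.
  have nA1 : ~ A1 z by move=> /AG1[].
  have nA2 : ~ A2 z by move=> /AG2[].
  have [d1 d10 dP1] := closed_off cA1 nA1; have [d2 d20 dP2] := closed_off cA2 nA2.
  have cs : {for z, continuous (fun w => s1 w - s2 w)} by apply: vcontB; [exact: ss1.1|exact: ss2.1].
  have /vcontP/(_ _ ep)[d3 d30 dP3] := cs.
  have [x x0 [x1 x2]] := pos_min2 d10 d20; have [d dp [dx dd]] := pos_min2 x0 d30.
  exists d => // w Gw wd; rewrite -sYn//; have := dP3 w (ltac:(lra)); rewrite ltr_norml => /andP[q1 q2].
  rewrite Ao1; last by apply: dP1; lra.
  rewrite Ao2; last by apply: dP2; lra.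
  by have := ge1 0%N w; have := ge2 0%N w; rewrite /=; lra.
- move=> z zr; have q1 : u1 z - delta < pms G s1 k z := NP1 k (leq_maxl _ _) z zr.
  have q2 : u2 z - delta < pms G s2 k z := NP2 k (leq_maxr _ _) z zr.
  have f1 := CP f fP z w0 zr w0r; have f2 := CP f fP w0 z w0r zr.
  have : f w0 / C0 <= f z by rewrite ler_pdivrMr 1?mulrC//; lra.
  have fE : f z = u1 z - u2 z by [].
  by rewrite fE in f1 *; move: f1; lra.
Qed.
End Local.

(** * Compositions and cylinders *)

Lemma dq_comp {R : realType} (f g : C R -> C R) w' w : cdiff f (g w) -> cdiff g w ->
  dq (f \o g) w' w = dq f (g w') (g w) * dq g w' w.
Proof.
have [<-|ww] := eqVneq w w'.
  move=> [l dl] [k dk]; rewrite !dq_diag (cderiv_derive1 dl) (cderiv_derive1 dk).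
  exact: (cderiv_derive1 (cderiv_comp dl dk)).
move=> _ _; have n0 : w - w' != 0 by rewrite subr_eq0.
by apply: (mulIf n0); rewrite -mulrA -!dqM.
Qed.

Section Compositions.
Context {R : realType}.
Variables (d : nat -> nat) (psi : nat -> nat -> C R -> C R) (eta : R) (V : set (C R)).

Definition conformal_system : Prop :=
  [/\ 0 < eta < 1, forall n i, (i < d n)%N -> nacmap eta V (psi n i),
      forall n i j z w, (i < d n)%N -> (j < d n)%N -> V z -> V w -> psi n i z = psi n j w -> i = j
    & forall z, cabs z < 1 + eta -> V z].

Hypothesis sys : conformal_system.
Let eta01 : 0 < eta < 1. Proof. by case: sys. Qed.
Let nac n i : (i < d n)%N -> nacmap eta V (psi n i). Proof. by case: sys => _ h _ _; exact: h. Qed.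
Let sep n i j z w : (i < d n)%N -> (j < d n)%N -> V z -> V w -> psi n i z = psi n j w -> i = j.
Proof. by case: sys => _ _ h _; exact: h. Qed.
Let VD z : cabs z < 1 + eta -> V z. Proof. by case: sys => _ _ _ h; exact: h. Qed.
Implicit Types (z w a b : C R) (u v : seq nat) (m n k : nat).

Let et0 : 0 < eta. Proof. by case/andP: eta01. Qed.
Let et1 : eta < 1. Proof. by case/andP: eta01. Qed.

(** The branch along a word starting at level [m]; the starting level is a parameter because the
    maps change from level to level. *)
Fixpoint comp m u : C R -> C R := if u is i :: v then psi m i \o comp m.+1 v else id.

Fixpoint okw m u : bool := if u is i :: v then (i < d m)%N && okw m.+1 v else true.

Lemma okw_cat m u v : okw m (u ++ v) = okw m u && okw (m + size u) v.
Proof.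
elim: u m => [|i u IH] m /=; first by rewrite addn0.
by rewrite IH andbA addSnnS.
Qed.

Lemma comp_cat m u v z : comp m (u ++ v) z = comp m u (comp (m + size u) v z).
Proof.
elim: u m => [|i u IH] m /=; first by rewrite addn0.
by rewrite IH addSnnS.
Qed.

Lemma psiV m i z : (i < d m)%N -> V z -> V (psi m i z).
Proof.
move=> id Vz; have [h _ _ h2 _] := nac id; apply: h; have := h2 z Vz; have := et0; lra.
Qed.

Lemma compV m u z : okw m u -> V z -> V (comp m u z).
Proof. by elim: u m => [//|i u IH] m /= /andP[id ok] Vz; apply: psiV => //; exact: IH. Qed.

Lemma comp_cdiff m u z : okw m u -> V z -> cdiff (comp m u) z.
Proof.
elim: u m => [|i u IH] m /=; first by move=> _ _; exact: cdiff_id.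
move=> /andP[id ok] Vz; apply: (@cdiff_comp _ (psi m i) (comp m.+1 u)); last exact: IH.
by have [_ h _ _ _] := nac id; apply: h; exact: compV.
Qed.

Lemma comp_inj m u z w : okw m u -> V z -> V w -> comp m u z = comp m u w -> z = w.
Proof.
elim: u m => [//|i u IH] m /= /andP[id ok] Vz Vw h; apply: (IH m.+1) => //.
by have [_ _ h' _ _] := nac id; apply: h' => //; exact: compV.
Qed.

Lemma comp_lt m u z : u != [::] -> okw m u -> V z -> cabs (comp m u z) < 1 - eta.
Proof.
case: u => // i u _ /= /andP[id ok] Vz.
by have [_ _ _ h _] := nac id; apply: h; exact: compV.
Qed.

Lemma comp_uniq m u v z w : size u = size v -> okw m u -> okw m v -> V z -> V w ->
  comp m u z = comp m v w -> u = v.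
Proof.
elim: u v m => [[]//|i u IH] [//|j v] m /= [s] /andP[id ou] /andP[jd ov] Vz Vw h.
have ij : i = j by apply: sep h => //; exact: compV.
subst j; congr (_ :: _); apply: (IH _ m.+1) => //.
by have [_ _ h' _ _] := nac id; apply: h' => //; exact: compV.
Qed.

Lemma V1 z : cabs z <= 1 -> V z.
Proof. by move=> h; apply: VD; have := et0; lra. Qed.

Lemma comp_le1 m u z : okw m u -> cabs z <= 1 -> cabs (comp m u z) <= 1.
Proof.
move=> ok z1; case: u ok => [//|i u] ok.
by have := @comp_lt m (i :: u) z isT ok (V1 z1); have := et0; lra.
Qed.

Lemma comp_lt1 m u z : okw m u -> cabs z < 1 -> cabs (comp m u z) < 1.
Proof.
move=> ok z1; case: u ok => [//|i u] ok.
by have := @comp_lt m (i :: u) z isT ok (V1 (ltW z1)); have := et0; lra.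
Qed.

Local Notation R1 := (1 + eta / 2).
Local Notation kp := (kap eta).

Let kp01 : 0 < kp < 1 := kap01 eta01.

Lemma comp_phd m u a b : okw m u -> cabs a < R1 -> cabs b < R1 ->
  phd eta (comp m u a) (comp m u b) <= kp ^+ size u * phd eta a b /\ cabs (comp m u a) < R1 /\ cabs (comp m u b) < R1.
Proof.
have ee := et0; move=> + ar br; elim: u m => [|i u IH] m /=; first by rewrite expr0 mul1r.
move=> /andP[id ok]; have [h1 [h2 h3]] := IH _ ok.
have lt z : cabs z < R1 -> cabs (psi m i z) < R1.
  by move=> zr; have [_ _ _ h _] := nac id; have := h z (VD (ltac:(lra))); lra.
split; last by split; apply: lt.
apply: (le_trans (phd_contract eta01 (nac id) h2 h3)).
by rewrite exprS -mulrA ler_wpM2l// ltW//; case/andP: kp01.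
Qed.

(** On the unit disk the denominators of [phd] lie between [R1^2 - 1] and [R1^2 + 1]; this is the
    price of passing from [phd] to the Euclidean distance and back. *)
Definition contr_const := 2 * (R1 ^+ 2 + 1) / (R1 ^+ 2 - 1).
Local Notation D0 := contr_const.

Let q0 : 0 < R1 ^+ 2 - 1.
Proof. by have ee := et0; rewrite subr_gt0 exprn_egt1//; lra. Qed.

Lemma D0_gt0 : 0 < D0.
Proof. by rewrite divr_gt0// mulr_gt0// addr_gt0// exprn_gt0//; have := et0; lra. Qed.

Lemma comp_contract m u a b : okw m u -> cabs a <= 1 -> cabs b <= 1 ->
  cabs (comp m u a - comp m u b) <= D0 * kp ^+ size u.
Proof.
move=> ok a1 b1; have ee := et0; have [k0 k1] := andP kp01.
have [h _] := comp_phd ok (ltac:(lra) : cabs a < R1) (ltac:(lra) : cabs b < R1).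
have r1 : 0 < R1 by lra.
have up x y : cabs x <= 1 -> cabs y <= 1 -> R1 ^+ 2 - 1 <= cabs (rc (R1 ^+ 2) - x * cj y) <= R1 ^+ 2 + 1.
  move=> x1 y1; have xy : cabs (x * cj y) <= 1 by rewrite cabsM cabs_cj mulr_ile1 ?cabs_ge0.
  have := cabs_subl (rc (R1 ^+ 2)) (x * cj y); have := cabsB (rc (R1 ^+ 2)) (x * cj y).
  by rewrite cabs_rc ger0_norm ?sqr_ge0// => *; apply/andP; split; lra.
have /andP[u1 u2] := up a b a1 b1.
have /andP[v1 v2] := up _ _ (comp_le1 ok a1) (comp_le1 ok b1).
move: h; rewrite /phd.
set A := cabs (rc _ - _) in v1 v2 *; set B := cabs (rc _ - _) in u1 u2 *.
set x := cabs (comp m u a - _); have ab : cabs (a - b) <= 2 by have := cabsB a b; lra.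
have A0 : 0 < A := lt_le_trans q0 v1; have B0 : 0 < B := lt_le_trans q0 u1.
rewrite ler_pdivrMr//.
have kn : 0 <= kp ^+ size u by rewrite exprn_ge0// ltW.
have hB : R1 * cabs (a - b) / B <= R1 * 2 / (R1 ^+ 2 - 1).
  apply: ler_pM => //; [by rewrite mulr_ge0 ?cabs_ge0 ?ltW|by rewrite invr_ge0 ltW|by rewrite ler_pM2l|].
  by rewrite lef_pV2 ?posrE.
move=> h; rewrite -(ler_pM2l r1); apply: (le_trans h).
have -> : R1 * (D0 * kp ^+ size u) = kp ^+ size u * (R1 * 2 / (R1 ^+ 2 - 1)) * (R1 ^+ 2 + 1).
  by rewrite /contr_const; ring.
apply: ler_pM => //; last by rewrite ler_wpM2l.
- by rewrite mulr_ge0// divr_ge0 ?mulr_ge0 ?cabs_ge0 ?ltW.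
- exact: ltW.
Qed.

Definition step_low : R := low_bound eta (low_bound eta eta).
Local Notation m2 := step_low.

Lemma m2_gt0 : 0 < m2. Proof. exact: expR_gt0. Qed.

Definition ln_dq_const : R :=
  (`|ln m2| + `|ln (8 / eta)|) * (2 * (1 + eta / 8) / (eta / 8 * (eta / 8))).
Local Notation L0 := ln_dq_const.

Let L00 : 0 <= L0.
Proof.
have ee := et0; apply: mulr_ge0; first by rewrite addr_ge0.
by rewrite divr_ge0 ?mulr_ge0//; lra.
Qed.

Lemma dq_psi_bounds m i w w' : (i < d m)%N -> cabs w <= 1 -> cabs w' <= 1 ->
  m2 <= cabs (dq (psi m i) w' w) <= 8 / eta.
Proof.
move=> id w1 w'1; have ee := et0.
have [h1 h2] := dq_bounds eta01 (nac id) (ltac:(lra) : cabs w <= 1 + eta / 8) (ltac:(lra) : cabs w' <= 1 + eta / 8).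
by rewrite /m2 h1 h2.
Qed.

Lemma dq_comp_cons m i u a b : okw m (i :: u) -> cabs a <= 1 -> cabs b <= 1 ->
  dq (comp m (i :: u)) a b = dq (psi m i) (comp m.+1 u a) (comp m.+1 u b) * dq (comp m.+1 u) a b.
Proof.
move=> /= /andP[id ok] a1 b1; apply: dq_comp; last by apply: comp_cdiff => //; exact: V1.
by have [_ h _ _ _] := nac id; apply/h/compV => //; exact: V1.
Qed.

Lemma dq_comp_gt0 m u a b : okw m u -> cabs a <= 1 -> cabs b <= 1 -> m2 ^+ size u <= cabs (dq (comp m u) a b).
Proof.
move=> + a1 b1; elim: u m => [|i u IH] m.
  move=> _; rewrite expr0 /=; have [->|ab] := eqVneq b a.
    by rewrite dq_diag (cderiv_derive1 (cderiv_id a)) cabs1.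
  by rewrite dqE// divff ?subr_eq0// cabs1.
move=> ok; rewrite dq_comp_cons// cabsM exprS; move: ok => /= /andP[id ok].
apply: ler_pM; [exact/ltW/m2_gt0|by rewrite exprn_ge0// ltW ?m2_gt0| |exact: IH].
by have /andP[] := dq_psi_bounds id (comp_le1 ok b1) (comp_le1 ok a1).
Qed.

(** The sum of the geometric series with terms [2 L0 D0 kp^k], one term for each letter of the
    word. *)
Definition dist_const : R := 2 * L0 * D0 / (1 - kp).
Local Notation Cd := dist_const.

Let Cd_ge0 : 0 <= Cd.
Proof.
have [k0 k1] := andP kp01; apply: divr_ge0; last by rewrite subr_ge0 ltW.
by apply: mulr_ge0; [exact: mulr_ge0|exact: ltW D0_gt0].
Qed.

(** The chain rule turns the difference of logarithms into a sum over the letters. Each term is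
    Lipschitz in its two arguments, which are images under the remaining part of the word and so
    geometrically close. *)
Lemma distortion m u a b a' b' : okw m u -> cabs a <= 1 -> cabs b <= 1 -> cabs a' <= 1 -> cabs b' <= 1 ->
  `|ln (cabs (dq (comp m u) a b)) - ln (cabs (dq (comp m u) a' b'))| <= Cd.
Proof.
move=> ok a1 b1 a'1 b'1; have [k0 k1] := andP kp01; have D00 := D0_gt0.
(* The induction needs the partial sum of the geometric series in place of its limit. *)
suff : `|ln (cabs (dq (comp m u) a b)) - ln (cabs (dq (comp m u) a' b'))| <= Cd * (1 - kp ^+ size u).
  move/le_trans; apply; apply: ler_piMr; first exact: Cd_ge0.
  by rewrite gerBl exprn_ge0// ltW.
elim: u m ok => [|i u IH] m ok.
  rewrite expr0 subrr mulr0 normr_le0 subr_eq0; apply/eqP.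
  have E x y : dq (comp m [::]) x y = 1.
    have [->|xy] := eqVneq y x; first by rewrite dq_diag (cderiv_derive1 (cderiv_id x)).
    by rewrite dqE// divff// subr_eq0.
  by rewrite !E.
rewrite !dq_comp_cons//; have /= /andP[id oku] := ok.
set g := comp m.+1 u.
have g1 z : cabs z <= 1 -> cabs (g z) <= 1 by move=> z1; exact: comp_le1.
have p1 x y : cabs x <= 1 -> cabs y <= 1 -> 0 < cabs (dq (psi m i) (g x) (g y)).
  by move=> x1 y1; have /andP[h _] := dq_psi_bounds id (g1 _ y1) (g1 _ x1); apply: lt_le_trans h; exact: m2_gt0.
have p2 x y : cabs x <= 1 -> cabs y <= 1 -> 0 < cabs (dq g x y).
  by move=> x1 y1; apply: lt_le_trans (dq_comp_gt0 oku x1 y1); rewrite exprn_gt0// m2_gt0.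
rewrite !cabsM !lnM ?posrE ?p1 ?p2//.
have := IH _ oku.
have Lp x y z : cabs x <= 1 -> cabs y <= 1 -> cabs z <= 1 ->
    `|ln (cabs (dq (psi m i) (g x) (g y))) - ln (cabs (dq (psi m i) (g x) (g z)))| <= L0 * (D0 * kp ^+ size u).
  move=> x1 y1 z1; apply: (le_trans (ln_dq_lip eta01 (nac id) (g1 _ x1) (g1 _ y1) (g1 _ z1))).
  by apply: ler_wpM2l => //; exact: comp_contract.
(* One argument is moved at a time: [b] to [b'], and then [a] to [a'] by symmetry of the difference
   quotient. *)
have q1 := Lp a b b' a1 b1 b'1; have q2 := Lp b' a a' b'1 a1 a'1.
rewrite (dqC _ (g b') (g a)) (dqC _ (g b') (g a')) in q2.
have -> : Cd * (1 - kp ^+ size (i :: u)) = Cd * (1 - kp ^+ size u) + 2 * (L0 * (D0 * kp ^+ size u)).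
  by rewrite /= exprS /dist_const; field; rewrite subr_eq0 gt_eqF.
move: q1 q2; move: (ln _) (ln _) (ln _) (ln _) (ln _) (Cd * _) (L0 * _) => x1 x2 x3 x4 x5 x6 x7.
by rewrite !ler_norml; lra.
Qed.

Definition cdist : R := expR Cd.
Local Notation cd := cdist.

Lemma cdist_ge1 : 1 <= cd.
Proof.
by rewrite /cdist -{1}expR0 ler_expR; exact: Cd_ge0.
Qed.

Lemma cdist_gt0 : 0 < cd. Proof. exact: expR_gt0. Qed.

(** The scale of a cylinder; any other difference quotient of the branch on the unit disk differs
    from it by a factor at most [cd]. *)
Definition lam m u : R := cabs (derive1 (comp m u) 0).

Lemma lam_low m u : okw m u -> m2 ^+ size u <= lam m u.
Proof. by move=> ok; rewrite /lam -dq_diag; apply: dq_comp_gt0; rewrite ?cabs0. Qed.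

Lemma lam_gt0 m u : okw m u -> 0 < lam m u.
Proof. by move=> /lam_low; apply: lt_le_trans; rewrite exprn_gt0// m2_gt0. Qed.

Lemma dq_lam m u a b : okw m u -> cabs a <= 1 -> cabs b <= 1 ->
  lam m u / cd <= cabs (dq (comp m u) a b) <= cd * lam m u.
Proof.
move=> ok a1 b1; have z1 : cabs (0 : C R) <= 1 by rewrite cabs0.
have h := distortion ok a1 b1 z1 z1; rewrite dq_diag -/(lam m u) in h.
have p : 0 < cabs (dq (comp m u) a b).
  by apply: lt_le_trans (dq_comp_gt0 ok a1 b1); rewrite exprn_gt0// m2_gt0.
have l0 := lam_gt0 ok; move: h; rewrite ler_norml => /andP[h1 h2].
rewrite -[lam m u]lnK ?posrE// -[X in _ <= X <= _]lnK ?posrE// /cdist -expRN -!expRD !ler_expR.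
by apply/andP; split; lra.
Qed.

Lemma comp_lip m u a b : okw m u -> cabs a <= 1 -> cabs b <= 1 ->
  lam m u / cd * cabs (a - b) <= cabs (comp m u a - comp m u b) <= cd * lam m u * cabs (a - b).
Proof.
move=> ok a1 b1; have /andP[h1 h2] := dq_lam ok b1 a1.
by rewrite cabs_dqM !ler_wpM2r ?cabs_ge0.
Qed.

Lemma lam_cat m u v : okw m (u ++ v) ->
  lam m u * lam (m + size u) v / cd <= lam m (u ++ v) <= cd * (lam m u * lam (m + size u) v).
Proof.
rewrite okw_cat => /andP[ou ov]; have z1 : cabs (0 : C R) <= 1 by rewrite cabs0.
have E : lam m (u ++ v) = cabs (dq (comp m u) (comp (m + size u) v 0) (comp (m + size u) v 0)) * lam (m + size u) v.
  rewrite /lam; have -> : comp m (u ++ v) = comp m u \o comp (m + size u) v.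
    by apply/funext => z; exact: comp_cat.
  rewrite -dq_diag dq_comp ?cabsM ?dq_diag//; last by apply: comp_cdiff => //; exact: V1.
  by apply: comp_cdiff => //; apply/compV => //; exact: V1.
have c1 := comp_le1 ov z1; have /andP[h1 h2] := dq_lam ou c1 c1.
rewrite E mulrAC mulrA !ler_pM2r ?lam_gt0//; exact/andP.
Qed.

Lemma lam_le m u : okw m u -> lam m u <= cd * D0 * kp ^+ size u.
Proof.
move=> ok; have z1 : cabs (0 : C R) <= 1 by rewrite cabs0.
have o1 : cabs (1 : C R) <= 1 by rewrite cabs1.
have /andP[h _] := comp_lip ok o1 z1; have := le_trans h (comp_contract ok o1 z1).
by rewrite subr0 cabs1 mulr1 ler_pdivrMr ?cdist_gt0// => /le_trans; apply; rewrite mulrC mulrA.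
Qed.

Lemma lam1 m i : (i < d m)%N -> m2 <= lam m [:: i] <= 8 / eta.
Proof.
move=> id; have z1 : cabs (0 : C R) <= 1 by rewrite cabs0.
by have := dq_psi_bounds id z1 z1; rewrite dq_diag.
Qed.

(** On the circle of radius [r] about [z] the branch stays at distance [r lam / cd] from its central
    value, so [disk_in_image] fills half of that radius. *)
Lemma image_ball m u z r y : okw m u -> 0 < r -> cabs z + r <= 1 ->
  cabs (y - comp m u z) < lam m u / cd * r / 2 -> exists2 w, cabs (w - z) < r & comp m u w = y.
Proof.
move=> ok r0 zr; have z1 : cabs z <= 1 by lra.
have b1 w : cabs (w - z) <= r -> cabs w <= 1 by move=> wr; have := cabs_subl w z; lra.
apply: disk_in_image => //.
- by rewrite mulr_gt0// divr_gt0 ?lam_gt0 ?cdist_gt0.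
- by move=> w /b1 w1; apply: comp_cdiff => //; exact: V1.
- move=> w wr; have w1 : cabs w <= 1 by apply: b1; rewrite wr.
  by have /andP[h _] := comp_lip ok w1 z1; rewrite -wr.
Qed.

Fixpoint words m n : seq (seq nat) :=
  if n is k.+1 then [seq i :: v | i <- iota 0 (d m), v <- words m.+1 k] else [:: [::]].

Lemma wordsP m n u : u \in words m n = (size u == n) && okw m u.
Proof.
elim: n m u => [|n IH] m u; first by rewrite inE; case: u.
apply/allpairsP/idP => [[[i v] /= [iI vI ->]]|].
  by move: vI iI; rewrite IH mem_iota /= eqSS => /andP[-> ->] ->.
case: u => //= i u; rewrite eqSS => /and3P[su id ok]; exists (i, u); split=> //=; first by rewrite mem_iota.
by rewrite IH su.
Qed.

Lemma words_uniq m n : uniq (words m n).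
Proof.
elim: n m => [//|n IH] m; apply: allpairs_uniq; [exact: iota_uniq|exact: IH|].
by move=> [i u] [j v] _ _ /= [-> ->].
Qed.

Definition cyl m u : set (C R) := comp m u @` @unit_disk R.

(** The limit set of the system started at level [m]. The length 0 is included: its cylinder is the
    unit disk. *)
Definition lset m : set (C R) := [set z | forall n, exists2 u, u \in words m n & cyl m u z].

Lemma lset_lt m z : lset m z -> cabs z < 1 - eta.
Proof.
move=> /(_ 1%N)[u]; rewrite wordsP => /andP[su ok] [w w1 <-].
by apply: comp_lt => //; [case: u su ok|apply/V1/ltW].
Qed.

Lemma cyl_pre m u v : okw m (u ++ v) -> cyl m (u ++ v) `<=` cyl m u.
Proof.
rewrite okw_cat => /andP[ou ov] _ [z z1 <-]; exists (comp (m + size u) v z); last by rewrite comp_cat.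
exact: comp_lt1.
Qed.

Lemma cyl_uniq m u v z : size u = size v -> okw m u -> okw m v -> cyl m u z -> cyl m v z -> u = v.
Proof.
move=> s ou ov [x x1 <-] [y y1 h]; apply: (comp_uniq s ou ov (V1 (ltW x1)) (V1 (ltW y1))).
by rewrite h.
Qed.

(** A branch maps the shifted limit set onto the part of the limit set in its cylinder: words coding
    an image point must start with [u], since cylinders of one length are disjoint. *)
Lemma lset_cyl m u z : okw m u -> cabs z < 1 -> lset (m + size u) z <-> lset m (comp m u z).
Proof.
move=> ok z1; split=> Lz n.
  have [nu|un] := leqP n (size u).
    exists (take n u); first by rewrite wordsP size_takel// eqxx; move: ok; rewrite -{1}(cat_take_drop n u) okw_cat => /andP[].
    by apply: (@cyl_pre m _ (drop n u)); rewrite cat_take_drop//; exists z.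
  have [v] := Lz (n - size u)%N; rewrite wordsP => /andP[/eqP sv ov] [w w1 wE].
  exists (u ++ v); first by rewrite wordsP size_cat sv subnKC ?(ltnW un)// eqxx okw_cat ok.
  by exists w => //; rewrite comp_cat wE.
have [v] := Lz (size u + n)%N; rewrite wordsP => /andP[/eqP sv ov] vz.
rewrite -(cat_take_drop (size u) v) in ov vz.
have su : size (take (size u) v) = size u by rewrite size_takel// sv leq_addr.
have tu : take (size u) v = u.
  apply: (@cyl_uniq m _ _ (comp m u z)) => //; [by move: ov; rewrite okw_cat => /andP[]|exact: cyl_pre vz|by exists z].
move: ov vz; rewrite tu okw_cat => /andP[_ ov] [w w1]; rewrite comp_cat => wE.
exists (drop (size u) v); first by rewrite wordsP size_drop sv addKn eqxx.
exists w => //; apply: (comp_inj ok) => //; last by apply/V1/ltW.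
by apply/V1/ltW; exact: comp_lt1.
Qed.

(** The shifted limit set keeps the distance [eta] from the unit circle, so limit points lie deep
    inside their cylinders, at a depth proportional to the scale. *)
Lemma lset_ball m u z y : okw m u -> lset m z -> cyl m u z ->
  cabs (y - z) < lam m u / cd * eta / 4 -> cyl m u y.
Proof.
move=> ok Lz [w w1 wE] yz; have ee := et0; rewrite -wE in Lz yz.
have Lw : lset (m + size u) w by apply/(lset_cyl ok w1).
have wr := lset_lt Lw.
have [x xr <-] : exists2 x, cabs (x - w) < eta / 2 & comp m u x = y.
  apply: image_ball => //; [lra|lra|].
  by move: yz; move: (lam m u / cd) => q; lra.
by exists x => //; rewrite /unit_disk /=; have := cabs_subl x w; lra.
Qed.

Lemma cyl_diam m u y z : okw m u -> cyl m u y -> cyl m u z -> cabs (y - z) <= 2 * cd * lam m u.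
Proof.
move=> ok [a a1 <-] [b b1 <-]; have /andP[_ h] := comp_lip ok (ltW a1) (ltW b1).
apply: (le_trans h); have -> : 2 * cd * lam m u = cd * lam m u * 2 by ring.
apply: ler_wpM2l; first by rewrite mulr_ge0 ?ltW ?lam_gt0 ?cdist_gt0.
by have := cabsB a b; rewrite /unit_disk/= in a1 b1; lra.
Qed.

(** The depth given by [lset_ball] is bounded below over all words of length [n], so an accumulation
    point lies in the cylinder of a nearby limit point. *)
Lemma lset_closed m : closed (lset m).
Proof.
apply/closedCP => z zP n; pose e := m2 ^+ n / cd * eta / 4.
have e0 : 0 < e by rewrite !(mulr_gt0, invr_gt0) ?exprn_gt0 ?m2_gt0 ?cdist_gt0.
have [w Lw wz] := zP e e0; have [u uw cw] := Lw n; exists u => //.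
move: uw; rewrite wordsP => /andP[/eqP su ok]; apply: (lset_ball ok Lw cw).
rewrite cabsBC; apply: lt_le_trans wz _; rewrite !ler_pM2r ?invr_gt0 ?cdist_gt0//.
by rewrite -su; exact: lam_low.
Qed.

Lemma lset_sep m u y z : okw m u -> lset m y -> cyl m u y -> ~ cyl m u z ->
  lam m u / cd * eta / 4 <= cabs (z - y).
Proof. by move=> ok Ly cy nz; rewrite leNgt; apply/negP => h; apply: nz; exact: lset_ball h. Qed.

Lemma cyl_open m u : okw m u -> open (cyl m u).
Proof.
move=> ok; apply/openCP => _ [z z1 <-]; rewrite /unit_disk/= in z1.
exists (lam m u / cd * ((1 - cabs z) / 2) / 2).
  by rewrite !(mulr_gt0, invr_gt0) ?lam_gt0 ?cdist_gt0// subr_gt0.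
move=> y yz; have [w wz <-] : exists2 w, cabs (w - z) < (1 - cabs z) / 2 & comp m u w = y.
  by apply: image_ball => //; lra.
by exists w => //; rewrite /unit_disk/=; have := cabs_subl w z; lra.
Qed.

Lemma comp_rcons m u i z : comp m (rcons u i) z = comp m u (psi (m + size u) i z).
Proof. by rewrite -cats1 comp_cat. Qed.

Lemma T_comp u z : okw 0 u -> cabs z < 1 -> T d psi (size u) (comp 0 u z) = z.
Proof.
elim/last_ind: u z => [//|u i IH] z; rewrite -cats1 okw_cat /= add0n andbT => /andP[ok id] z1.
rewrite comp_cat size_cat addn1 /= add0n.
have V1z : V z by apply/V1/ltW.
have p1 : cabs (psi (size u) i z) < 1.
  by have [_ _ _ h _] := nac id; have := h z V1z; have := et0; lra.
(* The point selected by [Phi] uses the same branch, by disjointness of the images, and is then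
   equal to [z] by injectivity. *)
rewrite IH// /Phi; case: xgetP => [w _ [/= w1 [j jd jE]]|/(_ z)]; last first.
  by case; split=> //; exists i.
have Vw : V w by apply/V1/ltW.
have ji := sep jd id Vw V1z jE; subst j.
by have [_ _ h _ _] := nac id; exact: h jE.
Qed.

Lemma T_cderiv u z : okw 0 u -> cabs z < 1 ->
  cderiv (T d psi (size u)) (comp 0 u z) (derive1 (comp 0 u) z)^-1.
Proof.
move=> ok z1; have [l dl] := comp_cdiff ok (V1 (ltW z1)); have lE := cderiv_derive1 dl.
have l0 : l != 0.
  rewrite -lE -cabs_gt0 -dq_diag; apply: lt_le_trans (dq_comp_gt0 ok (ltW z1) (ltW z1)).
  by rewrite exprn_gt0// m2_gt0.
have /openCP/(_ (comp 0 u z))[|e e0 eP] := cyl_open ok; first by exists z.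
have inv y : cyl 0 u y -> comp 0 u (T d psi (size u) y) = y by move=> [w w1 <-]; rewrite T_comp.
rewrite lE; apply: (inv_cderiv e0 dl l0 (T_comp ok z1)); last by move=> y /eP; exact: inv.
apply/ccontP => k k0.
have cl : 0 < lam 0 u / cd by rewrite divr_gt0 ?lam_gt0 ?cdist_gt0.
have [x x0 [xe xk]] := pos_min2 e0 (mulr_gt0 cl k0).
exists x => // y yx; have [w w1 wE] := eP y (ltac:(lra)); rewrite -wE !T_comp//.
have /andP[h _] := comp_lip ok (ltW w1) (ltW z1).
by rewrite -(ltr_pM2l cl); apply: le_lt_trans h _; rewrite wE; lra.
Qed.

End Compositions.

(** * Perron families on the sphere *)

Section SphereFunctions.
Context {R : realType}.
Implicit Types (z w c zeta : C R) (r t M e : R) (v : C R -> R) (K A B : set (C R)).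

(* No measurability is required: the integral of a nonnegative function is a
   supremum over the simple functions below it. *)
Lemma le_integral_gen d (X : measurableType d) (mu : {measure set X -> \bar R}) (D : set X)
    (f g : X -> \bar R) : (forall x, D x -> f x <= g x)%E ->
  (\int[mu]_(x in D) f x <= \int[mu]_(x in D) g x)%E.
Proof.
move=> fg; rewrite /integral; have fg' x : ((f \_ D) x <= (g \_ D) x)%E.
  by rewrite /patch; case: ifPn => // /set_mem; exact: fg.
apply: leeB; apply: ereal_sup_le => _ [h hP <-]; exists h => // x.
  by apply: le_trans (hP x) _; rewrite !funeposE; rewrite ge_max !le_max fg' lexx orbT.
by apply: le_trans (hP x) _; rewrite !funenegE; rewrite ge_max !le_max leeN2 fg' lexx orbT.
Qed.

Definition eavg (u : R -> \bar R) : \bar R :=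
  (((2 * pi)^-1)%:E * \int[lebesgue_measure]_(t in `[0%R, (2 * pi)%R]) u t)%E.

Lemma eavgE (g : R -> R) : tc g -> eavg (fun t => (g t)%:E) = (avg g)%:E.
Proof.
move=> cg; rewrite /eavg /avg /ii /Rintegral EFinM fineK//.
by apply: integrable_fin_num => //; apply: contitv_int => t _; exact: cg.
Qed.

Lemma eavg_le (u k : R -> \bar R) : (forall t, 0 <= t <= 2 * pi -> (u t <= k t)%E) -> (eavg u <= eavg k)%E.
Proof.
move=> uk; rewrite /eavg; apply: lee_wpmul2l.
  by rewrite lee_fin invr_ge0 mulr_ge0// pi_ge0.
by apply: le_integral_gen => t; rewrite /= in_itv/=; exact: uk.
Qed.

Lemma eq_eavg (u k : R -> \bar R) : (forall t, 0 <= t <= 2 * pi -> u t = k t) -> eavg u = eavg k.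
Proof. by move=> uk; apply/eqP; rewrite eq_le !eavg_le// => t /uk ->. Qed.

Lemma nbhs_someP z (S : set (@sphere R)) : nbhs (Some z : sphere) S <->
  exists2 e : R, 0 < e & forall w, cabs (w - z) < e -> S (Some w).
Proof. by rewrite -(nbhsCP z (Some @^-1` S)). Qed.

Lemma nbhs_none M (S : set (@sphere R)) : S None -> (forall w, M < cabs w -> S (Some w)) ->
  nbhs (None : @sphere R) S.
Proof.
move=> S0 SM; exists (cball_ 0 M).
  by split; [exact: cball_compact|apply: compact_closed; [exact: norm_hausdorff|exact: cball_compact]].
move=> _ [[w /= wM <-]|->//]; apply: SM.
by rewrite ltNge; apply/negP => h; apply: wM; rewrite /cball_/= subr0.
Qed.

Definition ext0 v (p : @sphere R) : \bar R := if p is Some z then (v z)%:E else 0%E.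

(* Continuous subharmonic functions vanishing near infinity, bounded by [theta]
   at the boundary, are competitors in the Perron problem. *)
Lemma ext0_perron K (theta : C R -> R) v M : closed K -> 0 <= M ->
  (forall z, ~ K z -> {for z, continuous v} /\ csub v z) ->
  (forall z, M < cabs z -> v z = 0) ->
  (forall z e, frontier K z -> 0 < e -> exists2 d : R, 0 < d &
     forall w, ~ K w -> cabs (w - z) < d -> v w <= theta z + e) ->
  perron_family K theta (ext0 v).
Proof.
move=> cK M0 sv v0 bv; split.
  move=> [z|] Kz.
    have {}Kz : ~ K z by move=> h; apply: Kz; exists z.
    have [cv su] := sv _ Kz; split; first exact: ltry.
      move=> a; rewrite lte_fin -subr_gt0 => /= va; apply/nbhs_someP.
      have /vcontP/(_ _ va)[x x0 xP] := cv; exists x => // w /xP.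
      by rewrite lte_fin ltr_norml => /andP[_]; rewrite ltrD2r.
    have [e e0 eP] := csub_submean su; have [k k0 kP] := closed_off cK Kz.
    have [x x0 [xe xk]] := pos_min2 e0 k0; exists x => // r /andP[r0 rx].
    rewrite -/(eavg _) [X in (_ <= X)%E](_ : _ = eavg (fun t => (v (circ z r t))%:E))//.
    rewrite eavgE; first by rewrite lee_fin eP// r0/=; lra.
    apply: vcirc_cont => t; apply: (sv _ _).1; apply: kP.
    by rewrite circ_dist gtr0_norm//; lra.
  split; first exact: ltry.
    move=> a; rewrite lte_fin => a0; apply: (@nbhs_none M) => //= w wM.
    by rewrite v0// lte_fin.
  (* In the chart at infinity the circle of radius [r] is [|z| = 1 / r], beyond [M], where [v]
     vanishes. *)
  exists (M + 1)^-1; first by rewrite invr_gt0; lra.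
  move=> r /andP[r0 rM]; rewrite -/(eavg _).
  have E t : 0 <= t <= 2 * pi -> ext0 v (circle None r t) = 0%E.
    move=> _; rewrite /= v0//; rewrite cabsV cabsM cabs_expi mulr1 -/(rc r) cabs_rc gtr0_norm//.
    apply: (@lt_trans _ _ (M + 1)); first by rewrite ltrDl.
    by rewrite -[M + 1]invrK ltf_pV2// posrE ?invr_gt0//; lra.
  by rewrite (eq_eavg E) eavgE ?avg_cst//; exact: tc_cst.
move=> zeta fz; apply/lee_addgt0Pr => e e0; rewrite -EFinD limf_esupE.
have [x x0 xP] := bv _ _ fz e0.
apply: ge_ereal_inf.
exists (ereal_sup (ext0 v @` [set p | outer_domain K p /\ exists2 w, p = Some w & cabs (w - zeta) < x])).
  exists [set p | outer_domain K p /\ exists2 w, p = Some w & cabs (w - zeta) < x] => //.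
  by apply/nbhs_someP; exists x => // w wx Kw /=; split => //; exists w.
apply: ge_ereal_sup => _ [p [Kp [w pE wx] <-]]; move: Kp; rewrite pE => Kp; rewrite lee_fin; apply: xP => //.
by move=> Kw; apply: Kp; exists w.
Qed.

Lemma frontier_sub K : closed K -> frontier K `<=` K.
Proof. by move=> cK z [/cK]. Qed.

Lemma openC_measurable A : open A -> measurable (A : set (borelC R)).
Proof. by move=> oA; exact: sub_sigma_algebra. Qed.

Lemma closedC_measurable A : closed A -> measurable (A : set (borelC R)).
Proof.
move=> cA; rewrite -[A]setCK; apply: measurableC; apply: openC_measurable.
by rewrite openC.
Qed.

Section HM.
Variables (K : set (C R)) (omega : probability (borelC R) R).
Hypothesis cK : closed K.
Hypothesis hm : is_harmonic_measure K infty omega.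

Lemma frontier_measurable : measurable (frontier K : set (borelC R)).
Proof.
apply: (@measurableD _ (borelC R)); first by apply: closedC_measurable; exact: closed_closure.
by apply: openC_measurable; exact: open_interior.
Qed.

Definition om A : R := fine (omega A).

Lemma om_fin A : measurable (A : set (borelC R)) -> omega A = (om A)%:E.
Proof. by move=> mA; rewrite /om fineK// fin_num_measure. Qed.

Lemma om_ge0 A : 0 <= om A.
Proof. by rewrite /om fine_ge0. Qed.

Lemma omegaI_frontier A : measurable (A : set (borelC R)) -> omega (A `&` frontier K) = omega A.
Proof.
move=> mA; have mF := frontier_measurable.
have mI : measurable (A `&` frontier K : set (borelC R)) by exact: (@measurableI _ (borelC R)).
have mD : measurable (A `\` frontier K : set (borelC R)) by exact: (@measurableD _ (borelC R)).
rewrite -[in RHS](setUIDK A (frontier K)) measureU//; last first.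
  by rewrite setDE setIACA setICr setI0.
rewrite -[LHS]adde0; congr (_ + _)%E; apply/esym.
apply/eqP; rewrite eq_le measure_ge0 andbT -hm.1; apply: le_measure; rewrite ?inE//.
by apply: (@measurableC _ (borelC R)).
Qed.

(** [A] is relatively clopen in [K], so that its indicator is an admissible boundary function. *)
Definition loc_const A := forall z, K z -> exists2 e : R, 0 < e &
  forall w, K w -> cabs (w - z) < e -> (A w <-> A z).

Lemma perron_indic A B (e : R) : measurable (A : set (borelC R)) -> measurable (B : set (borelC R)) ->
  loc_const A -> loc_const B ->
  perron_solution K (fun z => \1_A z - e * \1_B z) infty = (om A - e * om B)%:E.
Proof.
move=> mA mB lA lB; have mF := frontier_measurable; rewrite hm.2; last first.
  apply/subspace_continuousP => z Fz; have Kz := frontier_sub cK Fz.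
  have [d1 d10 P1] := lA _ Kz; have [d2 d20 P2] := lB _ Kz.
  have [x x0 [x1 x2]] := pos_min2 d10 d20.
  move=> S /nbhs_singleton Sz; apply/nbhsCP; exists x => // w wx /(frontier_sub cK) Kw /=.
  have i1 : \1_A w = \1_A z :> R.
    by rewrite !indicE; congr (_%:R); congr nat_of_bool; apply/idP/idP => /set_mem h; apply/mem_set/(P1 w Kw) => //; lra.
  have i2 : \1_B w = \1_B z :> R.
    by rewrite !indicE; congr (_%:R); congr nat_of_bool; apply/idP/idP => /set_mem h; apply/mem_set/(P2 w Kw) => //; lra.
  by move: Sz; rewrite /from_subspace /= i1 i2.
have iA D : measurable (D : set (borelC R)) -> omega.-integrable (frontier K) (EFin \o (\1_D : borelC R -> R)).
  move=> mD; apply: (integrableS measurableT mF) => //.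
  exact: integrable_indic.
under eq_integral => z _ do rewrite EFinB EFinM.
rewrite integralB_EFin//; [|exact: iA|].
  rewrite [X in (_ - X)%E](_ : _ = (e%:E * \int[omega]_(z in frontier K) (\1_B z)%:E)%E); last first.
    by rewrite -integralZl//; exact: iA.
  rewrite !integral_indic//.
  have iE D : measurable (D : set (borelC R)) -> omega (D `&` frontier K) = (om D)%:E.
    by move=> mD; rewrite -om_fin//; exact: omegaI_frontier.
  by rewrite EFinB EFinM -!iE.
exact: (integrableZl mF e (iA _ mB)).
Qed.

(** The competitor vanishes at infinity, where the Perron solution for [1_A - e 1_B] is
    [om A - e * om B]; hence this number is nonnegative. *)
Lemma hm_compare A B v M (e : R) : measurable (A : set (borelC R)) -> measurable (B : set (borelC R)) ->
  loc_const A -> loc_const B -> 0 <= M ->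
  (forall z, ~ K z -> {for z, continuous v} /\ csub v z) ->
  (forall z, M < cabs z -> v z = 0) ->
  (forall z x, K z -> 0 < x -> exists2 d : R, 0 < d &
     forall w, ~ K w -> cabs (w - z) < d -> v w <= \1_A z - e * \1_B z + x) ->
  e * om B <= om A.
Proof.
move=> mA mB lA lB M0 sv v0 bv; rewrite -subr_ge0 -lee_fin -perron_indic//.
apply: ereal_sup_ubound; exists (ext0 v) => //; apply: (@ext0_perron _ _ _ M) => //.
by move=> z x /(frontier_sub cK); exact: bv.
Qed.
End HM.
End SphereFunctions.

(** * Transport of local solutions by the branches *)

Section Gluing.
Context {R : realType}.
Implicit Types (z w c : C R) (r x e : R) (b g : C R -> R) (f : C R -> C R).

Lemma csub_comp g f z e : 0 < e -> (forall w, cabs (w - z) < e -> cdiff f w) ->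
  csub g (f z) -> csub (fun w => g (f w)) z.
Proof.
move=> e0 df sg phi w0 d d0 pw dp; have [x x0 [xd xP]] := phi_circ d0 e0 dp; rewrite pw in xP.
apply: (sg (fun w => f (phi w)) w0 x x0); first by rewrite pw.
move=> w wx; apply: cdiff_comp; last by apply: dp; lra.
by apply: df; exact: xP.
Qed.

Lemma cont_near (u v : C R -> R) z e : 0 < e -> (forall w, cabs (w - z) < e -> u w = v w) ->
  {for z, continuous u} -> {for z, continuous v}.
Proof.
move=> e0 uv /vcontP cu; apply/vcontP => k k0; have [d d0 dP] := cu k k0.
have [x x0 [xe xd]] := pos_min2 e0 d0; exists x => // w wx.
by rewrite -!uv ?subrr ?cabs0//; [apply: dP; lra|lra].
Qed.

Lemma cont_max0 b z : {for z, continuous b} -> {for z, continuous (fun w => Num.max (b w) 0)}.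
Proof.
move=> /vcontP cb; apply/vcontP => k k0; have [d d0 dP] := cb k k0; exists d => // w /dP.
have [h1|h1] := leP (b w) 0; have [h2|h2] := leP (b z) 0; rewrite !ltr_norml => /andP[q1 q2]; apply/andP; split; lra.
Qed.

Lemma csub_max0 b z : cnear b z -> csub b z -> csub (fun w => Num.max (b w) 0) z.
Proof.
move=> cb sb; have cm : cnear (fun w => Num.max (b w) 0) z.
  by have [e e0 eP] := cb; exists e => // w /eP; exact: cont_max0.
have [h|h] := leP 0 (b z).
  apply: (@csub_minorant _ b) => //; first by apply/esym/max_idPl.
  by exists 1 => // w _; rewrite le_max lexx.
apply: (@csub_minorant _ (fun=> 0)) => //; [by apply/esym/max_idPr/ltW|by exists 1 => // w _; rewrite le_max lexx orbT| |exact: csub_cst].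
by exists 1 => // w _; exact: vcont_cst.
Qed.

Variables (rg Ri Ro : R) (K : set (C R)) (b : C R -> R).
Hypotheses (gi : rg < Ri) (io : Ri < Ro) (cK : closed K) (Kg : forall z, K z -> cabs z < rg).
Hypothesis cb : forall z, cabs z < Ro -> ~ K z -> {for z, continuous b} /\ csub b z.
Hypothesis bpos : forall z, cabs z = rg -> 0 < b z.
Hypothesis bneg : forall z, Ri <= cabs z < Ro -> b z <= 0.

(** The positive part of [b], extended by zero, except that [b] itself is kept for [|w| <= rg],
    where its negative boundary values are wanted. The change is smooth enough because [b > 0] on
    the circle of radius [rg] and [b <= 0] before [Ro]. *)
Definition glue w : R := if cabs w <= rg then b w else if cabs w < Ro then Num.max (b w) 0 else 0.

Lemma glue_out w : Ri <= cabs w -> glue w = 0.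
Proof.
move=> wr; rewrite /glue leNgt (lt_le_trans gi wr)/=; case: ifP => // wo.
by apply/max_idPr/bneg; rewrite wr.
Qed.

Lemma cb_near z : cabs z < Ro -> ~ K z -> cnear b z.
Proof.
move=> zo nK; have [e e0 eP] := closed_off cK nK.
have gi' := gi; have io' := io; have [x x0 [xe xo]] := pos_min2 e0 (ltac:(lra) : 0 < Ro - cabs z).
exists x => // w wx; apply: (cb _ _).1; last by apply: eP; lra.
by have := cabs_subl w z; lra.
Qed.

Lemma glue_sub z : ~ K z -> {for z, continuous glue} /\ csub glue z.
Proof.
move=> nK.
have gi' := gi; have io' := io.
suff [u [e e0 [eu [cu su]]]] : exists u, exists2 e : R, 0 < e &
    (forall w, cabs (w - z) < e -> u w = glue w) /\ ({for z, continuous u} /\ csub u z).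
  by split; [exact: cont_near e0 eu cu|exact: csub_near e0 eu su].
have [zr|zr|zr] := ltgtP (cabs z) rg.
- have zo : cabs z < Ro by lra.
  have [c1 c2] := cb zo nK; exists b, (rg - cabs z); first by rewrite subr_gt0.
  by split => // w wz; rewrite /glue ifT//; have := cabs_subl w z; lra.
- have [zo|zo] := ltP (cabs z) Ro.
    have [c1 c2] := cb zo nK; exists (fun w => Num.max (b w) 0).
    have [x x0 [x1 x2]] := pos_min2 (ltac:(lra) : 0 < cabs z - rg) (ltac:(lra) : 0 < Ro - cabs z).
    exists x => //; split; last by split; [exact: cont_max0|apply: csub_max0 => //; exact: cb_near].
    move=> w wx; have h1 := cabs_subl w z; have := cabs_subl z w; rewrite (cabsBC z w) => h2.
    by rewrite /glue leNgt ifF ?ifT//; [lra|apply/negbTE; rewrite negbK; lra].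
  exists (fun=> 0), (cabs z - Ri); first by rewrite subr_gt0; lra.
  split; last by split; [exact: vcont_cst|exact: csub_cst].
  by move=> w wz; rewrite glue_out//; have := cabs_subl z w; rewrite (cabsBC z w); lra.
- have zo : cabs z < Ro by lra.
  have [c1 c2] := cb zo nK; exists b.
  have bz := bpos zr; have /vcontP/(_ _ bz)[d d0 dP] := c1.
  have [x x0 [x1 x2]] := pos_min2 d0 (ltac:(lra) : 0 < Ro - rg).
  exists x => //; split => // w wx; rewrite /glue; case: ifP => // _.
  have := dP w (ltac:(lra)); rewrite ltr_norml => /andP[h _].
  rewrite ifT; first by apply/esym/max_idPl; lra.
  by have := cabs_subl w z; lra.
Qed.
End Gluing.

(** * Comparison of cylinder masses with local solutions *)

Section Comparison.
Context {R : realType}.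
Variables (d : nat -> nat) (psi : nat -> nat -> C R -> C R) (eta : R) (V : set (C R)).
Hypothesis sys : conformal_system d psi eta V.
Variable omega : probability (borelC R) R.
Hypothesis hm : is_harmonic_measure (lset d psi 0) infty omega.
Implicit Types (z w : C R) (u v : seq nat) (m n k : nat).

Let et0 : 0 < eta. Proof. by case: sys => /andP[]. Qed.
Let et1 : eta < 1. Proof. by case: sys => /andP[]. Qed.

Local Notation K0 := (lset d psi 0).
Local Notation comp := (comp psi).
Local Notation cyl := (cyl psi).
Local Notation okw := (okw d).
Local Notation lset := (lset d psi).
Local Notation cd := (cdist eta).
Local Notation lam := (lam psi).

Definition Pm u : R := om omega (cyl 0 u).

Lemma cyl_meas u : okw 0 u -> measurable (cyl 0 u : set (borelC R)).
Proof. by move=> ok; apply: openC_measurable; exact (cyl_open sys ok). Qed.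

Lemma cyl_loc_const u : okw 0 u -> loc_const K0 (cyl 0 u).
Proof.
move=> ok z Kz; have [cz|cz] := pselect (cyl 0 u z).
  have /openCP/(_ z cz)[e e0 eP] := cyl_open sys ok.
  by exists e => // w _ /eP.
exists (lam 0 u / cd * eta / 4).
  by rewrite !(mulr_gt0, invr_gt0) ?(lam_gt0 sys)// cdist_gt0.
move=> w Kw wz; split=> // cw; have := lset_sep sys ok Kw cw cz.
by rewrite cabsBC; lra.
Qed.

(** The function [g] of the disk carried to the cylinder of [u] by the branch, and extended by
    zero. *)
Definition transport u (g : C R -> R) z : R :=
  if `[< cyl 0 u z >] then g (T d psi (size u) z) else 0.

Lemma transport_comp u g w : okw 0 u -> cabs w < 1 -> transport u g (comp 0 u w) = g w.
Proof.
move=> ok w1; rewrite /transport; case: asboolP => [_|]; last by case; exists w.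
by rewrite (T_comp sys).
Qed.

Section Transport.
Variables (u : seq nat) (ok : okw 0 u) (g : C R -> R) (Ri : R).
Hypothesis Ri1 : Ri < 1.
Hypothesis Ri0 : 0 <= Ri.
Hypothesis gout : forall w, Ri <= cabs w -> g w = 0.
Hypothesis gsub : forall w, cabs w < 1 -> ~ lset (size u) w -> {for w, continuous g} /\ csub g w.

(** The support of [g] lies in a disk of radius [Ri < 1], whose image keeps a positive distance from
    the complement of the cylinder; so the extension by zero causes no jump. *)
Lemma transport_off z : ~ cyl 0 u z -> exists2 e : R, 0 < e &
  forall y, cabs (y - z) < e -> transport u g y = 0.
Proof.
have h1 := Ri1; move=> nc; exists (lam 0 u / cd * (1 - Ri) / 2).
  by rewrite !(mulr_gt0, invr_gt0) ?(lam_gt0 sys) ?cdist_gt0 ?subr_gt0.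
move=> y yz; rewrite /transport; case: asboolP => // -[w w1 wE].
rewrite -wE (T_comp sys)//; apply: gout; rewrite leNgt; apply/negP => wr.
have [x xw xE] : exists2 x, cabs (x - w) < 1 - Ri & comp 0 u x = z.
  apply: (image_ball sys ok); [lra|lra|].
  by rewrite wE cabsBC.
by apply: nc; exists x => //; rewrite /unit_disk/=; have := cabs_subl x w; lra.
Qed.

Lemma transport_sub z : ~ K0 z -> {for z, continuous (transport u g)} /\ csub (transport u g) z.
Proof.
move=> nK; have [cz|cz] := pselect (cyl 0 u z); last first.
  have [e e0 eP] := transport_off cz.
  split; [apply: (@cont_near _ (fun=> 0) _ _ e) => //; last exact: vcont_cst|apply: (@csub_near _ (fun=> 0) _ _ e) => //; last exact: csub_cst].
    by move=> w /eP.
  by move=> w /eP.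
have /openCP/(_ z cz)[e e0 eP] := cyl_open sys ok.
have E w : cabs (w - z) < e -> g (T d psi (size u) w) = transport u g w.
  by move=> /eP h; rewrite /transport; case: asboolP.
have dT w : cyl 0 u w -> cdiff (T d psi (size u)) w.
  by move=> [x x1 <-]; eexists; exact: (T_cderiv sys).
have [w w1 wE] := cz.
have Tz : T d psi (size u) z = w by rewrite -wE (T_comp sys).
have nw : ~ lset (size u) w.
  by move=> /(lset_cyl sys ok w1); rewrite wE.
have [cg sg] := gsub w1 nw; rewrite -Tz in cg sg; split.
  apply: (@cont_near _ (fun w => g (T d psi (size u) w)) _ _ e e0 E).
  by apply: (@vcont_comp _ (T d psi (size u)) g) => //; apply: cdiff_cont; exact: dT.
apply: (@csub_near _ (fun w => g (T d psi (size u) w)) _ _ e e0 E).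
by apply: (@csub_comp _ g _ _ e e0) => // y /eP; exact: dT.
Qed.

Lemma transport_bd z x y : K0 z -> cyl 0 u z -> 0 < y ->
  (forall w, lset (size u) w -> exists2 k : R, 0 < k & forall w', cabs w' < 1 -> ~ lset (size u) w' ->
     cabs (w' - w) < k -> comp 0 u w = z -> g w' <= x + y) ->
  exists2 e : R, 0 < e & forall z', ~ K0 z' -> cabs (z' - z) < e -> transport u g z' <= x + y.
Proof.
move=> Kz cz y0 H; have [w w1 wE] := cz.
have Lw : lset (size u) w by apply/(lset_cyl sys ok w1); rewrite wE.
have [k k0 kP] := H w Lw.
have /openCP/(_ z cz)[e e0 eP] := cyl_open sys ok.
have c0 : 0 < lam 0 u / cd by rewrite divr_gt0 ?(lam_gt0 sys)// cdist_gt0.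
have [p p0 [pe pk]] := pos_min2 e0 (mulr_gt0 c0 k0).
exists p => // z' nK z'p; have [w' w'1 w'E] := eP z' (ltac:(lra)).
rewrite -w'E transport_comp//; apply: kP => //.
  by move=> /(lset_cyl sys ok w'1); rewrite w'E.
have /andP[h _] := comp_lip sys ok (ltW w'1) (ltW w1).
by rewrite -(ltr_pM2l c0); apply: le_lt_trans h _; rewrite w'E wE; lra.
Qed.
End Transport.

(** The conclusion of [local_solution] for the limit set shifted by [n] levels and its part coded by
    [v]. The number [a] is, up to the factor [C0], the value of the local solution on the circle of
    radius [1 - eta / 2]. *)
Definition local_approx n v (C0 a : R) := forall delta : R, 0 < delta -> exists h U : C R -> R,
  [/\ forall z, annulus_domain eta (lset n) z -> [/\ {for z, continuous h}, csub h z,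
        {for z, continuous U}, csub (fun w => - U w) z & 0 <= U z],
      exists2 Ri : R, 1 - eta / 2 < Ri < 1 - eta / 4 & forall z, Ri <= cabs z < 1 - eta / 4 -> h z <= 0,
      forall z e, lset n z -> 0 < e -> exists2 d : R, 0 < d & forall w, annulus_domain eta (lset n) w ->
        cabs (w - z) < d -> h w <= \1_(cyl n v) z + e /\ \1_(cyl n v) z - e <= U w
    & forall z, cabs z = 1 - eta / 2 -> a / C0 - delta <= h z /\ U z <= C0 * a + delta].

Lemma local_approx_exists : exists2 C0 : R, 1 <= C0 & forall n v, okw n v ->
  exists2 a : R, 0 <= a & local_approx n v C0 a.
Proof.
have eta01 : 0 < eta < 1 by case: sys.
have [C0 C01 H] := @local_solution R eta eta01; exists C0 => // n v ok.
pose Y : set (C R) := lset n `&` cyl n v.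
have r0 : 0 < lam n v / cd * eta / 4.
  by rewrite !(mulr_gt0, invr_gt0) ?(lam_gt0 sys) ?cdist_gt0.
have [|||a a0 aP] := H (lset n) Y _ (lset_closed sys (m := n)) _ _ r0.
- by move=> z /(lset_lt sys)/ltW.
- by move=> z [].
- by move=> y z [Ly cy] Lz nY; apply: (lset_sep sys ok Ly cy) => cz; exact: nY.
exists a => // delta /aP[h [U [h1 h2 h3 h4]]]; exists h, U; split=> // z e Lz e0.
have [k k0 kP] := h3 z e Lz e0; exists k => // w Gw wk.
have -> : \1_(cyl n v) z = \1_Y z :> R.
  by rewrite !indicE; congr (_%:R); congr nat_of_bool; apply/idP/idP => /set_mem h'; apply/mem_set; [split|case: h'].
exact: kP.
Qed.

Lemma cyl_cat u v w : okw 0 u -> okw (size u) v -> lset (size u) w -> cyl 0 (u ++ v) (comp 0 u w) <-> cyl (size u) v w.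
Proof.
move=> ou ov Lw; have w1 := lset_lt sys Lw; have ee := et0.
split=> [[x x1]|[x x1 <-]]; last by exists x => //; rewrite comp_cat.
rewrite comp_cat add0n => xw; exists x => //; apply: (comp_inj sys ou _ _ xw).
  by apply: (V1 sys); apply: ltW; exact: (comp_lt1 sys).
by apply: (V1 sys); lra.
Qed.

(* The subsolution [h - e U] built from [local_approx] and the branch of [u]
   competes in the Perron problem for [1_(u ++ v) - e 1_(u ++ v')]. *)
Lemma mass_step u v v' (C0 a a' e : R) : okw 0 u -> okw (size u) v -> okw (size u) v' -> 1 <= C0 ->
  local_approx (size u) v C0 a -> local_approx (size u) v' C0 a' -> 0 <= e ->
  e * (C0 * a') < a / C0 -> e * Pm (u ++ v') <= Pm (u ++ v).
Proof.
move=> ou ov ov' C01 La La' e0 ea; have ee := et0; have ee1 := et1.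
set n := size u in ov ov' La La' *.
(* On the inner gluing circle [b = h - e U] is at least [s - (1 + e) dl = s / 2], which is the
   positivity needed by [glue]. *)
pose s := a / C0 - e * (C0 * a'); have s0 : 0 < s by rewrite subr_gt0.
pose dl := s / (2 * (1 + e)); have e10 : 0 < 1 + e by lra.
have dl0 : 0 < dl by rewrite divr_gt0// mulr_gt0.
have [h [h' [h1 [Ri /andP[Ri1 Ri2] hRi] h3 h4]]] := La dl dl0.
have [U' [U [u1 _ u3 u4]]] := La' dl dl0.
pose b z := h z + e * - U z.
pose Ro := 1 - eta / 4.
have cb z : cabs z < Ro -> ~ lset n z -> {for z, continuous b} /\ csub b z.
  move=> zo nK; have Gz : annulus_domain eta (lset n) z by [].
  have [c1 c2 _ _ _] := h1 z Gz; have [_ _ c3 c4 _] := u1 z Gz.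
  have oG : open (annulus_domain eta (lset n)).
    by apply: annulus_domain_open; [case: sys|exact: (lset_closed sys)].
  have /openCP/(_ _ Gz)[k k0 kP] := oG.
  split; first by apply: vcontD => //; apply: vcontM; [exact: vcont_cst|exact: vcontN].
  have cU : cnear (fun w => - U w) z.
    exists k => // w /kP Gw; have [_ _ c _ _] := u1 w Gw; exact: (vcontN c).
  apply: (@csubD _ h (fun w => e * - U w)) => //.
  - by exists k => // w /kP Gw; have [c _ _ _ _] := h1 w Gw.
  - by have [x x0 xP] := cU; exists x => // w /xP c; apply: vcontM => //; exact: vcont_cst.
  - exact: csubZ.
have ltg z : lset n z -> cabs z < 1 - eta / 2 by move=> /(lset_lt sys); lra.
have bpos z : cabs z = 1 - eta / 2 -> 0 < b z.
  move=> zr; have [q1 _] := h4 z zr; have [_ q2] := u4 z zr.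
  have q3 : e * U z <= e * (C0 * a' + dl) by rewrite ler_wpM2l.
  have q4 : dl * (1 + e) = s / 2 by rewrite /dl; field; lra.
  by move: q1 q3 q4 s0; rewrite /b /s mulrN mulrDr; lra.
have bneg z : Ri <= cabs z < Ro -> b z <= 0.
  move=> zr; have q1 := hRi z zr; move/andP: zr => [z1 z2].
  have Gz : annulus_domain eta (lset n) z by split=> // /ltg; lra.
  have [_ _ _ _ q2] := u1 z Gz.
  have : 0 <= e * U z by rewrite mulr_ge0.
  by rewrite /b mulrN; lra.
pose g := glue (1 - eta / 2) Ro b.
have Ri0 : 0 <= Ri by lra.
have Ri3 : Ri < 1 by lra.
have gout w : Ri <= cabs w -> g w = 0 by exact: (glue_out Ri1 bneg).
have gsub w : cabs w < 1 -> ~ lset n w -> {for w, continuous g} /\ csub g w.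
  by move=> _; exact: (glue_sub Ri1 Ri2 (lset_closed sys (m := n)) cb bpos bneg).
have oA : okw 0 (u ++ v) by rewrite okw_cat ou.
have oB : okw 0 (u ++ v') by rewrite okw_cat ou.
have tsub := transport_sub ou Ri3 gout gsub.
have out1 z : 1 < cabs z -> transport u g z = 0.
  move=> z1; rewrite /transport; case: asboolP => // -[w w1 wE].
  by have := comp_lt1 sys ou w1; rewrite wE; lra.
apply: (hm_compare (lset_closed sys (m := 0)) hm (cyl_meas oA) (cyl_meas oB) (cyl_loc_const oA) (cyl_loc_const oB) ler01 tsub out1).
move=> z x Kz x0; have [cz|cz] := pselect (cyl 0 u z); last first.
  have [k k0 kP] := transport_off ou Ri3 gout cz; exists k => // w _ /kP ->.
  rewrite !indicE !memNset ?mulr0 ?subr0 ?add0r ?ltW// => cz'; apply: cz; exact: (cyl_pre sys _ cz').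
apply: (transport_bd ou) => // w Lw.
(* The errors of [h] and of [e U] at the boundary then add up to [x]. *)
have x1 : 0 < x / (1 + e) by rewrite divr_gt0.
have [k1 k10 kP1] := h3 w _ Lw x1; have [k2 k20 kP2] := u3 w _ Lw x1.
have wg := ltg w Lw.
have [p p0 [p1 p2]] := pos_min2 k10 k20; have [q q0 [qp qg]] := pos_min2 p0 (ltac:(lra) : 0 < 1 - eta / 2 - cabs w).
exists q => // w' _ nL wq wz.
have w'g : cabs w' < 1 - eta / 2 by have := cabs_subl w' w; lra.
have Gw' : annulus_domain eta (lset n) w' by split=> //; lra.
have [q1 _] := kP1 w' Gw' (ltac:(lra)); have [_ q2] := kP2 w' Gw' (ltac:(lra)).
have -> : g w' = b w' by rewrite /g /glue ifT// ltW.
have iE x' : okw n x' -> \1_(cyl 0 (u ++ x')) z = \1_(cyl n x') w :> R.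
  move=> ox; rewrite !indicE -wz; congr (_%:R); congr nat_of_bool.
  by apply/idP/idP => /set_mem hx; apply/mem_set/(cyl_cat ou ox Lw).
rewrite !iE//; have q3 : e * (\1_(cyl n v') w - x / (1 + e)) <= e * U w' by rewrite ler_wpM2l.
have q4 : x / (1 + e) + e * (x / (1 + e)) = x by field; lra.
by move: q1 q3 q4; rewrite /b mulrN mulrBr; lra.
Qed.

(** [mass_step] holds for every [e] with [C0^2 a' e < a]. If the inequality failed, an [e] slightly
    larger than [P / P'] would be admissible and give [P' e <= P]. The form without division also
    covers [a' = 0]. *)
Lemma mass_compare u v v' (C0 a a' : R) : okw 0 u -> okw (size u) v -> okw (size u) v' -> 1 <= C0 ->
  0 <= a -> 0 <= a' -> local_approx (size u) v C0 a -> local_approx (size u) v' C0 a' ->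
  a * Pm (u ++ v') <= C0 ^+ 2 * a' * Pm (u ++ v).
Proof.
move=> ou ov ov' C01 a0 a'0 La La'; rewrite leNgt; apply/negP => lt.
set P := Pm (u ++ v) in lt *; set P' := Pm (u ++ v') in lt *.
have P0 : 0 <= P by exact: om_ge0.
have P'0 : 0 <= P' by exact: om_ge0.
set q := C0 ^+ 2 * a' in lt; have q0 : 0 <= q by rewrite mulr_ge0// sqr_ge0.
have Pp : 0 < P'.
  rewrite lt_neqAle P'0 andbT; apply/eqP => h; move: lt; rewrite -h mulr0.
  by rewrite ltNge mulr_ge0.
pose s := a * P' - q * P; have s0 : 0 < s by rewrite subr_gt0.
pose t := s / (2 * (q + 1)); have t0 : 0 < t by rewrite divr_gt0// mulr_gt0//; lra.
pose e := (P + t) / P'.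
have e0 : 0 <= e by rewrite divr_ge0//; lra.
have eP : e * P' = P + t by rewrite /e divfK// gt_eqF.
have tq : q * t < s.
  rewrite /t mulrA ltr_pdivrMr; last by rewrite mulr_gt0//; lra.
  by rewrite mulrC ltr_pM2l//; lra.
have qe : q * e < a.
  by rewrite -(ltr_pM2r Pp) -mulrA eP mulrDr; move: tq; rewrite /s; lra.
have C00 : 0 < C0 by lra.
have : e * P' <= P.
  apply: (mass_step ou ov ov' C01 La La' e0); rewrite ltr_pdivlMr//.
  by move: qe; rewrite /q (_ : C0 ^+ 2 * a' * e = e * (C0 * a') * C0)//; ring.
by rewrite eP; lra.
Qed.

End Comparison.

(** * Polar limit sets *)

Section Usc.
Context {R : realType} {X : topologicalType}.
Implicit Types (W : X -> \bar R) (k : X -> R) (A : set X) (x : X).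

Definition uscat W x := (W x < +oo)%E /\
  forall a : R, (W x < a%:E)%E -> \forall y \near x, (W y < a%:E)%E.

(** Were there no maximum, the open conditions [W x < W q] would cover [A]; compactness is applied
    along the filter generated by the upper sections of [W], and yields some [q] with
    [W q < W q]. *)
Lemma usc_max W A : compact A -> A !=set0 -> (forall x, A x -> uscat W x) ->
  exists2 p, A p & forall x, A x -> (W x <= W p)%E.
Proof.
move=> cA [x0 Ax0] uW; apply: contrapT => nmax.
have nm p : A p -> exists2 q, A q & (W p < W q)%E.
  move=> Ap; apply: contrapT => h; apply: nmax; exists p => // x Ax.
  by rewrite leNgt; apply/negP => lt; apply: h; exists x.
pose F : set_system X := fun S => exists2 q0, A q0 & forall q, A q -> (W q0 <= W q)%E -> S q.
have FF : Filter F.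
  split; [by exists x0| |by move=> S S' SS' [q Aq qS]; exists q => // y Ay /(qS y Ay)/SS'].
  move=> S S' [q Aq qS] [q' Aq' qS']; have [le|le] := leP (W q) (W q').
    by exists q' => // y Ay h; split; [apply: qS => //; exact: le_trans h|exact: qS'].
  by exists q => // y Ay h; split; [exact: qS|apply: qS' => //; exact: le_trans (ltW le) h].
have [|q0 Aq0 /(_ q0 Aq0 (lexx _))] := (compact_near_coveringP A).1 cA X F (fun q x => (W x < W q)%E) FF.
  move=> x Ax; have [q Aq xq] := nm x Ax; have [wq _] := uW q Aq.
  have qE : W q = (fine (W q))%:E.
    have qlo : (-oo < W q)%E by apply: le_lt_trans xq; exact: leNye.
    by case: (W q) wq qlo.
  have [_ /(_ (fine (W q)))] := uW x Ax; rewrite -qE => /(_ xq) nx.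
  exists ([set y | (W y < W q)%E], [set q' | (W q <= W q')%E /\ A q']) => /=.
    by split => //; exists q.
  by move=> [y q'] /= [h1 [h2 _]]; exact: lt_le_trans h1 h2.
by move=> /(_ q0 Aq0); rewrite ltxx.
Qed.

Lemma usc_add W k x : uscat W x ->
  (forall e : R, 0 < e -> \forall y \near x, k y < k x + e) ->
  uscat (fun y => W y + (k y)%:E)%E x.
Proof.
move=> [Wy uW] ck; split; first by case: (W x) Wy => [r _| |_] //; rewrite -EFinD ltry.
move=> a lt; have [b xb ba] : exists2 b : R, (W x < b%:E)%E & b + k x < a.
  case: (W x) Wy lt => //= [r _|_ _].
    rewrite lte_fin => lt; exists ((r + (a - k x)) / 2); rewrite ?lte_fin; lra.
  by exists (a - k x - 1); [exact: ltNyr|lra].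
have e0 : 0 < a - (b + k x) by lra.
apply: filterS2 (uW b xb) (ck _ e0) => y h1 h2.
have h3 : (W y + (k y)%:E < b%:E + (k y)%:E)%E by rewrite lteD2rE.
by apply: (lt_trans h3); rewrite -EFinD lte_fin; lra.
Qed.
End Usc.

Section StrictMax.
Context {R : realType}.
Implicit Types (z w k : C R) (v : @sphere R -> \bar R).

Lemma avg_gt0 (g : R -> R) : tc g -> (forall t, 0 < g t) -> 0 < avg g.
Proof.
move=> cg g0; have pi0 : 0 <= 2 * pi :> R by rewrite mulr_ge0// pi_ge0.
have [c _ cP] : exists2 c, c \in `[0, 2 * pi] & forall t, t \in `[0, 2 * pi] -> g c <= g t.
  by apply: EVT_min => //; apply: continuous_subspaceT => t; exact: cg.
apply: lt_le_trans (g0 c) _; rewrite -(avg_cst (g c)); apply: avg_le => //; first exact: tc_cst.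

Qed.

(** At a local maximum of [v + k], nearby values of [v] are at most [v z + k z - k]. Averaging this
    over a small circle and using the strict inequality for [k] contradicts the submean inequality
    of [v]. *)
Lemma strict_max K v z (k : C R -> R) : subharmonic (outer_domain K) v -> ~ K z -> cnear k z ->
  (exists2 e : R, 0 < e & forall r, 0 < r < e -> k z < avg (fun t => k (circ z r t))) ->
  (-oo < v (Some z))%E ->
  (exists2 e : R, 0 < e & forall w, cabs (w - z) < e ->
    (v (Some w) + (k w)%:E <= v (Some z) + (k z)%:E)%E) -> False.
Proof.
move=> sv nK [e1 e10 ck] [e2 e20 sk] vz [e3 e30 mx].
have Kz : outer_domain K (Some z : sphere) by move=> [y Ky [yz]]; apply: nK; rewrite -yz.
have [vy _ [e4 e40 sub]] := sv _ Kz.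
have [x x0 [x1 x2]] := pos_min2 e10 e20; have [y y0 [y1 y2]] := pos_min2 e30 e40.
have [m m0 [mx' my]] := pos_min2 x0 y0; pose r := m / 2.
have r0 : 0 < r by rewrite divr_gt0. have rm : r < m by rewrite /r; lra.
have ci t : cabs (circ z r t - z) < m by rewrite circ_dist gtr0_norm.
have ct : tc (fun t => k (circ z r t)).
  by apply: vcirc_cont => t; apply: ck; have := ci t; lra.
have vE : v (Some z) = (fine (v (Some z)))%:E by case: (v _) vy vz.
have /(_ r) := sub; rewrite r0/= => /(_ (ltac:(lra))); apply/negP; rewrite -ltNge -/(eavg _).
set f := fine _ in vE.
apply: (@le_lt_trans _ _ (eavg (fun t => (f + k z - k (circ z r t))%:E))).
  apply: eavg_le => t _; rewrite -/(rc r) -/(circ z r t) EFinB leeBrDr//.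
  by rewrite EFinD -vE; apply: mx; have := ci t; lra.
rewrite eavgE; last by apply: tcB => //; exact: tc_cst.
rewrite avgB//; last exact: tc_cst.
by rewrite avg_cst vE lte_fin; have := sk r; rewrite r0/= => /(_ (ltac:(lra))); lra.
Qed.

Lemma strict_max_infty K v (k : @sphere R -> R) : subharmonic (outer_domain K) v ->
  k None = 0 ->
  (exists2 e : R, 0 < e & forall r, 0 < r < e -> tc (fun t => k (circle None r t)) /\ forall t, 0 < k (circle None r t)) ->
  (-oo < v None)%E ->
  (exists M : R, forall w, M < cabs w -> (v (Some w) + (k (Some w))%:E <= v None)%E) -> False.
Proof.
move=> sv kN [e1 e10 ck] vz [M mx].
have Kz : outer_domain K (None : sphere) by move=> [].
have [vy _ [e4 e40 sub]] := sv _ Kz.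
have M0 : 0 < `|M| + 1 by have := normr_ge0 M; lra.
have iM : 0 < (`|M| + 1)^-1 by rewrite invr_gt0.
have [x x0 [x1 x2]] := pos_min2 e10 e40.
have [m m0 [mx' my]] := pos_min2 x0 iM; pose r := m / 2.
have r0 : 0 < r by rewrite divr_gt0. have rm : r < m by rewrite /r; lra.
have [ct kp] := ck r (ltac:(by rewrite r0/=; lra)).
have vE : v None = (fine (v None))%:E by case: (v _) vy vz.
have /(_ r) := sub; rewrite r0/= => /(_ (ltac:(lra))); apply/negP; rewrite -ltNge -/(eavg _).
set f := fine _ in vE.
apply: (@le_lt_trans _ _ (eavg (fun t => (f - k (circle None r t))%:E))).
  apply: eavg_le => t _; rewrite EFinB leeBrDr// -vE; apply: mx.
  rewrite cabsV cabsM cabs_expi mulr1 -/(rc r) cabs_rc gtr0_norm//.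
  apply: (@lt_le_trans _ _ (`|M| + 1)); first by have := ler_norm M; lra.
  by rewrite -[`|M| + 1]invrK lef_pV2 ?posrE//; lra.
rewrite eavgE; last by apply: tcB => //; exact: tc_cst.
rewrite avgB//; last exact: tc_cst.
by rewrite avg_cst vE lte_fin; have := avg_gt0 ct kp; lra.
Qed.

(** The square of the modulus of [1 / (z - k0)]: strictly subharmonic off [k0], zero at infinity and
    positive around it. Added with a small factor, it rules out maxima at all points of the domain,
    infinity included, with no appeal to connectedness. *)
Definition rho (k0 : C R) (p : @sphere R) : R := if p is Some z then (cabs (z - k0) ^+ 2)^-1 else 0.

Lemma rho_cont k0 z : z != k0 -> {for z, continuous (fun w => rho k0 (Some w))}.
Proof.
move=> zk; apply: (@contV R (C R) (fun w => cabs (w - k0) ^+ 2)).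
  by rewrite expf_neq0// cabs_eq0 subr_eq0.
have c : {for z, continuous (fun w => cabs (w - k0))}.
  apply: (@vcont_comp _ (fun w => w - k0) (@cabs R)); last exact: cabs_cont.
  by apply: cdiff_cont; exists (1 - 0); apply: cderivB; [exact: cderiv_id|exact: cderiv_cst].
exact: vcontM.
Qed.

(** With [h w = 1 / (w - k0)], the function [|h w|^2] is a harmonic function plus [|h w - h z|^2],
    which is positive on small circles about [z]. *)
Lemma rho_strict k0 z : z != k0 -> exists2 e : R, 0 < e & forall r, 0 < r < e ->
  rho k0 (Some z) < avg (fun t => rho k0 (Some (circ z r t))).
Proof.
move=> zk; have zk0 : 0 < cabs (z - k0) by rewrite cabs_gt0 subr_eq0.
pose h w : C R := (w - k0)^-1.
have dh w : w != k0 -> cdiff h w.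
  move=> wk; have d1 : cderiv (fun w => w - k0) w (1 - 0) by apply: cderivB; [exact: cderiv_id|exact: cderiv_cst].
  by eexists; apply: cderivV d1; rewrite subr_eq0.
have nk w : cabs (w - z) < cabs (z - k0) -> w != k0.
  by apply: contraTneq => ->; rewrite cabsBC ltxx.
have [e e0 eP] := @affine_mean R h z _ (- cabs (h z) ^+ 2) zk0 (fun w wz => dh w (nk w wz)).
have [x x0 [xe xz]] := pos_min2 e0 zk0; exists x => // r /andP[r0 rx].
have [ct ae] := eP r (ltac:(rewrite r0/=; lra)) (rc 2 * cj (h z)).
have ci t : circ z r t != k0 by apply: nk; rewrite circ_dist gtr0_norm//; lra.
have E w : rho k0 (Some w) = (- cabs (h z) ^+ 2 + re (h w * (rc 2 * cj (h z)))) + cabs (h w - h z) ^+ 2.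
  rewrite /rho -exprVn -cabsV -/(h w) !cabs_sqr !cE /=; ring.
have cd : tc (fun t => cabs (h (circ z r t) - h z) ^+ 2).
  apply: (@vcirc_cont _ (fun w => cabs (h w - h z) ^+ 2)) => t.
  have c : {for circ z r t, continuous (fun w => cabs (h w - h z))}.
    apply: (@vcont_comp _ (fun w => h w - h z) (@cabs R)); last exact: cabs_cont.
    by apply: ccontB; [exact: cdiff_cont (dh _ (ci t))|exact: ccont_cst].
  exact: vcontM.
under eq_avg => t _ do rewrite E.
rewrite avgD//; last by apply: tcD => //; exact: tc_cst.
rewrite ae E subrr cabs0 expr0n /= addr0 ltrDl; apply: avg_gt0 => // t.
rewrite exprn_gt0// cabs_gt0 subr_eq0; apply/eqP => /invr_inj/addIr cz.
by have := circ_dist z r t; rewrite cz subrr cabs0 gtr0_norm//; lra.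
Qed.

Lemma rho_infty k0 : cabs k0 < 1 -> exists2 e : R, 0 < e & forall r, 0 < r < e ->
  tc (fun t => rho k0 (circle None r t)) /\ forall t, 0 < rho k0 (circle None r t).
Proof.
move=> k1; exists 1 => // r /andP[r0 r1].
have n0 t : rc r * expi t != 0.
  by rewrite mulf_neq0// ?expi_neq0// -cabs_gt0 cabs_rc gtr0_norm.
have ck t : (rc r * expi t)^-1 != k0.
  apply/eqP => h; move: k1; rewrite -h cabsV cabsM cabs_expi mulr1 cabs_rc gtr0_norm//.
  by rewrite invf_lt1// ltNge ltW.
split=> t; last by rewrite /= invr_gt0 exprn_gt0// cabs_gt0 subr_eq0.
apply: (@rcont_comp _ (fun t => (rc r * expi t)^-1) (fun w => rho k0 (Some w))); last exact: rho_cont.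
exact (@contV (C R) R (zt r) t (n0 t) (@zt_cont _ r t)).
Qed.

End StrictMax.

Lemma geo_small {R : realType} (k C e : R) : 0 < k < 1 -> 0 < e ->
  exists N, forall n, (N <= n)%N -> C * k ^+ n < e.
Proof.
move=> /andP[k0 k1] e0; have c0 : 0 < `|C| + 1 by rewrite ltr_wpDl.
have kn : `|k| < 1 by rewrite gtr0_norm.
have [N _ NP] := @cvgr0_norm_lt _ R^o _ _ _ (fun n => k ^+ n) (cvg_expr kn) _ (divr_gt0 e0 c0).
exists N => n /NP /=; rewrite ltr_pdivlMr// => h; apply: le_lt_trans h.
rewrite ger0_norm ?exprn_ge0 ?(ltW k0)// mulrC ler_wpM2l ?exprn_ge0 ?(ltW k0)//.
by have := ler_norm C; lra.
Qed.

Section Polar.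
Context {R : realType}.
Variables (d : nat -> nat) (psi : nat -> nat -> C R -> C R) (eta : R) (V : set (C R)).
Hypothesis sys : conformal_system d psi eta V.
Variable omega : probability (borelC R) R.
Hypothesis hm : is_harmonic_measure (lset d psi 0) infty omega.
Implicit Types (z w y : C R) (u v x : seq nat) (m n k : nat).

Let et0 : 0 < eta. Proof. by case: sys => /andP[]. Qed.
Let et1 : eta < 1. Proof. by case: sys => /andP[]. Qed.

Local Notation K0 := (lset d psi 0).
Local Notation comp := (comp psi).
Local Notation cyl := (cyl psi).
Local Notation okw := (okw d).
Local Notation lset := (lset d psi).
Local Notation cd := (cdist eta).
Local Notation lam := (lam psi).
Local Notation Pm := (Pm psi omega).
Local Notation words := (words d).

Lemma transport_local u g w : okw 0 u -> cabs w < 1 -> cnear g w -> csub g w ->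
  cnear (transport d psi u g) (comp 0 u w) /\ csub (transport d psi u g) (comp 0 u w).
Proof.
move=> ok w1 [e e0 cg] sg.
have cz : cyl 0 u (comp 0 u w) by exists w.
have /openCP/(_ _ cz)[k k0 kP] := cyl_open sys ok.
have E y : cyl 0 u y -> g (T d psi (size u) y) = transport d psi u g y.
  by move=> cy; rewrite /transport; case: asboolP.
have dT y : cyl 0 u y -> cdiff (T d psi (size u)) y.
  by move=> [x x1 <-]; eexists; exact: (T_cderiv sys).
have Tw : T d psi (size u) (comp 0 u w) = w by rewrite (T_comp sys).
split.
  have cT : {for comp 0 u w, continuous (T d psi (size u))} by exact/cdiff_cont/dT.
  have /ccontP/(_ _ e0)[r r0 rP] := cT.
  have [x x0 [xk xr]] := pos_min2 k0 r0; exists (x / 2); first by rewrite divr_gt0.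
  move=> y yx; have cy : cyl 0 u y by apply: kP; lra.
  have /openCP/(_ _ cy)[k' k'0 kP'] := cyl_open sys ok.
  apply: (@cont_near _ (fun y => g (T d psi (size u) y)) _ _ k') => //.
    by move=> y' /kP'; exact: E.
  apply: (@vcont_comp _ (T d psi (size u)) g); first exact/cdiff_cont/dT.
  by apply: cg; rewrite -Tw; apply: rP; lra.
apply: (@csub_near _ (fun y => g (T d psi (size u) y)) _ _ k k0); first by move=> y /kP/E.
apply: (@csub_comp _ g _ _ k k0); last by rewrite Tw.
by move=> y /kP; exact: dT.
Qed.

Lemma cyl_small (e : R) : 0 < e -> exists N, forall u y z, okw 0 u -> (N <= size u)%N ->
  cyl 0 u y -> cyl 0 u z -> cabs (y - z) < e.
Proof.
move=> e0; have k01 : 0 < kap eta < 1 by apply: kap01; case: sys.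
have [N NP] := geo_small (2 * cd * (cd * contr_const eta)) k01 e0.
exists N => u y z ok Nu cy cz; apply: le_lt_trans (NP _ Nu).
apply: (le_trans (cyl_diam sys ok cy cz)); rewrite -[leRHS]mulrA.
by apply: ler_wpM2l; [rewrite mulr_ge0// ltW// cdist_gt0|exact: (lam_le sys)].
Qed.

(** Near each limit point there is a small copy of the point [1 - eta / 2], which lies in no shifted
    limit set; so the interior is empty. *)
Lemma lset_frontier : frontier K0 = K0.
Proof.
apply/seteqP; split; first exact: frontier_sub (lset_closed sys (m := 0)).
move=> z Kz; split; first exact: subset_closure.
move=> /nbhsCP[e e0 eP]; have ee := et0; have ee1 := et1.
have [N NP] := cyl_small e0; have [u] := Kz N; rewrite wordsP => /andP[/eqP su ok] cz.
have w1 : cabs (rc (1 - eta / 2)) < 1 by rewrite cabs_rc gtr0_norm; lra.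
have : K0 (comp 0 u (rc (1 - eta / 2))).
  by apply: eP; apply: (NP u) => //; [rewrite su|exists (rc (1 - eta / 2))].
move=> /(lset_cyl sys ok w1)/(lset_lt sys).
by rewrite cabs_rc gtr0_norm; lra.
Qed.

Lemma omega_lset : omega K0 = 1%E.
Proof.
have mK : measurable (K0 : set (borelC R)) by apply: closedC_measurable; exact (lset_closed sys (m := 0)).
have := hm.1; rewrite lset_frontier => h.
have := probability_setC omega mK; rewrite h => /esym/eqP.
by rewrite sube_eq ?add0e ?fin_num_measure// => /eqP.
Qed.

(** The total mass one of the harmonic measure provides a point, which is then pulled back along its
    coding. *)
Lemma lset_neq0 n : lset n !=set0.
Proof.
have [z Kz] : K0 !=set0.
  by apply/set0P/negP => /eqP h; have := omega_lset; rewrite h measure0 => /esym/eqP; rewrite onee_eq0.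
have [u] := Kz n; rewrite wordsP => /andP[/eqP <- ok] [w w1 wE].
by exists w; apply/(lset_cyl sys ok w1); rewrite wE.
Qed.

Lemma om_seq (I : eqType) (s : seq I) (F : I -> set (C R)) :
  (forall i, i \in s -> measurable (F i : set (borelC R))) -> uniq s ->
  (forall i j z, i \in s -> j \in s -> F i z -> F j z -> i = j) ->
  measurable ([set z | exists2 i, i \in s & F i z] : set (borelC R)) /\
  om omega [set z | exists2 i, i \in s & F i z] = \sum_(i <- s) om omega (F i).
Proof.
elim: s => [|i s IH] mF /=.
  move=> _ _; rewrite big_nil (_ : [set z | _] = set0); last by apply/seteqP; split=> // z [].
  by rewrite /om measure0.
move=> /andP[ns us] dj; rewrite big_cons.
have [|//||m1 <-] := IH.
- by move=> j js; apply: mF; rewrite inE js orbT.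
- by move=> j k z js ks; apply: dj; rewrite inE ?js ?ks orbT.
have mi : measurable (F i : set (borelC R)) by apply: mF; rewrite mem_head.
have E : [set z | exists2 j, j \in i :: s & F j z] = F i `|` [set z | exists2 j, j \in s & F j z].
  apply/seteqP; split=> z.
    by move=> [j]; rewrite inE => /predU1P[->|js] Fz; [left|right; exists j].
  by move=> [Fz|[j js Fz]]; [exists i; rewrite ?mem_head|exists j => //; rewrite inE js orbT].
rewrite E; split; first exact: (@measurableU _ (borelC R)).
rewrite /om measureU//; first by rewrite fineD ?fin_num_measure.
apply/seteqP; split=> // z [Fi [j js Fj]]; have ij := dj i j z (mem_head _ _) (ltac:(by rewrite inE js orbT)) Fi Fj.
by rewrite ij js in ns.
Qed.

Lemma Pm_sum u k : okw 0 u -> Pm u = \sum_(v <- words (size u) k) Pm (u ++ v).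
Proof.
move=> ok.
have okv v : v \in words (size u) k -> okw 0 (u ++ v) by rewrite wordsP okw_cat ok => /andP[].
have dj v v' z : v \in words (size u) k -> v' \in words (size u) k ->
    cyl 0 (u ++ v) z -> cyl 0 (u ++ v') z -> v = v'.
  move=> vw vw' c c'; have ss : size (u ++ v) = size (u ++ v').
    by move: vw vw'; rewrite !size_cat !wordsP => /andP[/eqP -> _] /andP[/eqP -> _].
  have /eqP := cyl_uniq sys ss (okv v vw) (okv v' vw') c c'.
  by rewrite eqseq_cat// => /andP[_ /eqP].
have [m1 <-] := om_seq (F := fun v => cyl 0 (u ++ v)) (fun v vw => cyl_meas sys (okv v vw)) (words_uniq d (size u) k) dj.
rewrite /Pm /om -(omegaI_frontier hm (cyl_meas sys ok)) -(omegaI_frontier hm m1) lset_frontier.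
congr (fine (omega _)); apply/seteqP; split=> z [cz Kz]; split=> //.
  have [w] := Kz (size u + k)%N; rewrite wordsP => /andP[/eqP sw ow] cw.
  rewrite -(cat_take_drop (size u) w) in ow cw.
  have st : size (take (size u) w) = size u by rewrite size_takel// sw leq_addr.
  have tu : take (size u) w = u.
    by apply: (cyl_uniq sys st _ ok _ cz); [move: ow; rewrite okw_cat => /andP[]|exact: (cyl_pre sys ow)].
  rewrite tu in ow cw; exists (drop (size u) w) => //.
  by rewrite wordsP size_drop sw addKn eqxx; move: ow; rewrite okw_cat => /andP[].
by case: cz => v vw; exact: (cyl_pre sys (okv v vw)).
Qed.

Lemma Pm_nil : Pm [::] = 1.
Proof.
have oK := omega_lset; rewrite /Pm /om -(omegaI_frontier hm (cyl_meas sys (u := [::]) isT)).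
rewrite lset_frontier (_ : cyl 0 [::] `&` K0 = K0) ?oK//.
apply/seteqP; split=> [z []//|z Kz]; split=> //; exists z => //.
by have := lset_lt sys Kz; have := et0; rewrite /unit_disk/=; lra.
Qed.

Lemma Pm_total n : \sum_(u <- words 0 n) Pm u = 1.
Proof. by rewrite -Pm_nil (@Pm_sum [::] n isT). Qed.

End Polar.

(** * Perron competitors when the local solution vanishes *)

Section PolarExclusion.
Context {R : realType}.
Variables (d : nat -> nat) (psi : nat -> nat -> C R -> C R) (eta : R) (V : set (C R)).
Hypothesis sys : conformal_system d psi eta V.
Variable omega : probability (borelC R) R.
Hypothesis hm : is_harmonic_measure (lset d psi 0) infty omega.
Implicit Types (z w y : C R) (u x : seq nat) (m k : nat).

Let et0 : 0 < eta. Proof. by case: sys => /andP[]. Qed.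
Let et1 : eta < 1. Proof. by case: sys => /andP[]. Qed.

Local Notation K0 := (lset d psi 0).
Local Notation comp := (comp psi).
Local Notation cyl := (cyl psi).
Local Notation okw := (okw d).
Local Notation lset := (lset d psi).
Local Notation cd := (cdist eta).
Local Notation lam := (lam psi).
Local Notation Pm := (Pm psi omega).
Local Notation words := (words d).

Variables (n : nat) (C0 : R) (u' : seq nat) (k0 : C R) (v : @sphere R -> \bar R).
Hypothesis La : local_approx d psi eta n [::] C0 0.
Hypothesis uw' : u' \in words 0 n.
Hypothesis Kk0 : K0 k0.
Hypothesis ck0 : cyl 0 u' k0.
Hypothesis sv : subharmonic (outer_domain K0) v.
Hypothesis v2 : forall z, K0 z -> exists2 e : R, 0 < e &
  forall w, ~ K0 w -> cabs (w - z) < e -> (v (Some w) <= 2%:E)%E.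
Hypothesis v0 : forall z e, K0 z -> cyl 0 u' z -> 0 < e -> exists2 r : R, 0 < r &
  forall w, ~ K0 w -> cabs (w - z) < r -> (v (Some w) <= e%:E)%E.

Let ou' : okw 0 u'. Proof. by move: uw'; rewrite wordsP => /andP[]. Qed.

Lemma outer_some z : ~ K0 z -> outer_domain K0 (Some z : sphere).
Proof. by move=> nK [y Ky [yz]]; apply: nK; rewrite -yz. Qed.

Lemma neq_k0 z : ~ K0 z -> z != k0.
Proof. by apply: contra_notN => /eqP ->. Qed.

Section Perturbed.
Variables (sg : R) (sg0 : 0 < sg).

(** The competitor made strictly subharmonic. The pole [k0] lies in the cylinder of [u'], where the
    competitor is under control near the limit set. *)
Let W p := (v p + (sg * rho k0 p)%:E)%E.

Lemma csg_cont z : ~ K0 z -> {for z, continuous (fun w => sg * rho k0 (Some w))}.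
Proof. by move=> nK; apply: vcontM; [exact: vcont_cst|exact/rho_cont/neq_k0]. Qed.

Lemma W_usc_some z : ~ K0 z -> uscat W (Some z).
Proof.
move=> nK; apply: usc_add; first by have [h1 h2 _] := sv (outer_some nK).
move=> e e0; have /vcontP/(_ _ e0)[x x0 xP] := csg_cont nK.
apply/nbhs_someP; exists x => // w /xP; rewrite ltr_norml; lra.
Qed.

Lemma W_usc_none : uscat W None.
Proof.
apply: usc_add; first by have [h1 h2 _] := @sv None (ltac:(by move=> [])).
move=> e e0; apply: (@nbhs_none R (2 + sg / e)); first by rewrite ltrDl.
move=> w wM; rewrite /rho mulr0 add0r -ltr_pdivlMl//.
have k01 : cabs k0 < 1 by have := lset_lt sys Kk0; have := et0; lra.
have q0 : 0 < sg / e by rewrite divr_gt0.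
have wk : 1 + sg / e < cabs (w - k0) by have := cabs_subl w k0; lra.
have -> : sg^-1 * e = (sg / e)^-1 by rewrite invf_div mulrC.
rewrite ltf_pV2 ?posrE ?exprn_gt0//; [|lra].
apply: (@lt_le_trans _ _ (1 + sg / e)); first lra.
by rewrite expr2 -[leLHS]mulr1; apply: ler_pM; lra.
Qed.

Lemma W_strict z (kk : C R -> R) : ~ K0 z -> cnear kk z -> csub kk z -> (-oo < v (Some z))%E ->
  (exists2 e : R, 0 < e & forall w, cabs (w - z) < e ->
    (W (Some w) + (kk w)%:E <= W (Some z) + (kk z)%:E)%E) -> False.
Proof.
move=> nK ck sk vz mx.
have [e1 e10 nK1] := closed_off (lset_closed sys (m := 0)) nK.
have c1 w (h : cabs (w - z) < e1) := csg_cont (nK1 w h).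
have [e2 e20 c2] := ck.
apply: (strict_max (k := fun w => sg * rho k0 (Some w) + kk w) sv nK _ _ vz).
- have [x x0 [x1 x2]] := pos_min2 e10 e20; exists x => // w wx.
  by apply: vcontD; [apply: c1; lra|apply: c2; lra].
- have [e3 e30 E3] := rho_strict (neq_k0 nK); have [e4 e40 E4] := csub_submean sk.
  have [x x0 [x1 x2]] := pos_min2 e10 e20; have [y y0 [y3 y4]] := pos_min2 e30 e40.
  have [m m0 [mx' my]] := pos_min2 x0 y0; exists m => // r /andP[r0 rm].
  have c3 : tc (fun t => sg * rho k0 (Some (circ z r t))).
    by apply: (@vcirc_cont _ (fun w => sg * rho k0 (Some w))) => t; apply: c1; rewrite circ_dist gtr0_norm//; lra.
  have c4 : tc (fun t => kk (circ z r t)).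
    by apply: vcirc_cont => t; apply: c2; rewrite circ_dist gtr0_norm//; lra.
  have c5 : tc (fun t => rho k0 (Some (circ z r t))).
    apply: (@vcirc_cont _ (fun w => rho k0 (Some w))) => t; apply/rho_cont/neq_k0.
    by apply: nK1; rewrite circ_dist gtr0_norm//; lra.
  rewrite avgD// avgZ//; apply: ltr_leD; last by apply: E4; rewrite r0/=; lra.
  by rewrite ltr_pM2l// E3// r0/=; lra.
- by have [e e0 eP] := mx; exists e => // w /eP; rewrite !EFinD !addeA.
Qed.

Lemma W_strict_infty : (-oo < v None)%E ->
  (exists M : R, forall w, M < cabs w -> (W (Some w) <= W None)%E) -> False.
Proof.
move=> vz [M mx]; have k01 : cabs k0 < 1 by have := lset_lt sys Kk0; have := et0; lra.
apply: (@strict_max_infty _ K0 v (fun p => sg * rho k0 p) sv _ _ vz); first by rewrite /= mulr0.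
  have [e e0 eP] := rho_infty k01; exists e => // r /eP[h1 h2].
  by split=> [|t]; [exact: tcZ|exact: mulr_gt0].
by exists M => w /mx; rewrite /W /= mulr0 adde0.
Qed.

Let rp := 1 - eta / 3.

(* On the cylinders other than [u'] the perturbed function is controlled by its
   values on an outer circle, the harmonic measure of the limit set being zero. *)
Lemma W_inner x (m1 : R) w0 (b0 : R) : x \in words 0 n -> x != u' -> 0 < b0 ->
  (forall y, cyl 0 x y -> b0 <= cabs (y - k0)) ->
  (forall w, cabs w = rp -> (W (Some (comp 0 x w)) <= m1%:E)%E) ->
  cabs w0 = 1 - eta / 2 -> (W (Some (comp 0 x w0)) <= m1%:E)%E.
Proof.
have ee := et0; have ee1 := et1.
rewrite wordsP => /andP[/eqP sx ox] xu b00 b0P out w0r.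
have w01 : cabs w0 < 1 by lra.
have lt w : lset n w -> cabs w < 1 - eta by exact: (lset_lt sys).
have nKw w : cabs w < 1 -> ~ lset n w -> ~ K0 (comp 0 x w).
  by move=> w1 nL Kw; apply: nL; rewrite -sx; apply/(lset_cyl sys ox w1).
pose z := comp 0 x w0; have nKz : ~ K0 z by apply: nKw => // /lt; lra.
rewrite leNgt; apply/negP => m1W.
have [Wz _] := W_usc_some nKz.
pose M := fine (W (Some z)).
have WM : W (Some z) = M%:E.
  by rewrite /M; case: (W (Some z)) Wz m1W => //.
have mM : m1 < M by rewrite -lte_fin -WM.
(* A bound for [W] near the limit set inside the cylinder of [x], whose points are at distance at
   least [b0] from the pole. *)
pose B := 2 + sg / b0 ^+ 2.
have B0 : 0 < B by rewrite addr_gt0// divr_gt0// exprn_gt0.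
(* Near the limit set [U >= 1 / 2], so subtracting [Cc * U] from [W] brings it below
   [B - Cc / 2 <= m1]. *)
pose Cc := 2 * (B + `|m1|) + 1; have Cc0 : 0 < Cc by rewrite /Cc; have := normr_ge0 m1; lra.
have BC : B - Cc / 2 <= m1 by rewrite /Cc; have := ler_norm (- m1); rewrite normrN; lra.
(* Here [a = 0] is used: [U] can be made so small on the circle of radius [1 - eta / 2] that the
   penalty at [z] is at most half of [M - m1]. *)
have dl0 : 0 < (M - m1) / (2 * Cc) by rewrite divr_gt0 ?mulr_gt0 ?subr_gt0.
have [h [U [u1 _ u3 u4]]] := La dl0.
pose kk := transport d psi x (fun w => Cc * - U w).
have kkE w : cabs w < 1 -> kk (comp 0 x w) = - (Cc * U w).
  by move=> w1; rewrite /kk (transport_comp sys)// mulrN.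
have oG : open (annulus_domain eta (lset n)).
  by apply: annulus_domain_open; [case: sys|exact: (lset_closed sys (m := n))].
have ckk w : cabs w < 1 - eta / 4 -> ~ lset n w -> cnear kk (comp 0 x w) /\ csub kk (comp 0 x w).
  move=> wr nL; have Gw : annulus_domain eta (lset n) w by [].
  have /openCP/(_ _ Gw)[k kp kP] := oG.
  have cU : cnear (fun w => - U w) w.
    exists k => // y /kP Gy; have [_ _ c _ _] := u1 y Gy; exact: (vcontN c).
  apply: (transport_local sys ox); first lra.
    by have [e e0 eP] := cU; exists e => // y /eP c; apply: vcontM => //; exact: vcont_cst.
  by apply: csubZ => //; [exact: ltW|have [_ _ _ c _] := u1 w Gw].
pose Y y := (W (Some y) + (kk y)%:E)%E.
(* An open set containing the limit points of the cylinder, on which the penalized function does not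
   exceed [m1] off the limit set. *)
pose N2 : set (C R) := [set y | exists zeta e, [/\ K0 zeta, 0 < e, cabs (y - zeta) < e &
  forall y', ~ K0 y' -> cabs (y' - zeta) < e -> (Y y' <= m1%:E)%E]].
have oN2 : open N2.
  apply/openCP => y [zeta [e [Kz e0 ye eP]]]; exists (e - cabs (y - zeta)); first by rewrite subr_gt0.
  move=> y' y'y; exists zeta, e; split=> //.
  by have := cabs_tri y' zeta y; lra.
have KN2 zeta : K0 zeta -> cyl 0 x zeta -> N2 zeta.
  move=> Kz cz; have [w w1 wE] := cz.
  have Lw : lset n w by rewrite -sx; apply/(lset_cyl sys ox w1); rewrite wE.
  have [k kp kP] := u3 w (1 / 2) Lw (ltac:(lra)).
  have [e1 e10 E1] := v2 Kz.
  have /openCP/(_ zeta cz)[e2 e20 E2] := cyl_open sys ox.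
  have c0 : 0 < lam 0 x / cd by rewrite divr_gt0 ?(lam_gt0 sys)// cdist_gt0.
  have wg : 0 < 1 - eta / 4 - cabs w by have := lt w Lw; lra.
  have [q q0 [qk qw]] := pos_min2 kp wg.
  have [p p0 [p1 p2]] := pos_min2 e10 e20; have [e e0 [ep eq]] := pos_min2 p0 (mulr_gt0 c0 q0).
  exists zeta, e; split; rewrite ?subrr ?cabs0// => y nK ye.
  have cy : cyl 0 x y by apply: E2; lra.
  have [w' w'1 w'E] := cy.
  have /andP[cl _] := comp_lip sys ox (ltW w'1) (ltW w1).
  have ww : cabs (w' - w) < q.
    by rewrite -(ltr_pM2l c0); apply: le_lt_trans cl _; rewrite w'E wE; lra.
  have nL : ~ lset n w'.
    by move=> L; apply: nK; rewrite -w'E; apply/(lset_cyl sys ox w'1); rewrite sx.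
  have Gw' : annulus_domain eta (lset n) w' by split=> //; have := cabs_subl w' w; lra.
  have [_] := kP w' Gw' (ltac:(lra)).
  rewrite indicE mem_set; last by exists w.
  move=> /= U1; rewrite /Y -w'E kkE// w'E /W.
  have vy := E1 y nK (ltac:(lra)).
  have by0 := b0P y cy.
  have rb : sg * rho k0 (Some y) <= sg / b0 ^+ 2.
    rewrite ler_pM2l// /rho lef_pV2 ?posrE ?exprn_gt0//; last by apply: lt_le_trans by0.
    by rewrite lerXn2r// nnegrE ltW// (lt_le_trans b00).
  apply: (@le_trans _ _ (2%:E + (sg / b0 ^+ 2)%:E + (- (Cc / 2))%:E)%E).
    apply: leeD; first by apply: leeD => //; rewrite lee_fin.
    by rewrite lee_fin lerN2 ler_pM2l//; lra.
  by rewrite -!EFinD lee_fin; move: BC; rewrite /B; lra.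
pose A := comp 0 x @` cball_ 0 rp.
have cA : compact A.
  apply: continuous_compact; last exact: cball_compact.
  apply: continuous_in_subspaceT => w /set_mem; rewrite /cball_/= subr0 => wr.
  by apply: cdiff_cont; apply: (comp_cdiff sys ox); apply: (V1 sys); rewrite /rp in wr; lra.
(* What remains is compact and avoids the limit set. A maximum of [Y] there exceeds [m1]; it cannot
   lie on the outer circle, where [Y <= W <= m1], nor inside, where [W_strict] applies. *)
pose Q := A `\` N2.
have cQ : compact Q.
  by rewrite /Q setDE; apply: compact_closedI => //; rewrite closedC.
have Yz : (m1%:E < Y z)%E.
  have [_ uz] := u4 w0 w0r; rewrite /Y WM kkE// -EFinD lte_fin.
  have : Cc * U w0 <= Cc * ((M - m1) / (2 * Cc)) by rewrite ler_pM2l//; lra.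
  have -> : Cc * ((M - m1) / (2 * Cc)) = (M - m1) / 2 by field; lra.
  lra.
have nN2 y : ~ K0 y -> (m1%:E < Y y)%E -> ~ N2 y.
  by move=> nK lt1 [zeta [e [_ _ ye]]] /(_ y nK ye); rewrite leNgt lt1.
have Qz : Q z.
  split; last exact: nN2.
  by exists w0 => //; rewrite /cball_/= subr0 w0r /rp; lra.
have Qw y : Q y -> exists w, [/\ cabs w <= rp, comp 0 x w = y, ~ lset n w & ~ K0 y].
  move=> [[w /=]]; rewrite /cball_/= subr0 => wr wE nN; exists w.
  have w1 : cabs w < 1 by rewrite /rp in wr; lra.
  have nK : ~ K0 y by move=> Ky; apply: nN; apply: KN2 => //; exists w.
  by split=> //; rewrite -sx => /(lset_cyl sys ox w1); rewrite wE.
have uY y : Q y -> uscat Y y.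
  move=> /Qw[w [wr wE nL nK]]; apply: (@usc_add _ _ (fun y => W (Some y))).
    by have [h1 h2] := W_usc_some nK; split=> // a /h2 h3.
  move=> e e0; have [|ck _] := ckk w _ nL; first by rewrite /rp in wr; lra.
  rewrite wE in ck; have /vcontP/(_ _ e0)[r r0 rP] := cnear_at ck.
  by apply/nbhsCP; exists r => // y' /rP; rewrite ltr_norml; lra.
have [q Qq qP] := usc_max cQ (ex_intro _ z Qz) uY.
have Yq : (m1%:E < Y q)%E by apply: lt_le_trans Yz (qP _ Qz).
have [w [wr wE nL nK]] := Qw q Qq.
have w1 : cabs w < 1 by rewrite /rp in wr; lra.
have wo : cabs w < 1 - eta / 4 by rewrite /rp in wr; lra.
have Gw : annulus_domain eta (lset n) w by [].
have [_ _ _ _ U0] := u1 w Gw.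
move: wr; rewrite le_eqVlt => /predU1P[wr|wr].
  move: Yq; rewrite ltNge => /negP; apply; rewrite /Y -wE kkE//.
  apply: le_trans (out w wr); rewrite -[leRHS]adde0; apply: leeD => //.
  by rewrite lee_fin oppr_le0 mulr_ge0// ltW.
have [ck sk] := ckk w wo nL; rewrite wE in ck sk.
apply: (@W_strict q kk nK ck sk).
  by move: Yq; rewrite /Y /W; case: (v (Some q)) => [r _|_|]; [exact: ltNyr|by []|by rewrite !addNye].
have [e e0 eP] : exists2 e : R, 0 < e & forall y, cabs (y - q) < e -> A y.
  exists (lam 0 x / cd * (rp - cabs w) / 2).
    by rewrite !(mulr_gt0, invr_gt0) ?(lam_gt0 sys) ?cdist_gt0 ?subr_gt0.
  move=> y yq; have [y' y'w <-] : exists2 y', cabs (y' - w) < rp - cabs w & comp 0 x y' = y.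
    by apply: (image_ball sys ox); rewrite ?wE//; rewrite /rp in wr *; lra.
  by exists y' => //; rewrite /cball_/= subr0; have := cabs_subl y' w; lra.
have [k kp kP] := closed_off (lset_closed sys (m := 0)) nK.
have [r r0 [re_ rk]] := pos_min2 e0 kp; exists r => // y yr.
have [yN|yN] := pselect (N2 y); last by apply: qP; split=> //; apply: eP; lra.
apply: ltW; apply: le_lt_trans Yq; have [zeta [r' [_ _ yz]]] := yN; apply=> //.
by apply: kP; lra.
Qed.
End Perturbed.
End PolarExclusion.

(** * Quasi-Bernoulli property of harmonic measure *)

Section PolarExclusion2.
Context {R : realType}.
Variables (d : nat -> nat) (psi : nat -> nat -> C R -> C R) (eta : R) (V : set (C R)).
Hypothesis sys : conformal_system d psi eta V.
Variable omega : probability (borelC R) R.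
Hypothesis hm : is_harmonic_measure (lset d psi 0) infty omega.
Implicit Types (z w y : C R) (u x : seq nat) (m k : nat).

Let et0 : 0 < eta. Proof. by case: sys => /andP[]. Qed.
Let et1 : eta < 1. Proof. by case: sys => /andP[]. Qed.

Local Notation K0 := (lset d psi 0).
Local Notation comp := (comp psi).
Local Notation cyl := (cyl psi).
Local Notation okw := (okw d).
Local Notation lset := (lset d psi).
Local Notation cd := (cdist eta).
Local Notation lam := (lam psi).
Local Notation Pm := (Pm psi omega).
Local Notation words := (words d).

Variables (n : nat) (C0 : R) (u' : seq nat) (k0 : C R) (v : @sphere R -> \bar R).
Hypothesis La : local_approx d psi eta n [::] C0 0.
Hypothesis uw' : u' \in words 0 n.
Hypothesis Kk0 : K0 k0.
Hypothesis ck0 : cyl 0 u' k0.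
Hypothesis sv : subharmonic (outer_domain K0) v.
Hypothesis v2 : forall z, K0 z -> exists2 e : R, 0 < e &
  forall w, ~ K0 w -> cabs (w - z) < e -> (v (Some w) <= 2%:E)%E.
Hypothesis v0 : forall z e, K0 z -> cyl 0 u' z -> 0 < e -> exists2 r : R, 0 < r &
  forall w, ~ K0 w -> cabs (w - z) < r -> (v (Some w) <= e%:E)%E.

Let ou' : okw 0 u'. Proof. by move: uw'; rewrite wordsP => /andP[]. Qed.

(** If the value at infinity exceeded [2 s], maximize [W] over the sphere minus a neighbourhood of
    the limit points in the cylinder of [u'] and minus small copies of the disk in the other
    cylinders of length [n]. Strict subharmonicity forces the maximum onto the boundary of one such
    copy, where [W_inner] bounds it by the smaller values of [W] on a larger concentric copy. *)
Lemma perron_infty_le (s : R) : 0 < s -> (v None <= (2 * s)%:E)%E.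
Proof.
move=> s0; have ee := et0; have ee1 := et1; have [/eqP su' _] := andP (ltac:(by move: uw'; rewrite wordsP => h; exact: h) : (size u' == n) && okw 0 u').
(* A neighbourhood of the limit points coded by [u'], inside their cylinder, on which the competitor
   is at most [s]. *)
pose N : set (C R) := [set z | exists zeta r, [/\ K0 zeta /\ cyl 0 u' zeta, 0 < r, cabs (z - zeta) < r,
  forall y, cabs (y - zeta) < r -> cyl 0 u' y & forall y, ~ K0 y -> cabs (y - zeta) < r -> (v (Some y) <= s%:E)%E]].
have Ncyl z : N z -> cyl 0 u' z by move=> [zeta [r [_ _ zr h _]]]; exact: h.
have Nv z : N z -> ~ K0 z -> (v (Some z) <= s%:E)%E by move=> [zeta [r [_ _ zr _ h]]] nK; exact: h.
have oN : open N.
  apply/openCP => y [zeta [e [Kz e0 ye h1 h2]]]; exists (e - cabs (y - zeta)); first by rewrite subr_gt0.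
  move=> y' y'y; exists zeta, e; split=> //.
  by have := cabs_tri y' zeta y; lra.
have KN zeta : K0 zeta -> cyl 0 u' zeta -> N zeta.
  move=> Kz cz; have /openCP/(_ _ cz)[e e0 eP] := cyl_open sys ou'.
  have [r r0 rP] := v0 Kz cz s0; have [x x0 [xe xr]] := pos_min2 e0 r0.
  exists zeta, x; split; rewrite ?subrr ?cabs0//.
    by move=> y yx; apply: eP; lra.
  by move=> y nK yx; apply: rP => //; lra.
have /openCP/(_ k0 (KN k0 Kk0 ck0))[r0 r00 r0P] := oN.
pose h0 := r0 / 2; have h00 : 0 < h0 by rewrite divr_gt0.
(* At distance [h0] or more from the pole the perturbation is then at most [s], so that [W <= 2 s]
   on the part of [N] away from the pole. *)
pose sg := s * h0 ^+ 2; have sg0 : 0 < sg by rewrite mulr_gt0// exprn_gt0.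
have rhoP y : h0 <= cabs (y - k0) -> sg * rho k0 (Some y) <= s.
  move=> hy; have p : 0 < cabs (y - k0) by lra.
  by rewrite /sg /rho -mulrA ger_pMr// ler_pdivrMr ?exprn_gt0// mul1r lerXn2r// nnegrE ltW.
pose W p := (v p + (sg * rho k0 p)%:E)%E.
pose H (r : R) : set (C R) := [set z | exists x w, [/\ x \in words 0 n, x != u', comp 0 x w = z & cabs w <= r]].
have Hcyl r z : r < 1 -> H r z -> exists x, [/\ x \in words 0 n, x != u' & cyl 0 x z].
  by move=> r1 [x [w [xw xu wE wr]]]; exists x; split=> //; exists w => //; rewrite /unit_disk/=; lra.
pose rg := 1 - eta / 2; pose rp := 1 - eta / 3.
have cylE x x' z : x \in words 0 n -> x' \in words 0 n -> cyl 0 x z -> cyl 0 x' z -> x = x'.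
  rewrite !wordsP => /andP[/eqP s1 o1] /andP[/eqP s2 o2]; apply: (cyl_uniq sys) => //.
  by rewrite s1 s2.
have cH : closed (H rg).
  have -> : H rg = \bigcup_(x in [set` [seq x <- words 0 n | x != u']]) (comp 0 x @` cball_ 0 rg).
    apply/seteqP; split=> z.
      move=> [x [w [xw xu wE wr]]]; exists x; first by rewrite /= mem_filter xu.
      by exists w => //; rewrite /cball_/= subr0.
    move=> [x /=]; rewrite mem_filter => /andP[xu xw] [w]; rewrite /cball_/= subr0 => wr wE.
    by exists x, w.
  apply: closed_bigcup; first exact: finite_seq.
  move=> x /=; rewrite mem_filter wordsP => /and3P[_ _ ox].
  apply: compact_closed; first exact: norm_hausdorff.
  apply: (@continuous_compact (C R) (C R) (comp 0 x)); last exact: cball_compact.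
  apply: continuous_in_subspaceT => w /set_mem; rewrite /cball_/= subr0 => wr.
  by apply: cdiff_cont; apply: (comp_cdiff sys ox); apply: (V1 sys); rewrite /rg in wr; lra.
pose Ho : set (C R) := [set z | exists x w, [/\ x \in words 0 n, x != u', comp 0 x w = z & cabs w < rg]].
have HoH : Ho `<=` H rg by move=> z [x [w [h1 h2 h3 h4]]]; exists x, w; split=> //; exact: ltW.
have oHo : open Ho.
  apply/openCP => z [x [w [xw xu wE wr]]].
  have ox : okw 0 x by move: xw; rewrite wordsP => /andP[].
  exists (lam 0 x / cd * (rg - cabs w) / 2).
    by rewrite !(mulr_gt0, invr_gt0) ?(lam_gt0 sys) ?cdist_gt0 ?subr_gt0.
  move=> y yz; have [y' y'w yE] : exists2 y', cabs (y' - w) < rg - cabs w & comp 0 x y' = y.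
    by apply: (image_ball sys ox); rewrite ?wE//; rewrite /rg in wr *; lra.
  by exists x, y'; split=> //; have := cabs_subl y' w; lra.
pose F : set sphere := ~` (Some @` (N `|` Ho)).
have cF : compact F.
  apply: (@subclosed_compact _ F setT) => //; last exact: one_point_compactification_compact.
  rewrite closedC; apply: (@one_point_compactification_open_some (C R)); exact: openU.
have FN : F None by move=> [].
have FS z : F (Some z) <-> ~ N z /\ ~ Ho z.
  split=> [Fz|[h1 h2] [y [Ny|Hy] [yz]]]; [|by apply: h1; rewrite -yz|by apply: h2; rewrite -yz].
  by split=> h; apply: Fz; exists z => //; [left|right].
have FK z : F (Some z) -> ~ K0 z.
  move=> /FS[nN nH] Kz; have [x xw [w w1 wE]] := Kz n.
  have [xu|xu] := eqVneq x u'; first by apply: nN; apply: KN => //; rewrite -xu; exists w.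
  apply: nH; exists x, w; split=> //.
  move: xw; rewrite wordsP => /andP[_ ox].
  have := (lset_cyl sys ox w1).2; rewrite wE => /(_ Kz)/(lset_lt sys).
  by rewrite /rg; lra.
have uW p : F p -> uscat W p.
  case: p => [z /FK nK|_]; first exact (W_usc_some Kk0 sv sg nK).
  exact (W_usc_none sys Kk0 sv sg0).
have [p Fp pP] := usc_max cF (ex_intro _ None FN) uW.
rewrite leNgt; apply/negP => v2s.
have W2 : ((2 * s)%:E < W p)%E.
  by apply: lt_le_trans (pP _ FN); rewrite /W /rho mulr0 adde0.
have Wlo q : ((2 * s)%:E < W q)%E -> (-oo < v q)%E.
  by rewrite /W; case: (v q) => [r _|_|]; [exact: ltNyr|by []|by rewrite !addNye].
(* A maximum point with value above [2 s] cannot be at infinity nor at a point off the copies: near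
   it, points outside [F] belong to [N], where [W <= 2 s]. *)
have inner q : F q -> (forall q', F q' -> (W q' <= W q)%E) -> ((2 * s)%:E < W q)%E ->
    exists2 z, q = Some z & H rg z.
  move=> Fq qP W2q; case: q Fq qP W2q => [z|] Fq qP W2q; last first.
    apply: False_rect; apply: (W_strict_infty sys Kk0 sv sg0 (Wlo _ W2q)).
    exists 2 => w w2; apply: qP; apply/FS; split.
      by move=> /Ncyl[y y1 wE]; have := comp_lt1 sys ou' y1; rewrite wE; lra.
    move=> [x [y [xw _ wE yr]]]; have ox : okw 0 x by move: xw; rewrite wordsP => /andP[].
    have : cabs y < 1 by rewrite /rg in yr; lra.
    by move=> /(comp_lt1 sys ox); rewrite wE; lra.
  exists z => //; apply: contrapT => nH.
  have nK := FK _ Fq; have [nN _] := (FS z).1 Fq.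
  have [e1 e10 E1] := closed_off cH nH; have [e2 e20 E2] := closed_off (lset_closed sys (m := 0)) nK.
  have zk : r0 <= cabs (z - k0) by rewrite leNgt; apply/negP => /r0P.
  have [x x0 [x1 x2]] := pos_min2 e10 e20; have [e e0 [ex eh]] := pos_min2 x0 h00.
  have cn : cnear (fun _ : C R => 0 : R) z by exists 1 => // w _; exact: vcont_cst.
  apply: (W_strict sys Kk0 sv sg0 nK cn (@csub_cst R 0 z) (Wlo _ W2q)).
  exists e => // w we; rewrite !adde0.
  have nKw : ~ K0 w by apply: E2; lra.
  have [Nw|nNw] := pselect (N w); last first.
    by apply: qP; apply/FS; split=> // /HoH; apply: E1; lra.
  apply: ltW; apply: le_lt_trans W2q; apply: (@le_trans _ _ (s%:E + s%:E)%E); last by rewrite -EFinD lee_fin; lra.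
  apply: leeD; first exact: Nv.
  rewrite lee_fin; apply: rhoP; have := cabs_tri z k0 w; rewrite (cabsBC z w) /h0; rewrite /h0 in eh; lra.
have [z pE [x [w [xw xu wE wr]]]] := inner p Fp pP W2.
have ox : okw 0 x by move: xw; rewrite wordsP => /andP[].
have wrg : cabs w = rg.
  apply/eqP; rewrite eq_le wr/= leNgt; apply/negP => lt; rewrite pE in Fp.
  by have [_] := (FS z).1 Fp; apply; exists x, w.
have rp1 : rp < 1 by rewrite /rp; lra.
have rgp : rg < rp by rewrite /rg /rp; lra.
(* The larger copy, of radius [rp], lies between the removed copy and the boundary of the
   cylinder. *)
pose S : set sphere := Some @` (comp 0 x @` [set w | cabs w = rp]).
have cS : compact S.
  have csp : compact [set w : C R | cabs w = rp].
    have -> : [set w : C R | cabs w = rp] = cball_ 0 rp `&` ~` [set w | cabs w < rp].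
      apply/seteqP; split=> y; rewrite /cball_/= subr0; first by move=> ->; rewrite lexx ltxx.
      by move=> [h1 /negP]; rewrite -leNgt => h2; apply/eqP; rewrite eq_le h1.
    apply: compact_closedI; first exact: cball_compact.
    rewrite closedC; apply/openCP => y /= yr; exists (rp - cabs y); first by rewrite subr_gt0.
    by move=> y' h; have := cabs_subl y' y; lra.
  apply: (@continuous_compact _ _ (Some : C R -> sphere)).
    by apply: continuous_in_subspaceT => y _; exact: one_point_compactification_some_continuous.
  apply: continuous_compact => //.
  apply: continuous_in_subspaceT => y /set_mem /= yr.
  by apply: cdiff_cont; apply: (comp_cdiff sys ox); apply: (V1 sys); rewrite yr ltW.
have nx z' : cyl 0 x z' -> ~ N z'.
  by move=> cz /Ncyl cz'; move/eqP: xu; apply; exact: cylE cz cz'.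
have nHrp w' : cabs w' = rp -> ~ H rg (comp 0 x w').
  move=> w'r [x' [y [xw' _ yE yr]]]; have w'1 : cabs w' < 1 by rewrite w'r.
  have y1 : cabs y < 1 by rewrite /rg in yr; lra.
  have xx : x' = x by apply: (cylE _ _ (comp 0 x w')) => //; [exists y|exists w'].
  subst x'; have yw := comp_inj sys ox (V1 sys (ltW y1)) (V1 sys (ltW w'1)) yE.
  by move: yr; rewrite yw w'r; lra.
have FS' w' : cabs w' = rp -> F (Some (comp 0 x w')).
  move=> w'r; apply/FS; split; last by move=> /HoH; exact: nHrp.
  by apply: nx; exists w' => //; rewrite /unit_disk/= w'r.
have uS q : S q -> uscat W q by move=> [_ [w' w'r <-] <-]; exact/uW/FS'.
have Sne : S !=set0.
  have cr : cabs (rc rp) = rp by rewrite cabs_rc gtr0_norm//; rewrite /rp; lra.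
  by exists (Some (comp 0 x (rc rp))), (comp 0 x (rc rp)) => //; exists (rc rp).
have [q [_ [w' w'r <-] qE] qP] := usc_max cS Sne uS.
have Fq : F q by rewrite -qE; exact: FS'.
(* Equality would make [q] a maximum point off all the removed copies, against [inner]; so there is
   room for a number [m1] between the two values. *)
have := pP q Fq; rewrite le_eqVlt => /predU1P[WE|Wlt].
  have [||z' z'E Hz'] := inner q Fq; [by move=> y Fy; rewrite WE; exact: pP|by rewrite WE|].
  by move: z'E Hz'; rewrite -qE => -[<-]; exact: nHrp.
have [pfin _] := uW p Fp.
have [m1 qm mp] : exists2 m1 : R, (W q <= m1%:E)%E & (m1%:E < W p)%E.
  case: (W q) Wlt => [r rlt| |_]; first by exists r.
    by rewrite ltNge leey.
  by exists (2 * s); [exact: leNye|exact: W2].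
have b0P y : cyl 0 x y -> r0 <= cabs (y - k0).
  by move=> cy; rewrite leNgt; apply/negP => /r0P; exact: nx.
have := W_inner sys La Kk0 sv v2 sg0 xw xu r00 b0P _ wrg (m1 := m1).
rewrite wE => /(_ _) Wz; have : (W (Some z) <= m1%:E)%E.
  apply: Wz => y yr; apply: le_trans qm; apply: qP.
  by exists (comp 0 x y) => //; exists y.
by rewrite -pE leNgt mp.
Qed.

End PolarExclusion2.

Section PositiveCapacity.
Context {R : realType}.
Variables (d : nat -> nat) (psi : nat -> nat -> C R -> C R) (eta : R) (V : set (C R)).
Hypothesis sys : conformal_system d psi eta V.
Variable omega : probability (borelC R) R.
Hypothesis hm : is_harmonic_measure (lset d psi 0) infty omega.

(** Any Perron competitor for the indicator of the cylinder of [u] has boundary value 0 on the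
    cylinder of [u'], hence is nonpositive at infinity by [perron_infty_le]. *)
Lemma mass0_of_polar n C0 u u' : local_approx d psi eta n [::] C0 0 ->
  u \in words d 0 n -> u' \in words d 0 n -> u != u' -> Pm psi omega u <= 0.
Proof.
move=> La uw uw' uu; have ou : okw d 0 u by move: uw; rewrite wordsP => /andP[].
move: (uw'); rewrite wordsP => /andP[/eqP su' ou'].
have su : size u = n by move: uw; rewrite wordsP => /andP[/eqP].
have [w Lw] := lset_neq0 sys hm n.
have w1 : cabs w < 1.
  by have := lset_lt sys Lw; have [/andP[e0 _] _ _ _] := sys; lra.
have Kk0 : lset d psi 0 (comp psi 0 u' w) by apply/(lset_cyl sys ou' w1); rewrite su'.
have ck0 : cyl psi 0 u' (comp psi 0 u' w) by exists w.
have mA := cyl_meas sys ou; have lA := cyl_loc_const sys ou.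
have cK := lset_closed sys (m := 0).
have := perron_indic cK hm 0 mA mA lA lA; rewrite mul0r subr0 -/(Pm psi omega u) => PE.
rewrite -lee_fin -PE; apply: ge_ereal_sup => _ [v [sv bv] <-].
have bd z e : lset d psi 0 z -> 0 < e -> exists2 r : R, 0 < r & forall y, ~ lset d psi 0 y ->
    cabs (y - z) < r -> (v (Some y) <= (\1_(cyl psi 0 u) z + e)%:E)%E.
  move=> Kz e0; have := bv z; rewrite (lset_frontier sys) => /(_ Kz); rewrite mul0r subr0 limf_esupE => h.
  have /ereal_inf_lt[_ [S /nbhs_someP[r r0 rP] <-] /ltW hS] : 
      (ereal_inf [set ereal_sup [set v x | x in S] | S in within (outer_domain (lset d psi 0)) (nbhs (Some z : sphere))] < (\1_(cyl psi 0 u) z + e)%:E)%E.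
    by apply: le_lt_trans h _; rewrite lte_fin ltrDl.
  exists r => // y nK yr; apply: le_trans hS; apply: ereal_sup_ubound; exists (Some y) => //.
  by apply: rP => //; exact: outer_some.
have i1 z : \1_(cyl psi 0 u) z <= 1 :> R by rewrite indicE; case: (_ \in _).
apply/lee_addgt0Pr => e e0; rewrite add0e (_ : e = 2 * (e / 2)); last by field.
have e20 : 0 < e / 2 by rewrite divr_gt0.
have v2 z : lset d psi 0 z -> exists2 r : R, 0 < r & forall y, ~ lset d psi 0 y ->
    cabs (y - z) < r -> (v (Some y) <= 2%:E)%E.
  move=> Kz; have [r r0 rP] := bd z 1 Kz ltr01; exists r => // y nK yr.
  by apply: (le_trans (rP y nK yr)); rewrite lee_fin; have := i1 z; lra.
have v0 z x : lset d psi 0 z -> cyl psi 0 u' z -> 0 < x -> exists2 r : R, 0 < r &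
    forall y, ~ lset d psi 0 y -> cabs (y - z) < r -> (v (Some y) <= x%:E)%E.
  move=> Kz cz x0; have [r r0 rP] := bd z x Kz x0; exists r => // y nK yr.
  apply: (le_trans (rP y nK yr)); rewrite indicE memNset ?add0r// => cz'.
  by move/eqP: uu; apply; apply: (cyl_uniq sys _ ou ou' cz' cz); rewrite su su'.
exact (perron_infty_le sys La uw' Kk0 ck0 sv v2 v0 e20).
Qed.

(** With [a] and [b] attached to [v] and to the empty word, both [P(uv) / P(u)] and [P(u'v) / P(u')]
    are compared with [a / b], which depends only on the length of [u]; each comparison costs
    [C0^2]. *)
Lemma quasi_bernoulli : exists2 C1 : R, 1 <= C1 & forall u u' v, okw d 0 u -> okw d 0 u' ->
  size u = size u' -> okw d (size u) v ->
  Pm psi omega (u ++ v) * Pm psi omega u' <= C1 * Pm psi omega (u' ++ v) * Pm psi omega u.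
Proof.
have [C0 C01 CP] := local_approx_exists sys.
exists (C0 ^+ 4); first by rewrite exprn_ege1.
move=> u u' v ou ou' suu ov; have C00 : 0 <= C0 by lra.
have p0 x : 0 <= Pm psi omega x by exact: om_ge0.
have [a a0 La] := CP _ v ov; have [b b0 Lb] := CP (size u) [::] isT.
have [<-|uu] := eqVneq u u'.
  by rewrite -[leRHS]mulrA ler_peMl ?mulr_ge0 ?exprn_ege1.
have bp : 0 < b.
  (* If [b = 0], each word of this length has zero mass, another word being available since [u] and
     [u'] differ; but the masses add up to 1. *)
  rewrite lt_neqAle b0 andbT; apply/eqP => b00; rewrite -b00 in Lb.
  have uw : u \in words d 0 (size u) by rewrite wordsP eqxx.
  have uw' : u' \in words d 0 (size u) by rewrite wordsP suu eqxx.
  have P0 x : x \in words d 0 (size u) -> Pm psi omega x <= 0.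
    move=> xw; have [xu|xu] := eqVneq x u; last exact: mass0_of_polar Lb xw uw xu.
    by apply: (mass0_of_polar Lb xw uw'); rewrite xu.
  have := Pm_total sys hm (size u); have : \sum_(x <- words d 0 (size u)) Pm psi omega x <= 0.
    by rewrite big_seq; apply: sumr_le0 => x; exact: P0.
  by move=> h1 h2; move: h1; rewrite h2 ler10.
have h1 := mass_compare sys hm ou (v := [::]) isT ov C01 b0 a0 Lb La.
rewrite suu in La Lb ov; have h2 := mass_compare sys hm ou' ov (v' := [::]) isT C01 a0 b0 La Lb.
rewrite !cats0 in h1 h2; rewrite -(ler_pM2l bp) mulrA.
apply: (le_trans (ler_wpM2r (p0 u') h1)).
have -> : C0 ^+ 2 * a * Pm psi omega u * Pm psi omega u' = C0 ^+ 2 * Pm psi omega u * (a * Pm psi omega u') by ring.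
apply: (le_trans (ler_wpM2l _ h2)); first by rewrite mulr_ge0// exprn_ge0.
rewrite le_eqVlt; apply/orP; left; apply/eqP; ring.
Qed.
End PositiveCapacity.

(** * Almost additive functions on a weighted tree *)

Section WeightedTree.
Context {R : realType}.
Variables (d : nat -> nat) (q : nat -> seq nat -> R) (c : R).
Local Notation words := (words d).
Implicit Types (m n k : nat) (f g : seq nat -> R) (h : seq nat -> seq nat -> R).

Lemma words_cat m n k (F : seq nat -> R) :
  \sum_(w <- words m (n + k)) F w = \sum_(v <- words m n) \sum_(v' <- words (m + n) k) F (v ++ v').
Proof.
elim: n m F => [|n IH] m F; first by rewrite /= big_seq1 addn0.
rewrite addSn /= !big_allpairs_dep; apply: eq_bigr => i _.
by rewrite IH; apply: eq_bigr => v _; rewrite addSnnS.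
Qed.

Hypothesis q0 : forall m v, 0 <= q m v.
Hypothesis qs : forall m n, \sum_(v <- words m n) q m v = 1.
Hypothesis qr : forall m n k v, v \in words m n -> \sum_(v' <- words (m + n) k) q m (v ++ v') = q m v.
Hypothesis ql : forall m n k v', v' \in words (m + n) k -> \sum_(v <- words m n) q m (v ++ v') = q (m + n) v'.
Hypothesis c01 : 0 < c <= 1.
Hypothesis qc : forall m n k v v', v \in words m n -> v' \in words (m + n) k ->
  c * (q m v * q (m + n) v') <= q m (v ++ v').

Definition Ex m n f := \sum_(v <- words m n) q m v * f v.
(** The expectation of a function of two consecutive blocks under their joint law; [qr] and [ql] say
    that its marginals are the block laws. *)
Definition Jx m n k h := \sum_(v <- words m n) \sum_(v' <- words (m + n) k) q m (v ++ v') * h v v'.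

Lemma Ex_cat m n k f : Ex m (n + k) f = Jx m n k (fun v v' => f (v ++ v')).
Proof. exact: words_cat. Qed.

Lemma Jx_left m n k f : Jx m n k (fun v _ => f v) = Ex m n f.
Proof.
rewrite /Jx /Ex big_seq [RHS]big_seq; apply: eq_bigr => v vw.
by rewrite -mulr_suml qr.
Qed.

Lemma Jx_right m n k f : Jx m n k (fun _ v' => f v') = Ex (m + n) k f.
Proof.
rewrite /Jx /Ex exchange_big big_seq [RHS]big_seq; apply: eq_bigr => v vw.
by rewrite -mulr_suml (ql vw).
Qed.

Lemma JxD m n k h h' : Jx m n k (fun v v' => h v v' + h' v v') = Jx m n k h + Jx m n k h'.
Proof.
rewrite /Jx -big_split; apply: eq_bigr => v _; rewrite -big_split; apply: eq_bigr => v' _.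
by rewrite mulrDr.
Qed.

Lemma JxZ m n k a h : Jx m n k (fun v v' => a * h v v') = a * Jx m n k h.
Proof.
rewrite /Jx mulr_sumr; apply: eq_bigr => v _; rewrite mulr_sumr; apply: eq_bigr => v' _.
by rewrite mulrCA.
Qed.

Lemma Jx_cst m n k a : Jx m n k (fun _ _ => a) = a.
Proof. by rewrite (Jx_left m n k (fun=> a)) /Ex -mulr_suml qs mul1r. Qed.

Lemma Jx_le m n k h h' : (forall v v', v \in words m n -> v' \in words (m + n) k -> 0 < q m (v ++ v') -> h v v' <= h' v v') ->
  Jx m n k h <= Jx m n k h'.
Proof.
move=> hh; rewrite /Jx big_seq [leRHS]big_seq; apply: ler_sum => v vw.
rewrite big_seq [leRHS]big_seq; apply: ler_sum => v' vw'.
have := q0 m (v ++ v'); rewrite le_eqVlt => /predU1P[<-|qp]; first by rewrite !mul0r.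
by rewrite ler_pM2l// hh.
Qed.

Lemma ExD m n f g : Ex m n (fun v => f v + g v) = Ex m n f + Ex m n g.
Proof. by rewrite /Ex -big_split; apply: eq_bigr => v _; rewrite mulrDr. Qed.

Lemma ExZ m n a f : Ex m n (fun v => a * f v) = a * Ex m n f.
Proof. by rewrite /Ex mulr_sumr; apply: eq_bigr => v _; rewrite mulrCA. Qed.

Lemma Ex_cst m n a : Ex m n (fun=> a) = a.
Proof. by rewrite /Ex -mulr_suml qs mul1r. Qed.

Lemma eq_Ex m n f g : f =1 g -> Ex m n f = Ex m n g.
Proof. by move=> fg; apply: eq_bigr => v _; rewrite fg. Qed.

Lemma Ex_le m n f g : (forall v, v \in words m n -> 0 < q m v -> f v <= g v) -> Ex m n f <= Ex m n g.
Proof.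
move=> fg; rewrite /Ex big_seq [leRHS]big_seq; apply: ler_sum => v vw.
have := q0 m v; rewrite le_eqVlt => /predU1P[<-|qp]; first by rewrite !mul0r.
by rewrite ler_pM2l// fg.
Qed.

Lemma eq_Jx m n k h h' : (forall v v', h v v' = h' v v') -> Jx m n k h = Jx m n k h'.
Proof. by move=> hh; apply: eq_bigr => v _; apply: eq_bigr => v' _; rewrite hh. Qed.

Definition Vx m n f := Ex m n (fun v => (f v - Ex m n f) ^+ 2).

Lemma Vx_ge0 m n f : 0 <= Vx m n f.
Proof. by rewrite -(Ex_cst m n 0); apply: Ex_le => v _ _; exact: sqr_ge0. Qed.

Lemma Ex_sqr_sub m n f a : Ex m n (fun v => (f v - a) ^+ 2) = Vx m n f + (Ex m n f - a) ^+ 2.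
Proof.
set e := Ex m n f.
rewrite (@eq_Ex _ _ _ (fun v => (f v - e) ^+ 2 + ((2 * (e - a)) * f v + (- 2 * e * (e - a) + (e - a) ^+ 2)))); last first.
  by move=> v; ring.
rewrite ExD ExD ExZ Ex_cst -/e -/(Vx m n f); ring.
Qed.

Lemma Vx_le m n f a : Vx m n f <= Ex m n (fun v => (f v - a) ^+ 2).
Proof. by rewrite Ex_sqr_sub lerDl sqr_ge0. Qed.

Lemma Ex_centered m n f : Ex m n (fun v => f v - Ex m n f) = 0.
Proof. by rewrite ExD Ex_cst subrr. Qed.

(* [(f+g)^2 + (f-g)^2 = 2f^2 + 2g^2], and the joint law dominates [c] times the
   product law, under which [f - g] has variance [Vf + Vg]. *)
Lemma Jx_sqr_add m n k f g : Ex m n f = 0 -> Ex (m + n) k g = 0 ->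
  Jx m n k (fun v v' => (f v + g v') ^+ 2) <=
  (2 - c) * (Ex m n (fun v => f v ^+ 2) + Ex (m + n) k (fun v => g v ^+ 2)).
Proof.
move=> f0 g0; set Vf := Ex m n (fun v => f v ^+ 2); set Vg := Ex _ k _.
have low : c * (Vf + Vg) <= Jx m n k (fun v v' => (f v - g v') ^+ 2).
  apply: (@le_trans _ _ (\sum_(v <- words m n) \sum_(v' <- words (m + n) k) c * (q m v * q (m + n) v') * (f v - g v') ^+ 2)).
    rewrite (eq_bigr (fun v => c * (q m v * f v ^+ 2) + c * Vg * q m v)) => [|v _]; last first.
      rewrite (eq_bigr (fun v' => c * q m v * f v ^+ 2 * q (m + n) v' + (c * q m v * (q (m + n) v' * g v' ^+ 2) + - 2 * c * q m v * f v * (q (m + n) v' * g v')))) => [|v' _]; last by ring.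
      rewrite !big_split /= -!mulr_sumr qs [X in _ + (_ * X + _)](_ : _ = Vg)// [X in _ + (_ + _ * X)](_ : _ = 0)//.
      by ring.
    by rewrite big_split /= -!mulr_sumr qs -/Vf mulr1 mulrDr.
  rewrite /Jx big_seq [leRHS]big_seq; apply: ler_sum => v vw.
  rewrite big_seq [leRHS]big_seq; apply: ler_sum => v' vw'.
  by apply: ler_wpM2r; [exact: sqr_ge0|exact: qc vw vw'].
have : Jx m n k (fun v v' => (f v + g v') ^+ 2) + Jx m n k (fun v v' => (f v - g v') ^+ 2) = 2 * Vf + 2 * Vg.
  have E v v' : (f v + g v') ^+ 2 + (f v - g v') ^+ 2 = 2 * f v ^+ 2 + 2 * g v' ^+ 2 by ring.
  rewrite -JxD (eq_Jx _ _ _ E) (JxD m n k (fun v _ => 2 * f v ^+ 2) (fun _ v' => 2 * g v' ^+ 2)).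
  by rewrite (Jx_left m n k (fun v => 2 * f v ^+ 2)) (Jx_right m n k (fun v => 2 * g v ^+ 2)) !ExZ.
move: low; lra.
Qed.

Section AlmostAdditive.
Variables (G : nat -> seq nat -> R) (CG B : R).
Hypothesis CG0 : 0 <= CG.
Hypothesis Gadd : forall m n k v v', v \in words m n -> v' \in words (m + n) k -> 0 < q m (v ++ v') ->
  `|G m (v ++ v') - G m v - G (m + n) v'| <= CG.
Hypothesis B1 : forall m, Ex m 1 (fun v => G m v ^+ 2) <= B.

Definition Em m n := Ex m n (G m).
Definition Vm m n := Vx m n (G m).

Lemma sqr_split (x y t : R) : 0 < t -> (x + y) ^+ 2 <= (1 + t) * x ^+ 2 + (1 + t^-1) * y ^+ 2.
Proof.
move=> t0; rewrite -subr_ge0 (_ : _ - _ = t^-1 * (t * x - y) ^+ 2); last by field; rewrite gt_eqF.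
by rewrite mulr_ge0 ?sqr_ge0// invr_ge0 ltW.
Qed.

Let fc m n v := G m v - Em m n.

Lemma Vm_cat_le m n k (F : seq nat -> seq nat -> R) :
  (forall v v' x, `|x| <= CG -> (fc m n v + fc (m + n) k v' + x) ^+ 2 <= F v v') ->
  Vm m (n + k) <= Jx m n k F.
Proof.
move=> HF; apply: le_trans (Vx_le m (n + k) (G m) (Em m n + Em (m + n) k)) _.
rewrite Ex_cat; apply: Jx_le => v v' vw vw' qp.
have := HF v v' _ (Gadd vw vw' qp); congr (_ ^+ 2 <= _); rewrite /fc; ring.
Qed.

Lemma sqr_le_CG x : `|x| <= CG -> x ^+ 2 <= CG ^+ 2.
Proof. by move=> xC; rewrite -[x ^+ 2]real_normK ?num_real// lerXn2r// nnegrE. Qed.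

(** The growth factor of the variance when the length doubles: 4 is the trivial bound, 2 the value
    for independent blocks. *)
Let Lam := 4 - c.
Let C2 := (1 + 4 / c) * CG ^+ 2.

(** Young's inequality with parameter [c / 4] separates the additive error; [Jx_sqr_add] then gives
    the factor [2 (1 + c / 4) (2 - c) = 4 - c - c^2 / 2]. *)
Lemma Vm_double m n X : (forall m', Vm m' n <= X) -> Vm m (n + n) <= Lam * X + C2.
Proof.
move=> VX; have /andP[c0 c1] := c01; have t0 : 0 < c / 4 by lra.
have [p1 p2] : 0 <= 1 + c / 4 /\ 0 <= 2 - c by split; lra.
pose F v v' := (1 + c / 4) * (fc m n v + fc (m + n) n v') ^+ 2 + (1 + (c / 4)^-1) * CG ^+ 2.
apply: (@le_trans _ _ (Jx m n n F)).
  apply: Vm_cat_le => v v' x xC; apply: (le_trans (sqr_split _ _ t0)).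
  by rewrite lerD2l ler_wpM2l ?sqr_le_CG// addr_ge0// invr_ge0 ltW.
rewrite JxD JxZ Jx_cst invf_div; apply: lerD => //.
have J := Jx_sqr_add (Ex_centered m n (G m)) (Ex_centered (m + n) n (G (m + n))).
apply: (le_trans (ler_wpM2l p1 J)); rewrite -/(Vm m n) -/(Vm (m + n) n).
have X0 : 0 <= X by apply: le_trans (Vx_ge0 m n (G m)) (VX m).
apply: (@le_trans _ _ ((1 + c / 4) * ((2 - c) * (X + X)))).
  by apply: ler_wpM2l => //; apply: ler_wpM2l => //; apply: lerD; exact: VX.
have -> : (1 + c / 4) * ((2 - c) * (X + X)) = (Lam - c ^+ 2 / 2) * X by rewrite /Lam; field.
by rewrite ler_wpM2r// gerBl divr_ge0// sqr_ge0.
Qed.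

Lemma Vm_pow k : forall m, Vm m (2 ^ k) <= (B + C2) * Lam ^+ k - C2.
Proof.
have /andP[c0 c1] := c01; have C20 : 0 <= C2 by rewrite mulr_ge0 ?sqr_ge0// addr_ge0// divr_ge0// ltW.
elim: k => [|k IH] m.
  rewrite expn0 expr0 mulr1 addrK; apply: le_trans (B1 m).
  by apply: le_trans (Vx_le m 1 (G m) 0) _; rewrite (eq_Ex _ _ (g := fun v => G m v ^+ 2))// => v; rewrite subr0.
rewrite expnS mul2n -addnn; apply: (le_trans (Vm_double m IH)).
rewrite exprS mulrBr; have : 3 * C2 <= Lam * C2 by rewrite ler_wpM2r// /Lam; lra.
have -> : Lam * ((B + C2) * Lam ^+ k) = (B + C2) * (Lam * Lam ^+ k) by ring.
lra.
Qed.

(** Adding one block to [t] blocks with weights [1 + 1/t] and [1 + t] gives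
    [(1 + 1/t) t^2 + (1 + t) = (t + 1)^2]: the number of blocks enters only at the trivial quadratic
    rate. *)
Lemma Vm_blocks (h : nat) X j : (forall m, Vm m h <= X) -> (0 < j)%N ->
  Vm 0 (j * h) <= j%:R ^+ 2 * (2 * X + 2 * CG ^+ 2).
Proof.
move=> VX; have X0 : 0 <= X by apply: le_trans (Vx_ge0 0 h (G 0)) (VX 0%N).
have CC : 0 <= CG ^+ 2 by exact: sqr_ge0.
case: j => // j _; elim: j => [|j IH].
  by rewrite mul1n expr1n mul1r; have := VX 0%N; lra.
rewrite mulSn addnC; set t : R := j.+1%:R; have t0 : 0 < t by rewrite ltr0n.
set Y := 2 * X + _ in IH *.
pose F v v' := (1 + t^-1) * (fc 0 (j.+1 * h) v) ^+ 2 + (1 + t) * (2 * (fc (0 + j.+1 * h) h v') ^+ 2 + 2 * CG ^+ 2).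
apply: (@le_trans _ _ (Jx 0 (j.+1 * h) h F)).
  apply: Vm_cat_le => v v' x xC; rewrite -addrA; have ti : 0 < t^-1 by rewrite invr_gt0.
  apply: (le_trans (sqr_split _ _ ti)); rewrite invrK lerD2l; apply: ler_wpM2l; first lra.
  apply: (le_trans (sqr_split _ _ ltr01)); rewrite invr1 lerD2l; apply: ler_wpM2l => //.
  exact: sqr_le_CG.
have -> : Jx 0 (j.+1 * h) h F = (1 + t^-1) * Vm 0 (j.+1 * h) + (1 + t) * (2 * Vm (0 + j.+1 * h) h + 2 * CG ^+ 2).
  rewrite (JxD 0 (j.+1 * h) h (fun v _ => (1 + t^-1) * fc 0 (j.+1 * h) v ^+ 2)
    (fun _ v' => (1 + t) * (2 * fc (0 + j.+1 * h) h v' ^+ 2 + 2 * CG ^+ 2))).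
  rewrite (Jx_left 0 (j.+1 * h) h (fun v => (1 + t^-1) * fc 0 (j.+1 * h) v ^+ 2)).
  rewrite (Jx_right 0 (j.+1 * h) h (fun v' => (1 + t) * (2 * fc (0 + j.+1 * h) h v' ^+ 2 + 2 * CG ^+ 2))).
  by rewrite !ExZ ExD ExZ Ex_cst.
have h1 : 2 * Vm (0 + j.+1 * h) h + 2 * CG ^+ 2 <= Y by have := VX (0 + j.+1 * h)%N; rewrite /Y; lra.
apply: (@le_trans _ _ ((1 + t^-1) * (t ^+ 2 * Y) + (1 + t) * Y)).
  apply: lerD; apply: ler_wpM2l => //; last lra.
  by rewrite addr_ge0// invr_ge0 ltW.
have -> : j.+2%:R = t + 1 :> R by rewrite /t -natr1.
by rewrite le_eqVlt; apply/orP; left; apply/eqP; field; rewrite gt_eqF.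
Qed.

(** After division by [n^2], with [n = j 2^k], the factor [Lam^k] of the dyadic part becomes
    [(Lam / 4)^k]. *)
Lemma Vm_bound : exists A theta : R, [/\ 0 <= A, 0 < theta < 1 &
  forall j k, (0 < j)%N -> Vm 0 (j * 2 ^ k) <= A * (j * 2 ^ k)%:R ^+ 2 * theta ^+ k].
Proof.
have /andP[c0 c1] := c01; have C20 : 0 <= C2 by rewrite mulr_ge0 ?sqr_ge0// addr_ge0// divr_ge0// ltW.
have B0 : 0 <= B by apply: le_trans (B1 0%N); rewrite -(Ex_cst 0 1 0); apply: Ex_le => v _ _; exact: sqr_ge0.
exists (2 * (B + C2) + 2 * CG ^+ 2), (Lam / 4); split.
- by rewrite addr_ge0// mulr_ge0 ?sqr_ge0// addr_ge0.
- by apply/andP; split; rewrite /Lam; lra.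
move=> j k j0; have L1 : 1 <= Lam ^+ k by rewrite exprn_ege1// /Lam; lra.
have VX m : Vm m (2 ^ k) <= (B + C2) * Lam ^+ k by apply: (le_trans (Vm_pow k m)); lra.
apply: (le_trans (Vm_blocks VX j0)).
have -> : (2 * (B + C2) + 2 * CG ^+ 2) * (j * 2 ^ k)%:R ^+ 2 * (Lam / 4) ^+ k =
    j%:R ^+ 2 * (2 * ((B + C2) * Lam ^+ k) + 2 * CG ^+ 2 * Lam ^+ k).
  have p4 : ((2 : R) ^+ k) ^+ 2 = 4 ^+ k by rewrite -exprM mulnC exprM; congr (_ ^+ k); ring.
  rewrite natrM natrX exprMn p4 expr_div_n; field.
  by rewrite expf_neq0// pnatr_eq0.
apply: ler_wpM2l; first exact: sqr_ge0.
by rewrite lerD2l ler_peMr// mulr_ge0// sqr_ge0.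
Qed.

Lemma Em_cat m n k : `|Em m (n + k) - Em m n - Em (m + n) k| <= CG.
Proof.
rewrite /Em Ex_cat -(Jx_left m n k) -(Jx_right m n k) ler_norml; apply/andP; split.
  rewrite lerBrDr lerBrDr -(Jx_cst m n k (- CG)) -!JxD; apply: Jx_le => v v' vw vw' qp.
  by have := Gadd vw vw' qp; rewrite ler_norml; lra.
rewrite lerBlDr lerBlDr -(Jx_cst m n k CG) -!JxD; apply: Jx_le => v v' vw vw' qp.
by have := Gadd vw vw' qp; rewrite ler_norml; lra.
Qed.

Lemma Em_le m n : (0 < n)%N -> `|Em m n| <= n%:R * (1 + B + CG).
Proof.
have CG0' := CG0; have E1 m' : `|Em m' 1| <= 1 + B.
  have a (x : R) : `|x| <= 1 + x ^+ 2.
    by have := sqr_ge0 (`|x| - 1); rewrite sqrrB1 real_normK ?num_real//; have := normr_ge0 x; lra.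
  have : Ex m' 1 (fun v => `|G m' v|) <= 1 + B.
    apply: (@le_trans _ _ (Ex m' 1 (fun v => 1 + G m' v ^+ 2))).
      by apply: Ex_le => v _ _; exact: a.
    by rewrite ExD Ex_cst lerD2l.
  apply: le_trans; rewrite ler_norml -mulN1r -ExZ; apply/andP; split; apply: Ex_le => v _ _.
    by rewrite mulN1r lerNl ler_normr lexx orbT.
  exact: ler_norm.
case: n => // n _; elim: n m => [|n IH] m; first by rewrite mul1r; apply: (le_trans (E1 m)); lra.
rewrite -addn1; have := Em_cat m n.+1 1; have := IH m; have := E1 (m + n.+1)%N.
rewrite natrD mulrDl !ler_norml; lra.
Qed.
End AlmostAdditive.
End WeightedTree.

(** * Law of large numbers for harmonic measure *)

Lemma ln_almost_mul {R : realType} (x y z K : R) : 0 < x -> 0 < y -> 0 < z -> 0 < K ->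
  x <= K * (y * z) -> K^-1 * (y * z) <= x -> `|- ln x - - ln y - - ln z| <= ln K.
Proof.
move=> x0 y0 z0 K0 h1 h2; have yz : 0 < y * z by rewrite mulr_gt0.
have : ln x <= ln K + (ln y + ln z).
  by rewrite -!lnM ?posrE// ler_ln ?posrE ?mulr_gt0.
have : - ln K + (ln y + ln z) <= ln x.
  by rewrite -lnV ?posrE// -!lnM ?posrE ?invr_gt0// ler_ln ?posrE ?mulr_gt0 ?invr_gt0.
by rewrite ler_norml; lra.
Qed.

Section Masses.
Context {R : realType}.
Variables (d : nat -> nat) (psi : nat -> nat -> C R -> C R) (eta : R) (V : set (C R)).
Hypothesis sys : conformal_system d psi eta V.
Variable omega : probability (borelC R) R.
Hypothesis hm : is_harmonic_measure (lset d psi 0) infty omega.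
Implicit Types (z w y : C R) (u v x : seq nat) (m n k : nat).

Let et0 : 0 < eta. Proof. by case: sys => /andP[]. Qed.
Let et1 : eta < 1. Proof. by case: sys => /andP[]. Qed.

Local Notation comp := (comp psi).
Local Notation cyl := (cyl psi).
Local Notation okw := (okw d).
Local Notation cd := (cdist eta).
Local Notation lam := (lam psi).
Local Notation Pm := (Pm psi omega).
Local Notation words := (words d).

Lemma Pm_ge0 u : 0 <= Pm u. Proof. exact: om_ge0. Qed.

(* The law of the block of symbols at levels [m, m + size v). *)
Definition qm m v : R := \sum_(u <- words 0 m) Pm (u ++ v).

Lemma qm_ge0 m v : 0 <= qm m v.
Proof. by apply: sumr_ge0 => u _; exact: Pm_ge0. Qed.

Lemma qm0 v : qm 0 v = Pm v.
Proof. by rewrite /qm /= big_seq1. Qed.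

Lemma qm_total m n : \sum_(v <- words m n) qm m v = 1.
Proof. by rewrite exchange_big /= -(@words_cat R d 0 m n Pm) (Pm_total sys hm). Qed.

Lemma qm_right m n k v : v \in words m n -> \sum_(v' <- words (m + n) k) qm m (v ++ v') = qm m v.
Proof.
rewrite wordsP => /andP[/eqP sv ov].
rewrite exchange_big /= /qm big_seq [RHS]big_seq; apply: eq_bigr => u.
rewrite wordsP => /andP[/eqP su ou].
rewrite (Pm_sum sys hm k (u := u ++ v)); last by rewrite okw_cat ou add0n su.
by rewrite size_cat su sv; apply: eq_bigr => v' _; rewrite catA.
Qed.

Lemma qm_left m n k v : v \in words (m + n) k -> \sum_(u <- words m n) qm m (u ++ v) = qm (m + n) v.
Proof.
move=> _; rewrite exchange_big /= /qm (@words_cat R d 0 m n (fun u => Pm (u ++ v))) add0n.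
by apply: eq_bigr => u _; apply: eq_bigr => u' _; rewrite catA.
Qed.

(** [quasi_bernoulli] summed over all words [u'] of length [m]: their masses add up to 1, those of
    [u' ++ v] to [qm m v]. *)
Lemma qm_quasi : exists2 C1 : R, 1 <= C1 & forall m u v, u \in words 0 m -> okw m v ->
  Pm (u ++ v) <= C1 * (Pm u * qm m v) /\ Pm u * qm m v <= C1 * Pm (u ++ v).
Proof.
have [C1 C11 H] := quasi_bernoulli sys hm; exists C1 => // m u v.
rewrite wordsP => /andP[/eqP su ou] ov.
have okE u' : u' \in words 0 m -> okw 0 u' /\ size u' = m by rewrite wordsP => /andP[/eqP].
split.
  rewrite -[leLHS]mulr1 -(Pm_total sys hm m) mulr_sumr.
  have -> : C1 * (Pm u * qm m v) = \sum_(u' <- words 0 m) C1 * Pm (u' ++ v) * Pm u.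
    by rewrite -mulr_suml -mulr_sumr -/(qm m v); ring.
  rewrite big_seq [leRHS]big_seq; apply: ler_sum => u' /okE[ou' su'].
  by apply: H; rewrite ?su ?su'.
have -> : Pm u * qm m v = \sum_(u' <- words 0 m) Pm (u' ++ v) * Pm u.
  by rewrite -mulr_suml -/(qm m v) mulrC.
rewrite -[leRHS]mulr1 -(Pm_total sys hm m) mulr_sumr.
rewrite big_seq [leRHS]big_seq; apply: ler_sum => u' /okE[ou' su'].
by apply: H; rewrite ?su ?su'.
Qed.

Lemma qm_product : exists2 C1 : R, 1 <= C1 & forall m n k v v', v \in words m n -> v' \in words (m + n) k ->
  qm m (v ++ v') <= C1 * (qm m v * qm (m + n) v') /\ C1^-1 * (qm m v * qm (m + n) v') <= qm m (v ++ v').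
Proof.
have [C1 C11 H] := qm_quasi; have C10 : 0 < C1 by lra.
exists C1 => // m n k v v'; rewrite !wordsP => /andP[/eqP sv ov] /andP[_ ov'].
have uP u : u \in words 0 m -> Pm (u ++ v ++ v') <= C1 * (Pm (u ++ v) * qm (m + n) v') /\
    Pm (u ++ v) * qm (m + n) v' <= C1 * Pm (u ++ v ++ v').
  rewrite wordsP => /andP[/eqP su ou]; rewrite catA; apply: H => //.
  by rewrite wordsP size_cat su sv eqxx okw_cat ou add0n su.
split; last rewrite mulrC ler_pdivrMr//.
  rewrite /qm mulr_suml mulr_sumr big_seq [leRHS]big_seq; apply: ler_sum => u /uP[h _].
  exact: h.
rewrite [leRHS]mulrC /qm mulr_suml mulr_sumr big_seq [leRHS]big_seq; apply: ler_sum => u /uP[_ h].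
exact: h.
Qed.

Definition Gmass m v : R := - ln (qm m v).
Definition Glam m v : R := - ln (lam m v).

Lemma Gmass_add : exists2 CG : R, 0 <= CG & forall m n k v v', v \in words m n -> v' \in words (m + n) k ->
  0 < qm m (v ++ v') -> `|Gmass m (v ++ v') - Gmass m v - Gmass (m + n) v'| <= CG.
Proof.
have [C1 C11 H] := qm_product; have C10 : 0 < C1 by lra.
exists (ln C1); first by rewrite ln_ge0.
move=> m n k v v' vw vw' qp; have [h1 h2] := H _ _ _ _ _ vw vw'.
have p : 0 < qm m v * qm (m + n) v'.
  have := lt_le_trans qp h1; rewrite pmulr_rgt0//.
have qv : 0 < qm m v.
  by rewrite lt_neqAle qm_ge0 andbT; apply/eqP => h; rewrite -h mul0r ltxx in p.
have qv' : 0 < qm (m + n) v' by rewrite -(pmulr_rgt0 _ qv).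
exact: ln_almost_mul.
Qed.

Lemma Glam_add m n k v v' : v \in words m n -> v' \in words (m + n) k ->
  `|Glam m (v ++ v') - Glam m v - Glam (m + n) v'| <= ln cd.
Proof.
rewrite !wordsP => /andP[/eqP sv ov] /andP[_ ov'].
have o : okw m (v ++ v') by rewrite okw_cat ov sv.
have l1 := lam_gt0 sys ov; have l2 := lam_gt0 sys ov'; have l3 := lam_gt0 sys o.
have c0 := cdist_gt0 eta.
have := lam_cat sys o; rewrite sv => /andP[h1 h2].
rewrite mulrC in h1; exact (ln_almost_mul l3 l1 l2 c0 h2 h1).
Qed.

(** With [t = - ln x] the claim is [t^2 <= 4 exp t], the square of [t / 2 <= exp (t / 2)]. *)
Lemma xlnx2 (x : R) : 0 <= x -> x <= 1 -> x * (- ln x) ^+ 2 <= 4.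
Proof.
rewrite le_eqVlt => /predU1P[<-|x0]; first by rewrite mul0r.
move=> x1; have [t0 xE] : 0 <= - ln x /\ x = expR (- - ln x).
  by split; [rewrite oppr_ge0 ln_le0|rewrite opprK lnK].
set t := - ln x in t0 xE *; rewrite xE expRN mulrC ler_pdivrMr ?expR_gt0//.
have h : t / 2 <= expR (t / 2) by apply: le_trans (expR_ge1Dx _); lra.
have -> : expR t = expR (t / 2) ^+ 2 by rewrite -expRM_natl; congr expR; field.
have -> : t ^+ 2 = 4 * (t / 2) ^+ 2 by field.
by rewrite ler_pM2l// lerXn2r// nnegrE ?expR_ge0// divr_ge0.
Qed.

(** Each one-letter cylinder contains a disk of radius [2 r] about the image of 0, and these
    cylinders are disjoint; so the images of 0 are [2 r] apart and fall in different cells of a grid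
    of side [r]. *)
Lemma d_bounded : exists D : nat, forall m, (d m <= D)%N.
Proof.
have m20 := m2_gt0 eta; have c0 := cdist_gt0 eta.
pose r := step_low eta / cd / 4; have r0 : 0 < r by rewrite !divr_gt0.
pose N := (Num.truncn (2 / r)).+1.
exists (N * N)%N => m.
pose cc i : C R := comp m [:: i] 0.
have z1 : cabs (0 : C R) < 1 by rewrite cabs0.
have ok1 i : (i < d m)%N -> okw m [:: i] by move=> id; rewrite /= id.
have c1 i : (i < d m)%N -> cabs (cc i) < 1 by move=> id; exact (comp_lt1 sys (ok1 _ id) z1).
have far i j : (i < d m)%N -> (j < d m)%N -> cabs (cc j - cc i) < 2 * r -> i = j.
  move=> id jd h.
  have [y] : exists2 y, cabs (y - 0) < 1 & comp m [:: i] y = cc j.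
    apply: (image_ball sys (ok1 _ id)) => //; first by rewrite cabs0 add0r.
    apply: lt_le_trans h _; rewrite mulr1.
    have /andP[l1 _] := lam1 sys id.
    have : step_low eta / cd <= lam m [:: i] / cd by rewrite ler_pM2r ?invr_gt0.
    by rewrite /r; lra.
  rewrite subr0 => y1 yE.
  have [] // : [:: i] = [:: j].
  have ci : cyl m [:: i] (cc j) by exists y.
  have cj : cyl m [:: j] (cc j) by exists 0.
  exact (cyl_uniq sys (erefl 1%N : size [:: i] = size [:: j]) (ok1 _ id) (ok1 _ jd) ci cj).
pose cell (p : C R -> R) i := Num.truncn ((p (cc i) + 1) / r).
have cellP (p : C R -> R) i : (forall z, `|p z| <= cabs z) -> (i < d m)%N ->
    (cell p i < N)%N /\ (cell p i)%:R * r <= p (cc i) + 1 < (cell p i).+1%:R * r.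
  move=> pl id; have := c1 i id; have := pl (cc i); rewrite ler_norml => /andP[h1 h2] h3.
  have ge0 : 0 <= (p (cc i) + 1) / r by rewrite divr_ge0 ?(ltW r0)//; lra.
  have := truncn_itv ge0; rewrite ler_pdivlMr// ltr_pdivrMr// => h4; split=> //.
  rewrite ltnS; apply: le_truncn; rewrite ler_pM2r ?invr_gt0//; lra.
pose f (i : 'I_(d m)) : 'I_N * 'I_N :=
  (Ordinal (cellP (@re R) i (@re_le R) (ltn_ord i)).1, Ordinal (cellP (@im R) i (@im_le R) (ltn_ord i)).1).
have finj : injective f.
  move=> i j [] e1 e2; apply/val_inj/far; rewrite ?ltn_ord//.
  have [_ /andP[a1 a2]] := cellP (@re R) i (@re_le R) (ltn_ord i).
  have [_ /andP[a3 a4]] := cellP (@re R) j (@re_le R) (ltn_ord j).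
  have [_ /andP[b1 b2]] := cellP (@im R) i (@im_le R) (ltn_ord i).
  have [_ /andP[b3 b4]] := cellP (@im R) j (@im_le R) (ltn_ord j).
  rewrite -e1 in a3 a4; rewrite -e2 in b3 b4.
  apply: le_lt_trans (cabs_le _) _; rewrite reB imB.
  rewrite -!natr1 !mulrDl !mul1r in a2 a4 b2 b4.
  have q1 : `|re (cc j) - re (cc i)| < r by rewrite ltr_norml; apply/andP; split; lra.
  have q2 : `|im (cc j) - im (cc i)| < r by rewrite ltr_norml; apply/andP; split; lra.
  lra.
by have := leq_card _ finj; rewrite card_prod !card_ord.
Qed.

Lemma size_words1 m : size (words m 1) = d m.
Proof. by rewrite /= (size_allpairs cons (iota 0 (d m)) [:: [::]]) size_iota muln1. Qed.

Lemma qm_le1 m n v : v \in words m n -> qm m v <= 1.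
Proof.
move=> vw; rewrite -(qm_total m n) (bigD1_seq v) ?words_uniq//= lerDl.
by apply: sumr_ge0 => u _; exact: qm_ge0.
Qed.

(** Each of the boundedly many letters contributes at most 4, by [xlnx2]. *)
Lemma Gmass_step : exists B : R, forall m, Ex d qm m 1 (fun v => Gmass m v ^+ 2) <= B.
Proof.
have [D HD] := d_bounded; exists (4 * D%:R) => m.
apply: (@le_trans _ _ (\sum_(v <- words m 1) 4)).
  rewrite /Ex big_seq [leRHS]big_seq; apply: ler_sum => v vw.
  by apply: xlnx2; [exact: qm_ge0|exact: qm_le1 vw].
by rewrite big_const_seq count_predT size_words1 iter_addr addr0 -[leLHS]mulr_natr ler_pM2l// ler_nat.
Qed.

Lemma Glam_step : exists B : R, forall m, Ex d qm m 1 (fun v => Glam m v ^+ 2) <= B.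
Proof.
have m20 := m2_gt0 eta; have e8 : 0 < 8 / eta by rewrite divr_gt0.
exists ((`|ln (step_low eta)| + `|ln (8 / eta)|) ^+ 2) => m.
rewrite -[leRHS](Ex_cst qm_total m 1); apply: Ex_le; first exact: qm_ge0.
move=> v; rewrite wordsP => /andP[/eqP sv ov] _.
case: v sv ov => [//|i [|//]] _ ov; have id : (i < d m)%N by move: ov; rewrite /= andbT.
have /andP[h1 h2] := lam1 sys id; have lp := lam_gt0 sys ov.
rewrite -ler_ln ?posrE// in h1; rewrite -ler_ln ?posrE// in h2.
rewrite -[leLHS]real_normK ?num_real// lerXn2r// ?nnegrE ?addr_ge0// /Glam normrN.
have := ler_norm (ln (8 / eta)); have := ler_norm (- ln (step_low eta)); rewrite normrN.
have := normr_ge0 (ln (8 / eta)); have := normr_ge0 (ln (step_low eta)).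
by move=> *; rewrite ler_norml; apply/andP; split; lra.
Qed.

Lemma Gmass_mono m n k v v' : v \in words m n -> v' \in words (m + n) k -> 0 < qm m (v ++ v') ->
  Gmass m v <= Gmass m (v ++ v').
Proof.
move=> vw vw' qp; have h : qm m (v ++ v') <= qm m v.
  rewrite -(qm_right k vw) (bigD1_seq v') ?words_uniq//= lerDl.
  by apply: sumr_ge0 => u _; exact: qm_ge0.
by rewrite /Gmass lerN2 ler_ln ?posrE// (lt_le_trans qp).
Qed.

Lemma Glam_mono : exists2 C2 : R, 0 <= C2 & forall m n k v v', v \in words m n -> v' \in words (m + n) k ->
  Glam m v <= Glam m (v ++ v') + C2.
Proof.
have aux (x y z L K : R) : `|- x - - y - - z| <= L -> z <= K -> - y <= - x + (L + `|K|).
  by rewrite ler_norml; have := ler_norm K; lra.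
have c0 := cdist_gt0 eta; have D00 := D0_gt0 sys; have c1 := cdist_ge1 sys.
exists (ln cd + `|ln (cd * contr_const eta)|); first by rewrite addr_ge0// ln_ge0.
move=> m n k v v' vw vw'; have add := Glam_add vw vw'; move: vw'; rewrite wordsP => /andP[_ ov'].
have lp := lam_gt0 sys ov'; have h : lam (m + n) v' <= cd * contr_const eta.
  apply: (le_trans (lam_le sys ov')); apply: ler_piMr; first by apply: mulr_ge0; exact: ltW.
  have /andP[k0 k1] : 0 < kap eta < 1 by apply: kap01; case: sys.
  by apply: exprn_ile1; exact: ltW.
have K0 : 0 < cd * contr_const eta by apply: mulr_gt0.
rewrite -(ler_ln lp K0) in h.
exact (aux _ _ _ _ _ add h).
Qed.

End Masses.

(* Every large [n] lies between [j 2^k] and [(j+1) 2^k] with [j] large, where almost monotonicity interpolates. *)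
Lemma fill_in {R : realType} (S e : nat -> R) (K : R) : 0 <= K ->
  (forall n h, S n <= S (n + h)%N + K) ->
  (forall n h, (0 < h)%N -> e (n + h)%N <= e n + K * h%:R) ->
  (forall r j : nat, (0 < j)%N -> exists k0, forall k, (k0 <= k)%N ->
    `|S (j * 2 ^ k)%N - e (j * 2 ^ k)%N| <= (j * 2 ^ k)%:R / r.+1%:R) ->
  forall eps : R, 0 < eps -> exists N, forall n, (N <= n)%N -> `|S n - e n| <= eps * n%:R.
Proof.
move=> K0 Sm em conv eps eps0.
have trP (x : R) : 0 <= x -> x < (Num.truncn x).+1%:R by move=> /truncn_itv/andP[].
(* [J] makes [K 2^k], the error of interpolation, at most [eps n / 4] once [n >= J 2^k]; [r] does
   the same for the deviation at the grid points, which are at most [2 n]. *)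
pose J := (Num.truncn (4 * K / eps)).+1.
have JP : 4 * K < eps * J%:R.
  have h : 0 <= 4 * K / eps by rewrite divr_ge0 ?mulr_ge0// ltW.
  by have := trP _ h; rewrite ltr_pdivrMr// [_ * eps]mulrC.
pose r := Num.truncn (8 / eps).
have rP : 8 < eps * r.+1%:R.
  have h : 0 <= 8 / eps by rewrite divr_ge0// ltW.
  by have := trP _ h; rewrite ltr_pdivrMr// [_ * eps]mulrC.
(* The hypothesis is not uniform in [j], but only the finitely many [j] between [J] and [2 J]
   occur. *)
have [k0 k0P] : exists k0, forall k j, (k0 <= k)%N -> (J <= j <= J + J)%N ->
    `|S (j * 2 ^ k)%N - e (j * 2 ^ k)%N| <= (j * 2 ^ k)%:R / r.+1%:R.
  have : forall m, exists k0, forall k j, (k0 <= k)%N -> (J <= j <= J + m)%N ->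
      `|S (j * 2 ^ k)%N - e (j * 2 ^ k)%N| <= (j * 2 ^ k)%:R / r.+1%:R.
    elim=> [|m [k1 k1P]].
      have [k0 k0P] := conv r J isT; exists k0 => k j kk; rewrite addn0 => jj.
      by have /andP[q1 q2] := jj; have -> : j = J by [apply/eqP; rewrite eqn_leq q1 q2]; apply: k0P.
    have [k2 k2P] := conv r (J + m.+1)%N isT; exists (maxn k1 k2) => k j.
    rewrite geq_max => /andP[kk1 kk2] jj.
    have [->|jn] := eqVneq j (J + m.+1)%N; first exact: k2P.
    by apply: k1P => //; lia.
  exact.
exists (J * 2 ^ k0)%N => n nJ.
have J0 : (0 < J)%N by [].
have n1 : (2 ^ k0 <= n %/ J)%N by rewrite leq_divRL// mulnC.
have q0 : (0 < n %/ J)%N by apply: leq_trans n1; rewrite expn_gt0.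
have /andP[t1 t2] := trunc_log_bounds (isT : 1 < 2)%N q0.
(* The scale for which [n / 2^k] lies in [[J, 2 J)]. *)
set k := trunc_log 2 (n %/ J) in t1 t2.
have kk : (k0 <= k)%N by rewrite -ltnS -(ltn_exp2l _ _ (isT : 1 < 2)%N) (leq_ltn_trans n1).
have p2 : (0 < 2 ^ k)%N by rewrite expn_gt0.
have nJ1 : (J * 2 ^ k <= n)%N by rewrite mulnC -leq_divRL.
have nJ2 : (n < J * 2 ^ k.+1)%N by rewrite mulnC -ltn_divLR.
pose j := (n %/ 2 ^ k)%N.
have j1 : (J <= j)%N by rewrite leq_divRL.
have j2 : (j < J + J)%N by rewrite ltn_divLR// addnn -muln2 -mulnA -expnS.
have nj1 : (j * 2 ^ k <= n)%N by exact: leq_trunc_div.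
have nj2 : (n < j.+1 * 2 ^ k)%N by rewrite -ltn_divLR.
have a1 := k0P k j kk (ltac:(lia)); have a2 := k0P k j.+1 kk (ltac:(lia)).
set n1' := (j * 2 ^ k)%N in nj1 a1; set n2' := (j.+1 * 2 ^ k)%N in nj2 a2.
have n21 : n2' = (n1' + 2 ^ k)%N by rewrite /n2' /n1' mulSn addnC.
have J2n : J%:R * (2 ^ k)%:R <= n%:R :> R by rewrite -natrM ler_nat.
have n2n : (n2' <= 2 * n)%N.
  have : (2 ^ k <= J * 2 ^ k)%N by rewrite leq_pmull.
  by rewrite n21 mul2n -addnn => h; apply: leq_add nj1 (leq_trans h nJ1).
have r0 : 0 < r.+1%:R :> R by rewrite ltr0n.
have nn : 0 <= n%:R :> R by rewrite ler0n.
have Kk : K * (2 ^ k)%:R <= eps / 4 * n%:R.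
  have h1 : 4 * K * (2 ^ k)%:R <= eps * J%:R * (2 ^ k)%:R by rewrite ler_wpM2r ?ltW.
  have h2 : eps * (J%:R * (2 ^ k)%:R) <= eps * n%:R by rewrite ler_wpM2l// ltW.
  lra.
have Kn : K <= eps / 4 * n%:R.
  apply: le_trans Kk; rewrite -[leLHS]mulr1; apply: ler_wpM2l => //; rewrite ler1n; exact: p2.
have rr : n2'%:R / r.+1%:R <= eps / 4 * n%:R.
  rewrite ler_pdivrMr//; have : n2'%:R <= 2 * n%:R :> R by rewrite -natrM ler_nat.
  have : 8 * n%:R <= eps * r.+1%:R * n%:R by rewrite ler_wpM2r// ltW.
  lra.
have rr1 : n1'%:R / r.+1%:R <= n2'%:R / r.+1%:R :> R.
  by rewrite ler_pM2r ?invr_gt0// ler_nat n21 leq_addr.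
clearbody n1' n2'; clear n1 k0P JP rP nJ t1 t2 kk nJ1 nJ2 j1 j2 q0 conv.
have nj2' := ltnW nj2.
have s1 := Sm n (n2' - n)%N; rewrite (subnKC nj2') in s1.
have s2 := Sm n1' (n - n1')%N; rewrite (subnKC nj1) in s2.
have e1 : e n2' <= e n + K * (2 ^ k)%:R.
  have h1 : (0 < n2' - n)%N by rewrite subn_gt0.
  have h := em n (n2' - n)%N h1; rewrite (subnKC nj2') in h.
  apply: (le_trans h); rewrite lerD2l; apply: ler_wpM2l => //; rewrite ler_nat leq_subLR n21.
  by rewrite leq_add2r.
have e2 : e n <= e n1' + K * (2 ^ k)%:R.
  have [->|nn1] := eqVneq n1' n; first by rewrite lerDl mulr_ge0.
  have h1 : (0 < n - n1')%N by rewrite subn_gt0 ltn_neqAle nn1.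
  have h := em n1' (n - n1')%N h1; rewrite (subnKC nj1) in h.
  by apply: (le_trans h); rewrite lerD2l; apply: ler_wpM2l => //; rewrite ler_nat leq_subLR -n21.
have aux (Sn S1 S2 en e1' e2' q1 q2 Kp nn' : R) : Sn <= S2 + K -> S1 <= Sn + K -> e2' <= en + Kp -> en <= e1' + Kp ->
    `|S1 - e1'| <= q1 -> `|S2 - e2'| <= q2 -> q1 <= q2 -> q2 <= eps / 4 * nn' -> Kp <= eps / 4 * nn' ->
    K <= eps / 4 * nn' -> `|Sn - en| <= eps * nn'.
  move=> i1 i2 i3 i4; rewrite !ler_norml => /andP[b1 b2] /andP[b3 b4] i5 i6 i7 i8; apply/andP; split; lra.
exact: aux s1 s2 e1 e2 a1 a2 rr1 rr Kk Kn.
Qed.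

Lemma geo_series {R : realType} (a th : R) : 0 <= a -> 0 < th < 1 ->
  (\sum_(0 <= k <oo) (a * th ^+ k)%:E <= (a / (1 - th))%:E)%E.
Proof.
move=> a0 /andP[t0 t1]; apply: lime_le.
  by apply: is_cvg_nneseries => n _ _; rewrite lee_fin mulr_ge0// exprn_ge0// ltW.
apply: nearW => n; rewrite sumEFin lee_fin -mulr_sumr ler_pdivlMr ?subr_gt0// -mulrA -[leRHS]mulr1 ler_wpM2l//.
have -> : \sum_(0 <= k < n) th ^+ k = (1 - th ^+ n) / (1 - th).
  elim: n => [|n IHn]; first by rewrite big_geq// expr0 subrr mul0r.
  by rewrite big_nat_recr//= IHn !exprS; field; rewrite subr_eq0 gt_eqF.
rewrite divfK; last by rewrite subr_eq0 gt_eqF.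
by rewrite gerBl exprn_ge0// ltW.
Qed.

Section Null.
Context {R : realType} (omega : probability (borelC R) R).

Lemma null_bigcup (F : nat -> set (C R)) : (forall k, measurable (F k : set (borelC R))) ->
  (forall k, omega (F k) = 0%E) ->
  measurable (\bigcup_k F k : set (borelC R)) /\ omega (\bigcup_k F k) = 0%E.
Proof.
move=> mF F0; have mU : measurable (\bigcup_k F k : set (borelC R)) by apply: (@bigcup_measurable _ (borelC R)).
split=> //; apply/eqP; rewrite eq_le measure_ge0 andbT.
have h : (omega (\bigcup_k F k) <= \sum_(0 <= k <oo) omega (F k))%E.
  exact (@measure_sigma_subadditive _ R (borelC R) omega (\bigcup_k F k) F mF mU (@subset_refl _ _)).
apply: (le_trans h); rewrite eseries0// => k _ _; exact: F0.
Qed.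

Lemma null_setU (A B : set (C R)) : measurable (A : set (borelC R)) -> measurable (B : set (borelC R)) ->
  omega A = 0%E -> omega B = 0%E -> measurable (A `|` B : set (borelC R)) /\ omega (A `|` B) = 0%E.
Proof.
move=> mA mB A0 B0; have -> : A `|` B = \bigcup_k (fun k => if k == 0%N then A else B) k.
  apply/seteqP; split=> x [].
  - by exists 0%N.
  - by exists 1%N.
  - by move=> [|k] _ /=; [left|right].
by apply: null_bigcup => [] [|k].
Qed.
End Null.

(** * Chebyshev and Borel-Cantelli along dyadic scales *)

Section LargeNumbers.
Context {R : realType}.
Variables (d : nat -> nat) (psi : nat -> nat -> C R -> C R) (eta : R) (V : set (C R)).
Hypothesis sys : conformal_system d psi eta V.
Variable omega : probability (borelC R) R.
Hypothesis hm : is_harmonic_measure (lset d psi 0) infty omega.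
Implicit Types (z w x y : C R) (u v : seq nat) (m n k : nat).

Local Notation K0 := (lset d psi 0).
Local Notation cyl := (cyl psi).
Local Notation okw := (okw d).
Local Notation Pm := (Pm psi omega).
Local Notation words := (words d).
Local Notation qm := (qm d psi omega).

Definition ev n (B : pred (seq nat)) : set (C R) :=
  [set x | exists2 u, u \in [seq u <- words 0 n | B u] & cyl 0 u x].

Lemma evP n B : measurable (ev n B : set (borelC R)) /\ om omega (ev n B) = \sum_(u <- words 0 n | B u) Pm u.
Proof.
have wP u : u \in [seq u <- words 0 n | B u] -> okw 0 u /\ size u = n.
  by rewrite mem_filter wordsP => /and3P[_ /eqP].
pose s := [seq u <- words 0 n | B u].
have h1 u : u \in s -> measurable (cyl 0 u : set (borelC R)) by move=> /wP[ou _]; exact: (cyl_meas sys ou).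
have h2 : uniq s by rewrite filter_uniq// words_uniq.
have h3 u v z : u \in s -> v \in s -> cyl 0 u z -> cyl 0 v z -> u = v.
  by move=> /wP[ou su] /wP[ov sv]; apply: (cyl_uniq sys) => //; rewrite su sv.
have [z1 z2] := om_seq omega h1 h2 h3.
by split; [exact: z1|rewrite /ev z2 /s big_filter].
Qed.

Lemma ev_negligible (F : nat -> set (C R)) : (forall k, measurable (F k : set (borelC R))) ->
  (exists a theta : R, [/\ 0 <= a, 0 < theta < 1 & forall k, om omega (F k) <= a * theta ^+ k]) ->
  omega (lim_sup_set F) = 0%E.
Proof.
move=> mF [a [th [a0 t01 FP]]].
apply: (@lim_sup_set_cvg0 _ (borelC R) R omega F mF).
apply: (@le_lt_trans _ _ (a / (1 - th))%:E); last exact: ltry.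
apply: le_trans (geo_series a0 t01); apply: lee_nneseries => // k _.
by have := FP k; rewrite -lee_fin -(om_fin omega (mF k)).
Qed.

Section OneQuantity.
Variables (G : nat -> seq nat -> R) (CG B : R).
Hypothesis CG0 : 0 <= CG.
Hypothesis Gadd : forall m n k v v', v \in words m n -> v' \in words (m + n) k -> 0 < qm m (v ++ v') ->
  `|G m (v ++ v') - G m v - G (m + n) v'| <= CG.
Hypothesis B1 : forall m, Ex d qm m 1 (fun v => G m v ^+ 2) <= B.

Let q0 := @qm_ge0 R d psi omega.
Let qs := qm_total sys hm.
Let qr m n k v (vw : v \in words m n) := qm_right sys hm k vw.
Let ql m n k v (vw : v \in words (m + n) k) := qm_left psi omega vw.

Local Notation Em := (Em d qm G).

(** Chebyshev's inequality with the variance decay of [Vm_bound]. *)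
Lemma deviation : exists A theta : R, [/\ 0 <= A, 0 < theta < 1 & forall j k (e : R), (0 < j)%N -> 0 < e ->
  om omega (ev (j * 2 ^ k) (fun u => e * (j * 2 ^ k)%:R < `|G 0 u - Em 0 (j * 2 ^ k)|)) <= A / e ^+ 2 * theta ^+ k].
Proof.
have [C1 C11 H] := qm_product sys hm; have C10 : 0 < C1 by lra.
have c01 : 0 < C1^-1 <= 1 by rewrite invr_gt0 C10 invf_le1.
have [A [th [A0 t01 AP]]] := Vm_bound q0 qs qr ql c01 (fun m n k v v' h h' => (H m n k v v' h h').2) CG0 Gadd B1.
exists A, th; split=> // j k e j0 e0; rewrite (evP _ _).2; set n := (j * 2 ^ k)%N.
have n0 : 0 < n%:R :> R by rewrite ltr0n muln_gt0 j0 expn_gt0.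
have en : 0 < (e * n%:R) ^+ 2 by rewrite exprn_gt0// mulr_gt0.
rewrite -(ler_pM2l en).
have -> : (e * n%:R) ^+ 2 * (A / e ^+ 2 * th ^+ k) = A * n%:R ^+ 2 * th ^+ k.
  by field; rewrite gt_eqF.
apply: le_trans (AP j k j0); rewrite -/n mulr_sumr /Vm /Vx /Ex big_mkcond /=.
apply: ler_sum => u _; rewrite qm0; case: ifPn => [h|_]; last by rewrite mulr_ge0 ?sqr_ge0 ?Pm_ge0.
rewrite mulrC ler_wpM2l ?Pm_ge0// -[leRHS]real_normK ?num_real// lerXn2r ?nnegrE ?normr_ge0//; last exact: ltW.
by rewrite mulr_ge0 ?ltW.
Qed.

(** For each precision [1 / (r + 1)] and each multiplier [j] the probabilities are summable in [k];
    the exceptional set is the countable union of the corresponding limsup sets. *)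
Lemma deviation_null : exists2 Z : set (C R), measurable (Z : set (borelC R)) /\ omega Z = 0%E &
  forall x, ~ Z x -> forall r j : nat, (0 < j)%N -> exists k0, forall k, (k0 <= k)%N ->
    forall u, u \in words 0 (j * 2 ^ k) -> cyl 0 u x ->
    `|G 0 u - Em 0 (j * 2 ^ k)| <= (j * 2 ^ k)%:R / r.+1%:R.
Proof.
have [A [th [A0 t01 AP]]] := deviation.
pose F r j k := ev (j.+1 * 2 ^ k) (fun u => r.+1%:R^-1 * (j.+1 * 2 ^ k)%:R < `|G 0 u - Em 0 (j.+1 * 2 ^ k)|).
have mF r j k : measurable (F r j k : set (borelC R)) by exact: (evP _ _).1.
have nF r j : omega (lim_sup_set (F r j)) = 0%E.
  apply: ev_negligible => //; exists (A / (r.+1%:R^-1) ^+ 2), th; split=> //.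
    by rewrite divr_ge0// sqr_ge0.
  by move=> k; apply: AP => //; rewrite invr_gt0.
have mL r j : measurable (lim_sup_set (F r j) : set (borelC R)).
  by apply: (@bigcapT_measurable _ (borelC R)) => n; apply: (@bigcup_measurable _ (borelC R)).
pose Z : set (borelC R) := \bigcup_r \bigcup_j lim_sup_set (F r j).
have nJ r := null_bigcup (mL r) (nF r).
exists Z; first exact: null_bigcup (fun r => (nJ r).1) (fun r => (nJ r).2).
move=> x nx r j j0; apply: contrapT => nk; apply: nx; exists r => //; exists j.-1 => // n _.
apply: contrapT => nn; apply: nk; exists n => k nk u uw cu; rewrite leNgt; apply/negP => h.
apply: nn; exists k => //; rewrite /F prednK//; exists u => //.
by rewrite mem_filter uw andbT mulrC.
Qed.

Hypothesis Gmono : forall m n k v v', v \in words m n -> v' \in words (m + n) k -> 0 < qm m (v ++ v') ->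
  G m v <= G m (v ++ v') + CG.

Lemma words_split n h x : K0 x -> exists u v, [/\ u \in words 0 n, v \in words (0 + n) h,
  cyl 0 u x, cyl 0 (u ++ v) x & u ++ v \in words 0 (n + h)].
Proof.
move=> /(_ (n + h)%N)[w]; rewrite wordsP => /andP[/eqP sw ow] cw.
have st : size (take n w) = n by rewrite size_takel// sw leq_addr.
have : okw 0 (take n w ++ drop n w) by rewrite cat_take_drop.
rewrite okw_cat st => /andP[ ow1 ow2].
exists (take n w), (drop n w); rewrite !wordsP st size_drop sw addKn !eqxx cat_take_drop sw eqxx ow ow1 ow2; split=> //.
by apply: (cyl_pre sys (u := take n w) (v := drop n w)); rewrite cat_take_drop.
Qed.

(** Along the coding of a point [G] is almost increasing by [Gmono], and its means grow at most
    linearly between two levels; these are the hypotheses of [fill_in]. *)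
Lemma lln_null : exists2 Z : set (C R), measurable (Z : set (borelC R)) /\ omega Z = 0%E &
  forall x, ~ Z x -> K0 x -> (forall n u, u \in words 0 n -> cyl 0 u x -> 0 < Pm u) ->
  forall eps : R, 0 < eps -> exists N, forall n, (N <= n)%N -> forall u, u \in words 0 n -> cyl 0 u x ->
    `|G 0 u - Em 0 n| <= eps * n%:R.
Proof.
have [Z mZ ZP] := deviation_null; exists Z => // x nx Kx pos eps eps0.
have B0 : 0 <= B by apply: le_trans (B1 0%N); rewrite -(Ex_cst qs 0 1 0); apply: Ex_le => // v _ _; exact: sqr_ge0.
pose wd n := xget [::] [set u | u \in words 0 n /\ cyl 0 u x].
have wdP n : wd n \in words 0 n /\ cyl 0 (wd n) x.
  by have [u uw cu] := Kx n; rewrite /wd; case: xgetP => [_ _ //|/(_ u)]; case.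
have wdE n u : u \in words 0 n -> cyl 0 u x -> u = wd n.
  have [w1 c1] := wdP n; move: w1; rewrite !wordsP => /andP[/eqP s1 o1] /andP[/eqP su ou] cu.
  by apply: (cyl_uniq sys _ ou o1 cu c1); rewrite su s1.
pose K := 1 + B + 2 * CG.
have K0' : 0 <= K by have := CG0; rewrite /K; lra.
have [||r j j0|N NP] := @fill_in R (fun n => G 0 (wd n)) (Em 0) K K0' _ _ _ eps eps0.
- move=> n h; have [u [v [uw vw cu cuv uvw]]] := words_split n h Kx.
  rewrite -(wdE _ _ uw cu) -(wdE _ _ uvw cuv).
  apply: (le_trans (Gmono uw vw _)); first by rewrite qm0; exact: pos uvw cuv.
  by rewrite lerD2l /K; have := CG0; have := B0; lra.
- move=> n h h0; have := Em_cat q0 qs qr ql Gadd 0 n h; have := Em_le q0 qs qr ql CG0 Gadd B1 (0 + n)%N h0.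
  rewrite !ler_norml => /andP[_ a1] /andP[_ a2].
  have h1 : CG <= CG * h%:R by rewrite ler_peMr// ler1n.
  by move: a1 a2 h1; rewrite /K; lra.
- by have [k0 k0P] := ZP x nx r j j0; exists k0 => k kk; have [w1 c1] := wdP (j * 2 ^ k)%N; exact: k0P.
- by exists N => n Nn u uw cu; rewrite (wdE n u uw cu); exact: NP.
Qed.
End OneQuantity.

Definition EL n : R := Em d qm (Gmass d psi omega) 0 n.
Definition El n : R := Em d qm (Glam psi) 0 n.

Lemma EL_le : exists2 M : R, 0 <= M & forall n, (0 < n)%N -> EL n <= M * n%:R.
Proof.
have [C1 C10 add1] := Gmass_add sys hm; have [B1 st1] := Gmass_step sys hm.
have q0 := @qm_ge0 R d psi omega; have qs := qm_total sys hm.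
have qr m n k v (vw : v \in words m n) := qm_right sys hm k vw.
have ql m n k v (vw : v \in words (m + n) k) := qm_left psi omega vw.
have h n (n0 : (0 < n)%N) := Em_le q0 qs qr ql C10 add1 st1 0 n0.
exists `|1 + B1 + C1| => // n n0; apply: (le_trans (ler_norm _)); apply: (le_trans (h n n0)).
by rewrite mulrC; apply: ler_wpM2r => //; exact: ler_norm.
Qed.

Lemma lln_set : exists Z : set (C R), [/\ measurable (Z : set (borelC R)), Z `<=` K0, omega Z = 1%E,
  forall x n u, Z x -> u \in words 0 n -> cyl 0 u x -> 0 < Pm u &
  forall x eps, Z x -> 0 < eps -> exists N, forall n, (N <= n)%N -> forall u, u \in words 0 n -> cyl 0 u x ->
    `|- ln (Pm u) - EL n| <= eps * n%:R /\ `|- ln (lam psi 0 u) - El n| <= eps * n%:R].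
Proof.
have [C1 C10 add1] := Gmass_add sys hm; have [B1 st1] := Gmass_step sys hm.
have [Z1 [mZ1 nZ1] ZP1] := lln_null C10 add1 st1 (fun m n k v v' vw vw' qp =>
  le_trans (Gmass_mono sys hm vw vw' qp) (ler_wpDr C10 (lexx _))).
have [C2 C20 mono2] := Glam_mono sys; have [B2 st2] := Glam_step sys hm.
have lc : 0 <= ln (cdist eta) by rewrite ln_ge0// (cdist_ge1 sys).
have CC : 0 <= C2 + ln (cdist eta) by exact: addr_ge0.
have [Z2 [mZ2 nZ2] ZP2] := lln_null CC (fun m n k v v' vw vw' _ =>
  le_trans (Glam_add sys vw vw') (ler_wpDl C20 (lexx _))) st2 (fun m n k v v' vw vw' _ =>
  le_trans (mono2 m n k v v' vw vw') (lerD (lexx _) (ler_wpDr lc (lexx _)))).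
(* Cylinders of zero mass are discarded: there the convention [ln 0 = 0] would falsify the local
   quantities. *)
pose Z3 : set (C R) := \bigcup_n ev n (fun u => Pm u == 0).
have mE n : measurable (ev n (fun u => Pm u == 0) : set (borelC R)) by exact: (evP _ _).1.
have mZ3 : measurable (Z3 : set (borelC R)) by apply: (@bigcup_measurable _ (borelC R)).
have nZ3 : omega Z3 = 0%E.
  apply: (null_bigcup mE _).2 => n; rewrite (om_fin omega (mE n)) (evP _ _).2 big1// => u.
  by move=> /eqP.
have mK : measurable (K0 : set (borelC R)) by apply: closedC_measurable; exact (lset_closed sys (m := 0)).
have [mU1 nU1] := null_setU mZ1 mZ2 nZ1 nZ2; have [mU nU] := null_setU mU1 mZ3 nU1 nZ3.
exists (K0 `\` (Z1 `|` Z2 `|` Z3)).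
have pos x n u : ~ Z3 x -> u \in words 0 n -> cyl 0 u x -> 0 < Pm u.
  move=> n3 uw cu; rewrite lt_neqAle Pm_ge0 andbT eq_sym; apply/negP => /eqP P0.
  by apply: n3; exists n => //; exists u => //; rewrite mem_filter uw P0 eqxx.
split.
- exact: (@measurableD _ (borelC R)).
- by move=> x [].
- rewrite measureD//; last by rewrite (le_lt_trans (probability_le1 _ mK))// ltry.
  transitivity (1 - 0 : \bar R)%E; last by rewrite sube0.
  congr (_ - _)%E; first exact: (omega_lset sys hm).
  apply/eqP; rewrite eq_le measure_ge0 andbT -nU; apply: le_measure; rewrite ?inE//.
  exact: (@measurableI _ (borelC R)).
- by move=> x n u [_ xU]; apply: pos => h; apply: xU; right.
- move=> x eps [Kx xU] e0.
  have n1 : ~ Z1 x by move=> h; apply: xU; left; left.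
  have n2 : ~ Z2 x by move=> h; apply: xU; left; right.
  have p x' n u := pos x n u (fun h => xU (or_intror h)).
  have [N1 NP1] := ZP1 x n1 Kx (p x) eps e0; have [N2 NP2] := ZP2 x n2 Kx (p x) eps e0.
  exists (maxn N1 N2) => n; rewrite geq_max => /andP[h1 h2] u uw cu; split; last exact: NP2.
  by have := NP1 n h1 u uw cu; rewrite /Gmass qm0.
Qed.
End LargeNumbers.

(** * Scales and typical points *)

Section Thin.
Context {R : realType} (omega : probability (borelC R) R).

(* Null sets for the outer measure: the sets of typical points met below are not known to be Borel. *)
Definition thin (W : set (C R)) := forall e : R, 0 < e ->
  exists B : set (C R), [/\ measurable (B : set (borelC R)), W `<=` B & (omega B <= e%:E)%E].

Lemma measure_cover (B : nat -> set (C R)) : (forall k, measurable (B k : set (borelC R))) ->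
  measurable (\bigcup_k B k : set (borelC R)) /\
  (omega (\bigcup_k B k) <= \sum_(0 <= k <oo) omega (B k))%E.
Proof.
move=> mB; have mU : measurable (\bigcup_k B k : set (borelC R)) by apply: (@bigcup_measurable _ (borelC R)).
split=> //.
exact (@measure_sigma_subadditive _ R (borelC R) omega (\bigcup_k B k) B mB mU (@subset_refl _ _)).
Qed.

Lemma half_series (e : R) : 0 <= e -> (\sum_(0 <= k <oo) (e / (2 ^ k.+1)%:R)%:E <= e%:E)%E.
Proof. by move=> e0; have := @epsilon_trick0 R e xpredT e0. Qed.

Lemma thin_bigcup (W : nat -> set (C R)) : (forall k, thin (W k)) -> thin (\bigcup_k W k).
Proof.
move=> tW e e0.
have h k : exists B : set (C R), [/\ measurable (B : set (borelC R)), W k `<=` B &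
    (omega B <= (e / (2 ^ k.+1)%:R)%:E)%E].
  by apply: tW; rewrite divr_gt0// ltr0n expn_gt0.
have [B BP] := choice h.
have [mU leU] := measure_cover (fun k => (let: And3 m _ _ := BP k in m)).
exists (\bigcup_k B k); split=> //.
  by move=> x [k _ Wx]; exists k => //; have [_ + _] := BP k; apply.
apply: (le_trans leU); apply: (le_trans _ (half_series (ltW e0))).
by apply: lee_nneseries => // k _; have [_ _ +] := BP k.
Qed.

Lemma thin_sub (W W' : set (C R)) : W `<=` W' -> thin W' -> thin W.
Proof. by move=> s t e e0; have [B [mB sB lB]] := t e e0; exists B; split=> // x /s /sB. Qed.

(** The intersection of two sets of full measure cannot be covered by a set of measure at most
    1/2. *)
Lemma thin_full (Z Z' : set (C R)) : measurable (Z : set (borelC R)) -> measurable (Z' : set (borelC R)) ->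
  omega Z = 1%E -> omega Z' = 1%E -> ~ thin (Z `&` Z').
Proof.
move=> mZ mZ' oZ oZ' /(_ (1 / 2) ltac:(lra))[B [mB sB lB]].
have nul (A : set (C R)) : measurable (A : set (borelC R)) -> omega A = 1%E -> measurable (~` A : set (borelC R)) /\ omega (~` A) = 0%E.
  move=> mA oA; split; first exact: (@measurableC _ (borelC R)).
  have h : omega (~` A) = (1 - omega A)%E by exact (@probability_setC _ (borelC R) R omega A mA).
  by rewrite h oA subee.
have [m1 n1] := nul _ mZ oZ; have [m2 n2] := nul _ mZ' oZ'.
have [m3 n3] := null_setU m1 m2 n1 n2.
have mU : measurable (B `|` (~` Z `|` ~` Z') : set (borelC R)) by exact: (@measurableU _ (borelC R)).
have : (1 <= omega (B `|` (~` Z `|` ~` Z')))%E.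
  have h : omega (setT : set (borelC R)) = 1%E by exact: probability_setT.
  rewrite -h; apply: le_measure; rewrite ?inE//.
  move=> x _; have [zx|nz] := pselect (Z x); last by right; left.
  by have [zx'|nz'] := pselect (Z' x); [left; exact: sB|right; right].
apply/negP; rewrite -ltNge.
have h : (omega (B `|` (~` Z `|` ~` Z')) <= omega B + omega (~` Z `|` ~` Z'))%E by exact (@measureU2 _ (borelC R) R omega B (~` Z `|` ~` Z') mB m3).
apply: (le_lt_trans h); move: n3 => ->; rewrite adde0.
by apply: (le_lt_trans lB); rewrite lte_fin; lra.
Qed.
End Thin.

(** * Cylinders around a point and their scales *)

Section Geometry.
Context {R : realType}.
Variables (d : nat -> nat) (psi : nat -> nat -> C R -> C R) (eta : R) (V : set (C R)).
Hypothesis sys : conformal_system d psi eta V.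
Implicit Types (z w x y : C R) (u v : seq nat) (m n k : nat).

Local Notation K0 := (lset d psi 0).
Local Notation cyl := (cyl psi 0).
Local Notation ell := (lam psi 0).
Local Notation words := (words d 0).

Definition wd n x : seq nat := xget [::] [set u | u \in words n /\ cyl u x].

Lemma wdP n x : K0 x -> wd n x \in words n /\ cyl (wd n x) x.
Proof. by move=> Kx; have [u uw cu] := Kx n; rewrite /wd; case: xgetP => [_ _ //|/(_ u)]; case. Qed.

Lemma wdE n x u : u \in words n -> cyl u x -> u = wd n x.
Proof.
rewrite /wd => uw cu; case: xgetP => [v _ [vw cv]|/(_ u)]; last by case.
move: uw vw; rewrite !wordsP => /andP[/eqP s1 o1] /andP[/eqP su ou].
by apply: (cyl_uniq sys _ o1 ou cu cv); rewrite su s1.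
Qed.

(** The geometry used by the dimension estimates: scales decay at least geometrically and by at most
    a constant factor per level, and a cylinder is comparable to a ball about each of its limit
    points. *)
Record scaling (Ca cb kp : R) := Scaling {
  sc_ge1 : 1 <= Ca;
  sc_gt0 : 0 < cb;
  sc_kp : 0 < kp < 1;
  sc_lam : forall n u, u \in words n -> 0 < ell u <= Ca * kp ^+ n;
  sc_step : forall n x, K0 x -> ell (wd n x) <= Ca * ell (wd n.+1 x);
  sc_diam : forall n u y z, u \in words n -> cyl u y -> cyl u z -> cabs (y - z) <= Ca * ell u;
  sc_ball : forall n u y z, u \in words n -> K0 z -> cyl u z -> cabs (y - z) < cb * ell u -> cyl u y }.

Lemma scalingP : exists Ca cb kp : R, scaling Ca cb kp.
Proof.
have cd0 := cdist_gt0 eta; have D0 := D0_gt0 sys; have m0 := m2_gt0 eta.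
have cd1 := cdist_ge1 sys.
have e01 : 0 < eta < 1 by case: sys.
move: (lam_cat sys (m := 0)) (lam_le sys (m := 0)) (cyl_diam sys (m := 0)) (lset_ball sys (m := 0)) (lam1 sys).
move: cd0 D0 m0 cd1; move: (cdist eta) (contr_const eta) (step_low eta) => cd D m2 cd0 D0 m0 cd1 lcat lle cdi lba l1.
(* Besides the 1, one summand for each estimate: the decay of the scales, the step from one level to
   the next, and the diameter. *)
pose Ca := 1 + cd * D + cd / m2 + 2 * cd.
have a1 : 0 < cd * D by exact: mulr_gt0.
have a2 : 0 < cd / m2 by exact: divr_gt0.
have aux (l q M : R) : 0 < l -> m2 <= q -> l * q / cd <= M -> l <= Ca * M.
  move=> l0 mq hM; have M0 : 0 <= M by apply: le_trans hM; rewrite divr_ge0 ?(ltW cd0)// mulr_ge0 ?(ltW l0)// (le_trans (ltW m0)).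
  have e1 : cd / m2 * (l * q / cd) = l * (q / m2) by field; rewrite (gt_eqF m0) (gt_eqF cd0).
  have e2 : l <= l * (q / m2) by rewrite ler_peMr ?(ltW l0)// ler_pdivlMr// mul1r.
  have e3 : cd / m2 * (l * q / cd) <= cd / m2 * M by apply: ler_wpM2l; rewrite ?(ltW a2).
  have e4 : cd / m2 * M <= Ca * M by apply: ler_wpM2r => //; rewrite /Ca; lra.
  by lra.
have okP n u : u \in words n -> okw d 0 u /\ size u = n by rewrite wordsP => /andP[/eqP].
have kp0 : 0 < kap eta < 1 by exact: kap01.
have kpn n : 0 < kap eta ^+ n by rewrite exprn_gt0//; case/andP: kp0.
exists Ca, (eta / (4 * cd)), (kap eta); split=> //.
- by rewrite /Ca; lra.
- by case/andP: e01 => e0 _; rewrite divr_gt0// mulr_gt0.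
- move=> n u /okP[ ou su]; rewrite (lam_gt0 sys ou) /=; apply: (le_trans (lle u ou)); rewrite su.
  by rewrite ler_pM2r// /Ca; lra.
- move=> n x Kx; have [hw1 c1] := wdP n Kx; have [hw2 c2] := wdP n.+1 Kx.
  have [ ow1 s1] := okP _ _ hw1; have := okP _ _ hw2; case=> o2 s2.
  case/lastP E : (wd n.+1 x) => [|v i]; first by move: s2; rewrite E.
  move: o2 s2 c2; rewrite E -cats1 => o2; rewrite size_cat addn1 => -[s2] c2.
  have o3 := o2; move: o3; rewrite okw_cat => /andP[ ov /= /andP[ oi _]].
  have e : v = wd n x.
    by apply: wdE; rewrite ?wordsP ?s2 ?eqxx//; exact: (cyl_pre sys o2).
  have lv := lam_gt0 sys ov; have /andP[h1 _] := lcat _ _ o2; have /andP[h2 _] := l1 _ _ oi.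
  rewrite -e; exact: aux lv h2 h1.
- move=> n u y z /okP[ ou su] cy cz; apply: (le_trans (cdi _ _ _ ou cy cz)).
  by rewrite ler_pM2r ?(lam_gt0 sys)// /Ca; lra.
- move=> n u y z /okP[ ou su] Kz cz h; apply: (lba u z y ou Kz cz); apply: (lt_le_trans h).
  by rewrite le_eqVlt; apply/orP; left; apply/eqP; field; rewrite gt_eqF.
Qed.

Section Scale.
Variables (Ca cb kp : R).
Hypothesis sc : scaling Ca cb kp.

(** The first level at which the scale falls to [rho] is [n + 1]; the threshold [rho0] does not
    depend on the point. *)
Lemma scale_level N : exists2 rho0 : R, 0 < rho0 & forall x (rho : R), K0 x -> 0 < rho <= rho0 ->
  exists n, [/\ (N <= n)%N, rho < ell (wd n x), ell (wd n x) <= Ca * ell (wd n.+1 x) & ell (wd n.+1 x) <= rho].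
Proof.
have aux (l : R) : 0 < l -> l <= l / 2 -> False by lra.
have C1 := sc_ge1 sc; have C0 : 0 < Ca by lra.
have l0 : 0 < ell [::] by exact: (lam_gt0 sys).
have CN0 n : 0 < Ca ^+ n by exact: exprn_gt0.
(* One level divides the scale by at most [Ca], so so small a scale is reached only after level
   [N]. *)
exists (ell [::] / Ca ^+ N / 2); first by rewrite !divr_gt0.
move=> x rho Kx /andP[r0 rr].
have low n : ell [::] <= Ca ^+ n * ell (wd n x).
  elim: n => [|n IH].
    rewrite expr0 mul1r; have [+ _] := wdP 0 Kx; rewrite wordsP => /andP[/eqP/size0nil -> _].
    exact: lexx.
  apply: (le_trans IH); rewrite exprSr -mulrA; apply: (ler_wpM2l (ltW (CN0 n))); exact (sc_step sc n Kx).
have ex : exists n, ell (wd n x) <= rho.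
  have [N1 NP] := geo_small Ca (sc_kp sc) r0; exists N1.
  have [w1 _] := wdP N1 Kx; have /andP[_ h] := sc_lam sc w1.
  exact: (le_trans h (ltW (NP _ (leqnn _)))).
have [m mr mmin] := ex_minnP ex.
have Nm : (N < m)%N.
  rewrite ltnNge; apply/negP => mN.
  have h : ell (wd m x) <= ell [::] / Ca ^+ N / 2 by apply: le_trans rr.
  have h2 : Ca ^+ m * ell (wd m x) <= Ca ^+ N * ell (wd m x).
    have [wm _] := wdP m Kx; have /andP[lm _] := sc_lam sc wm.
    exact: (ler_wpM2r (ltW lm) (ler_weXn2l C1 mN)).
  have h3 : Ca ^+ N * ell (wd m x) <= ell [::] / 2.
    apply: (@le_trans _ _ (Ca ^+ N * (ell [::] / Ca ^+ N / 2))); first by rewrite ler_pM2l.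
    by rewrite le_eqVlt; apply/orP; left; apply/eqP; field; rewrite gt_eqF.
  exact: (aux _ l0 (le_trans (low m) (le_trans h2 h3))).
case: m mr mmin Nm => // n mr mmin Nm; exists n; split; [exact: Nm| |exact (sc_step sc n Kx)|exact: mr].
by rewrite ltNge; apply/negP => /mmin; rewrite ltnn.
Qed.

Lemma lam_tail (A e : R) : 0 < A -> 0 < e -> exists N, forall n u, (N <= n)%N -> u \in words n -> A * ell u < e.
Proof.
move=> A0 e0; have [N NP] := geo_small (A * Ca) (sc_kp sc) e0; exists N => n u Nn uw.
have /andP[_ h] := sc_lam sc uw; apply: le_lt_trans (NP _ Nn).
by rewrite -mulrA ler_pM2l.
Qed.

Lemma powR_tail (A t e : R) : 0 < A -> 0 < t -> 0 < e ->
  exists N, forall n u, (N <= n)%N -> u \in words n -> A * ell u `^ t < e.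
Proof.
move=> A0 t0 e0.
have eA : 0 < (e / A) `^ t^-1 by rewrite powR_gt0// divr_gt0.
have [N NP] := lam_tail (A := 1) ltr01 eA; exists N => n u Nn uw.
have /andP[l0 _] := sc_lam sc uw; have := NP n u Nn uw; rewrite mul1r => h.
rewrite mulrC -ltr_pdivlMr//.
have := gt0_ltr_powR t0 _ _ h; rewrite !nnegrE (ltW l0) (ltW eA) -powRrM mulVf ?gt_eqF// powRr1; last by rewrite divr_ge0 ?ltW.
exact.
Qed.
End Scale.
End Geometry.

(** * Typical points and their mass exponents *)

Section Pointwise.
Context {R : realType}.
Variables (d : nat -> nat) (psi : nat -> nat -> C R -> C R) (eta : R) (V : set (C R)).
Hypothesis sys : conformal_system d psi eta V.
Variable omega : probability (borelC R) R.
Hypothesis hm : is_harmonic_measure (lset d psi 0) infty omega.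
Implicit Types (z w x y : C R) (u v : seq nat) (m n k : nat).

Local Notation K0 := (lset d psi 0).
Local Notation cyl := (cyl psi 0).
Local Notation lam := (lam psi 0).
Local Notation words := (words d 0).
Local Notation Pm := (Pm psi omega).
Local Notation wd := (wd d psi).
Local Notation EL := (EL d psi omega).
Local Notation El := (El d psi omega).

Record typical (Z : set (C R)) := Typical {
  ty_meas : measurable (Z : set (borelC R));
  ty_lset : Z `<=` K0;
  ty_full : omega Z = 1%E;
  ty_pos : forall x n, Z x -> 0 < Pm (wd n x);
  ty_lln : forall x eps, Z x -> 0 < eps -> exists N, forall n, (N <= n)%N ->
    `|- ln (Pm (wd n x)) - EL n| <= eps * n%:R /\ `|- ln (lam (wd n x)) - El n| <= eps * n%:R }.

Lemma typicalP : exists Z, typical Z.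
Proof.
have [Z [mZ ZK oZ pZ lZ]] := lln_set sys hm; exists Z; split=> // x.
  by move=> n Zx; have [w1 c1] := wdP n (ZK _ Zx); exact: pZ w1 c1.
move=> eps Zx e0; have [N NP] := lZ x eps Zx e0; exists N => n Nn.
by have [w1 c1] := wdP n (ZK _ Zx); exact: NP.
Qed.

Variables (Z : set (C R)) (Ca cb kp : R).
Hypothesis ty : typical Z.
Hypothesis sc : scaling d psi Ca cb kp.

Lemma lnlam_low : exists c C' : R, [/\ 0 < c & forall n u, u \in words n -> c * n%:R - C' <= - ln (lam u)].
Proof.
have /andP[k0 k1] := sc_kp sc; have C1 := sc_ge1 sc; have C0 : 0 < Ca by lra.
exists (- ln kp), (ln Ca); split; first by rewrite oppr_gt0 ln_lt0 ?k0.
move=> n u uw; have /andP[l0 l1] := sc_lam sc uw.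
have h : ln (lam u) <= ln (Ca * kp ^+ n) by rewrite ler_ln ?posrE// mulr_gt0 ?exprn_gt0.
by move: h; rewrite lnM ?posrE ?exprn_gt0// lnXn// -mulr_natr; lra.
Qed.

Lemma nat_large (c a : R) : 0 < c -> exists N, forall n, (N <= n)%N -> a <= c * n%:R.
Proof.
move=> c0; exists (Num.truncn `|a / c|).+1 => n Nn; rewrite mulrC -ler_pdivrMr//.
have /truncn_itv/andP[_ h] : 0 <= `|a / c| by [].
by apply: (le_trans (ler_norm _)); apply: (le_trans (ltW h)); rewrite ler_nat.
Qed.

(** The errors of the law of large numbers are [o(n)], whereas [- ln lam] grows linearly; the gap
    between [s] and [s'] absorbs them. *)
Lemma mass_upper (s s' : R) x : 0 < s < s' -> Z x -> exists N, forall n, (N <= n)%N ->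
  s' * El n <= EL n -> Pm (wd n x) <= lam (wd n x) `^ s.
Proof.
move=> /andP[s0 ss] Zx; have [c [C' [c0 low]]] := lnlam_low.
have s10 : 0 < s' + 1 by lra.
(* Chosen so that the two errors together are at most [(s' - s) c n / 2], while
   [- ln lam >= c n / 2] for large [n]. *)
have e0 : 0 < (s' - s) * c / (2 * (s' + 1)) by rewrite divr_gt0 ?mulr_gt0//; lra.
have [N1 NP1] := ty_lln ty Zx e0.
have c20 : 0 < c / 2 by exact: divr_gt0.
have [N2 NP2] := nat_large C' c20.
exists (maxn N1 N2) => n; rewrite geq_max => /andP[n1 n2] hE.
have [h1 h2] := NP1 n n1; have h3 := NP2 n n2.
have [w1 _] := wdP n (ty_lset ty Zx); have h4 := low n _ w1; have /andP[l0 _] := sc_lam sc w1.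
have p0 := ty_pos ty n Zx.
rewrite -ler_ln ?posrE ?powR_gt0// ln_powR.
move: h1 h2; rewrite !ler_norml => /andP[a1 _] /andP[_ a2].
have E : (s' - s) * c / (2 * (s' + 1)) * n%:R * (s' + 1) = (s' - s) * (c / 2 * n%:R) by field; rewrite gt_eqF.
have b1 : s' * (- ln (lam (wd n x)) - El n) <= s' * ((s' - s) * c / (2 * (s' + 1)) * n%:R).
  by apply: ler_wpM2l => //; lra.
have b2 : (s' - s) * (c * n%:R - C') <= (s' - s) * (- ln (lam (wd n x))) by apply: ler_wpM2l => //; lra.
have b3 : (s' - s) * C' <= (s' - s) * (c / 2 * n%:R) by apply: ler_wpM2l => //; lra.
move: a1 a2 b1 b2 b3 E hE; move: (ln _) (ln _) (El n) (EL n) ((s' - s) * c / (2 * (s' + 1)) * n%:R) => lP ll E1 E2 en.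
move: (n%:R : R) => nn; lra.
Qed.

Lemma mass_lower (s s' : R) x : 0 <= s' < s -> Z x -> exists N, forall n, (N <= n)%N ->
  EL n <= s' * El n -> lam (wd n x) `^ s <= Pm (wd n x).
Proof.
move=> /andP[s0 ss] Zx; have [c [C' [c0 low]]] := lnlam_low.
have s10 : 0 < s' + 1 by lra.
have e0 : 0 < (s - s') * c / (2 * (s' + 1)) by rewrite divr_gt0 ?mulr_gt0//; lra.
have [N1 NP1] := ty_lln ty Zx e0.
have c20 : 0 < c / 2 by exact: divr_gt0.
have [N2 NP2] := nat_large C' c20.
exists (maxn N1 N2) => n; rewrite geq_max => /andP[n1 n2] hE.
have [h1 h2] := NP1 n n1; have h3 := NP2 n n2.
have [w1 _] := wdP n (ty_lset ty Zx); have h4 := low n _ w1; have /andP[l0 _] := sc_lam sc w1.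
have p0 := ty_pos ty n Zx.
rewrite -ler_ln ?posrE ?powR_gt0// ln_powR.
move: h1 h2; rewrite !ler_norml => /andP[_ a1] /andP[a2 _].
have E : (s - s') * c / (2 * (s' + 1)) * n%:R * (s' + 1) = (s - s') * (c / 2 * n%:R) by field; rewrite gt_eqF.
have b1 : s' * (El n - - ln (lam (wd n x))) <= s' * ((s - s') * c / (2 * (s' + 1)) * n%:R).
  by apply: ler_wpM2l => //; lra.
have b2 : (s - s') * (c * n%:R - C') <= (s - s') * (- ln (lam (wd n x))) by apply: ler_wpM2l => //; lra.
have b3 : (s - s') * C' <= (s - s') * (c / 2 * n%:R) by apply: ler_wpM2l => //; lra.
move: a1 a2 b1 b2 b3 E hE; move: (ln _) (ln _) (El n) (EL n) ((s - s') * c / (2 * (s' + 1)) * n%:R) => lP ll E1 E2 en.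
move: (n%:R : R) => nn; lra.
Qed.

Lemma typical_support : Z `<=` msupport omega.
Proof.
move=> x Zx U oU Ux; have Kx := ty_lset ty Zx.
have [r r0 rU] : exists2 r : R, 0 < r & forall y, cabs (y - x) < r -> U y.
  by apply/nbhsCP; exact: open_nbhs_nbhs.
have [N NP] := cyl_small sys r0.
have [w1 c1] := wdP N Kx; move: (w1); rewrite wordsP => /andP[/eqP sw ow].
have mc : measurable (cyl (wd N x) : set (borelC R)) := cyl_meas sys ow.
have h : (omega (cyl (wd N x)) <= omega U)%E.
  apply: le_measure; rewrite ?inE//; first exact: (openC_measurable oU).
  by move=> y cy; apply: rU; apply: (NP _ _ _ ow _ cy c1); rewrite sw.
apply: lt_le_trans h; rewrite (om_fin omega mc) lte_fin; exact: (ty_pos ty N Zx).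
Qed.

Lemma typical_carrier : carriers omega Z.
Proof. by split; [exact: (ty_meas ty)|exact: typical_support|exact: (ty_full ty)]. Qed.

End Pointwise.

(** * Dimension estimates *)

Section SumTools.
Context {R : realType}.

Lemma esum_nat (D : set nat) (f : nat -> \bar R) : (forall k, D k -> (0 <= f k)%E) ->
  (\esum_(k in D) f k = \sum_(0 <= k <oo) (if k \in D then f k else 0))%E.
Proof.
move=> f0; rewrite esum_mkcond nneseries_esumT// => k.
by case: ifPn => // /set_mem; exact: f0.
Qed.

Lemma esum_seq (T : choiceType) (s : seq T) (f : T -> \bar R) : uniq s ->
  (forall i, i \in s -> (0 <= f i)%E) -> (\esum_(i in [set` s]) f i = \sum_(i <- s) f i)%E.
Proof.
move=> us f0; rewrite esum_fset; first by rewrite (fsbig_seq _ _ us).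
  exact: finite_seq.
by move=> i /set_mem; exact: f0.
Qed.

Lemma esum_levels (K : set nat) (s : nat -> seq (seq nat)) (f : seq nat -> \bar R) (a th : R) :
  (forall u, (0 <= f u)%E) -> (forall n, uniq (s n)) -> (forall n u, u \in s n -> size u = n) ->
  0 <= a -> 0 < th < 1 -> (forall n, K n -> (\sum_(u <- s n) f u <= (a * th ^+ n)%:E)%E) ->
  (\esum_(u in \bigcup_(n in K) [set` s n]) f u <= (a / (1 - th))%:E)%E.
Proof.
move=> f0 us ss a0 t01 h; rewrite esum_bigcupT//; last first.
  by move=> i j _ _ [u [/= /ss <- /ss]].
rewrite esum_nat; last by move=> k _; apply: esum_ge0.
apply: le_trans (geo_series a0 t01); apply: lee_nneseries => [k _ _|k _].
  by case: ifP => // _; apply: esum_ge0.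
have /andP[t0 _] := t01.
case: ifPn => [/set_mem Kk|_]; last by rewrite lee_fin mulr_ge0// exprn_ge0// ltW.
by rewrite esum_seq//; exact: h.
Qed.

Lemma ltr_div_mul (a b c : R) : 0 < b -> a / b < c -> a < b * c.
Proof. by move=> b0; rewrite ltr_pdivrMr// mulrC. Qed.

Lemma ler_div_mul (a b c : R) : 0 < b -> a / b <= c -> a <= b * c.
Proof. by move=> b0; rewrite ler_pdivrMr// mulrC. Qed.

Lemma ler_mul_div (a b c : R) : 0 < b -> c <= a / b -> b * c <= a.
Proof. by move=> b0; rewrite ler_pdivlMr// mulrC. Qed.

Lemma quarter_sum (a b : R) : 0 < b -> a <= b -> a / 4 + b / 4 < b.
Proof. lra. Qed.

Lemma diameter_ge0 (A : set (C R)) : (0 <= diameter A)%E.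
Proof. by rewrite /diameter le_max lexx. Qed.

Lemma diameter_le (A : set (C R)) (r : R) : 0 <= r -> (forall x y, A x -> A y -> cabs (x - y) <= r) ->
  (diameter A <= r%:E)%E.
Proof.
move=> r0 h; rewrite /diameter ge_max lee_fin r0 /=; apply/ereal_supP => _ [[x y] [/= Ax Ay] <-].
by rewrite lee_fin; exact: h.
Qed.

Lemma diameterP (A : set (C R)) (delta : R) : (diameter A <= delta%:E)%E ->
  exists r : R, [/\ diameter A = r%:E, 0 <= r <= delta & forall x y, A x -> A y -> cabs (x - y) <= r].
Proof.
move=> h; have d0 := diameter_ge0 A.
have fd : diameter A \is a fin_num by rewrite ge0_fin_numE// (le_lt_trans h) ?ltry.
exists (fine (diameter A)); rewrite fineK//; split=> //.
  by rewrite -!lee_fin fineK// d0.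
move=> x y Ax Ay; rewrite -lee_fin fineK// /diameter le_max; apply/orP; right.
by apply: ereal_sup_ubound; exists (x, y).
Qed.

Lemma ereal0_le (x : \bar R) : (forall e : R, 0 < e -> (x <= e%:E)%E) -> (x <= 0)%E.
Proof. by move=> h; apply/lee_addgt0Pr => e e0; rewrite add0e; exact: h. Qed.
End SumTools.

Section Dimensions.
Local Opaque lam.
Context {R : realType}.
Variables (d : nat -> nat) (psi : nat -> nat -> C R -> C R) (eta : R) (V : set (C R)).
Hypothesis sys : conformal_system d psi eta V.
Variable omega : probability (borelC R) R.
Hypothesis hm : is_harmonic_measure (lset d psi 0) infty omega.
Variables (Z : set (C R)) (Ca cb kp : R).
Hypothesis ty : typical d psi omega Z.
Hypothesis sc : scaling d psi Ca cb kp.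
Implicit Types (z w x y : C R) (u v : seq nat) (m n k : nat).

Local Notation K0 := (lset d psi 0).
Local Notation cyl := (cyl psi 0).
Local Notation lam := (lam psi 0).
Local Notation words := (words d 0).
Local Notation Pm := (Pm psi omega).
Local Notation wd := (wd d psi).
Local Notation EL := (EL d psi omega).
Local Notation El := (El d psi omega).
Local Notation ev := (ev d psi).

Let ZK x : Z x -> K0 x.
Proof. exact: (ty_lset ty). Qed.

Let Ca0 : 0 < Ca.
Proof. exact: lt_le_trans ltr01 (sc_ge1 sc). Qed.

Let cb0 : 0 < cb.
Proof. exact: (sc_gt0 sc). Qed.

Let lam0 n u : u \in words n -> 0 < lam u.
Proof. by move=> /(sc_lam sc)/andP[]. Qed.

Let mcyl n u : u \in words n -> measurable (cyl u : set (borelC R)).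
Proof. by rewrite wordsP => /andP[_ ou]; exact: (cyl_meas sys ou). Qed.

Let omP n u : u \in words n -> omega (cyl u) = (Pm u)%:E.
Proof. by move=> uw; exact: (om_fin omega (mcyl uw)). Qed.

(** [I] is the set of levels at which the mass bound is demanded: all of them for Hausdorff
    dimension, a subsequence for packing dimension. *)
Definition upper_good (I : set nat) (t : R) N : set (C R) :=
  [set x | Z x /\ forall n, (N <= n)%N -> I n -> Pm (wd n x) <= lam (wd n x) `^ t].

(** Mass distribution: the typical points of a set of diameter [r] containing a good point [x] all
    lie in one cylinder around [x] of scale comparable to [r / cb], to which the mass bound at [x]
    applies. *)
Lemma ball_mass (t : R) N : 0 < t -> exists A delta0 : R, [/\ 0 < A, 0 < delta0 &
  forall (U : set (C R)) (r : R), 0 < r <= delta0 -> (forall x y, U x -> U y -> cabs (x - y) <= r) ->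
  exists B : set (C R), [/\ measurable (B : set (borelC R)), U `&` upper_good setT t N `<=` B &
    (omega B <= (A * r `^ t)%:E)%E]].
Proof.
move=> t0; have [rho0 r00 rhoP] := scale_level sys sc N.
exists ((Ca / cb) `^ t), (cb * rho0); split; first by rewrite powR_gt0 ?divr_gt0.
  exact: mulr_gt0.
move=> U r /andP[r0 rr] Ur.
have [[x [Ux [Zx gx]]]|nx] := pselect (U `&` upper_good setT t N !=set0); last first.
  exists set0; split; first exact: (@measurable0 _ (borelC R)).
    by move=> y Wy; apply: nx; exists y.
  by rewrite measure0 lee_fin mulr_ge0 ?powR_ge0.
have rc : 0 < r / cb <= rho0 by rewrite divr_gt0// ler_pdivrMr// mulrC.
have [n [Nn h1 h2 h3]] := rhoP x _ (ZK Zx) rc.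
have [w1 c1] := wdP n (ZK Zx); exists (cyl (wd n x)); split; first exact: mcyl w1.
  move=> y [Uy [Zy _]]; apply: (sc_ball sc w1 (ZK Zx) c1); apply: (le_lt_trans (Ur _ _ Uy Ux)).
  exact: ltr_div_mul cb0 h1.
rewrite (omP w1) lee_fin; apply: (le_trans (gx n Nn I)).
have l0 := lam0 w1.
rewrite -powRM ?(ltW r0) ?divr_ge0 ?(ltW Ca0) ?(ltW cb0)//.
apply: ge0_ler_powR; rewrite ?nnegrE ?(ltW t0) ?(ltW l0) ?mulr_ge0 ?invr_ge0 ?(ltW r0) ?(ltW cb0) ?(ltW Ca0)//.
apply: (le_trans h2); rewrite -mulrA; apply: (ler_wpM2l (ltW Ca0)); apply: (le_trans h3).
by rewrite mulrC.
Qed.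

Lemma hausdorff_thin (t : R) N (Z' : set (C R)) : 0 < t -> hausdorff_measure t Z' = 0%E ->
  thin omega (Z' `&` upper_good setT t N).
Proof.
move=> t0 H0 e e0; have [A [delta0 [A0 d0 AP]]] := ball_mass N t0.
have pm0 : (hausdorff_premeasure t delta0 Z' <= 0)%E.
  by rewrite -H0; apply: ereal_sup_ubound; exists delta0.
have e20 : 0 < e / 2 / A by rewrite !divr_gt0.
have [_ [D [U [ZU dU ->]]] lte] := ereal_inf_lt (le_lt_trans pm0 (e20 : (0 < (e / 2 / A)%:E)%E)).
have BP k : exists B : set (C R), [/\ measurable (B : set (borelC R)), D k -> U k `&` upper_good setT t N `<=` B &
    (omega B <= A%:E * (if k \in D then diameter (U k) `^ t else 0) + (e / 2 / (2 ^ k.+1)%:R)%:E)%E].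
  have ek : 0 < e / 2 / (2 ^ k.+1)%:R by rewrite !divr_gt0// ltr0n expn_gt0.
  case: ifPn => [/set_mem Dk|/negP nk]; last first.
    exists set0; split; first exact: (@measurable0 _ (borelC R)).
      by move=> Dk; exfalso; apply: nk; exact/mem_set.
    by rewrite measure0 mule0 add0e lee_fin ltW.
  have [r [-> /andP[r0 rd] rU]] := diameterP (dU k Dk).
  (* A covering set of diameter 0 costs nothing in the Hausdorff sum; it is given a positive radius
     whose cost fits in a summable reserve. *)
  have [r' [r'0 rr' le']] : exists r' : R, [/\ 0 < r' <= delta0, r <= r' &
      A * r' `^ t <= A * r `^ t + e / 2 / (2 ^ k.+1)%:R].
    have [->|rn] := eqVneq r 0; last first.
      have rp : 0 < r by rewrite lt_neqAle eq_sym rn.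
      by exists r; split; rewrite ?rp// lerDl ltW.
    pose q := e / 2 / (2 ^ k.+1)%:R.
    have q0 : 0 < (q / A) `^ t^-1 by rewrite powR_gt0// divr_gt0.
    exists (Num.min delta0 ((q / A) `^ t^-1)); split.
    - by rewrite lt_min d0 q0 ge_min lexx.
    - by rewrite le_min !ltW.
    - rewrite powR0 ?gt_eqF// mulr0 add0r mulrC -ler_pdivlMr//.
      apply: (@le_trans _ _ (((q / A) `^ t^-1) `^ t)).
        apply: ge0_ler_powR; rewrite ?nnegrE ?(ltW t0) ?le_min ?(ltW d0) ?(ltW q0)//.
        by rewrite ge_min lexx orbT.
      by rewrite -powRrM mulVf ?gt_eqF// powRr1// ltW// divr_gt0.
  have [B [mB sB lB]] := AP (U k) r' r'0 (fun x y Ux Uy => le_trans (rU x y Ux Uy) rr').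
  exists B; split=> //; rewrite poweR_EFin; apply: (le_trans lB).
  by rewrite -EFinM -EFinD lee_fin.
have [B BQ] := choice BP.
have [mU leU] := measure_cover omega (fun k => (let: And3 m _ _ := BQ k in m)).
exists (\bigcup_k B k); split=> //.
  by move=> x [/ZU[k Dk Ux] gx]; exists k => //; have [_ s _] := BQ k; exact: s.
apply: (le_trans leU).
have dt k : (0 <= if k \in D then diameter (U k) `^ t else 0)%E by case: ifP => // _; exact: poweR_ge0.
have ek k : (0 <= (e / 2 / (2 ^ k.+1)%:R)%:E)%E by rewrite lee_fin !divr_ge0// ltW.
apply: (@le_trans _ _ (\sum_(0 <= k <oo) (A%:E * (if k \in D then diameter (U k) `^ t else 0) + (e / 2 / (2 ^ k.+1)%:R)%:E))%E).
  by apply: lee_nneseries => // k _; have [_ _ +] := BQ k.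
have A0' : (0 <= A%:E)%E by rewrite lee_fin ltW.
rewrite nneseriesD; [|by move=> k _ _; exact: mule_ge0|by []].
rewrite nneseriesZl//.
have -> : e%:E = ((e / 2)%:E + (e / 2)%:E)%E by rewrite -EFinD -splitr.
apply: leeD; last by apply: half_series; rewrite divr_ge0// ltW.
rewrite -esum_nat; last by move=> k _; exact: poweR_ge0.
rewrite muleC -lee_pdivlMr//; apply: (le_trans (ltW lte)).
by rewrite -EFinM.
Qed.

(** A carrier meets [Z] in a set of full measure, and every point of [Z] is good from some [N] on;
    so the countably many pieces cannot all be thin. *)
Lemma thin_carrier (I : set nat) (t s' : R) (Z' : set (C R)) (E : nat -> set (C R)) :
  0 < t < s' -> (forall n, I n -> s' * El n <= EL n) -> carriers omega Z' ->
  Z' `<=` \bigcup_k E k -> ~ (forall k N, thin omega (E k `&` upper_good I t N)).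
Proof.
move=> ts hI [mZ' sZ' oZ'] ZE th; apply: (thin_full (ty_meas ty) mZ' (ty_full ty) oZ').
have := thin_bigcup (fun k => thin_bigcup (th k)); apply: thin_sub => x [Zx /ZE[k _ Ek]].
have [N NP] := mass_upper ty sc ts Zx.
by exists k => //; exists N => //; split=> //; split=> // n Nn /hI; exact: NP.
Qed.

Lemma HD_ge (s s' : R) : 0 < s < s' -> (exists N, forall n, (N <= n)%N -> s' * El n <= EL n) ->
  (s%:E <= HD omega)%E.
Proof.
move=> /andP[s0 ss] [N0 NP]; apply/ereal_infP => _ [Z' cZ' <-].
apply/ereal_infP => _ [t [t0 Ht] <-]; rewrite lee_fin leNgt; apply/negP => ts.
have tt : 0 < t < s' by rewrite t0 (lt_trans ts).
apply: (@thin_carrier [set n | (N0 <= n)%N] t s' Z' (fun=> Z') tt NP cZ').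
  by move=> x Zx; exists 0%N.
move=> _ N; apply: thin_sub (hausdorff_thin (maxn N N0) t0 Ht) => x [Zx [zx gx]]; split=> //; split=> // n.
by rewrite geq_max => /andP[n1 n2] _; exact: gx.
Qed.

(** A carrier of packing measure zero splits into pieces of premeasure below 1. At one level [n]
    with the mass bound, balls of radius [cb * lam / 4] centred at good points of the piece, one in
    each cylinder, form a packing; so the [t]-sum of the scales is bounded, and the mass, at most
    the [s]-sum, is small since [s > t]. *)
Lemma PD_ge (s s' : R) : 0 < s < s' -> (forall N, exists2 n, (N <= n)%N & s' * El n <= EL n) ->
  (s%:E <= PD omega)%E.
Proof.
move=> /andP[s0 ss] fr; apply/ereal_infP => _ [Z' cZ' <-].
apply/ereal_infP => _ [t [t0 Ht] <-]; rewrite lee_fin leNgt; apply/negP => ts.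
have : (packing_measure t Z' < 1)%E by rewrite Ht lte_fin.
move=> /ereal_inf_lt[_ [E [ZE ->]] lt1].
have st : 0 < s < s' by rewrite s0.
apply: (@thin_carrier [set n | s' * El n <= EL n] s s' Z' E st (fun n h => h) cZ' ZE) => k N.
have pm0 A : (0 <= packing_premeasure t A)%E.
  apply/ereal_infP => _ [dl _ <-]; apply: ereal_sup_ubound.
  by exists set0, (fun=> 0), (fun=> 1); split=> //; rewrite esum_set0.
have : (packing_premeasure t (E k) < 1)%E.
  apply: le_lt_trans lt1.
  apply: le_trans (nneseries_lim_ge k.+1 _); last by move=> n _ _; exact: pm0.
  rewrite big_nat_recr//= leeDr//; apply: sume_ge0 => n _; exact: pm0.
move=> /ereal_inf_lt[_ [dl /= dl0 <-] ltp] e e0.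
have st0 : 0 < s - t by lra.
have c1 : 0 < (2 / cb) `^ t by rewrite powR_gt0// divr_gt0.
have [M1 MP1] := powR_tail sc c1 st0 e0.
have c4 : 0 < cb / 4 by exact: divr_gt0.
have [M2 MP2] := lam_tail sc c4 dl0.
have [n] := fr (maxn N (maxn M1 M2)); rewrite !geq_max => /and3P[n0 n1 n2] hn.
pose W := E k `&` upper_good [set n | s' * El n <= EL n] s N.
pose G := [pred u | `[< exists2 x, W x & cyl u x >]].
have [mB oB] := evP sys omega n G.
exists (ev n G); split=> //.
  move=> x Wx; have [_ [Zx _]] := Wx; have [w1 c2] := wdP n (ZK Zx); exists (wd n x) => //.
  by rewrite mem_filter w1 andbT; apply/asboolP; exists x.
rewrite (om_fin omega mB) lee_fin oB.
pose gs := [seq u <- words n | G u].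
have gsP u : u \in gs -> u \in words n /\ exists2 x, W x & cyl u x.
  by rewrite mem_filter => /andP[/asboolP].
pose X u := xget 0 [set x | W x /\ cyl u x].
have XP u : u \in gs -> W (X u) /\ cyl u (X u).
  by move=> /gsP[_ [x Wx cx]]; rewrite /X; case: xgetP => [_ _ //|/(_ x)]; case.
pose Xk k := X (odflt [::] (unpickle k)).
pose rk k := cb * lam (odflt [::] (unpickle k)) / 4.
have pk u : odflt [::] (unpickle (pickle u)) = u by rewrite pickleK.
have key : (\sum_(u <- gs) ((2 * (cb * lam u / 4)) `^ t)%:E <= 1)%E.
  apply: ltW; apply: le_lt_trans ltp; apply: ereal_sup_ubound.
  exists [set pickle u | u in [set` gs]], Xk, rk; split.
  - by move=> _ [u /= ug <-]; rewrite /Xk pk; have [[]] := XP _ ug.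
  - move=> _ [u /= ug <-]; rewrite /rk pk; have [uw _] := gsP _ ug; have l0 := lam0 uw.
    rewrite divr_gt0 ?mulr_gt0//=; have := MP2 n u n2 uw; rewrite mulrAC => h; exact: ltW.
  - move=> _ _ [u /= ug <-] [v /= vg <-] [z []]; rewrite /cball /= /Xk /rk !pk => zu zv.
    have [uw _] := gsP _ ug; have [vw _] := gsP _ vg.
    have [Wu cu] := XP _ ug; have [Wv cv] := XP _ vg.
    have Ku : K0 (X u) by case: Wu => _ [/ZK].
    have Kv : K0 (X v) by case: Wv => _ [/ZK].
    have lu := lam0 uw; have lv := lam0 vw.
    have tri : cabs (X u - X v) <= cb * lam u / 4 + cb * lam v / 4.
      apply: (le_trans (cabs_tri _ _ z)); rewrite cabsBC; exact: (lerD zu zv).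
    (* If two balls meet, their centres are closer than [cb] times the larger scale, so both lie in
       the larger cylinder. *)
    congr pickle; case: (leP (lam u) (lam v)) => luv.
      rewrite (wdE sys uw cu) [in RHS](wdE sys (x := X u) vw)//.
      apply: (sc_ball sc vw Kv cv); apply: (le_lt_trans tri).
      exact: quarter_sum (mulr_gt0 cb0 lv) (ler_wpM2l (ltW cb0) luv).
    rewrite [in RHS](wdE sys vw cv) (wdE sys (x := X v) uw)//.
    apply: (sc_ball sc uw Ku cu); rewrite cabsBC; apply: (le_lt_trans tri).
    rewrite addrC; exact: quarter_sum (mulr_gt0 cb0 lu) (ler_wpM2l (ltW cb0) (ltW luv)).
  - rewrite esum_image; last by move=> u v _ _; exact: (pcan_inj pickleK).
    have h1 : uniq gs by rewrite filter_uniq// words_uniq.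
    have h2 i : i \in gs -> (0 <= ((2 * rk (pickle i)) `^ t)%:E)%E by move=> _; rewrite lee_fin powR_ge0.
    rewrite (esum_seq h1 h2).
    by apply: eq_bigr => u _; rewrite /rk pk.
move: key; rewrite sumEFin lee_fin => key.
rewrite -[X in X <= _]big_filter -/gs.
apply: (@le_trans _ _ (\sum_(u <- gs) e * (2 * (cb * lam u / 4)) `^ t)); last first.
  by rewrite -mulr_sumr ler_piMr// ltW.
rewrite big_seq [leRHS]big_seq; apply: ler_sum => u ug.
have [uw [x Wx cx]] := gsP _ ug; have l0 := lam0 uw.
have [_ [Zx gx]] := Wx; have ux := wdE sys uw cx.
have : Pm u <= lam u `^ s by rewrite ux; exact: gx.
move=> /le_trans; apply.
have -> : s = (s - t) + t by ring.
rewrite powRD; last by rewrite (gt_eqF l0) implybT.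
have -> : 2 * (cb * lam u / 4) = (cb / 2) * lam u by field.
have cb20 : 0 < cb / 2 by exact: divr_gt0.
rewrite (powRM _ (ltW cb20) (ltW l0)) mulrA; apply: ler_wpM2r; first exact: powR_ge0.
have h := MP1 n u n1 uw; rewrite -ler_pdivrMr ?powR_gt0//.
apply: le_trans (ltW h); rewrite mulrC le_eqVlt; apply/orP; left; apply/eqP; congr (_ * _).
have c20 : 0 < 2 / cb by exact: divr_gt0.
have m1 : (cb / 2) `^ t * (2 / cb) `^ t = 1.
  by rewrite -powRM ?(ltW cb20) ?(ltW c20)// -invf_div mulVf ?powR1// gt_eqF.
have p0 : (cb / 2) `^ t != 0 by rewrite gt_eqF// powR_gt0.
by apply: (mulfI p0); rewrite m1 mulfV.
Qed.

Definition lower_good (t : R) n : pred (seq nat) := fun u => lam u `^ t <= Pm u.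

Lemma Pm_le1 n : \sum_(u <- words n) Pm u <= 1.
Proof. by rewrite (Pm_total sys hm). Qed.

(** [Z] is covered by the cylinders with [Pm >= lam^s1] at the infinitely many favourable levels. At
    each level the sum of the [diam^s] is at most a geometric factor times the total mass, and these
    factors are summable over the levels. *)
Lemma HD_le (s s' : R) : 0 <= s' < s -> (forall N, exists2 n, (N <= n)%N & EL n <= s' * El n) ->
  (HD omega <= s%:E)%E.
Proof.
move=> /andP[s'0 ss] fr.
apply: (@le_trans _ _ (hausdorff_dim Z)).
  by apply: ereal_inf_lbound; exists Z => //; exact: (typical_carrier sys ty).
apply: ereal_inf_lbound; exists s => //; split; first by lra.
pose s1 := (s' + s) / 2; have s1P : 0 <= s' < s1 by rewrite /s1 s'0 /=; lra.
have ss1 : 0 < s - s1 by rewrite /s1; lra.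
have s0 : 0 < s by lra.
have /andP[k0 k1] := sc_kp sc.
(* Half of the exponent gained makes the sum over all levels converge, the other half makes it
   small. *)
pose th := kp `^ ((s - s1) / 2).
have th01 : 0 < th < 1.
  have q0 : 0 < (s - s1) / 2 by exact: divr_gt0.
  rewrite /th powR_gt0//=; have h := gt0_ltr_powR q0 (ltW k0 : kp \in Num.nneg) ler01 k1.
  by rewrite powR1 in h.
pose A := Ca `^ s * Ca `^ (s - s1).
have A0 : 0 < A by rewrite mulr_gt0 ?powR_gt0.
have level n : \sum_(u <- words n | lower_good s1 n u) (Ca * lam u) `^ s <= A * th ^+ n * th ^+ n.
  have step u : u \in words n -> lower_good s1 n u -> (Ca * lam u) `^ s <= A * th ^+ n * th ^+ n * Pm u.
    rewrite /lower_good => uw gu; have l0 := lam0 uw; have /andP[_ l1] := sc_lam sc uw.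
    rewrite powRM ?(ltW Ca0) ?(ltW l0)//.
    have -> : lam u `^ s = lam u `^ (s - s1) * lam u `^ s1.
      by rewrite -powRD ?subrK// (gt_eqF l0) implybT.
    have h : lam u `^ (s - s1) <= Ca `^ (s - s1) * (th ^+ n * th ^+ n).
      have -> : th ^+ n * th ^+ n = (kp ^+ n) `^ (s - s1).
        rewrite /th -!powR_mulrn ?powR_ge0 ?(ltW k0)// -!powRrM.
        rewrite -powRD ?(gt_eqF k0) ?implybT//; congr (_ `^ _); by field.
      rewrite -powRM ?(ltW Ca0) ?exprn_ge0 ?(ltW k0)//.
      apply: ge0_ler_powR; rewrite ?nnegrE ?(ltW ss1) ?(ltW l0) ?mulr_ge0 ?exprn_ge0 ?(ltW Ca0) ?(ltW k0)//.
    rewrite /A -!mulrA; apply: ler_wpM2l; first exact: powR_ge0.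
    rewrite !mulrA; apply: ler_pM; rewrite ?powR_ge0//.
    by rewrite -mulrA.
  rewrite big_seq_cond; apply: (@le_trans _ _ (\sum_(u <- words n | (u \in words n) && lower_good s1 n u) A * th ^+ n * th ^+ n * Pm u)).
    by apply: ler_sum => u /andP[]; exact: step.
  rewrite -big_seq_cond -mulr_sumr ler_piMr//.
    have /andP[t0 _] := th01; have tn : 0 <= th ^+ n by rewrite exprn_ge0// ltW.
    exact: mulr_ge0 (mulr_ge0 (ltW A0) tn) tn.
  apply: le_trans (Pm_le1 n); rewrite big_mkcond /=; apply: ler_sum => u _.
  by case: ifP => // _; exact: Pm_ge0.
have pre delta e : 0 < delta -> 0 < e -> (hausdorff_premeasure s delta Z <= e%:E)%E.
  move=> d0 e0; have [N1 NP1] := lam_tail sc Ca0 d0.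
  have /andP[t0 t1] := th01; have t10 : 0 < 1 - th by rewrite subr_gt0.
  have [N2 NP2] := geo_small A th01 (mulr_gt0 e0 t10).
  pose K := [set n | (maxn N1 N2 <= n)%N /\ EL n <= s' * El n].
  pose gs n := [seq u <- words n | lower_good s1 n u].
  pose S : set (seq nat) := \bigcup_(n in K) [set` gs n].
  have SP u : S u -> exists2 n, K n & u \in words n.
    by move=> [n Kn /=]; rewrite mem_filter => /andP[_ uw]; exists n.
  pose cov k := cyl (odflt [::] (unpickle k)).
  have pk u : odflt [::] (unpickle (pickle u)) = u by rewrite pickleK.
  have dc u : S u -> (diameter (cyl u) <= (Ca * lam u)%:E)%E.
    move=> /SP[n _ uw]; apply: diameter_le; first by rewrite mulr_ge0 ?(ltW Ca0) ?(ltW (lam0 uw)).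
    by move=> x y cx cy; exact: (sc_diam sc uw).
  apply: (@le_trans _ _ (\esum_(k in [set pickle u | u in S]) diameter (cov k) `^ s)%E).
    apply: ereal_inf_lbound; exists [set pickle u | u in S], cov; split=> //.
    - move=> x Zx; have [N3 NP3] := mass_lower ty sc s1P Zx.
      have [n] := fr (maxn (maxn N1 N2) N3); rewrite geq_max => /andP[n1 n3] hn.
      have [w1 c1] := wdP n (ZK Zx); exists (pickle (wd n x)); last by rewrite /cov pk.
      exists (wd n x) => //; exists n => //=; rewrite mem_filter w1 andbT.
      exact: NP3.
    - move=> _ [u Su <-]; rewrite /cov pk; apply: (le_trans (dc _ Su)); rewrite lee_fin.
      have [n [nN _] uw] := SP _ Su; apply: ltW; apply: (NP1 n) => //.
      by apply: leq_trans nN; exact: leq_maxl.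
  rewrite esum_image; last by move=> u v _ _; exact: (pcan_inj pickleK).
  apply: (@le_trans _ _ (\esum_(u in S) ((Ca * lam u) `^ s)%:E)%E).
    apply: le_esum => u Su; rewrite /cov pk -poweR_EFin; apply: gt0_ler_poweR; rewrite ?(ltW s0)//.
    - by rewrite in_itv /= diameter_ge0 leey.
    - have [n _ uw] := SP _ Su.
      by rewrite in_itv /= lee_fin leey andbT mulr_ge0 ?(ltW Ca0) ?(ltW (lam0 uw)).
    - exact: dc.
  have -> : e%:E = (e * (1 - th) / (1 - th))%:E by congr EFin; field; rewrite gt_eqF.
  apply: esum_levels => //.
  - by move=> u; rewrite lee_fin powR_ge0.
  - by move=> n; rewrite filter_uniq// words_uniq.
  - by move=> n u; rewrite mem_filter wordsP => /and3P[_ /eqP].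
  - exact: (ltW (mulr_gt0 e0 t10)).
  - move=> n [nN _]; rewrite sumEFin lee_fin big_filter; apply: (le_trans (level n)).
    apply: ler_wpM2r; first by rewrite exprn_ge0// ltW.
    by apply: ltW; apply: NP2; apply: leq_trans nN; exact: leq_maxr.
apply/eqP; rewrite eq_le; apply/andP; split.
  apply/ereal_supP => _ [delta /= d0 <-]; apply: ereal0_le => e e0; exact: pre.
apply: (@le_trans _ _ (hausdorff_premeasure s 1 Z)).
  by apply/ereal_infP => _ [D [U [_ _ ->]]]; apply: esum_ge0 => k _; exact: poweR_ge0.
by apply: ereal_sup_ubound; exists 1 => //=.
Qed.

(** Each ball of a packing centred in [E N] contains a cylinder of comparable size around its
    centre, whose mass is at least a multiple of [r^s1]. The balls are disjoint, so these masses add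
    up to at most 1, and the gap [s - s1] makes the packing sum small. *)
Lemma PD_le (s s' : R) : 0 <= s' < s -> (exists N, forall n, (N <= n)%N -> EL n <= s' * El n) ->
  (PD omega <= s%:E)%E.
Proof.
move=> /andP[s'0 ss] [N0 N0P].
apply: (@le_trans _ _ (packing_dim Z)).
  by apply: ereal_inf_lbound; exists Z => //; exact: (typical_carrier sys ty).
apply: ereal_inf_lbound; exists s => //; split; first by lra.
pose s1 := (s' + s) / 2; have s1P : 0 <= s' < s1 by rewrite /s1 s'0 /=; lra.
have ss1 : 0 < s - s1 by rewrite /s1; lra.
have s10 : 0 < s1 by rewrite /s1; lra.
pose E N := [set x | Z x /\ forall n, (N <= n)%N -> lam (wd n x) `^ s1 <= Pm (wd n x)].
have pm0 A : (0 <= packing_premeasure s A)%E.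
  apply/ereal_infP => _ [dl _ <-]; apply: ereal_sup_ubound.
  by exists set0, (fun=> 0), (fun=> 1); split=> //; rewrite esum_set0.
have pre N : packing_premeasure s (E N) = 0%E.
  apply/eqP; rewrite eq_le pm0 andbT; apply: ereal0_le => e e0.
  have [rho0 r00 rhoP] := scale_level sys sc N.
  pose A := (2 * Ca * Ca) `^ s1.
  have A0 : 0 < A by rewrite powR_gt0// !mulr_gt0.
  have q0 : 0 < (e / A) `^ (s - s1)^-1 by rewrite powR_gt0// divr_gt0.
  (* The first bound makes [scale_level] applicable to [r / Ca], the second gives
     [(2 r)^(s - s1) <= e / A]. *)
  pose delta := Num.min (Ca * rho0) ((e / A) `^ (s - s1)^-1 / 2).
  have d0 : 0 < delta by rewrite lt_min !mulr_gt0.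
  apply: (@le_trans _ _ (packing_sum s delta (E N))).
    by apply: ereal_inf_lbound; exists delta.
  apply/ereal_supP => _ [D [c [r [cE rP tr ->]]]].
  have dP k : D k -> exists u, exists n, [/\ u \in words n, cyl u `<=` cball (c k) (r k) & (2 * r k) `^ s <= e * Pm u].
    move=> Dk; have [Zc gc] := cE k Dk; have /andP[r0] := rP k Dk; rewrite le_min => /andP[rd1 rd2].
    have rc : 0 < r k / Ca <= rho0 by rewrite divr_gt0// ler_pdivrMr// mulrC.
    have [n [Nn h1 h2 h3]] := rhoP (c k) _ (ZK Zc) rc.
    have [w1 c1] := wdP n.+1 (ZK Zc); have l0 := lam0 w1.
    exists (wd n.+1 (c k)), n.+1; split=> //.
      move=> y cy; apply: (le_trans (sc_diam sc w1 cy c1)).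
      exact: ler_mul_div Ca0 h3.
    have rl : 2 * r k <= 2 * Ca * Ca * lam (wd n.+1 (c k)).
      have h4 := ler_div_mul Ca0 (le_trans (ltW h1) h2).
      by rewrite -!mulrA ler_pM2l.
    have r20 : 0 < 2 * r k by rewrite mulr_gt0.
    have -> : (2 * r k) `^ s = (2 * r k) `^ (s - s1) * (2 * r k) `^ s1.
      by rewrite -powRD ?subrK// (gt_eqF r20) implybT.
    have -> : e = e / A * A by rewrite divfK ?gt_eqF.
    rewrite -mulrA; apply: ler_pM; rewrite ?powR_ge0//.
      apply: (@le_trans _ _ (((e / A) `^ (s - s1)^-1) `^ (s - s1))).
        apply: ge0_ler_powR; rewrite ?nnegrE ?(ltW ss1) ?(ltW r20) ?(ltW q0)//.
        by rewrite mulrC -ler_pdivlMr.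
      by rewrite -powRrM mulVf ?gt_eqF// powRr1// ltW// divr_gt0.
    apply: (@le_trans _ _ ((2 * Ca * Ca * lam (wd n.+1 (c k))) `^ s1)).
      apply: ge0_ler_powR; rewrite ?nnegrE ?(ltW s10) ?(ltW r20) ?mulr_ge0 ?(ltW Ca0) ?(ltW l0)//.
    rewrite powRM ?mulr_ge0 ?(ltW Ca0) ?(ltW l0)//; apply: ler_wpM2l; first exact: ltW.
    by apply: gc; exact: leqW.
  have eu k : exists u, D k -> exists n, [/\ u \in words n, cyl u `<=` cball (c k) (r k) & (2 * r k) `^ s <= e * Pm u].
    by have [/dP[u uP]|nD] := pselect (D k); [exists u|exists [::]].
  have [uu uP] := choice eu.
  pose B k := if k \in D then cyl (uu k) else set0.
  have mB k : measurable (B k : set (borelC R)).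
    rewrite /B; case: ifP => [/set_mem /uP[n [uw _ _]]|_]; first exact: mcyl uw.
    exact: (@measurable0 _ (borelC R)).
  have tB : trivIset setT B.
    apply: (iffLR (trivIset_mkcond D (fun k => cyl (uu k)))) => i j Di Dj [z [zi zj]]; apply: (tr i j Di Dj).
    by have [n [_ si _]] := uP _ Di; have [m [_ sj _]] := uP _ Dj; exists z; split; [exact: si|exact: sj].
  have mU : measurable (\bigcup_k B k : set (borelC R)) by apply: (@bigcup_measurable _ (borelC R)).
  have sU : omega (\bigcup_k B k) = (\sum_(0 <= k <oo) omega (B k))%E.
    exact (@measure_semi_bigcup _ R (borelC R) omega B mB tB mU).
  rewrite esum_nat; last by move=> k _; rewrite lee_fin powR_ge0.
  apply: (@le_trans _ _ (\sum_(0 <= k <oo) (e%:E * omega (B k)))%E).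
    apply: lee_nneseries => [k _ _|k _].
      by case: ifP => // _; rewrite lee_fin powR_ge0.
    case: ifPn => [kD|_]; last by rewrite mule_ge0 ?lee_fin ?(ltW e0).
    have [n [uw _ h]] := uP k (set_mem kD).
    by rewrite /B kD (omP uw) -EFinM lee_fin.
  rewrite nneseriesZl// -sU -[leRHS]mule1; apply: lee_wpmul2l; first by rewrite lee_fin ltW.
  exact: probability_le1.
apply/eqP; rewrite eq_le; apply/andP; split; last first.
  by apply/ereal_infP => _ [F [_ ->]]; apply: nneseries_ge0 => k _ _; exact: pm0.
apply: ereal_inf_lbound; exists E; split; last by rewrite eseries0.
move=> x Zx; have [N NP] := mass_lower ty sc s1P Zx.
exists (maxn N N0) => //; split=> // n; rewrite geq_max => /andP[n1 n2].
by apply: NP => //; exact: N0P.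
Qed.
End Dimensions.

(** * Entropies and exponents *)

Section LimitBounds.
Context {R : realType}.
Implicit Types (x y : \bar R) (u : nat -> \bar R).

Lemma limn_esup_inf u : limn_esup u = ereal_inf (range (esups u)).
Proof.
rewrite limn_esup_lim; apply: cvg_lim => //; apply: ereal_nonincreasing_cvgn.
exact: nonincreasing_esups.
Qed.

Lemma limn_esup_lt u x : (limn_esup u < x)%E -> exists N, forall n, (N <= n)%N -> (u n < x)%E.
Proof.
rewrite limn_esup_inf => /ereal_inf_lt[_ [N _ <-] h]; exists N => n Nn.
by apply: le_lt_trans h; apply: ereal_sup_ubound; exists n.
Qed.

Lemma limn_esup_gt u x : (x < limn_esup u)%E -> forall N, exists2 n, (N <= n)%N & (x < u n)%E.
Proof.
rewrite limn_esup_inf => h N.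
have : (x < esups u N)%E by apply: (lt_le_trans h); apply: ereal_inf_lbound; exists N.
by move=> /ereal_sup_gt[_ [n Nn <-] xu]; exists n.
Qed.

Lemma limn_einf_gt u x : (x < limn_einf u)%E -> exists N, forall n, (N <= n)%N -> (x < u n)%E.
Proof.
rewrite /limn_einf lteNr => /limn_esup_lt[N NP]; exists N => n /NP.
by rewrite /= lteN2.
Qed.

Lemma limn_einf_lt u x : (limn_einf u < x)%E -> forall N, exists2 n, (N <= n)%N & (u n < x)%E.
Proof.
rewrite /limn_einf lteNl => /limn_esup_gt h N; have [n Nn] := h N.
by rewrite /= lteN2; exists n.
Qed.

Lemma le_slack x y : (forall s del : R, (y < s%:E)%E -> 0 < del -> (x <= (s + del)%:E)%E) -> (x <= y)%E.
Proof.
case: y => [y|_|h]; last 1 first.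
- case: x h => [x| |] h; rewrite ?leNye//.
    have := h (x - 2) 1 (ltNyr _) ltr01; rewrite lee_fin => h1.
    by exfalso; move: h1; lra.
  by have := h 0 1 (ltNyr _) ltr01.
- move=> h; apply/lee_addgt0Pr => e e0; have -> : (y%:E + e%:E)%E = ((y + e / 2) + e / 2)%:E.
    by rewrite -EFinD; congr EFin; field.
  by apply: h; rewrite ?lte_fin; lra.
- by rewrite leey.
Qed.

Lemma ge_slack x y : (forall s del : R, (s%:E < y)%E -> 0 < del -> ((s - del)%:E <= x)%E) -> (y <= x)%E.
Proof.
move=> h; rewrite -leeN2; apply: le_slack => s del; rewrite lteNl -EFinN => sy d0.
have := h _ _ sy d0; rewrite leeNl -EFinN => h1.
by rewrite opprD.
Qed.
End LimitBounds.

Lemma ratio_close {R : realType} (L l E e : nat -> R) (M c K : R) :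
  0 < c -> 0 <= M -> (forall n, 0 <= E n) -> (forall n, (0 < n)%N -> E n <= M * n%:R) ->
  (forall n, c * n%:R - K <= e n) ->
  (forall eps, 0 < eps -> exists N, forall n, (N <= n)%N -> `|L n - E n| <= eps * n%:R) ->
  (forall eps, 0 < eps -> exists N, forall n, (N <= n)%N -> `|l n - e n| <= eps * n%:R) ->
  forall eps, 0 < eps -> exists N, forall n, (N <= n)%N -> `|L n / l n - E n / e n| <= eps.
Proof.
move=> c0 M0 E0 EM ec hL hl eps eps0.
(* From [L/l - E/e = (L - E)/l + (E/e) (e - l)/l], with [l >= c n / 4] and [E/e <= 2 M / c]. *)
pose D := 4 / c + 2 * M / c * (4 / c).
have D0 : 0 < D by apply: ltr_pwDl; rewrite ?mulr_ge0 ?invr_ge0 ?divr_gt0// ltW.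
pose ep := Num.min (eps / D) (c / 4).
have ep0 : 0 < ep by rewrite lt_min !divr_gt0.
have [N1 NP1] := hL _ ep0; have [N2 NP2] := hl _ ep0.
have [N3 NP3] := nat_large K (divr_gt0 c0 (ltr0n _ 2 : 0 < 2)).
exists (maxn 1 (maxn N1 (maxn N2 N3))) => n; rewrite !geq_max => /and4P[n0 n1 n2 n3].
have nR : 0 < n%:R :> R by rewrite ltr0n.
have h1 := NP1 n n1; have h2 := NP2 n n2; have h3 := NP3 n n3; have h4 := ec n; have h5 := EM n n0; have h6 := E0 n.
have epc : ep <= c / 4 by rewrite ge_min lexx orbT.
have epD : ep * D <= eps by rewrite -ler_pdivlMr// ge_min lexx.
have e1 : c / 2 * n%:R <= e n by lra.
have l1 : c / 4 * n%:R <= l n.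
  have h7 : ep * n%:R <= c / 4 * n%:R by rewrite ler_pM2r.
  by move: h2; rewrite ler_norml => /andP[h8 _]; lra.
have c4 : 0 < c / 4 * n%:R by rewrite mulr_gt0// divr_gt0.
have c2 : 0 < c / 2 * n%:R by rewrite mulr_gt0// divr_gt0.
have l0 : 0 < l n by exact: lt_le_trans l1.
have e0 : 0 < e n by exact: lt_le_trans e1.
have -> : L n / l n - E n / e n = (L n - E n) / l n + E n / e n * ((e n - l n) / l n).
  by field; rewrite !gt_eqF.
have q1 (a : R) : `|a| <= ep * n%:R -> `|a / l n| <= ep * (4 / c).
  move=> ha; rewrite normrM normfV (gtr0_norm l0) ler_pdivrMr//; apply: (le_trans ha).
  have -> : ep * n%:R = ep * (4 / c) * (c / 4 * n%:R) by field; rewrite gt_eqF.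
  by apply: ler_wpM2l l1; rewrite mulr_ge0 ?divr_ge0 ?ltW.
have q2 : `|E n / e n| <= 2 * M / c.
  rewrite ger0_norm ?divr_ge0 ?(ltW e0)// ler_pdivrMr//; apply: (le_trans h5).
  have -> : M * n%:R = 2 * M / c * (c / 2 * n%:R) by field; rewrite gt_eqF.
  by apply: ler_wpM2l e1; rewrite !mulr_ge0 ?invr_ge0// ltW.
apply: (le_trans (ler_normD _ _)); apply: le_trans epD.
have -> : ep * D = ep * (4 / c) + 2 * M / c * (ep * (4 / c)) by rewrite /D; ring.
apply: lerD; first exact: q1.
by rewrite normrM; apply: ler_pM => //; apply: q1; rewrite distrC.
Qed.

Lemma ln_sup_bounds {R : realType} (S : set R) (a b : R) : S !=set0 ->
  (forall q, S q -> `|ln q + a| <= b /\ 0 < q) -> `|ln (sup S) + a| <= b.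
Proof.
move=> [q0 Sq0] h; have [h0 p0] := h q0 Sq0.
have ub : ubound S (expR (b - a)).
  move=> q /h[hq p]; rewrite -[leLHS]lnK ?posrE// ler_expR.
  by move: hq; rewrite ler_norml => /andP[_ hq]; lra.
have sP : has_sup S by split; [exists q0|exists (expR (b - a))].
have le1 : q0 <= sup S by exact: sup_upper_bound.
have le2 : sup S <= expR (b - a) by apply: ge_sup => //; exists q0.
have s0 : 0 < sup S by exact: lt_le_trans le1.
have a1 : ln q0 <= ln (sup S) by rewrite ler_ln ?posrE.
have a2 : ln (sup S) <= b - a by rewrite -[leRHS]expRK ler_ln ?posrE ?expR_gt0.
by move: h0; rewrite !ler_norml => /andP[h1 h2]; apply/andP; split; lra.
Qed.

Section Entropy.
Context {R : realType}.
Variables (d : nat -> nat) (psi : nat -> nat -> C R -> C R) (eta : R) (V : set (C R)).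
Hypothesis sys : conformal_system d psi eta V.
Variable omega : probability (borelC R) R.
Hypothesis hm : is_harmonic_measure (lset d psi 0) infty omega.
Variables (Z : set (C R)) (Ca cb kp : R).
Hypothesis ty : typical d psi omega Z.
Hypothesis sc : scaling d psi Ca cb kp.
Implicit Types (z w x y : C R) (u v : seq nat) (m n k : nat).

Local Notation K0 := (lset d psi 0).
Local Notation cyl := (cyl psi 0).
Local Notation lam := (lam psi 0).
Local Notation words := (words d 0).
Local Notation Pm := (Pm psi omega).
Local Notation wd := (wd d psi).
Local Notation EL := (EL d psi omega).
Local Notation El := (El d psi omega).

Lemma ELE n : EL n = \sum_(u <- words n) Pm u * - ln (Pm u).
Proof. by rewrite /EL /Em /Ex; apply: eq_bigr => u _; rewrite /Gmass qm0. Qed.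

Lemma ElE n : El n = \sum_(u <- words n) Pm u * - ln (lam u).
Proof. by rewrite /El /Em /Ex; apply: eq_bigr => u _; rewrite /Glam qm0. Qed.

Lemma EL_ge0 n : 0 <= EL n.
Proof.
rewrite ELE big_seq; apply: sumr_ge0 => u; rewrite wordsP => /andP[_ ou].
rewrite mulr_ge0 ?Pm_ge0// oppr_ge0 ln_le0//.
by have := probability_le1 omega (cyl_meas sys ou); rewrite (om_fin omega (cyl_meas sys ou)) lee_fin.
Qed.

Lemma El_low : exists c K : R, 0 < c /\ forall n, c * n%:R - K <= El n.
Proof.
have [c [K [c0 low]]] := lnlam_low sc; exists c, K; split=> // n.
have -> : c * n%:R - K = \sum_(u <- words n) Pm u * (c * n%:R - K).
  by rewrite -mulr_suml (Pm_total sys hm) mul1r.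
rewrite ElE big_seq [leRHS]big_seq.
by apply: ler_sum => u uw; apply: ler_wpM2l; [exact: Pm_ge0|exact: low uw].
Qed.

(** A strict inequality between a number and the lower or upper limit of [b] means an inequality
    between [EL] and a multiple of [El] at infinitely many or at all large levels: these are the
    hypotheses of the four dimension estimates. *)
Lemma dims_limit (b : nat -> R) :
  (forall eps, 0 < eps -> exists N, forall n, (N <= n)%N -> `|b n - EL n / El n| <= eps) ->
  HD omega = limn_einf (fun n => (b n)%:E) /\ PD omega = limn_esup (fun n => (b n)%:E).
Proof.
move=> hb; have [c [K [c0 low]]] := El_low.
have [N0 NP0] := nat_large (K + 1) c0.
have El0 n : (N0 <= n)%N -> 0 < El n by move=> /NP0; have := low n; lra.
have Hd (W : set (C R)) : (0 <= hausdorff_dim W)%E by apply/ereal_infP => _ [s [s0 _] <-]; rewrite lee_fin ltW.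
have Pd (W : set (C R)) : (0 <= packing_dim W)%E by apply/ereal_infP => _ [s [s0 _] <-]; rewrite lee_fin ltW.
have HD0 : (0 <= HD omega)%E by apply/ereal_infP => _ [W _ <-]; exact: Hd.
have PD0 : (0 <= PD omega)%E by apply/ereal_infP => _ [W _ <-]; exact: Pd.
have up s del : 0 < del -> exists N, forall n, (N <= n)%N -> b n < s -> 0 <= s + del /\ EL n <= (s + del) * El n.
  move=> d0; have [N NP] := hb _ d0; exists (maxn N N0) => n; rewrite geq_max => /andP[n1 n2] bs.
  have := NP n n1; rewrite ler_norml => /andP[h _]; have e0 := El0 n n2.
  have r0 : 0 <= EL n / El n by rewrite divr_ge0 ?EL_ge0 ?ltW.
  have r1 : EL n / El n <= s + del by lra.
  by split; [lra|rewrite -ler_pdivrMr].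
have dn s del : 0 < del -> exists N, forall n, (N <= n)%N -> s < b n -> (s - del) * El n <= EL n.
  move=> d0; have [N NP] := hb _ d0; exists (maxn N N0) => n; rewrite geq_max => /andP[n1 n2] bs.
  have := NP n n1; rewrite ler_norml => /andP[_ h]; have e0 := El0 n n2.
  by rewrite -ler_pdivlMr//; lra.
have half del : 0 < del -> 0 < del / 2 :> R by move=> d0; rewrite divr_gt0.
split; apply/eqP; rewrite eq_le; apply/andP; split.
- apply: le_slack => s del hs d0; have d2 := half _ d0; have [N NP] := up s _ d2.
  have fr := limn_einf_lt hs.
  have s0 : 0 <= s + del / 2.
    by have [n Nn] := fr N; rewrite lte_fin => /(NP n Nn)[].
  apply: (HD_le sys hm ty sc (s' := s + del / 2)); first by rewrite s0 /=; lra.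
  move=> m; have [n] := fr (maxn N m); rewrite geq_max lte_fin => /andP[n1 n2] /(NP n n1)[_ h].
  by exists n.
- apply: ge_slack => s del hs d0; have [sd|sd] := leP (s - del) 0.
    by apply: le_trans HD0; rewrite lee_fin.
  have d2 := half _ d0; have [N NP] := dn s _ d2; have [N1 NP1] := limn_einf_gt hs.
  apply: (HD_ge sys ty sc (s' := s - del / 2)); first by rewrite sd /=; lra.
  exists (maxn N N1) => n; rewrite geq_max => /andP[n1 n2]; apply: NP => //.
  by have := NP1 n n2; rewrite lte_fin.
- apply: le_slack => s del hs d0; have d2 := half _ d0; have [N NP] := up s _ d2.
  have [N1 NP1] := limn_esup_lt hs.
  have s0 : 0 <= s + del / 2.
    have := NP1 (maxn N N1) (leq_maxr _ _); rewrite lte_fin => h.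
    by have [] := NP (maxn N N1) (leq_maxl _ _) h.
  apply: (PD_le sys ty sc (s' := s + del / 2)); first by rewrite s0 /=; lra.
  exists (maxn N N1) => n; rewrite geq_max => /andP[n1 n2].
  by have := NP1 n n2; rewrite lte_fin => /(NP n n1)[].
(* As for the lower limit above, an exponent that is not positive is settled by the nonnegativity of
   the dimension. *)
- apply: ge_slack => s del hs d0; have [sd|sd] := leP (s - del) 0.
    by apply: le_trans PD0; rewrite lee_fin.
  have d2 := half _ d0; have [N NP] := dn s _ d2; have fr := limn_esup_gt hs.
  apply: (PD_ge sys ty sc (s' := s - del / 2)); first by rewrite sd /=; lra.
  move=> m; have [n] := fr (maxn N m); rewrite geq_max lte_fin => /andP[n1 n2] h.
  by exists n => //; exact: NP.
Qed.

Lemma dims_ratio (L l : nat -> R) :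
  (forall eps, 0 < eps -> exists N, forall n, (N <= n)%N -> `|L n - EL n| <= eps * n%:R) ->
  (forall eps, 0 < eps -> exists N, forall n, (N <= n)%N -> `|l n - El n| <= eps * n%:R) ->
  HD omega = limn_einf (fun n => (L n / l n)%:E) /\ PD omega = limn_esup (fun n => (L n / l n)%:E).
Proof.
move=> hL hl; apply: dims_limit; have [M M0 EM] := EL_le sys hm; have [c [K [c0 low]]] := El_low.
exact: (ratio_close c0 M0 EL_ge0 EM low hL hl).
Qed.

(* [T_n] inverts the composition along [u], so bounded distortion puts its derivative on the cylinder between [1 / (cd lam)] and [cd / lam]. *)
Lemma T_deriv_bounds u x : okw d 0 u -> cyl u x ->
  `|ln (cabs (derive1 (T d psi (size u)) x)) + ln (lam u)| <= ln (cdist eta) /\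
  0 < cabs (derive1 (T d psi (size u)) x).
Proof.
move=> ou [w w1 <-]; rewrite (cderiv_derive1 (T_cderiv sys ou w1)) cabsV.
have := dq_lam sys ou (ltW w1) (ltW w1); rewrite dq_diag.
have l0 := lam_gt0 sys ou; have c0 := cdist_gt0 eta.
move: l0 c0; move: (lam u) (cdist eta) (cabs _) => l cd q l0 c0 /andP[h1 h2].
have q0 : 0 < q by apply: lt_le_trans h1; exact: divr_gt0.
split; last by rewrite invr_gt0.
rewrite lnV ?posrE//; have a1 : ln (l / cd) <= ln q by rewrite ler_ln ?posrE ?divr_gt0.
have a2 : ln q <= ln (cd * l) by rewrite ler_ln ?posrE ?mulr_gt0.
rewrite ln_div ?posrE// in a1; rewrite lnM ?posrE// in a2.
by rewrite ler_norml; apply/andP; split; lra.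
Qed.

Lemma cyl_center u : cyl u (comp psi 0 u 0).
Proof. by exists 0 => //; suff : cabs (0 : C R) < 1 by []; rewrite cabs0. Qed.

Lemma T_norm_bounds u : okw d 0 u -> `|ln (T_norm d psi (size u) (cyl u)) + ln (lam u)| <= ln (cdist eta).
Proof.
move=> ou; apply: ln_sup_bounds; first by exists (cabs (derive1 (T d psi (size u)) (comp psi 0 u 0))), (comp psi 0 u 0) => //; exact: cyl_center.
by move=> _ [x cx <-]; exact: T_deriv_bounds.
Qed.

Lemma branchE (a : nat -> nat) n : branch psi a n = comp psi 0 (mkseq a n).
Proof.
elim: n => [//|n IH]; apply/funext => z; rewrite mkseqS comp_rcons size_mkseq add0n.
by rewrite -IH.
Qed.

Lemma okw_nth u m : okw d m u = all (fun k => nth 0%N u k < d (m + k))%N (iota 0 (size u)).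
Proof.
elim: u m => [//|i u IH] m /=; rewrite addn0 IH; congr andb.
by rewrite (iotaDl 1 0) all_map; apply: eq_all => k /=; rewrite addSnnS.
Qed.

Lemma cylindersE n : cylinders d psi n = [set cyl u | u in [set` words n]].
Proof.
apply/seteqP; split=> [_ [a ad ->]|_ [u /= uw <-]].
  exists (mkseq a n); last by rewrite branchE.
  rewrite /= wordsP size_mkseq eqxx okw_nth size_mkseq; apply/allP => k.
  by rewrite mem_iota add0n /= => kn; rewrite nth_mkseq//; exact: ad.
move: uw; rewrite wordsP => /andP[/eqP su ou]; exists (nth 0%N u).
  move=> k kn; move: ou; rewrite okw_nth su => /allP/(_ k); rewrite mem_iota add0n; exact.
by rewrite branchE -su mkseq_nth.
Qed.

Lemma cyl_inj n u v : u \in words n -> v \in words n -> cyl u = cyl v -> u = v.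
Proof.
rewrite !wordsP => /andP[/eqP su ou] /andP[/eqP sv ov] uv.
have c0 := cyl_center u.
by apply: (cyl_uniq sys _ ou ov c0); rewrite ?su ?sv// -uv.
Qed.

Lemma cylinders_sum n (F : set (C R) -> R) :
  \sum_(X \in cylinders d psi n) F X = \sum_(u <- words n) F (cyl u).
Proof.
rewrite cylindersE fsbig_image; first by rewrite -fsbig_seq// words_uniq.
by move=> u v /set_mem uw /set_mem vw; exact: cyl_inj uw vw.
Qed.

Lemma limit_setE : limit_set d psi = K0.
Proof.
apply/seteqP; split=> [z h n|z h n _]; last first.
  by have [u uw cu] := h n; exists (cyl u) => //; rewrite cylindersE; exists u.
have [n0|n0] := posnP n; last first.
  by have [X] := h n n0; rewrite cylindersE => -[u /= uw <-] cu; exists u.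
(* Length 0 occurs in [lset] and not in [limit_set]; it follows from length 1. *)
have [X] := h 1%N isT; rewrite cylindersE => -[u uw <-] [w w1 <-].
have := uw : u \in words 1; rewrite wordsP => /andP[_ ou]; exists [::]; first by rewrite wordsP n0.
by exists (comp psi 0 u w) => //; exact: (comp_lt1 sys ou w1).
Qed.

Lemma nH n : (0 < n)%N -> H d psi omega n = EL n / n%:R.
Proof.
move=> n0; rewrite /H cylinders_sum ELE mulrC -mulNr -sumrN; congr (_ / _).
by apply: eq_bigr => u _; rewrite -mulrN.
Qed.

(** On each cylinder the supremum of the derivative of [T] is [1 / lam] up to the distortion
    constant; the bound is averaged with total mass 1. *)
Lemma nchi n : (0 < n)%N -> `|n%:R * chi d psi omega n - El n| <= ln (cdist eta).
Proof.
move=> n0; have nR : n%:R != 0 :> R by rewrite pnatr_eq0 -lt0n.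
rewrite /chi cylinders_sum mulrA mulfV// mul1r ElE -sumrB.
apply: (le_trans (ler_norm_sum _ _ _)).
rewrite -[leRHS]mul1r -(Pm_total sys hm n) mulr_suml big_seq [leRHS]big_seq; apply: ler_sum => u.
rewrite wordsP => /andP[/eqP su ou].
have -> : fine (omega (cyl u)) * ln (T_norm d psi n (cyl u)) - Pm u * - ln (lam u) =
    Pm u * (ln (T_norm d psi n (cyl u)) + ln (lam u)) by rewrite mulrDr mulrN opprK.
rewrite normrM (ger0_norm (Pm_ge0 _ _ _)); apply: ler_wpM2l; first exact: Pm_ge0.
by rewrite -su; exact: T_norm_bounds.
Qed.

(** Intersecting with the limit set does not change the mass of a cylinder, since the limit set has
    full measure. *)
Lemma h_locE n x : Z x -> h_loc d psi omega n x = - (n%:R^-1 * ln (Pm (wd n x))).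
Proof.
move=> Zx; have Kx := ty_lset ty Zx; rewrite /h_loc /cylinder_at limit_setE.
have [w1 c1] := wdP n Kx.
have -> : xget set0 [set X | cylinders d psi n X /\ X x] = cyl (wd n x).
  case: xgetP => [X _ [+ Xx]|/(_ (cyl (wd n x)))]; last by case; split=> //; rewrite cylindersE; exists (wd n x).
  by rewrite cylindersE => -[u /= uw uX]; rewrite -uX in Xx *; rewrite -(wdE sys uw Xx).
congr (- (_ * ln (fine _))); have ow := w1; rewrite wordsP in ow; have /andP[_ ok] := ow.
have mc : measurable (cyl (wd n x) : set (borelC R)) := cyl_meas sys ok.
have mK : measurable (K0 : set (borelC R)) by apply: closedC_measurable; exact (lset_closed sys (m := 0)).
have oc : omega (~` K0) = 0%E.
  have h : omega (~` K0) = (1 - omega K0)%E by exact (@probability_setC _ (borelC R) R omega K0 mK).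
  by rewrite h (omega_lset sys hm) subee.
have mI : measurable (K0 `&` cyl (wd n x) : set (borelC R)) by exact: (@measurableI _ (borelC R)).
have mC : measurable (~` K0 : set (borelC R)) by exact: (@measurableC _ (borelC R)).
apply/eqP; rewrite eq_le; apply/andP; split.
  by apply: le_measure; rewrite ?inE// => y [].
have h : (omega ((K0 `&` cyl (wd n x)) `|` ~` K0) <= omega (K0 `&` cyl (wd n x)) + omega (~` K0))%E.
  exact (@measureU2 _ (borelC R) R omega _ _ mI mC).
have s : cyl (wd n x) `<=` (K0 `&` cyl (wd n x)) `|` ~` K0.
  by move=> y cy; have [Ky|nK] := pselect (K0 y); [left|right].
have h2 : (omega (cyl (wd n x)) <= omega ((K0 `&` cyl (wd n x)) `|` ~` K0))%E.
  by apply: le_measure; rewrite ?inE//; exact: (@measurableU _ (borelC R)).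
by apply: (le_trans h2); apply: (le_trans h); rewrite oc adde0.
Qed.

Lemma close_const (a b c : nat -> R) (K : R) :
  (forall eps, 0 < eps -> exists N, forall n, (N <= n)%N -> `|b n - c n| <= eps * n%:R) ->
  (forall n, (0 < n)%N -> `|a n - b n| <= K) ->
  forall eps, 0 < eps -> exists N, forall n, (N <= n)%N -> `|a n - c n| <= eps * n%:R.
Proof.
move=> h ab eps e0; have e2 : 0 < eps / 2 by rewrite divr_gt0.
have [N1 NP1] := h _ e2; have [N2 NP2] := nat_large K e2.
exists (maxn 1 (maxn N1 N2)) => n; rewrite !geq_max => /and3P[n0 n1 n2].
have -> : a n - c n = (a n - b n) + (b n - c n) by ring.
apply: (le_trans (ler_normD _ _)).
by have := NP1 n n1; have := NP2 n n2; have := ab n n0; lra.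
Qed.

Lemma dims_global :
  HD omega = limn_einf (fun n => (H d psi omega n / chi d psi omega n)%:E) /\
  PD omega = limn_esup (fun n => (H d psi omega n / chi d psi omega n)%:E).
Proof.
(* For [n = 0] both sides are 0, because [0^-1 = 0]. *)
have E n : H d psi omega n / chi d psi omega n = n%:R * H d psi omega n / (n%:R * chi d psi omega n).
  have [->|n0] := posnP n; first by rewrite /H /chi invr0 !mul0r oppr0 !mul0r.
  by rewrite -mulf_div divff ?mul1r// pnatr_eq0 -lt0n.
have -> : (fun n => (H d psi omega n / chi d psi omega n)%:E) =
    (fun n => (n%:R * H d psi omega n / (n%:R * chi d psi omega n))%:E) by apply/funext => n; rewrite E.
have triv (s : nat -> R) eps : 0 < eps -> exists N, forall n, (N <= n)%N -> `|s n - s n| <= eps * n%:R.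
  by move=> e0; exists 0%N => n _; rewrite subrr normr0 mulr_ge0// ltW.
apply: (dims_ratio (L := fun n => n%:R * H d psi omega n) (l := fun n => n%:R * chi d psi omega n)).
  apply: (close_const (K := 0) (triv EL)) => n n0.
  rewrite nH// mulrC divfK ?subrr ?normr0//; by rewrite pnatr_eq0 -lt0n.
exact: close_const (triv El) nchi.
Qed.

Lemma dims_local x : Z x ->
  HD omega = limn_einf (fun n => (h_loc d psi omega n x / chi_loc d psi n x)%:E) /\
  PD omega = limn_esup (fun n => (h_loc d psi omega n x / chi_loc d psi n x)%:E).
Proof.
move=> Zx; have Kx := ty_lset ty Zx.
pose q n := ln (cabs (derive1 (T d psi n) x)).
(* For [n = 0] the factor [n^-1] makes the local ratio 0; the [if] reproduces this value. *)
have -> : (fun n => (h_loc d psi omega n x / chi_loc d psi n x)%:E) =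
    (fun n => (- ln (Pm (wd n x)) / (if n == 0%N then 0 else q n))%:E).
  apply/funext => n; congr EFin; rewrite h_locE// /chi_loc -/(q n).
  have [->|n0] := eqVneq n 0%N; first by rewrite invr0 !mul0r !invr0 oppr0 !mulr0 ?mul0r.
  rewrite -mulrN -mulf_div divff ?mul1r//.
  by rewrite invr_eq0 pnatr_eq0.
apply: (dims_ratio (L := fun n => - ln (Pm (wd n x))) (l := fun n => if n == 0%N then 0 else q n)).
  move=> eps e0; have [N NP] := ty_lln ty Zx e0; exists N => n Nn; by have [] := NP n Nn.
apply: (close_const (b := fun n => - ln (lam (wd n x))) (K := ln (cdist eta))).
  move=> eps e0; have [N NP] := ty_lln ty Zx e0; exists N => n Nn; by have [] := NP n Nn.
move=> n n0; rewrite gtn_eqF// opprK; have [w1 c1] := wdP n Kx; move: w1; rewrite wordsP => /andP[/eqP sw ow].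
by have [h _] := T_deriv_bounds ow c1; move: h; rewrite sw.
Qed.
End Entropy.

Lemma nacifs_system {R : realType} (d : nat -> nat) (psi : nat -> nat -> C R -> C R) :
  is_nacifs d psi -> exists eta V, conformal_system d psi eta V.
Proof.
move=> [eta [V [[eta01 oV DV] h]]]; exists eta, V; have /andP[e0 e1] := eta01.
have VD z : cabs z < 1 + eta -> V z.
  move=> z1; apply: DV; have e1' : 0 < 1 + eta by lra.
  have r0 : (rc (1 + eta) : C R) != 0 by rewrite -cabs_gt0 cabs_rc gtr0_norm.
  exists (z / rc (1 + eta)); last by rewrite mulrC divfK.
  by rewrite /unit_disk /= cabsf cabs_rc gtr0_norm// ltr_pdivrMr// mul1r.
split=> //.
- move=> n i id; have [_ [_ inj der] _ dil bd] := h n i id; split=> //.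
  + by move=> z Vz; exists (derive1 (psi n i) z); apply: derivable_cderiv; exact: der.
  + by move=> z w Vz Vw; apply: inj; exact/mem_set.
  + move=> z Vz; have [w w1 <-] := dil _ (ex_intro2 _ _ z Vz erefl).
    have e1' : 0 < 1 - eta by lra.
    rewrite cabsM; have -> : cabs (real_complex R (1 - eta) : C R) = 1 - eta by rewrite cabs_rc gtr0_norm.
    by rewrite -[ltRHS]mulr1 ltr_pM2l.
  + by move=> z Vz; have /andP[] := bd _ (ex_intro2 _ _ z Vz erefl).
- move=> n i j z w id jd Vz Vw E; apply/eqP; apply: contrapT => /negP ij.
  have [_ _ dis _ _] := h n i id; have := dis j jd ij; rewrite -subset0 => /(_ (psi n i z)); apply.
  by split; [exists z|exists w].
Qed.

Theorem theorem1p4 (R : realType) (d : nat -> nat)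
    (psi : nat -> nat -> C R -> C R) (omega : probability (borelC R) R) :
  is_nacifs d psi ->
  is_harmonic_measure (limit_set d psi) infty omega ->
  [/\ HD omega = limn_einf (fun n => (H d psi omega n / chi d psi omega n)%:E),
      PD omega = limn_esup (fun n => (H d psi omega n / chi d psi omega n)%:E)
    & {ae omega, forall x, limit_set d psi x ->
        HD omega =
          limn_einf (fun n => (h_loc d psi omega n x / chi_loc d psi n x)%:E) /\
        PD omega =
          limn_esup (fun n => (h_loc d psi omega n x / chi_loc d psi n x)%:E)}].
Proof.
move=> /nacifs_system[eta [V sys]] hm0.
have hm : is_harmonic_measure (lset d psi 0) infty omega by rewrite -(limit_setE sys).
have [Z ty] := typicalP sys hm; have [Ca [cb [kp sc]]] := scalingP sys.
have [g1 g2] := dims_global sys hm ty sc; split=> //.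
have mZ := ty_meas ty; exists (~` Z); split.
- exact: (@measurableC _ (borelC R)).
- have h : omega (~` Z) = (1 - omega Z)%E by exact (@probability_setC _ (borelC R) R omega Z mZ).
  by rewrite h (ty_full ty) subee.
- move=> x /= nx Zx; apply: nx => _; exact: (dims_local sys hm ty sc).
Qed.
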